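(* Let $W$ be a finite Coxeter group with Coxeter arrangement $\mathscr{A}(W)$, and let $X\in L(\mathscr{A}(W))$. Then the restriction $\mathscr{A}(W)^X$ is accurate.
   Context: The Coxeter arrangement $\mathscr{A}(W)$ is the arrangement, in the (real) reflection representation of $W$, consisting of the reflecting hyperplanes of all reflections in $W$. For an arrangement $\mathscr{A}$ (finite set of linear hyperplanes) in $U\cong\mathbb{K}^m$, $L(\mathscr{A})$ is the set of all intersections of subsets of $\mathscr{A}$ (the empty intersection is $U$); for $X\in L(\mathscr{A})$ the restriction is $\mathscr{A}^X=\{H\cap X\mid H\in\mathscr{A},H\not\supseteq X\}$, an arrangement in $X$. Let $S=\mathrm{Sym}(U^* )\cong\mathbb{K}[x_1,\dots,x_m]$ and $H=\ker\alpha_H$. $D(\mathscr{A})=\{\theta\in\mathrm{Der}_{\mathbb{K}}(S)\mid\theta(\alpha_H)\in\alpha_HS\ \forall H\in\mathscr{A}\}$. $\theta=\sum f_i\,\partial/\partial x_i$ is homogeneous of degree $p$ if all $f_i$ are homogeneous of degree $p$ (or zero). $\mathscr{A}$ is free if $D(\mathscr{A})$ is a free $S$-module; its exponents are the degrees of a homogeneous basis. Accurate: $\mathscr{A}$ is free with exponents $e_1\le\dots\le e_m$, and for every integer $1\le d\le m$ there is $X\in L(\mathscr{A})$ with $\dim X=d$ such that $\mathscr{A}^X$ is free with exponents $e_1\le\dots\le e_d$. *)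

(* Defs.v *)
From HB Require Import structures.
From mathcomp Require Import all_boot all_order all_algebra all_fingroup.
From mathcomp Require Import mxrepresentation.
From mathcomp Require Import reals trigo.
From mathcomp Require Import mpoly.

Set Implicit Arguments.
Unset Strict Implicit.
Unset Printing Implicit Defensive.

Import Order.TTheory GRing.Theory Num.Theory.

Local Open Scope ring_scope.

(* An arrangement in U is a finite set of linear hyperplanes, given as a
   sequence of subspaces; only membership in the sequence matters.
   Sym(U^* ) is {mpoly K[m]} with m = dim U, where 'X_i is the i-th coordinate
   function with respect to the basis vbasis {:U}. *)
Section Arrangements.

Variables (K : fieldType) (U : vectType K).

Local Notation sym_dual := {mpoly K[\dim {:U}]}.

(* U^* is the degree 1 part of Sym(U^* ). *)
Definition is_defining_form (H : {vspace U}) (alpha : sym_dual) : Prop :=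
  alpha \is 1.-homog /\
  forall v : U, (v \in H) = (alpha.@[fun i => coord (vbasis {:U}) i v] == 0).

Definition is_derivation (theta : {linear sym_dual -> sym_dual}) : Prop :=
  forall p q : sym_dual, theta (p * q) = theta p * q + p * theta q.

(* A derivation is \sum_i f_i d/dx_i with f_i = theta 'X_i. *)
Definition homogeneous_derivation (d : nat)
    (theta : {linear sym_dual -> sym_dual}) : Prop :=
  forall i : 'I_(\dim {:U}), theta 'X_i \is d.-homog.

Definition in_derivation_module (A : seq {vspace U})
    (theta : {linear sym_dual -> sym_dual}) : Prop :=
  is_derivation theta /\
  forall (H : {vspace U}) (alpha : sym_dual),
    H \in A -> is_defining_form H alpha ->
    exists q : sym_dual, theta alpha = alpha * q.

Definition derivation_module_basis (A : seq {vspace U}) (k : nat)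
    (theta : 'I_k -> {linear sym_dual -> sym_dual}) : Prop :=
  (forall j, in_derivation_module A (theta j)) /\
  forall delta : {linear sym_dual -> sym_dual}, in_derivation_module A delta ->
    exists! g : {ffun 'I_k -> sym_dual},
      forall p : sym_dual, delta p = \sum_(j < k) g j * theta j p.

Definition free_with_exponents (A : seq {vspace U}) (e : seq nat) : Prop :=
  exists theta : 'I_(size e) -> {linear sym_dual -> sym_dual},
    derivation_module_basis A theta /\
    forall j : 'I_(size e), homogeneous_derivation (nth 0%N e j) (theta j).

Definition in_intersection_lattice (A : seq {vspace U}) (X : {vspace U}) :
    Prop :=
  exists B : seq {vspace U},
    {subset B <= A} /\ X = (\bigcap_(H <- B) H)%VS.

(* H :&: X as a subspace of X is the preimage of H under the inclusion of X. *)
Definition restriction (A : seq {vspace U}) (X : {vspace U}) :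
    seq {vspace subvs_of X} :=
  [seq (linfun (vsval : subvs_of X -> U) @^-1: H)%VS
     | H <- A & ~~ (X <= H)%VS].

End Arrangements.

Definition accurate (K : fieldType) (U : vectType K) (A : seq {vspace U}) :
    Prop :=
  exists e : seq nat,
    [/\ size e = \dim {:U}, sorted leq e, free_with_exponents A e &
        forall d : nat, (1 <= d <= \dim {:U})%N ->
          exists X : {vspace U},
            [/\ in_intersection_lattice A X, \dim X = d &
                free_with_exponents (restriction A X) (take d e)]].

(* (W, s) is a Coxeter system: W has the presentation with generators s i and
   relations (s i * s j) ^ m(i, j) = 1, where m(i, j) is the order of
   s i * s j. The universal property ranges over all groups, finite or not. *)
Definition coxeter_system (W : finGroupType) (n : nat) (s : 'I_n -> W) : Prop :=
  [/\ injective s,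
      forall i, #[s i]%g = 2%N,
      <<[set s i | i : 'I_n]>>%g = [set: W] &
      forall (G : groupType) (f : 'I_n -> G),
        (forall i j, ((f i * f j) ^+ #[s i * s j])%g = 1%g) ->
        exists phi : {multiplicative W -> G}, forall i, phi (s i) = f i].

Definition coxeter_reflections (W : finGroupType) (n : nat) (s : 'I_n -> W) :
    {set W} :=
  [set (s i ^ w)%g | i : 'I_n, w : W].

Section ReflectionRepresentation.

Variables (R : realType) (W : finGroupType) (n : nat) (s : 'I_n -> W).

(* B(alpha_i, alpha_j) = - cos (pi / m(i, j)), with alpha_i = delta_mx 0 i. *)
Definition coxeter_form (u v : 'rV[R]_n) : R :=
  \sum_(i < n) \sum_(j < n)
     u 0 i * v 0 j * - cos (pi / (#[s i * s j]%g)%:R).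

(* As the generators determine it, there is at most one such rG; it acts on row
   vectors from the right. *)
Definition is_reflection_representation
    (rG : mx_representation R [set: W] n) : Prop :=
  forall (i : 'I_n) (v : 'rV[R]_n),
    v *m rG (s i) = v - (2 * coxeter_form (delta_mx 0 i) v) *: delta_mx 0 i.

Definition coxeter_arrangement (rG : mx_representation R [set: W] n) :
    seq {vspace 'rV[R]_n} :=
  [seq fixedSpace (linfun (mulmxr (rG t))) | t <- enum (coxeter_reflections s)].

End ReflectionRepresentation.

(* Main.v *)
Require Import Defs.
From HB Require Import structures.
From mathcomp Require Import all_boot all_order all_algebra all_fingroup.
From mathcomp Require Import mxrepresentation.
From mathcomp Require Import boolp reals trigo mpoly.
From mathcomp Require Import zify ring lra ssrZ.
From Stdlib Require BinInt BinNat.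

(* A restriction of [A(W)^X] to one of its flats is [A(W)^Y] for a flat [Y] of [A(W)] inside [X].
   Hence it suffices that every flat [X] is free and contains a flat [Y] of codimension one whose
   exponents are those of [X] without the largest one: iterating gives the flats of all dimensions.
   This property is invariant under linear isomorphisms and passes to products.

   As [W] is finite, its Coxeter form is positive definite, so its diagram is a disjoint union of
   diagrams of types A, B, D, E6, E7, E8, F4, H3, H4 and I2(m). Restrictions of types A and B are
   again of types A and B, those of type D lie between D_k and B_k, and all of these have explicit
   bases of Vandermonde type. Arrangements in the plane are elementary. In the remaining types every
   flat is conjugate to one through the closed dominant chamber, which leaves finitely many; each of
   their restrictions is built from the empty arrangement by adding hyperplanes in an order found by
   a computer search and checked by evaluation, freeness being preserved because the
   derivations restricted to the new hyperplane are multiples of Terao's polynomial. *)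

Set Implicit Arguments.
Unset Strict Implicit.
Unset Printing Implicit Defensive.

Import Order.TTheory GRing.Theory Num.Theory.

Local Open Scope ring_scope.

(** * Linear substitutions in polynomials *)

(** The addition theorem would ask for the freeness of every restriction A^H met on the way, and
    certificates would branch accordingly. Terao's polynomial avoids this: every derivation of A
    sends the form of H, modulo that form, to a multiple of one polynomial of degree d = |A| -
    |A^H|. Basis elements of degree below d are therefore already tangent to H, and one of degree d
    is either tangent or has a nonzero constant as quotient. In the second case it clears the other
    basis elements and is itself multiplied by the form, so that its exponent grows by one. It
    remains to ensure that some quotient is nonzero, and this follows from counts of hyperplanes and
    exponents, which are cheap to evaluate. The condition on flats is stronger than accuracy, but it
    can be checked one flat at a time. Most certificates are shared, because the longest element of
    a parabolic subgroup carries one standard flat to another. *)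

Section LinearSubstitution.

Variable F : fieldType.

Lemma mpoly_alg_ind m (P : {mpoly F[m]} -> Prop) :
  (forall c, P c%:MP) -> (forall i, P 'X_i) ->
  (forall p q, P p -> P q -> P (p + q)) ->
  (forall p q, P p -> P q -> P (p * q)) -> forall p, P p.
Proof.
move=> PC PX PD PM; apply: mpolyind => [|c u p _ _ Pp].
  by rewrite -mpolyC0; apply: (PC).
apply: (PD) => //; rewrite -mul_mpolyC; apply: (PM) => //.
rewrite mpolyXE_id; elim/big_rec: _ => [|i q _ Pq].
  by rewrite -mpolyC1; apply: (PC).
apply: (PM) => //; elim: (u i) => [|k IH]; first by rewrite expr0 -mpolyC1; apply: (PC).
by rewrite exprS; apply: (PM).
Qed.

Definition lin m (a : 'rV[F]_m) : {mpoly F[m]} := \sum_j a 0 j *: 'X_j.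

Lemma lin_is_linear m : linear (@lin m).
Proof.
move=> c a b; rewrite /lin scaler_sumr -big_split /=; apply: eq_bigr => j _.
by rewrite !mxE scalerDl scalerA.
Qed.

HB.instance Definition _ m :=
  GRing.isLinear.Build F 'rV[F]_m {mpoly F[m]} *:%R (@lin m) (@lin_is_linear m).

Lemma mcoeff_lin m (a : 'rV[F]_m) j : (lin a)@_(U_(j)%MM) = a 0 j.
Proof.
rewrite /lin linear_sum (bigD1 j) //= mcoeffZ mcoeffXU eqxx mulr1 big1 ?addr0 //.
by move=> i nij; rewrite mcoeffZ mcoeffXU (negPf nij) mulr0.
Qed.

Lemma lin_inj m : injective (@lin m).
Proof. by move=> a b ab; apply/rowP => j; rewrite -!mcoeff_lin ab. Qed.

Lemma lin_eq0 m (a : 'rV[F]_m) : (lin a == 0) = (a == 0).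
Proof. by rewrite -(inj_eq (@lin_inj m)) raddf0. Qed.

Lemma lin_homog m (a : 'rV[F]_m) : lin a \is 1.-homog.
Proof. by apply: rpred_sum => j _; rewrite rpredZ // dhomogX /= mdeg1. Qed.

Lemma lin_delta m (i : 'I_m) : lin (delta_mx 0 i) = 'X_i.
Proof.
rewrite /lin (bigD1 i) //= mxE !eqxx scale1r big1 ?addr0 // => j nij.
by rewrite mxE eqxx (negPf nij) scale0r.
Qed.

Lemma meval_lin m (a : 'rV[F]_m) (x : 'cV[F]_m) :
  (lin a).@[fun i => x i 0] = (a *m x) 0 0.
Proof.
rewrite /lin raddf_sum mxE; apply: eq_bigr => j _.
by rewrite /= mevalZ mevalXU.
Qed.

(** Pullback of polynomial functions along [x |-> E x]; for [E] of full column rank this is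
    restriction to the subspace spanned by its columns. *)
Definition sub m k (E : 'M[F]_(m, k)) : {mpoly F[m]} -> {mpoly F[k]} :=
  comp_mpoly [tuple lin (row i E) | i < m].

HB.instance Definition _ m k (E : 'M[F]_(m, k)) :=
  GRing.RMorphism.copy (sub E) (comp_mpoly [tuple lin (row i E) | i < m]).
HB.instance Definition _ m k (E : 'M[F]_(m, k)) :=
  GRing.Linear.copy (sub E) (comp_mpoly [tuple lin (row i E) | i < m]).

Lemma subC m k (E : 'M[F]_(m, k)) c : sub E c%:MP = c%:MP.
Proof. exact: comp_mpolyC. Qed.

Lemma subX m k (E : 'M[F]_(m, k)) i : sub E 'X_i = lin (row i E).
Proof. by rewrite /sub comp_mpolyXU -tnth_nth tnth_mktuple. Qed.

Lemma sub_lin m k (E : 'M[F]_(m, k)) a : sub E (lin a) = lin (a *m E).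
Proof.
rewrite {1}/lin linear_sum mulmx_sum_row linear_sum; apply: eq_bigr => j _.
by rewrite !linearZ /= subX.
Qed.

Lemma sub_comp m k l (E : 'M[F]_(m, k)) (E' : 'M[F]_(k, l)) p :
  sub E' (sub E p) = sub (E *m E') p.
Proof.
elim/mpoly_alg_ind: p => [c|i|p q IHp IHq|p q IHp IHq].
- by rewrite !subC.
- by rewrite !subX sub_lin row_mul.
- by rewrite !rmorphD /= IHp IHq.
- by rewrite !rmorphM /= IHp IHq.
Qed.

Lemma sub1 m p : sub (1%:M : 'M[F]_m) p = p.
Proof.
elim/mpoly_alg_ind: p => [c|i|p q IHp IHq|p q IHp IHq].
- by rewrite subC.
- by rewrite subX row1 lin_delta.
- by rewrite rmorphD /= IHp IHq.
- by rewrite rmorphM /= IHp IHq.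
Qed.

Lemma meval_sub m k (E : 'M[F]_(m, k)) p (x : 'cV[F]_k) :
  (sub E p).@[fun i => x i 0] = p.@[fun i => (E *m x) i 0].
Proof.
elim/mpoly_alg_ind: p => [c|i|p q IHp IHq|p q IHp IHq].
- by rewrite subC !mevalC.
- by rewrite subX mevalXU meval_lin -row_mul mxE.
- by rewrite rmorphD !mevalD IHp IHq.
- by rewrite rmorphM !mevalM IHp IHq.
Qed.

Lemma prodf_homog n (I : Type) (r : seq I) (P : pred I) (f : I -> {mpoly F[n]}) d :
  (forall i, P i -> f i \is (d i).-homog) ->
  \prod_(i <- r | P i) f i \is (\sum_(i <- r | P i) d i)%N.-homog.
Proof.
move=> h; elim/big_rec2: _ => [|i e p Pi hp]; first exact: dhomog1.
by apply: dhomogM => //; apply: h.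
Qed.

Lemma sub_homog m k (E : 'M[F]_(m, k)) p d :
  p \is d.-homog -> sub E p \is d.-homog.
Proof.
move=> hp; rewrite /sub comp_mpolyE; rewrite big_seq; apply: rpred_sum => u up.
have ud : mdeg u = d := dhomog_mf hp up.
rewrite rpredZ // -ud mdegE; apply: prodf_homog => i _.
by rewrite -[X in X.-homog]mul1n; apply: dhomogMn; rewrite tnth_mktuple lin_homog.
Qed.

(* Substituting [x - a(x) u], with [a(u) = 1], projects onto [ker a]. *)
Lemma sub_proj m (a : 'rV[F]_m) (u : 'cV[F]_m) p :
  exists q, p - sub (1%:M - u *m a) p = lin a * q.
Proof.
elim/mpoly_alg_ind: p => [c|i|p q [p1 IHp] [q1 IHq]|p q [p1 IHp] [q1 IHq]].
- by exists 0; rewrite subC subrr mulr0.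
- exists (u i 0)%:MP; rewrite subX linearB /= row1 linearB /= lin_delta.
  rewrite opprB addrC subrK row_mul [lin a * _]mulrC mul_mpolyC -linearZ /=.
  by congr lin; apply/rowP=> j; rewrite !mxE big_ord_recl big_ord0 addr0 !mxE.
- by exists (p1 + q1); rewrite rmorphD mulrDr -IHp -IHq opprD addrACA.
- exists (p1 * q + sub (1%:M - u *m a) p * q1).
  rewrite rmorphM /= mulrDr [lin a * (p1 * q)]mulrA -IHp.
  by rewrite [lin a * (_ * q1)]mulrCA -IHq mulrBl mulrBr addrA subrK.
Qed.

Lemma form_unit m (a : 'rV[F]_m) : a != 0 -> exists u : 'cV[F]_m, a *m u = 1%:M.
Proof.
move=> /rV0Pn [j aj]; exists ((a 0 j)^-1 *: delta_mx j 0).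
by rewrite -scalemxAr -colE; apply/matrixP=> i k; rewrite !ord1 !mxE mulVf.
Qed.

Definition pdvd m (p q : {mpoly F[m]}) := exists r, q = p * r.

Lemma pdvd_refl m (p : {mpoly F[m]}) : pdvd p p.
Proof. by exists 1; rewrite mulr1. Qed.

Lemma pdvd0 m (p : {mpoly F[m]}) : pdvd p 0.
Proof. by exists 0; rewrite mulr0. Qed.

Lemma pdvd_mulr m (p q r : {mpoly F[m]}) : pdvd p q -> pdvd p (q * r).
Proof. by case=> s ->; exists (s * r); rewrite mulrA. Qed.

Lemma pdvd_mull m (p q r : {mpoly F[m]}) : pdvd p q -> pdvd p (r * q).
Proof. by rewrite mulrC; apply: pdvd_mulr. Qed.

Lemma pdvdD m (p q r : {mpoly F[m]}) : pdvd p q -> pdvd p r -> pdvd p (q + r).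
Proof. by case=> s -> [t ->]; exists (s + t); rewrite mulrDr. Qed.

Lemma pdvdN m (p q : {mpoly F[m]}) : pdvd p q -> pdvd p (- q).
Proof. by case=> s ->; exists (- s); rewrite mulrN. Qed.

Lemma pdvdB m (p q r : {mpoly F[m]}) : pdvd p q -> pdvd p r -> pdvd p (q - r).
Proof. by move=> h1 h2; apply: pdvdD => //; apply: pdvdN. Qed.

Lemma pdvdZ m (p q : {mpoly F[m]}) c : pdvd p q -> pdvd p (c *: q).
Proof. by rewrite -mul_mpolyC; apply: pdvd_mull. Qed.

Lemma pdvd_sum m (I : Type) (r : seq I) (P : pred I) (f : I -> {mpoly F[m]}) p :
  (forall i, P i -> pdvd p (f i)) -> pdvd p (\sum_(i <- r | P i) f i).
Proof.
by move=> h; elim/big_rec: _ => [|i q Pi]; [apply: pdvd0 | apply: pdvdD; apply: h].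
Qed.

Lemma pdvd_mul m (p q r s : {mpoly F[m]}) :
  pdvd p q -> pdvd r s -> pdvd (p * r) (q * s).
Proof. by case=> t -> [u ->]; exists (t * u); rewrite mulrACA. Qed.

Lemma pdvdZl m (p q : {mpoly F[m]}) c : c != 0 -> pdvd p q -> pdvd (c *: p) q.
Proof.
move=> c0 [r ->]; exists (c^-1 *: r).
by rewrite -scalerAl -scalerAr scalerA mulfV // scale1r.
Qed.

Lemma sub_pdvd m k (E : 'M[F]_(m, k)) p q : pdvd p q -> pdvd (sub E p) (sub E q).
Proof. by case=> r ->; exists (sub E r); rewrite rmorphM. Qed.

(** Multiplication by [p] shifts degrees by [d], so only the component of degree [e] of a cofactor
    contributes to [q]. *)
Lemma pdvd_homog m (p q : {mpoly F[m]}) d e :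
  p \is d.-homog -> q \is (d + e)%N.-homog -> pdvd p q ->
  exists2 r, r \is e.-homog & q = p * r.
Proof.
move=> hp hq [r qr]; exists (pihomog mdeg e r); first exact: pihomogP.
rewrite -[LHS](pihomog_dE hq) qr.
rewrite [in LHS](pihomog_partitionE (leqnn (mmeasure mdeg r))) mulr_sumr linear_sum /=.
rewrite (eq_bigr (fun i : 'I__ => if (i : nat) == e then p * pihomog mdeg e r else 0)).
  case: (ltnP e (mmeasure mdeg r)) => he; last first.
    have -> : pihomog mdeg e r = 0.
      rewrite pihomogE big_seq_cond big1 // => u /andP [ur /eqP ue].
      by have := mmeasure_mnm_lt mdeg ur; rewrite ue ltnNge he.
    by rewrite mulr0 big1 // => i _; case: eqP.
  rewrite (bigD1 (Ordinal he)) //= eqxx big1 ?addr0 // => i ni.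
  by case: eqP => // ie; case/eqP: ni; apply: val_inj.
move=> i _; case: eqP => [<-|ne].
  by apply: pihomog_dE; apply: dhomogM => //; apply: pihomogP.
rewrite (@pihomog_ne0 _ _ _ (d + i)%N) //; last by apply: dhomogM => //; apply: pihomogP.
by rewrite eqn_add2l; apply/eqP.
Qed.

Lemma dhomog_lt_pdvd m (p q : {mpoly F[m]}) d e :
  p \is d.-homog -> q \is e.-homog -> p != 0 -> pdvd p q -> (e < d)%N -> q = 0.
Proof.
move=> hp hq p0 [r qr] ed; apply/eqP; apply: contraT => q0.
have r0 : r != 0 by apply: contraNneq q0 => r0; rewrite qr r0 mulr0.
have := msizeM p0 r0; rewrite -qr.
have hs (f : {mpoly F[m]}) c : f != 0 -> f \is c.-homog -> msize f = c.+1.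
  move=> f0 hf; have := dhomog_msize hf; move/(dhomog_uniq f0 hf).
  by move=> ->; rewrite prednK // lt0n mmeasure_poly_eq0.
rewrite (hs q e) // (hs p d) // => e1.
have r1 : (0 < msize r)%N by rewrite lt0n mmeasure_poly_eq0.
by move: ed; rewrite ltnNge -ltnS e1 addSn /= -[X in (X <= _)%N]addn0 ltn_add2l r1.
Qed.

End LinearSubstitution.

(** Cramer's rule for rows: the coordinates of [v] with respect to the rows of [M] are these
    determinants divided by that of [M]. *)
Lemma mulmx_adj_row (R : comPzRingType) n (M : 'M[R]_n) (v : 'rV[R]_n) j :
  (v *m \adj M) 0 j = \det (\matrix_(i, k) if i == j then v 0 k else M i k).
Proof.
rewrite (expand_det_row _ j) mxE; apply: eq_bigr => k _.
rewrite !mxE eqxx; congr (_ * _).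
rewrite /cofactor; congr (_ * \det _); apply/matrixP => i l; rewrite !mxE.
by rewrite eq_sym (negPf (neq_lift _ _)).
Qed.

(** * Saito's criterion *)

Section Saito.

Variable F : fieldType.

(** One form for each hyperplane: the forms are nonzero and pairwise nonproportional, so that
    lengths of lists count hyperplanes. *)
Definition arr m (L : seq 'rV[F]_m) : bool :=
  all (fun a => a != 0) L && pairwise (fun a b => ~~ (a <= b)%MS) L.

Lemma sub_row_sym m (a b : 'rV[F]_m) : a != 0 -> (a <= b)%MS -> (b <= a)%MS.
Proof.
move=> a0 /sub_rVP [c ac]; apply/sub_rVP; exists c^-1.
have c0 : c != 0 by apply: contraNneq a0 => c0; rewrite ac c0 scale0r.
by rewrite ac scalerA mulVf // scale1r.
Qed.

Lemma arr_cons m (a : 'rV[F]_m) L :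
  arr (a :: L) = [&& a != 0, all (fun b => ~~ (a <= b)%MS) L & arr L].
Proof. by rewrite /arr /= -!andbA; congr andb; rewrite andbCA. Qed.

Lemma arr_neq0 m (L : seq 'rV[F]_m) a : arr L -> a \in L -> a != 0.
Proof. by case/andP => /allP h _ /h. Qed.

Lemma arr_eq m (L : seq 'rV[F]_m) a b :
  arr L -> a \in L -> b \in L -> (a <= b)%MS -> a = b.
Proof.
elim: L => [|c L IH] //; rewrite arr_cons !inE => /and3P [c0 /allP cL aL].
case/predU1P => [->|ha] /predU1P [->|hb] ab //; last exact: IH.
- by have := cL _ hb; rewrite ab.
- by have := cL _ ha; rewrite (sub_row_sym (arr_neq0 aL ha) ab).
Qed.

Lemma arr_uniq m (L : seq 'rV[F]_m) : arr L -> uniq L.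
Proof.
elim: L => [|a L IH] //; rewrite arr_cons /= => /and3P [a0 /allP aL /IH ->].
by rewrite andbT; apply: contraT => /negbNE /aL; rewrite submx_refl.
Qed.

Lemma arrP m (L : seq 'rV[F]_m) :
  uniq L -> {in L, forall a, a != 0} -> {in L &, forall a b, (a <= b)%MS -> a = b} ->
  arr L.
Proof.
elim: L => [|a L IH] //= /andP [aL uL] h0 h; rewrite arr_cons h0 ?mem_head //=.
rewrite IH // ?andbT; last 2 first.
- by move=> b bL; apply: h0; rewrite inE bL orbT.
- by move=> b c bL cL; apply: h; rewrite inE ?bL ?cL orbT.
apply/allP => b bL; apply/negP => ab; case/negP: aL.
by rewrite (h _ _ _ _ ab) ?inE ?eqxx ?bL ?orbT.
Qed.

(** The substitution restricts to [ker a] along the direction [u]. Divisibility by a linear form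
    thus becomes an equation in an integral domain, and linear forms are seen to be prime without
    unique factorization. *)
Lemma lin_dvdP m (a : 'rV[F]_m) (u : 'cV[F]_m) p :
  a *m u = 1%:M -> pdvd (lin a) p <-> sub (1%:M - u *m a) p = 0.
Proof.
move=> au; split=> [[q ->]|h].
  by rewrite rmorphM /= sub_lin mulmxBr mulmx1 mulmxA au mul1mx subrr raddf0 mul0r.
by have [q] := sub_proj a u p; rewrite h subr0 => ->; exists q.
Qed.

Lemma lin_prime m (a : 'rV[F]_m) p q :
  a != 0 -> pdvd (lin a) (p * q) -> pdvd (lin a) p \/ pdvd (lin a) q.
Proof.
move=> /form_unit [u au]; rewrite !(lin_dvdP _ au) rmorphM => /eqP.
by rewrite mulf_eq0 => /orP [/eqP|/eqP]; [left | right].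
Qed.

Lemma lin_pdvd_lin m (a b : 'rV[F]_m) : a != 0 -> pdvd (lin a) (lin b) -> (b <= a)%MS.
Proof.
move=> /form_unit [u au] /(lin_dvdP _ au); rewrite sub_lin => /eqP.
rewrite lin_eq0 mulmxBr mulmx1 subr_eq0 mulmxA => /eqP ->.
by rewrite submxMl.
Qed.

Lemma lin_pdvd_prod m (a : 'rV[F]_m) (I : eqType) (r : seq I) (f : I -> {mpoly F[m]}) :
  a != 0 -> pdvd (lin a) (\prod_(i <- r) f i) -> exists2 i, i \in r & pdvd (lin a) (f i).
Proof.
move=> a0; elim: r => [|i r IH]; last first.
  rewrite big_cons => /(lin_prime a0) [h|/IH [j jr h]]; first by exists i; rewrite ?mem_head.
  by exists j => //; rewrite inE jr orbT.
rewrite big_nil => -[q q1]; case/eqP: (oner_neq0 {mpoly F[m]}).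
have /(lin_dvdP _ _) : pdvd (lin a) 1 by exists q.
by have [u au] := form_unit a0; move=> /(_ _ au); rewrite rmorph1.
Qed.

Lemma lin_pdvd_exp m (a : 'rV[F]_m) p n :
  a != 0 -> pdvd (lin a) (p ^+ n) -> pdvd (lin a) p.
Proof.
move=> a0; elim: n => [[q q1]|n IH]; last by rewrite exprS => /(lin_prime a0) [].
by exists (q * p); rewrite mulrA -q1 mul1r.
Qed.

(** Factors are split off one at a time: each of them passes to [q], as the form is prime and does
    not divide [c]. *)
Lemma lin_exp_coprime m (a : 'rV[F]_m) c q n :
  a != 0 -> ~ pdvd (lin a) c -> pdvd (lin a ^+ n) (c * q) -> pdvd (lin a ^+ n) q.
Proof.
move=> a0 ac; have la0 : lin a != 0 by rewrite lin_eq0.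
elim: n q => [|n IH] q; first by exists q; rewrite expr0 mul1r.
move=> h; have [//|[r qr]] : pdvd (lin a) c \/ pdvd (lin a) q.
  by apply: lin_prime => //; case: h => s ->; exists (lin a ^+ n * s); rewrite mulrA -exprS.
have /IH [s rs] : pdvd (lin a ^+ n) (c * r).
  case: h => s hs; exists s; apply: (mulfI la0).
  by rewrite mulrCA -qr hs mulrA -exprS.
by exists s; rewrite qr rs exprS mulrA.
Qed.

Lemma prod_lin_pdvd m (L : seq 'rV[F]_m) (n : 'rV[F]_m -> nat) p :
  arr L -> {in L, forall b, pdvd (lin b ^+ n b) p} ->
  pdvd (\prod_(b <- L) lin b ^+ n b) p.
Proof.
elim: L p => [|a L IH] p; first by move=> _ _; rewrite big_nil; exists p; rewrite mul1r.
rewrite arr_cons => /and3P [a0 /allP aL hL] h; rewrite big_cons.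
have [q pq] := h _ (mem_head _ _); rewrite pq; apply: pdvd_mul; first exact: pdvd_refl.
apply: IH => // b bL; apply: (@lin_exp_coprime _ _ (lin a ^+ n a)); last 1 first.
- by rewrite -pq; apply: h; rewrite inE bL orbT.
- exact: (arr_neq0 hL bL).
move/(lin_pdvd_exp (arr_neq0 hL bL)) => /(lin_pdvd_lin (arr_neq0 hL bL)).
exact/negP/aL.
Qed.

Definition liftm m p q (A : 'M[F]_(p, q)) : 'M[{mpoly F[m]}]_(p, q) :=
  map_mx (@mpolyC m F) A.

Lemma liftmE m p q (A : 'M[F]_(p, q)) i j : liftm m A i j = (A i j)%:MP.
Proof. by rewrite mxE. Qed.

Lemma liftmM m p q r (A : 'M[F]_(p, q)) (B : 'M[F]_(q, r)) :
  liftm m (A *m B) = liftm m A *m liftm m B.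
Proof. exact: map_mxM. Qed.

Lemma liftm1 m p : liftm m (1%:M : 'M[F]_p) = 1%:M.
Proof. exact: map_mx1. Qed.

(* The value of the derivation with coefficient row [row i M] on the form [a]. *)
Definition dval m k (M : 'M[{mpoly F[m]}]_(k, m)) (a : 'rV[F]_m) : 'cV[{mpoly F[m]}]_k :=
  M *m liftm m a^T.

Lemma dval_mul m k (M : 'M[{mpoly F[m]}]_(k, m)) a : dval M a = M *m liftm m a^T.
Proof. by []. Qed.

(** For all forms of an arrangement together, this says that the rows of [M], read as derivations,
    belong to its derivation module. *)
Definition tang m k (M : 'M[{mpoly F[m]}]_(k, m)) (a : 'rV[F]_m) : Prop :=
  forall i, pdvd (lin a) (dval M a i 0).

Lemma dvalE m k (M : 'M[{mpoly F[m]}]_(k, m)) a i :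
  dval M a i 0 = \sum_j a 0 j *: M i j.
Proof. by rewrite mxE; apply: eq_bigr => j _; rewrite !mxE mulrC mul_mpolyC. Qed.

Lemma dvalM m k l (U : 'M_(l, k)) (M : 'M[{mpoly F[m]}]_(k, m)) a :
  dval (U *m M) a = U *m dval M a.
Proof. by rewrite /dval mulmxA. Qed.

Lemma dvalZ m k (M : 'M[{mpoly F[m]}]_(k, m)) c a :
  dval M (c *: a) = c%:MP *: dval M a.
Proof. by rewrite /dval /liftm linearZ map_mxZ -scalemxAr. Qed.

Lemma dvalBl m k (M N : 'M[{mpoly F[m]}]_(k, m)) a :
  dval (M - N) a = dval M a - dval N a.
Proof. by rewrite /dval mulmxBl. Qed.

Lemma dvalZl m k (M : 'M[{mpoly F[m]}]_(k, m)) p a : dval (p *: M) a = p *: dval M a.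
Proof. by rewrite /dval scalemxAl. Qed.

Lemma dval_suml m k (I : finType) (M : I -> 'M[{mpoly F[m]}]_(k, m)) a :
  dval (\sum_i M i) a = \sum_i dval (M i) a.
Proof. by rewrite /dval mulmx_suml. Qed.

Lemma dval_row m k (M : 'M[{mpoly F[m]}]_(k, m)) a i : dval (row i M) a 0 0 = dval M a i 0.
Proof. by rewrite !dvalE; apply: eq_bigr => l _; rewrite mxE. Qed.

Lemma tangM m k l (U : 'M_(l, k)) (M : 'M[{mpoly F[m]}]_(k, m)) a :
  tang M a -> tang (U *m M) a.
Proof.
by move=> h i; rewrite dvalM mxE; apply: pdvd_sum => j _; apply: pdvd_mull.
Qed.

Lemma tangZ m k (M : 'M[{mpoly F[m]}]_(k, m)) c a :
  c != 0 -> tang M a -> tang M (c *: a).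
Proof.
move=> c0 h i; rewrite dvalZ mxE linearZ /=; apply: pdvdZl => //.
by apply: pdvd_mull.
Qed.

Lemma map_liftm m k (E : 'M[F]_(m, k)) p q (A : 'M[F]_(p, q)) :
  map_mx (sub E) (liftm m A) = liftm k A.
Proof. by apply/matrixP => i j; rewrite !mxE subC. Qed.

Lemma map_dval m k l (E : 'M[F]_(m, l)) (M : 'M[{mpoly F[m]}]_(k, m)) a i :
  sub E (dval M a i 0) = (map_mx (sub E) M *m liftm l a^T) i 0.
Proof. by rewrite /dval -(map_liftm E) -map_mxM [RHS]mxE. Qed.

Lemma liftm_eq0 m p q (A : 'M[F]_(p, q)) : (liftm m A == 0) = (A == 0).
Proof.
apply/eqP/eqP => [h|->]; last by rewrite /liftm map_mx0.
by apply/matrixP => i j; move/matrixP/(_ i j): h; rewrite !mxE => /eqP; rewrite mpolyC_eq0 => /eqP.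
Qed.

Lemma det_ker m n (M : 'M[{mpoly F[m]}]_n) (a : 'rV[F]_n) :
  a != 0 -> M *m liftm m a^T = 0 -> \det M = 0.
Proof.
move=> a0 h; apply/eqP; rewrite -det_tr; apply/det0P; exists (liftm m a).
  by rewrite liftm_eq0.
apply: trmx_inj; rewrite trmx_mul trmxK trmx0 -{}h.
by congr (_ *m _); apply/matrixP => i j; rewrite !mxE.
Qed.

(** On [ker a] the matrix kills the nonzero constant column [a^T], hence its determinant vanishes
    there. *)
Lemma det_tang m (M : 'M[{mpoly F[m]}]_m) a : a != 0 -> tang M a -> pdvd (lin a) (\det M).
Proof.
move=> a0 h; have [u au] := form_unit a0; apply/(lin_dvdP _ au).
rewrite -det_map_mx; apply: (det_ker a0); apply/colP => i.
by rewrite -map_dval [RHS]mxE; apply/(lin_dvdP _ au).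
Qed.

Lemma det_homog m n (M : 'M[{mpoly F[m]}]_n) (e : 'I_n -> nat) :
  (forall i j, M i j \is (e i).-homog) -> \det M \is (\sum_i e i)%N.-homog.
Proof.
move=> h; apply: rpred_sum => s _; rewrite -signr_odd -[(-1) ^+ _]/(GRing.sign _ _).
rewrite rpredMsign; exact: prodf_homog.
Qed.

(** Saito's criterion taken as a definition. The degree count forces the determinant to be a
    constant times the product of the forms, and that the rows form a basis is a consequence. *)
Definition saito m (M : 'M[{mpoly F[m]}]_m) (L : seq 'rV[F]_m) (e : 'I_m -> nat) : Prop :=
  [/\ forall i j, M i j \is (e i).-homog, forall a, a \in L -> tang M a,
      \det M != 0 & (\sum_i e i)%N = size L].

Definition sfree m (L : seq 'rV[F]_m) (e : 'I_m -> nat) : Prop := exists M, saito M L e.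

Lemma prod_lin_homog m (L : seq 'rV[F]_m) : \prod_(a <- L) lin a \is (size L).-homog.
Proof.
rewrite -sum1_size; apply: prodf_homog => a _; exact: lin_homog.
Qed.

Lemma prod_lin_neq0 m (L : seq 'rV[F]_m) : arr L -> \prod_(a <- L) lin a != 0.
Proof.
move=> hL; rewrite prodf_seq_neq0; apply/allP => a /(arr_neq0 hL).
by rewrite lin_eq0.
Qed.

Lemma det_prod_dvd m (M : 'M[{mpoly F[m]}]_m) L :
  arr L -> (forall a, a \in L -> tang M a) -> pdvd (\prod_(a <- L) lin a) (\det M).
Proof.
move=> hL h; have := @prod_lin_pdvd _ L (fun=> 1%N) (\det M) hL.
rewrite (eq_bigr _ (fun i _ => expr1 _)); apply => a aL; rewrite expr1.
by apply: det_tang; [apply: (arr_neq0 hL) | apply: h].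
Qed.

Lemma saito_lower m (M : 'M[{mpoly F[m]}]_m) L (e : 'I_m -> nat) :
  arr L -> (forall i j, M i j \is (e i).-homog) -> (forall a, a \in L -> tang M a) ->
  \det M != 0 -> (size L <= \sum_i e i)%N.
Proof.
move=> hL he ht d0; rewrite leqNgt; apply: contra d0 => lt.
rewrite (dhomog_lt_pdvd (prod_lin_homog L) (det_homog he) _ _ lt) ?eqxx //.
  exact: prod_lin_neq0.
exact: det_prod_dvd.
Qed.

Lemma homog0_const m (p : {mpoly F[m]}) : p \is 0.-homog -> exists c, p = c%:MP.
Proof.
move=> hp; exists p@_0%MM; apply/mpolyP => u; rewrite mcoeffC.
case: (eqVneq u 0%MM) => [->|u0]; first by rewrite mulr1.
rewrite mulr0; apply/eqP; apply: contraT.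
by rewrite -mcoeff_msupp => /(dhomog_mf hp) /eqP /=; rewrite mdeg_eq0 (negPf u0).
Qed.

Lemma saito_det m (M : 'M[{mpoly F[m]}]_m) L e :
  arr L -> saito M L e -> exists2 c, c != 0 & \det M = c%:MP * \prod_(a <- L) lin a.
Proof.
move=> hL [he ht d0 se].
have hd : \det M \is (size L + 0)%N.-homog by rewrite addn0 -se; apply: det_homog.
have [r /homog0_const [c ->] dM] := pdvd_homog (prod_lin_homog L) hd (det_prod_dvd hL ht).
exists c; last by rewrite dM mulrC.
by apply: contraNneq d0 => c0; rewrite dM c0 mpolyC0 mulr0.
Qed.

(** Replacing row [j] of [M] by [eta] keeps all rows tangent, so the new determinant is divisible by
    the product of the forms, that is by [\det M]; the quotients are Cramer's coordinates. As the
    subtraction of degrees truncates, the case [d < e j] is recorded separately. *)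
Lemma saito_basis m (M : 'M[{mpoly F[m]}]_m) L e (eta : 'rV[{mpoly F[m]}]_m) :
  arr L -> saito M L e -> (forall a, a \in L -> tang eta a) ->
  exists2 h : 'rV_m, eta = h *m M &
    forall d, (forall j, eta 0 j \is d.-homog) ->
    forall j, h 0 j \is (d - e j).-homog /\ ((d < e j)%N -> h 0 j = 0).
Proof.
move=> hL sM ht; have [he hM d0 se] := sM; have [c c0 dM] := saito_det hL sM.
pose R j : 'M_m := \matrix_(i, k) if i == j then eta 0 k else M i k.
have RE j : (eta *m \adj M) 0 j = \det (R j) := mulmx_adj_row M eta j.
have Rt j a : a \in L -> tang (R j) a.
  move=> aL i; rewrite dvalE; case: (eqVneq i j) => [->|nij].
    have := ht _ aL 0; rewrite dvalE.
    by congr pdvd; apply: eq_bigr => k _; rewrite mxE eqxx.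
  have := hM _ aL i; rewrite dvalE.
  by congr pdvd; apply: eq_bigr => k _; rewrite mxE (negPf nij).
have Rd j := det_prod_dvd hL (Rt j).
have [h hE] : exists h : 'I_m -> {mpoly F[m]},
    forall j, \det (R j) = \det M * h j.
  have H j : exists r, \det (R j) == \det M * r.
    have [r rE] := Rd j; exists (c^-1 *: r).
    by rewrite dM -scalerAr -mulrA -rE mul_mpolyC scalerA mulVf // scale1r.
  by exists (fun j => xchoose (H j)) => j; apply/eqP/(xchooseP (H j)).
pose hr : 'rV_m := \row_j h j.
have eE : eta = hr *m M.
  have D : eta *m \adj M = \det M *: hr.
    by apply/rowP => j; rewrite RE hE !mxE.
  apply/rowP => j; apply: (mulfI d0).
  have : eta *m \adj M *m M = \det M *: (hr *m M) by rewrite D scalemxAl.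
  rewrite -mulmxA mul_adj_mx mul_mx_scalar => /rowP /(_ j).
  by rewrite !mxE.
exists hr => // d hd j; rewrite mxE.
have Rh i k : R j i k \is (if i == j then d else e i).-homog.
  by rewrite mxE; case: eqP.
have dR := det_homog Rh; rewrite (bigD1 j) //= eqxx in dR.
rewrite (eq_bigr e) in dR; last by move=> i /negPf ->.
have dMh := det_homog he; rewrite (bigD1 j) //= in dMh.
case: (leqP (e j) d) => [ed|de].
  split=> //; have E : (d + \sum_(i < m | i != j) e i = e j + \sum_(i < m | i != j) e i + (d - e j))%N.
    by rewrite addnAC subnKC.
  rewrite E in dR.
  have [|r hr' rE] := pdvd_homog dMh dR; first by exists (h j).
  by rewrite (mulfI d0 (etrans (esym (hE j)) rE)).
suff h0 : h j = 0 by rewrite h0 dhomog0.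
have R0 : \det (R j) = 0.
  apply: (dhomog_lt_pdvd dMh dR d0); first by exists (h j).
  by rewrite ltn_add2r.
by apply: (mulfI d0); rewrite -hE R0 mulr0.
Qed.

End Saito.

Local Opaque dval liftm.

(** The minor formed by two linear forms and their values under a derivation is only scaled by [c]
    when the second form is multiplied by [c] and a multiple of the first is added to it. *)
Lemma scale_cross (R : comNzRingType) (S : comAlgType R) (c d : R) (x y z w : S) :
  x * (c *: z + d *: w) - (c *: y + d *: x) * w = c *: (x * z - y * w).
Proof.
rewrite mulrDr mulrDl -!scalerAr -!scalerAl opprD addrACA.
by rewrite subrr addr0 scalerBr.
Qed.

Lemma homogZ (R : nzRingType) n (c : R) (p : {mpoly R[n]}) d :
  p \is d.-homog -> c *: p \is d.-homog.
Proof. exact: dhomogZ. Qed.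

Lemma row0E (R : Type) p q (X : 'M[R]_(p, q)) i l : row i X 0 l = X i l.
Proof. by rewrite mxE. Qed.

(** * Addition of hyperplanes *)

Section Hyperplanes.

Variable F : fieldType.

(* The columns of [E] form a basis of the hyperplane [ker a]. *)
Definition hyper m k (E : 'M[F]_(m, k)) (a : 'rV[F]_m) : Prop :=
  row_full E /\ forall x : 'rV_m, (x *m E == 0) = (x <= a)%MS.

Lemma hyper_dvd m k (E : 'M[F]_(m, k)) a p :
  hyper E a -> a != 0 -> sub E p = 0 <-> pdvd (lin a) p.
Proof.
move=> [/row_fullP [E' E'E] hE] a0.
have aE : a *m E = 0 by apply/eqP; rewrite hE.
split=> [p0|[q ->]]; last by rewrite rmorphM /= sub_lin aE raddf0 mul0r.
have [u hu] : exists u : 'cV_m, 1%:M - E *m E' = u *m a.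
  suff : (1%:M - E *m E' <= a)%MS by move=> /submxP [u ->]; exists u.
  apply/row_subP => i; rewrite -hE -row_mul mulmxBl mul1mx -mulmxA E'E mulmx1 subrr.
  by rewrite row0.
have [q] := sub_proj a u p.
by rewrite -hu subKr -sub_comp p0 raddf0 subr0 => ->; exists q.
Qed.

(** The forms are given by a predicate, since roots are generated inductively. Forms vanishing on
    the column space of [E] disappear; the others are represented once up to scalars. *)
Definition restr_to m k (A : 'rV[F]_m -> Prop) (E : 'M[F]_(m, k)) (L : seq 'rV[F]_k) :=
  [/\ arr L,
      forall a, A a -> a *m E = 0 \/ (exists2 l, l \in L & (a *m E <= l)%MS) &
      forall l, l \in L -> exists2 a, A a & (l <= a *m E)%MS].

Lemma arr_filter m (L : seq 'rV[F]_m) (P : pred 'rV[F]_m) : arr L -> arr (filter P L).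
Proof.
move=> hL; apply: arrP; first by rewrite filter_uniq // arr_uniq.
  by move=> a; rewrite mem_filter => /andP [_ /(arr_neq0 hL)].
by move=> a b; rewrite !mem_filter => /andP [_ aL] /andP [_ bL]; apply: arr_eq hL _ _.
Qed.

Lemma pdvd_prod_exp m (I : eqType) (r : seq I) (f : I -> {mpoly F[m]}) p :
  {in r, forall i, pdvd p (f i)} -> pdvd (p ^+ size r) (\prod_(i <- r) f i).
Proof.
elim: r => [|i r IH] h; first by rewrite big_nil expr0; apply: pdvd_refl.
rewrite big_cons exprS; apply: pdvd_mul; first by apply: h; rewrite mem_head.
by apply: IH => j jr; apply: h; rewrite inE jr orbT.
Qed.

Section Collisions.

Variables (m k : nat) (A : seq 'rV[F]_m) (a : 'rV[F]_m) (E : 'M[F]_(m, k)).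
Variable L : seq 'rV[F]_k.
Hypotheses (hE : hyper E a) (hA : arr (a :: A)) (hL : restr_to (fun b => b \in A) E L).

Let cls (l : 'rV[F]_k) := [seq b <- A | (b *m E <= l)%MS].

(* Terao's polynomial [B]: every derivation of [A] sends [a] into the ideal
   generated by [a] and [B], and its degree is [|A| - |A^H|]. *)
Definition terao_poly : {mpoly F[k]} := \prod_(l <- L) lin l ^+ (size (cls l)).-1.

Lemma arr_a_neq0 : a != 0. Proof. exact: arr_neq0 hA (mem_head _ _). Qed.

Lemma arr_restr_neq0 b : b \in A -> b *m E != 0.
Proof.
move=> bA; case: hE => _ ->; apply/negP => /(arr_eq hA) ba.
have ab : b = a by apply: ba; rewrite ?mem_head // inE bA orbT.
by have := arr_uniq hA; rewrite /= -ab bA.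
Qed.

(** Each hyperplane of [A] meets [ker a] in exactly one hyperplane of the restriction; count the
    pairs in two ways. *)
Lemma cls_size : (\sum_(l <- L) size (cls l))%N = size A.
Proof.
have [aL hAL hLA] := hL.
transitivity (\sum_(b <- A) \sum_(l <- L) (b *m E <= l)%MS)%N.
  rewrite exchange_big; apply: eq_bigr => l _.
  by rewrite size_filter -sum1_count big_mkcond; apply: eq_bigr => b _; case: (_ <= _)%MS.
rewrite -sum1_size big_seq [RHS]big_seq; apply: eq_bigr => b bA.
have [/eqP|[l lL bl]] := hAL b bA; first by rewrite (negPf (arr_restr_neq0 bA)).
rewrite (bigD1_seq l) ?arr_uniq //= bl big_seq_cond big1 ?addn0 // => l' /andP [l'L ne].
case: (boolP (_ <= _)%MS) => // bl'; case/eqP: ne; apply: (arr_eq aL) => //.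
by apply: submx_trans bl; apply: sub_row_sym bl'; apply: arr_restr_neq0.
Qed.

Lemma cls_gt0 l : l \in L -> (0 < size (cls l))%N.
Proof.
have [aL hAL hLA] := hL.
move=> lL; have [b bA lb] := hLA l lL; rewrite -has_predT; apply/hasP; exists b => //.
by rewrite mem_filter bA (sub_row_sym (arr_neq0 aL lL)).
Qed.

Lemma terao_size : ((\sum_(l <- L) (size (cls l)).-1) + size L)%N = size A.
Proof.
rewrite -cls_size -sum1_size -big_split /= big_seq [RHS]big_seq.
by apply: eq_bigr => l lL; rewrite addn1 prednK // cls_gt0.
Qed.

Lemma terao_homog : terao_poly \is (size A - size L)%N.-homog.
Proof.
rewrite -terao_size addnK; apply: prodf_homog => l _.
by rewrite -[X in X.-homog]mul1n; apply: dhomogMn; apply: lin_homog.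
Qed.

Lemma restr_size_le : (size L <= size A)%N.
Proof. by rewrite -terao_size leq_addl. Qed.

Lemma terao_neq0 : terao_poly != 0.
Proof.
have [aL _ _] := hL; rewrite prodf_seq_neq0; apply/allP => l lL.
by rewrite expf_neq0 // lin_eq0 (arr_neq0 aL lL).
Qed.

(** The forms [b] with the same trace [l] on [ker a] agree up to scalars modulo [a]. Hence the minor
    [G] of [a] and [b] under [eta] is the same for all of them up to scalars, and every such [b]
    divides it. On [ker a] it reduces to [- b * eta(a)]; cancelling one of the proportional factors
    leaves the power of [l] in Terao's polynomial. *)
Lemma terao_dvd (eta : 'rV[{mpoly F[m]}]_m) :
  (forall b, b \in A -> tang eta b) -> pdvd terao_poly (sub E (dval eta a 0 0)).
Proof.
move=> ht; have [aL hAL hLA] := hL.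
apply: prod_lin_pdvd => // l lL.
have := cls_gt0 lL; have clsA b : b \in cls l -> (b \in A) * (b *m E <= l)%MS.
  by rewrite mem_filter => /andP [-> ->].
have : arr (cls l) by apply: arr_filter; move: hA; rewrite arr_cons => /and3P [].
case: (cls l) clsA => [|b1 s] // clsA hs _ /=.
have [b1A b1l] := clsA b1 (mem_head _ _).
pose v b := dval eta b 0 0.
pose G := lin a * v b1 - lin b1 * v a.
have vZ c d x y : v (c *: x + d *: y) = c *: v x + d *: v y.
  rewrite /v !dvalE !scaler_sumr -big_split /=; apply: eq_bigr => j _.
  by rewrite !mxE scalerDl !scalerA.
have G1 b : b \in b1 :: s -> pdvd (lin b) G.
  move=> bs; have [bA bl] := clsA b bs.
  have /sub_rVP [c hc] : (b *m E <= b1 *m E)%MS.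
    by apply: submx_trans bl _; apply: sub_row_sym b1l; apply: arr_restr_neq0.
  have c0 : c != 0.
    by apply: contraNneq (arr_restr_neq0 bA) => c0; rewrite hc c0 scale0r.
  have /sub_rVP [d hd] : (b - c *: b1 <= a)%MS.
    by case: hE => _ <-; rewrite mulmxBl hc -scalemxAl subrr.
  have b1E : b1 = c^-1 *: b + (- (c^-1 * d)) *: a.
    have -> : b = c *: b1 + d *: a by rewrite -hd addrC subrK.
    by rewrite scalerDr scalerA mulVf // scale1r scalerA scaleNr addrK.
  have -> : G = c^-1 *: (lin a * v b - lin b * v a).
    have lb1 : lin b1 = c^-1 *: lin b + (- (c^-1 * d)) *: lin a.
      by rewrite [in LHS]b1E linearD !linearZ.
    have vb1 : v b1 = c^-1 *: v b + (- (c^-1 * d)) *: v a by rewrite [in LHS]b1E vZ.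
    by rewrite /G lb1 vb1 scale_cross.
  apply: pdvdZ; apply: pdvdB; first by apply: pdvd_mull; apply: ht.
  by apply: pdvd_mulr; apply: pdvd_refl.
have /(sub_pdvd E) : pdvd (\prod_(b <- b1 :: s) lin b) G.
  have := @prod_lin_pdvd _ _ (b1 :: s) (fun=> 1%N) G hs.
  by rewrite (eq_bigr _ (fun i _ => expr1 _)); apply => b bs; rewrite expr1; apply: G1.
have aE : a *m E = 0 by case: hE => _ h; apply/eqP; rewrite h.
have -> : sub E G = - (lin (b1 *m E) * sub E (v a)).
  rewrite /G rmorphB [X in X - _](rmorphM (sub E)) [X in _ - X](rmorphM (sub E)).
  by rewrite /= 2!sub_lin aE raddf0 mul0r sub0r.
rewrite rmorph_prod big_cons /=.
case=> q; rewrite sub_lin -mulrA => /eqP; rewrite eqr_oppLR -mulrN => /eqP.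
have b1E0 : lin (b1 *m E) != 0 by rewrite lin_eq0 arr_restr_neq0.
move/(mulfI b1E0) => vE; rewrite vE -mulrN; apply: pdvd_mulr.
apply: pdvd_prod_exp => b bs; rewrite sub_lin.
have [|bA /sub_rVP [c ->]] := clsA b; first by rewrite inE bs orbT.
by rewrite linearZ; apply: pdvdZ; apply: pdvd_refl.
Qed.

Lemma terao_quot (eta : 'rV[{mpoly F[m]}]_m) e :
  (forall b, b \in A -> tang eta b) -> (forall j, eta 0 j \is e.-homog) ->
  exists g, [/\ g \is (e - (size A - size L)).-homog,
    (e < size A - size L)%N -> g = 0 & sub E (dval eta a 0 0) = g * terao_poly].
Proof.
move=> ht he; have hd := terao_dvd ht.
have hs : sub E (dval eta a 0 0) \is e.-homog.
  apply: sub_homog; rewrite dvalE; apply: rpred_sum => j _; apply: homogZ; exact: he.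
case: (leqP (size A - size L) e) => h.
  rewrite -(subnKC h) in hs; have [g hg gE] := pdvd_homog terao_homog hs hd.
  by exists g; split; rewrite // mulrC.
exists 0; split; rewrite ?dhomog0 // mul0r.
exact: dhomog_lt_pdvd terao_homog hs terao_neq0 hd h.
Qed.

End Collisions.

(** The selected rows have degree [d], and their quotients form a constant matrix [C]. Its inverse
    yields combinations [N] of these rows such that the value on [a j'], restricted to the kernel of
    [a j'], is [B j'] for row [j'] and zero for the others. Multiplying row [j] of [N] by [a j] and
    clearing all unselected rows with [N] gives derivations tangent to all the new hyperplanes; only
    the selected degrees grow, by one. *)
Lemma exchange m k (A : seq 'rV[F]_m) M (e : 'I_m -> nat) q
    (a : 'I_q -> 'rV[F]_m) (E : 'I_q -> 'M[F]_(m, k)) (B : 'I_q -> {mpoly F[k]}) d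
    (G : 'I_m -> 'I_q -> {mpoly F[k]}) (f : 'I_q -> 'I_m) (C : 'M[F]_q) :
  saito M A e -> (forall j, a j != 0) -> (forall j, hyper (E j) (a j)) ->
  (forall i j, sub (E j) (dval M (a j) i 0) = G i j * B j) ->
  (forall i j, G i j \is (e i - d).-homog) ->
  (forall i j, (e i < d)%N -> G i j = 0) ->
  injective f -> (forall j, e (f j) = d) -> C \in unitmx ->
  (forall j j', G (f j) j' = (C j j')%:MP) ->
  sfree (A ++ [seq a j | j <- enum 'I_q]) (fun i => e i + (i \in codom f))%N.
Proof.
move=> [he ht d0 se] a0 hE hG hGh hG0 finj fd Cu GC.
pose D := invmx C.
have [T [TE T0]] : exists T : 'M[F]_(q, m), (forall j j', T j (f j') = D j j') /\
    (forall j i, i \notin codom f -> T j i = 0).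
  exists (D *m (\matrix_(j, i) (f j == i)%:R)); split=> [j j'|j i ni].
    rewrite mxE (bigD1 j') //= mxE eqxx mulr1 big1 ?addr0 // => l lj.
    by rewrite mxE inj_eq // (negPf lj) mulr0.
  rewrite mxE big1 // => l _; rewrite mxE.
  by case: eqP => [fl|]; rewrite ?mulr0 //; rewrite -fl codom_f in ni.
pose N := liftm m T *m M.
have hN j i : N j i \is d.-homog.
  rewrite mxE; apply: rpred_sum => l _; rewrite liftmE mul_mpolyC.
  case: (boolP (l \in codom f)) => [/codomP [j' ->]|/T0 ->]; last first.
    by rewrite scale0r dhomog0.
  by rewrite rpredZ // -(fd j').
have NB j j' : sub (E j') (dval N (a j') j 0) = if j == j' then B j' else 0.
  rewrite dvalM mxE raddf_sum /=.
  have -> : \sum_(i < m) sub (E j') (liftm m T j i * dval M (a j') i 0) =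
            \sum_i (T j i)%:MP * (G i j' * B j').
    by apply: eq_bigr => i _; rewrite rmorphM /= hG liftmE subC.
  have -> : \sum_i (T j i)%:MP * (G i j' * B j') =
            \sum_l (D j l)%:MP * ((C l j')%:MP * B j').
    rewrite (bigID (mem (codom f))) /= addrC big1 ?add0r; last first.
      by move=> i ni; rewrite T0 // mpolyC0 mul0r.
    rewrite (reindex_onto f (fun i => odflt j [pick l | f l == i])) /=; last first.
      move=> i /codomP [l ->]; case: pickP => [l' /eqP //|/(_ l)].
      by rewrite eqxx.
    apply: eq_big => [l|l _]; last by rewrite TE GC.
    rewrite codom_f; case: pickP => [l' /eqP /finj ->|/(_ l)]; rewrite eqxx //.
  have : (D *m C) j j' = (j == j')%:R by rewrite mulVmx // mxE.
  rewrite mxE => DC; rewrite (eq_bigr (fun l => (D j l * C l j')%:MP * B j')); last first.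
    by move=> l _; rewrite mulrA mpolyCM.
  rewrite -mulr_suml -raddf_sum DC /=; case: (j == j') => /=; first by rewrite mul1r.
  by rewrite mpolyC0 mul0r.
have [E' hE'] : exists E' : 'I_q -> 'M[F]_(k, m), forall j, E' j *m E j = 1%:M.
  have H j : exists X, X *m E j == 1%:M.
    by case: (hE j) => /row_fullP [X XE] _; exists X; apply/eqP.
  by exists (fun j => xchoose (H j)) => j; apply/eqP/(xchooseP (H j)).
(* [E' j] is a left inverse of [E j], so [sub (E' j)] lifts the quotient [G i j] from the hyperplane
   to the whole space. *)
pose U : 'M[{mpoly F[m]}]_m := \matrix_(i, l)
  if [pick j | f j == i] is Some j then lin (a j) * (T j l)%:MP
  else (i == l)%:R - \sum_j sub (E' j) (G i j) * (T j l)%:MP.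
have UMf j : row (f j) (U *m M) = lin (a j) *: row j N.
  apply/rowP => l; rewrite !mxE mulr_sumr; apply: eq_bigr => i _; rewrite !mxE ?liftmE.
  by case: pickP => [j' /eqP /finj ->|/(_ j)]; rewrite ?eqxx // mulrA.
have UMn i : i \notin codom f ->
    row i (U *m M) = row i M - \sum_j sub (E' j) (G i j) *: row j N.
  move=> ni; apply/rowP => l; rewrite !mxE summxE.
  have p0 : [pick j | f j == i] = None.
    by case: pickP => // j /eqP fj; rewrite -fj codom_f in ni.
  under eq_bigr do rewrite mxE p0 mulrBl; rewrite sumrB; congr (_ - _).
    rewrite (bigD1 i) //= eqxx mul1r big1 ?addr0 // => i' ni'.
    by rewrite eq_sym (negPf ni') mul0r.
  under eq_bigr do rewrite mulr_suml; rewrite exchange_big /=; apply: eq_bigr => j _.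
  rewrite !mxE mulr_sumr; apply: eq_bigr => i' _; by rewrite ?liftmE ?mxE mulrA.
exists (U *m M); split.
- move=> i l; case: (boolP (i \in codom f)) => [/codomP [j ->]|ni].
    have -> : (U *m M) (f j) l = lin (a j) * N j l.
      by rewrite -[LHS]row0E UMf mxE row0E.
    by rewrite fd addnC; apply: dhomogM; [apply: lin_homog | apply: hN].
  have -> : (U *m M) i l = M i l - \sum_j sub (E' j) (G i j) * N j l.
    rewrite -[LHS]row0E UMn // mxE row0E; congr (_ + _).
    by rewrite mxE summxE; congr (- _); apply: eq_bigr => j _; rewrite mxE row0E.
  rewrite addn0 rpredB //; apply: rpred_sum => j _; case: (ltnP (e i) d) => h.
    by rewrite hG0 // raddf0 mul0r dhomog0.
  by rewrite -(subnK h); apply: dhomogM; [apply: sub_homog | apply: hN].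
- move=> b; rewrite mem_cat => /orP [bA|/mapP [j0 _ ->]]; first exact: tangM (ht b bA).
  move=> i; rewrite -dval_row; case: (boolP (i \in codom f)) => [/codomP [j ->]|ni].
    rewrite UMf dvalZl mxE dval_row.
    case: (eqVneq j j0) => [->|ne]; first by apply: pdvd_mulr; apply: pdvd_refl.
    by apply: pdvd_mull; apply/(hyper_dvd _ (hE j0) (a0 j0)); rewrite NB (negPf ne).
  apply/(hyper_dvd _ (hE j0) (a0 j0)); rewrite UMn // dvalBl dval_suml mxE.
  rewrite [X in _ + X]mxE summxE rmorphB /= dval_row hG rmorph_sum /=.
  apply/eqP; rewrite subr_eq0 (bigD1 j0) //= big1 ?addr0 => [|j ne].
    by rewrite dvalZl mxE dval_row rmorphM /= NB eqxx sub_comp hE' sub1.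
  by rewrite dvalZl mxE dval_row rmorphM /= NB (negPf ne) mulr0.
(* Outside the image of [f] the columns of [U] are those of the identity, so a row vector killed by
   [U] is supported on the image; there [U] is [D] with its rows scaled by the nonzero forms
   [a j]. *)
- rewrite det_mulmx mulf_neq0 //; apply/det0P => -[v v0 vU].
  have vE l : \sum_i v 0 i * U i l = 0 by move/rowP/(_ l): vU; rewrite !mxE.
  have vn l : l \notin codom f -> v 0 l = 0.
    move=> nl; have := vE l; rewrite (bigD1 l) //= big1 => [|i il].
      rewrite addr0 mxE; case: pickP => [j /eqP fj|_]; first by rewrite -fj codom_f in nl.
      rewrite eqxx big1 ?subr0 ?mulr1 // => j _; by rewrite T0 // mpolyC0 mulr0.
    rewrite mxE; case: pickP => [j _|_]; first by rewrite T0 // mpolyC0 !mulr0.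
    rewrite (negPf il) big1 ?subr0 ?mulr0 // => j _; by rewrite T0 // mpolyC0 mulr0.
  pose w : 'rV_q := \row_j (v 0 (f j) * lin (a j)).
  have wD : w *m liftm m D = 0.
    apply/rowP => l; rewrite !mxE -[RHS](vE (f l)) [RHS](bigID (mem (codom f))) /=.
    rewrite [X in _ = _ + X]big1 ?addr0; last by move=> i ni; rewrite vn // mul0r.
    rewrite [RHS](reindex_onto f (fun i => odflt l [pick l | f l == i])) /=; last first.
      move=> i /codomP [j ->]; case: pickP => [l' /eqP //|/(_ j)].
      by rewrite eqxx.
    apply: eq_big => [j|j _].
      rewrite codom_f; case: pickP => [l' /eqP /finj ->|/(_ j)]; rewrite eqxx //.
    rewrite !mxE; case: pickP => [l' /eqP /finj ->|/(_ j)]; last by rewrite eqxx.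
    by rewrite mulrA TE.
  have w0 : w = 0.
    have DC : liftm m D *m liftm m C = 1%:M.
      by rewrite -liftmM mulVmx // liftm1.
    by rewrite -[w]mulmx1 -DC mulmxA wD mul0mx.
  case/eqP: v0; apply/rowP => i; rewrite [RHS]mxE.
  case: (boolP (i \in codom f)) => [/codomP [j ->]|/vn //].
  move/rowP/(_ j): w0; rewrite !mxE => /eqP; rewrite mulf_eq0 lin_eq0 (negPf (a0 j)) orbF.
  by move/eqP.
- have cq : #|codom f| = q by rewrite card_codom // card_ord.
  rewrite big_split /= se size_cat size_map size_enum_ord -[in RHS]cq; congr (_ + _)%N.
  rewrite -sum1_card [RHS]big_mkcond; apply: eq_bigr => i _.
  by case: (i \in codom f).
Qed.

End Hyperplanes.

Section Rules.

Variable F : fieldType.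

Definition free_exp m (A : seq 'rV[F]_m) (es : seq nat) : Prop :=
  exists2 e : 'I_m -> nat, sfree A e & perm_eq es [seq e i | i <- enum 'I_m].

(** An equation of multisets, in which the removed exponents are added on the other side instead of
    being subtracted. *)
Lemma exps_bump m q (e : 'I_m -> nat) (f : 'I_q -> 'I_m) d :
  injective f -> (forall j, e (f j) = d) ->
  perm_eq ([seq e i + (i \in codom f) | i <- enum 'I_m] ++ nseq q d)%N
          ([seq e i | i <- enum 'I_m] ++ nseq q d.+1).
Proof.
move=> finj fd; pose r := [seq i <- enum 'I_m | i \notin codom f].
have pe : perm_eq (enum 'I_m) ([seq f j | j <- enum 'I_q] ++ r).
  apply: uniq_perm; first exact: enum_uniq.
    rewrite cat_uniq (map_inj_uniq finj) enum_uniq filter_uniq ?enum_uniq // andbT.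
    apply/hasPn => i; rewrite mem_filter => /andP [ni _]; apply: contra ni.
    by case/mapP => j _ ->; apply: codom_f.
  move=> i; rewrite mem_enum mem_cat mem_filter mem_enum andbT inE.
  by case: (i \in codom f).
have h (g : 'I_m -> nat) c : (forall j, g (f j) = c) ->
    perm_eq [seq g i | i <- enum 'I_m] (nseq q c ++ [seq g i | i <- r]).
  move=> gc; have Ec : [seq g (f j) | j <- enum 'I_q] = nseq q c.
    by rewrite -[in RHS](size_enum_ord q); elim: (enum 'I_q) => //= j s ->; rewrite gc.
  by apply: perm_trans (perm_map g pe) _; rewrite map_cat -map_comp /comp Ec.
have h1 : perm_eq [seq e i + (i \in codom f) | i <- enum 'I_m]%N
    (nseq q d.+1 ++ [seq e i + (i \in codom f) | i <- r]%N).
  by apply: (h (fun i => e i + (i \in codom f))%N) => j; rewrite fd codom_f addn1.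
have h2 := h e d fd.
have er : [seq (e i + (i \in codom f))%N | i <- r] = [seq e i | i <- r].
  by apply/eq_in_map => i; rewrite mem_filter => /andP [/negPf -> _]; rewrite addn0.
rewrite er in h1; apply/seq.permP => p; move: (seq.permP h1 p) (seq.permP h2 p).
by rewrite !count_cat; lia.
Qed.

Lemma perm_cancel_exps (es es' fs fs' s s' : seq nat) :
  perm_eq es fs -> perm_eq (es' ++ s) (es ++ s') -> perm_eq (fs' ++ s) (fs ++ s') ->
  perm_eq es' fs'.
Proof.
move=> /seq.permP h1 /seq.permP h2 /seq.permP h3; apply/seq.permP => p.
by move: (h1 p) (h2 p) (h3 p); rewrite !count_cat; lia.
Qed.

Lemma exchange_quot m k (A : seq 'rV[F]_m) M (e : 'I_m -> nat) q
    (a : 'I_q -> 'rV[F]_m) (E : 'I_q -> 'M[F]_(m, k)) (L : 'I_q -> seq 'rV[F]_k) d :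
  saito M A e -> (forall j, hyper (E j) (a j)) -> (forall j, arr (a j :: A)) ->
  (forall j, restr_to (fun b => b \in A) (E j) (L j)) ->
  (forall j, size A = d + size (L j))%N ->
  exists G : 'I_m -> 'I_q -> {mpoly F[k]},
  [/\ forall i j, sub (E j) (dval M (a j) i 0) = G i j * terao_poly A (E j) (L j),
      forall i j, G i j \is (e i - d).-homog & forall i j, (e i < d)%N -> G i j = 0].
Proof.
move=> [he ht d0 se] hE hA hL hd.
have H i j : exists g, [&& g \is (e i - d).-homog, (e i < d)%N ==> (g == 0) &
     sub (E j) (dval M (a j) i 0) == g * terao_poly A (E j) (L j)].
  have [||g [g1 g2 g3]] := terao_quot (hE j) (hA j) (hL j) (eta := row i M) (e := e i).
  - by move=> b bA l; rewrite ord1 dval_row; apply: ht.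
  - by move=> l; rewrite mxE.
  have dE : (size A - size (L j))%N = d by rewrite (hd j) addnK.
  rewrite dE in g1 g2; rewrite dval_row in g3.
  by exists g; rewrite g1 g3 eqxx andbT /=; apply/implyP => /g2 ->.
exists (fun i j => xchoose (H i j)); split=> i j; have /and3P [h1 h2 h3] := xchooseP (H i j).
- exact/eqP.
- exact: h1.
- by move=> h; apply/eqP; move/implyP: h2; apply.
Qed.

Definition point_off m (A : seq 'rV[F]_m) q (a : 'I_q -> 'rV[F]_m) : Prop :=
  exists x : 'cV[F]_m, (forall j, a j *m x = 0) /\ (forall b, b \in A -> b *m x != 0).

Lemma meval_map_mx m k (M : 'M[{mpoly F[m]}]_(k, m)) (a : 'rV[F]_m) (x : 'cV[F]_m) i :
  (dval M a i 0).@[fun i => x i 0] =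
  (map_mx (meval (fun i => x i 0)) M *m a^T) i 0 :> F.
Proof.
rewrite dvalE raddf_sum /= mxE; apply: eq_bigr => j _.
by rewrite mevalZ !mxE mulrC.
Qed.

(** As [d] is the largest exponent, all quotients are constants and form a matrix [C]. At a point
    [x] on all new hyperplanes and on no old one the matrix [M] is invertible, because its
    determinant is a nonzero constant times the product of the old forms; so its values on the
    independent forms [a j] have rank [q]. These values are [C] with scaled columns, hence [C] has
    rank [q], and [q] of its rows can be exchanged. *)
Lemma add_block m k (A : seq 'rV[F]_m) es es' q
    (a : 'I_q -> 'rV[F]_m) (E : 'I_q -> 'M[F]_(m, k)) (L : 'I_q -> seq 'rV[F]_k) d :
  free_exp A es -> arr A -> (forall j, hyper (E j) (a j)) ->
  (forall j, arr (a j :: A)) ->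
  (forall j, restr_to (fun b => b \in A) (E j) (L j)) ->
  (forall j, size A = d + size (L j))%N ->
  all (fun n => n <= d)%N es -> row_free (\matrix_j a j) -> point_off A a ->
  perm_eq (es' ++ nseq q d) (es ++ nseq q d.+1) ->
  free_exp (A ++ [seq a j | j <- enum 'I_q]) es'.
Proof.
move=> [e [M sM] pe] aA hE hA hL hd hes hfree [x [xa xA]] pes.
have [G [G1 G2 G3]] := exchange_quot sM hE hA hL hd.
have [he ht d0 se] := sM.
have [c c0 dM] := saito_det aA sM.
have ed i : (e i <= d)%N.
  by move/allP: hes; apply; rewrite (perm_mem pe) map_f // mem_enum.
have GC i j : exists cc, (G i j == cc%:MP) && ((e i < d)%N ==> (cc == 0)).
  case: (ltnP (e i) d) => h; first by exists 0; rewrite G3 // mpolyC0 !eqxx.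
  have := G2 i j; rewrite (_ : (e i - d)%N = 0%N); last by apply/eqP; rewrite subn_eq0.
  by case/homog0_const => cc ->; exists cc; rewrite eqxx.
pose C : 'M[F]_(m, q) := \matrix_(i, j) xchoose (GC i j).
have CG i j : G i j = (C i j)%:MP.
  by rewrite mxE; case/andP: (xchooseP (GC i j)) => /eqP.
have C0 i j : (e i < d)%N -> C i j = 0.
  by move=> h; rewrite mxE; case/andP: (xchooseP (GC i j)) => _ /implyP/(_ h)/eqP.
pose ev p : F := p.@[fun i => x i 0].
pose Mx := map_mx (meval (fun i => x i 0)) M.
have Mxu : Mx \in unitmx.
  rewrite unitmxE /Mx det_map_mx dM rmorphM /= mevalC unitfE mulf_neq0 //.
  rewrite rmorph_prod prodf_seq_neq0; apply/allP => b bA /=.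
  rewrite meval_lin; apply: contra (xA b bA) => /eqP bx.
  by apply/eqP/rowP => j; rewrite !ord1 bx mxE.
have Xz j : exists z, x == E j *m z.
  have [/row_fullP [E' E'E] hEj] := hE j.
  have [u hu] : exists u : 'cV_m, 1%:M - E j *m E' = u *m a j.
    suff : (1%:M - E j *m E' <= a j)%MS by move=> /submxP [u ->]; exists u.
    apply/row_subP => i; rewrite -hEj -row_mul mulmxBl mul1mx -mulmxA E'E mulmx1 subrr.
    by rewrite row0.
  exists (E' *m x); rewrite mulmxA -subr_eq0 -{1}[x]mul1mx -mulmxBl hu -mulmxA.
  by rewrite xa mulmx0.
pose z j := xchoose (Xz j).
have xz j : x = E j *m z j by apply/eqP/(xchooseP (Xz j)).
pose Bx : 'rV[F]_q := \row_j (terao_poly A (E j) (L j)).@[fun i => z j i 0].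
have MC : Mx *m (\matrix_j a j)^T = C *m diag_mx Bx.
  apply/matrixP => i j; rewrite mul_mx_diag [in RHS]mxE.
  have -> : (Mx *m (\matrix_j a j)^T) i j = (Mx *m (a j)^T) i 0.
    by rewrite !mxE; apply: eq_bigr => l _; rewrite !mxE.
  rewrite -meval_map_mx // {1}(xz j) -meval_sub G1 mevalM CG mevalC.
  by rewrite [Bx _ _]mxE.
have Cfull : row_full C.
  rewrite /row_full eqn_leq rank_leq_col /=.
  apply: leq_trans (mxrankM_maxl C (diag_mx Bx)); rewrite -MC.
  rewrite -mxrank_tr trmx_mul trmxK mxrankMfree; last by rewrite row_free_unit unitmx_tr.
  by move: hfree; rewrite /row_free => /eqP ->.
(* The rows of [C] chosen by [f] are independent, in particular nonzero, which forces the
   corresponding degrees to be [d]. *)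
pose f := fullrankfun Cfull.
have finj : injective f by apply: fullrankfun_inj.
have fd j : e (f j) = d.
  apply/eqP; rewrite eqn_leq ed leqNgt; apply/negP => h.
  have := fullrowsub_unit Cfull; rewrite -row_free_unit => /row_freeP [X XE].
  have := congr1 (fun Y => row j Y) XE; rewrite row_mul.
  have -> : row j (rowsub f C) = 0.
    by apply/rowP => l; rewrite 2!mxE C0 // mxE.
  rewrite mul0mx => /rowP /(_ j); rewrite !mxE eqxx => /esym/eqP.
  by rewrite oner_eq0.
have := @exchange F m k A M e q a E (fun j => terao_poly A (E j) (L j)) d G f
  (rowsub f C) sM (fun j => arr_a_neq0 (hA j)) hE G1 G2 G3 finj fd
  (fullrowsub_unit Cfull).
move=> [|M' sM']; first by move=> j j'; rewrite CG [in RHS]mxE.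
refine (ex_intro2 _ _ _ (ex_intro _ M' sM') _).
exact: perm_cancel_exps pe pes (exps_bump finj fd).
Qed.

End Rules.

(** * Adding a single hyperplane *)

Section SingleStep.

Variables (F : fieldType) (k : nat).
Local Notation m := k.+1.
Variables (A : seq 'rV[F]_m) (M : 'M[{mpoly F[m]}]_m) (e : 'I_m -> nat).
Variables (a : 'rV[F]_m) (E : 'M[F]_(m, k)) (L : seq 'rV[F]_k) (d : nat).
Hypotheses (sM : saito M A e) (hE : hyper E a) (hA : arr (a :: A)).
Hypothesis hL : restr_to (fun b => b \in A) E L.
Hypothesis hd : (size A = d + size L)%N.

Let Mb := map_mx (sub E) M.

Let aA : arr A. Proof. by move: hA; rewrite arr_cons => /and3P []. Qed.
Let a0 : a != 0. Proof. exact: arr_a_neq0 hA. Qed.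

(** The determinant of [M] is a constant times the product of forms none of which is proportional to
    [a]. *)
Lemma det_restr_neq0 : \det Mb != 0.
Proof.
have [c c0 dM] := saito_det aA sM.
rewrite det_map_mx; apply/eqP => /(hyper_dvd _ hE a0); rewrite dM mul_mpolyC => h.
have {}h : pdvd (lin a) (\prod_(b <- A) lin b).
  by have := pdvdZ c^-1 h; rewrite scalerA mulVf // scale1r.
have [b bA /(lin_pdvd_lin a0) ba] := lin_pdvd_prod a0 h.
have := hA; rewrite arr_cons => /and3P [_ /allP /(_ b bA) /negP []].
by rewrite (sub_row_sym (arr_neq0 aA bA)).
Qed.

Lemma restr_rows_free (v : 'rV[{mpoly F[k]}]_m) : v *m Mb = 0 -> v = 0.
Proof.
move=> vM; apply/eqP; apply: contraT => v0.
by case/negP: det_restr_neq0; apply/det0P; exists v.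
Qed.

(** A derivation tangent to [ker a] restricts to a derivation of the hyperplane, whose coefficients
    in the basis [E] are read off with a left inverse of [E]. For the other rows only the degrees
    are kept. *)
Lemma tangent_rows : exists N : 'M[{mpoly F[k]}]_(m, k),
  (forall i j, N i j \is (e i).-homog) /\
  forall i, sub E (dval M a i 0) = 0 ->
    row i Mb = row i N *m liftm k E^T /\
    forall l, l \in L -> pdvd (lin l) (dval N l i 0).
Proof.
have [/row_fullP [E' E'E] hEa] := hE; have [he ht d0 se] := sM.
have [u hu] : exists u : 'cV_m, 1%:M - E *m E' = u *m a.
  suff : (1%:M - E *m E' <= a)%MS by move=> /submxP [u ->]; exists u.
  apply/row_subP => i; rewrite -hEa -row_mul mulmxBl mul1mx -mulmxA E'E mulmx1 subrr.
  by rewrite row0.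
pose N := Mb *m liftm k E'^T.
have t1 i : sub E (dval M a i 0) = 0 -> row i Mb = row i N *m liftm k E^T.
  move=> ta; rewrite -row_mul -mulmxA -liftmM -trmx_mul.
  have -> : E *m E' = 1%:M - u *m a by rewrite -hu subKr.
  rewrite linearB /= trmx1 trmx_mul /=.
  have -> : liftm k (1%:M - a^T *m u^T) = 1%:M - liftm k a^T *m liftm k u^T :> 'M_m.
    by apply/matrixP => i1 i2; rewrite -liftmM -(liftm1 _ k) !(liftmE, mxE) mpolyCB.
  have ra : row i Mb *m liftm k a^T = 0.
    by apply/rowP => j; rewrite ord1 -row_mul row0E -map_dval ta mxE.
  by rewrite row_mul mulmxBr mulmx1 mulmxA ra mul0mx subr0.
exists N; split=> [i j|i ta].
  rewrite mxE; apply: rpred_sum => l _; rewrite liftmE mulrC mul_mpolyC [Mb _ _]mxE.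
  by apply: homogZ; apply: sub_homog; apply: he.
split; first exact: t1.
move=> l lL; have [aL hAL hLA] := hL; have [b bA /sub_rVP [c lE]] := hLA l lL.
have c0 : c != 0 by apply: contraNneq (arr_neq0 aL lL) => c0; rewrite lE c0 scale0r.
have tb : pdvd (lin (b *m E)) (dval N (b *m E) i 0).
  rewrite -dval_row dval_mul trmx_mul liftmM mulmxA -t1 // -sub_lin.
  have := sub_pdvd E (ht b bA i); rewrite map_dval; congr pdvd.
  by rewrite -row_mul row0E.
rewrite lE dvalZ mxE linearZ /=; apply: pdvdZl => //; exact: pdvd_mull.
Qed.

(** The restricted rows of [M] are independent because [a] does not divide [\det M]; a relation
    between the rows of [N1] would be a relation between them. *)
Lemma minor_rows i1 : (forall i, i != i1 -> sub E (dval M a i 0) = 0) ->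
  exists N1 : 'M[{mpoly F[k]}]_k, [/\ forall i j, N1 i j \is (e (lift i1 i)).-homog,
    forall l, l \in L -> tang N1 l & \det N1 != 0].
Proof.
move=> tan1; have [N [Nh Nt]] := tangent_rows.
have nl j : lift i1 j != i1 by rewrite eq_sym neq_lift.
pose N1 : 'M_k := row' i1 N.
have N1h i j : N1 i j \is (e (lift i1 i)).-homog by rewrite mxE; apply: Nh.
have N1t l : l \in L -> tang N1 l.
  move=> lL i; have [_ /(_ l lL)] := Nt _ (tan1 _ (nl i)).
  rewrite !dvalE; congr pdvd.
  by apply: eq_bigr => j _; rewrite mxE.
have N1d : \det N1 != 0.
  apply/negP => /det0P [v v0 vN].
  pose w : 'rV[{mpoly F[k]}]_m := \row_i (if unlift i1 i is Some j then v 0 j else 0).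
  have w0 : w = 0.
    apply: restr_rows_free; rewrite mulmx_sum_row (bigD1_ord i1) //=.
    rewrite [w _ _]mxE unlift_none scale0r add0r.
    transitivity ((v *m N1) *m liftm k E^T); last by rewrite vN mul0mx.
    rewrite [v *m N1]mulmx_sum_row mulmx_suml; apply: eq_bigr => j _.
    rewrite [w _ _]mxE liftK -scalemxAl; congr (_ *: _).
    have [-> _] := Nt _ (tan1 _ (nl j)).
    by congr (_ *m _); apply/rowP => l; rewrite !mxE.
  case/eqP: v0; apply/rowP => j; rewrite [RHS]mxE.
  by move/rowP/(_ (lift i1 j)): w0; rewrite !mxE liftK.
by exists N1; split.
Qed.

(* If every [G i] with [e i = d] vanished, all rows of degree at most [d] would be tangent to the
   hyperplane; this and the next lemma exclude that. *)
Lemma single_S : (#|[set i | (d < e i)%N]| <= 1)%N ->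
  ~ (forall i, (e i <= d)%N -> sub E (dval M a i 0) = 0).
Proof.
move=> c1 tan; have [he ht d0 se] := sM.
have [i1 tan1] : exists i1, forall i, i != i1 -> sub E (dval M a i 0) = 0.
  case: (set_0Vmem [set i | (d < e i)%N]) => [s0|[i1 i1s]].
    exists ord0 => i _; apply: tan; rewrite leqNgt.
    by have := in_set0 i; rewrite -s0 inE => ->.
  exists i1 => i ne; apply: tan; rewrite leqNgt; apply/negP => h.
  move: c1; rewrite (cardsD1 i1) i1s (cardsD1 i) !inE ne h /=.
  by rewrite addnA.
case: (leqP (e i1) d) => ei1.
  case/negP: det_restr_neq0; apply/eqP; apply: (det_ker a0).
  apply/colP => i; rewrite -map_dval [RHS]mxE.
  by case: (eqVneq i i1) => [->|/tan1 //]; apply: tan.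
(* The rows other than [i1] restrict to a nonsingular matrix tangent to [L], so their degrees sum to
   at least [size L]; but the sum is [size L + d - e i1], which is smaller. *)
have [N1 [N1h N1t N1d]] := minor_rows tan1.
have [aL _ _] := hL.
have := saito_lower aL N1h N1t N1d.
move: se; rewrite hd (bigD1_ord i1) //=; lia.
Qed.

(** Otherwise the restricted rows of degree at most [d] would be tangent to [C], hence combinations
    of the basis elements of [C] of degree at most [d]. There are fewer of these, yet the restricted
    rows are independent. *)
Lemma single_R (C : seq 'rV[F]_k) cs : {subset C <= L} -> arr C -> free_exp C cs ->
  (count (fun n => (n <= d)%N) cs < #|[set i | (e i <= d)%N]|)%N ->
  ~ (forall i, (e i <= d)%N -> sub E (dval M a i 0) = 0).
Proof.
move=> CL aC [c [K sK] pc] lt tan; have [N [Nh Nt]] := tangent_rows.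
set I := [set i | (e i <= d)%N] in lt.
set J := [set j | (c j <= d)%N].
have cJ : count (fun n => (n <= d)%N) cs = #|J|.
  move/seq.permP: pc => ->; rewrite count_map -sum1_count -sum1_card big_enum_cond.
  by apply: eq_bigl => j; rewrite /= !inE.
rewrite {}cJ in lt.
have hI (i : 'I_#|I|) : (e (enum_val i) <= d)%N by have := enum_valP i; rewrite inE.
have H (i : 'I_#|I|) : exists h : 'rV[{mpoly F[k]}]_k,
    (row (enum_val i) N == h *m K) && [forall j, (d < c j)%N ==> (h 0 j == 0)].
  have [_ nt] := Nt _ (tan _ (hI i)).
  have [|h hE' h0] := saito_basis aC sK (eta := row (enum_val i) N).
    by move=> l lC j; rewrite ord1 dval_row; apply: nt; apply: CL.
  exists h; rewrite hE' eqxx; apply/forallP => j; apply/implyP => dj.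
  have [|_ h1] := h0 (e (enum_val i)) _ j; first by move=> j'; rewrite row0E.
  by rewrite h1 // (leq_ltn_trans (hI i)).
pose h i := xchoose (H i).
have hK i : row (enum_val i) N = h i *m K.
  by have /andP [/eqP] := xchooseP (H i).
have h0 i j : (d < c j)%N -> h i 0 j = 0.
  by move=> dj; have /andP [_ /forallP/(_ j)/implyP/(_ dj)/eqP] := xchooseP (H i).
(* The coordinates on [J] are padded by zero columns to a square matrix, which is singular because
   its last column is zero. *)
pose colJ (r : 'I_#|I|) : option 'I_k := omap (fun x : 'I_#|J| => enum_val x) (insub (r : nat)).
pose W : 'M[{mpoly F[k]}]_#|I| := \matrix_(i, r) if colJ r is Some j then h i 0 j else 0.
have /det0P [v v0 vW] : \det W == 0.
  rewrite -det_tr; apply/det0P; have cI : (#|I|.-1 < #|I|)%N by case: #|I| lt.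
  exists (delta_mx 0 (Ordinal cI)).
    by apply/rV0Pn; exists (Ordinal cI); rewrite mxE !eqxx oner_neq0.
  rewrite -rowE; apply/rowP => i; rewrite !mxE /colJ insubN //= -leqNgt -ltnS.
  by rewrite prednK //; case: #|I| lt.
have vh : \sum_i v 0 i *: h i = 0.
  apply/rowP => j; rewrite summxE [RHS]mxE.
  case: (ltnP d (c j)) => dj; first by rewrite big1 // => i _; rewrite mxE h0 // mulr0.
  have jJ : j \in J by rewrite inE.
  have rI : (enum_rank_in jJ j < #|I|)%N by apply: ltn_trans (ltn_ord _) lt.
  move/rowP/(_ (Ordinal rI)): vW; rewrite !mxE => vWj; rewrite -[RHS]vWj.
  apply: eq_bigr => i _; rewrite !mxE /colJ /=.
  have -> : insub (enum_rank_in jJ j : nat) = Some (enum_rank_in jJ j) :> option 'I_#|J|.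
    by rewrite valK.
  by rewrite /= enum_rankK_in.
pose w : 'rV[{mpoly F[k]}]_m := \sum_i v 0 i *: delta_mx 0 (enum_val i).
have w0 : w = 0.
  apply: restr_rows_free; rewrite mulmx_suml.
  transitivity ((\sum_i v 0 i *: h i) *m K *m liftm k E^T); last by rewrite vh !mul0mx.
  rewrite !mulmx_suml; apply: eq_bigr => i _; rewrite -!scalemxAl -rowE; congr (_ *: _).
  by have [-> _] := Nt _ (tan _ (hI i)); rewrite hK.
case/eqP: v0; apply/rowP => i; rewrite [RHS]mxE.
move/rowP/(_ (enum_val i)): w0; rewrite [RHS]mxE summxE (bigD1 i) //= !mxE !eqxx mulr1.
rewrite big1 ?addr0 // => i' ne; rewrite !mxE eqxx /=.
by rewrite (inj_eq enum_val_inj) eq_sym (negPf ne) mulr0.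
Qed.

End SingleStep.

(** The first half is [exchange] for one form. For the second, row [i0] clears the values of all
    other rows on [a]; these rows then restrict to a basis for [L], which needs no certificate of
    its own. *)
Lemma single_free (F : fieldType) k (A : seq 'rV[F]_k.+1) M e a
    (E : 'M[F]_(k.+1, k)) (L : seq 'rV[F]_k) d (G : 'I_k.+1 -> {mpoly F[k]}) i0 c :
  saito M A e -> hyper E a -> arr (a :: A) -> restr_to (fun b => b \in A) E L ->
  (size A = d + size L)%N ->
  (forall i, sub E (dval M a i 0) = G i * terao_poly A E L) ->
  (forall i, G i \is (e i - d).-homog) -> (forall i, (e i < d)%N -> G i = 0) ->
  e i0 = d -> c != 0 -> G i0 = c%:MP ->
  sfree (A ++ [:: a]) (fun i => e i + (i == i0))%N /\ sfree L (fun i => e (lift i0 i)).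
Proof.
set m := k.+1 in e M *; move=> sM hE hA hL hd G1 G2 G3 ei0 c0 Gi0; have a0 : a != 0 := arr_a_neq0 hA.
have [he ht d0 se] := sM.
split.
  have inj1 : injective (fun _ : 'I_1 => i0) by move=> x y _; rewrite (ord1 x) (ord1 y).
  have cu : (c%:M : 'M[F]_1) \in unitmx by rewrite unitmxE det_scalar1 unitfE.
  have GC (j j' : 'I_1) : G i0 = ((c%:M : 'M[F]_1) j j')%:MP by rewrite !ord1 Gi0 mxE.
  have [M' sM'] := @exchange F m k A M e 1 (fun=> a) (fun=> E)
    (fun=> terao_poly A E L) d (fun i _ => G i) (fun=> i0) c%:M sM (fun=> a0) (fun=> hE)
    (fun i _ => G1 i) (fun i _ => G2 i) (fun i _ => G3 i) inj1 (fun=> ei0) cu GC.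
  exists M'; have [he' ht' d0' se'] := sM'.
  have cod i : (i \in codom (fun _ : 'I_1 => i0)) = (i == i0).
    by apply/codomP/eqP => [[]|->] //; exists ord0.
  have eL : [seq a | _ <- enum 'I_1] = [:: a].
    by move: (size_enum_ord 1); case: (enum 'I_1) => [|x []].
  rewrite -eL; split; [|exact: ht'|exact: d0'|].
    by move=> i j; rewrite -cod; apply: he'.
  by rewrite -se'; apply: eq_bigr => i _; rewrite cod.
have [/row_fullP [E' E'E] hEa] := hE.
pose g : 'cV[{mpoly F[m]}]_m := \col_i (if i == i0 then 0 else c^-1 *: sub E' (G i)).
pose U := 1%:M - g *m (delta_mx 0 i0 : 'rV_m).
have Uu : U *m (1%:M + g *m (delta_mx 0 i0 : 'rV_m)) = 1%:M.
  rewrite mulmxDr mulmx1 mulmxBl mul1mx mulmxA -[g *m _ *m g]mulmxA.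
  have -> : (delta_mx 0 i0 : 'rV_m) *m g = 0.
    by rewrite -rowE; apply/matrixP => x y; rewrite !mxE eqxx.
  by rewrite mulmx0 mul0mx subr0 subrK.
have dU : \det U != 0.
  by apply/eqP => dU0; have := congr1 determinant Uu;
    rewrite det_mulmx dU0 mul0r det1 => /esym/eqP; rewrite oner_eq0.
have UME i : row i (U *m M) = row i M - g i 0 *: row i0 M.
  rewrite /U mulmxBl mul1mx linearB /=; congr (_ - _).
  by rewrite -mulmxA -rowE row_mul; apply/rowP => j; rewrite !mxE big_ord1 !mxE.
have gE i : g i 0 = if i == i0 then 0 else c^-1 *: sub E' (G i) by rewrite mxE.
have sM2 : saito (U *m M) A e.
  split; last exact: se.
  - move=> i j; rewrite -row0E UME mxE row0E [X in _ + X]mxE [X in _ - X]mxE row0E gE.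
    case: (eqVneq i i0) => [->|ne]; first by rewrite mul0r subr0.
    apply: rpredB; first exact: he.
    case: (ltnP (e i) d) => h; first by rewrite G3 // raddf0 scaler0 mul0r dhomog0.
    rewrite -(subnK h); apply: dhomogM; last by rewrite -ei0.
    by apply: homogZ; apply: sub_homog; apply: G2.
  - by move=> b bA; apply: tangM; apply: ht.
  - by rewrite det_mulmx mulf_neq0.
have tan2 i : i != i0 -> sub E (dval (U *m M) a i 0) = 0.
  move=> ne; rewrite -dval_row UME dvalBl dvalZl mxE [X in _ + X]mxE [X in _ - X]mxE.
  rewrite !dval_row rmorphB rmorphM /= !G1 gE (negPf ne) linearZ /= sub_comp E'E sub1 Gi0.
  by rewrite mul_mpolyC -scalerAl -scalerAr scalerA mulVf // scale1r subrr.
have [N1 [N1h N1t N1d]] := minor_rows sM2 hE hA hL tan2.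
exists N1; split=> //; apply: (@addnI (e i0)).
by move: se; rewrite hd (bigD1_ord i0) //= ei0.
Qed.

Section AddSingle.

Variable F : fieldType.

Lemma count_exps m (es : seq nat) (e : 'I_m -> nat) (p : pred nat) :
  perm_eq es [seq e i | i <- enum 'I_m] -> count p es = #|[set i | p (e i)]|.
Proof.
move/seq.permP => ->; rewrite count_map -sum1_count -sum1_card big_enum_cond.
by apply: eq_bigl => j; rewrite /= !inE.
Qed.

(** Rows of degree below [d] are tangent to [ker a] because their quotient vanishes. If the
    quotients in degree [d] vanished too, all rows of degree at most [d] would be tangent, which
    each of the two alternatives excludes. *)
Lemma add_single k (A : seq 'rV[F]_k.+1) es a (E : 'M[F]_(k.+1, k)) (L : seq 'rV[F]_k) d :
  free_exp A es -> hyper E a -> arr (a :: A) -> restr_to (fun b => b \in A) E L ->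
  (size A = d + size L)%N ->
  (count (fun n => d < n)%N es <= 1)%N \/
    (exists C cs, [/\ {subset C <= L}, arr C, free_exp C cs &
       (count (fun n => n <= d)%N cs < count (fun n => n <= d)%N es)%N]) ->
  (forall es', perm_eq (es' ++ [:: d]) (es ++ [:: d.+1]) -> free_exp (A ++ [:: a]) es') /\
  (forall es', perm_eq (d :: es') es -> free_exp L es').
Proof.
move=> [e [M sM] pe] hE hA hL hd cond.
have [G [G1 G2 G3]] := exchange_quot (q := 1) sM (fun=> hE) (fun=> hA) (fun=> hL) (fun=> hd).
have [i0 ei0 Gi0] : exists2 i0, e i0 = d & G i0 ord0 != 0.
  case: (pickP (fun i => (e i == d) && (G i ord0 != 0))) => [i /andP [/eqP] |no].
    by exists i.
  have tan i : (e i <= d)%N -> sub E (dval M a i 0) = 0.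
    rewrite (G1 i ord0) leq_eqVlt => /orP [ei|/G3 ->]; last by rewrite mul0r.
    by have /negbT := no i; rewrite ei /= negbK => /eqP ->; rewrite mul0r.
  case: cond => [c1|[C [cs [CL aC fC lt]]]].
    by case: (single_S sM hE hA hL hd _ tan); rewrite -(count_exps (fun n => d < n)%N pe).
  by case: (single_R sM hE hA hL CL aC fC _ tan); rewrite -(count_exps (fun n => n <= d)%N pe).
have [c cE] : exists c, G i0 ord0 = c%:MP.
  by apply: homog0_const; have := G2 i0 ord0; rewrite ei0 subnn.
have c0 : c != 0 by apply: contraNneq Gi0 => c0; rewrite cE c0 mpolyC0.
have [f1 f2] := single_free sM hE hA hL hd (fun i => G1 i ord0) (fun i => G2 i ord0)
  (fun i => G3 i ord0) ei0 c0 cE.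
split=> [es' pes|es' pes].
  refine (ex_intro2 _ _ _ f1 _); apply: (perm_cancel_exps pe pes).
  have inj1 : injective (fun _ : 'I_1 => i0) by move=> x y _; rewrite (ord1 x) (ord1 y).
  have := exps_bump inj1 (fun=> ei0); congr (perm_eq (_ ++ _) _).
  apply: eq_map => i; congr (_ + nat_of_bool _)%N.
  by apply/codomP/eqP => [[]|->] //; exists ord0.
refine (ex_intro2 _ _ _ f2 _); rewrite -(perm_cons d); apply: perm_trans pes _.
apply: perm_trans pe _.
have pi : perm_eq (enum 'I_k.+1) (i0 :: [seq lift i0 i | i <- enum 'I_k]).
  apply: uniq_perm; first exact: enum_uniq.
    rewrite /= (map_inj_uniq (@lift_inj _ _)) enum_uniq andbT.
    by apply/negP => /mapP [i _ /eqP]; rewrite (negPf (neq_lift _ _)).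
  move=> i; rewrite mem_enum inE; symmetry; apply/orP.
  case: (unliftP i0 i) => [j ->|->]; [right | by left].
  by apply/mapP; exists j; rewrite ?mem_enum.
by apply: perm_trans (perm_map e pi) _; rewrite /= ei0 -map_comp.
Qed.

Lemma free_exp0 m : free_exp ([::] : seq 'rV[F]_m) (nseq m 0%N).
Proof.
exists (fun=> 0%N).
  exists 1%:M; split=> [i j|//||]; last by rewrite big1.
    by rewrite mxE; case: (i == j); rewrite ?dhomog1 ?dhomog0.
  by rewrite det1 oner_neq0.
by rewrite -[m in nseq m](size_enum_ord m); elim: (enum 'I_m) => //= i s; rewrite perm_cons.
Qed.

End AddSingle.

Lemma fresh_point (R : realFieldType) (s : seq R) : exists t : R, t \notin s.
Proof.
exists (1 + \sum_(v <- s) `|v|); apply/negP => ts.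
set t := 1 + _ in ts.
have h : `|t| <= \sum_(v <- s) `|v|.
  by rewrite (big_rem _ ts) /= lerDl; apply: sumr_ge0 => v _; apply: normr_ge0.
by have := le_trans (ler_norm t) h; rewrite leNgt /t ltrDr ltr01.
Qed.

(** If the new form vanishes at [x], a point [y] off its kernel is corrected by a multiple [t x];
    each earlier form excludes one value of [t]. *)
Lemma generic_point (R : realFieldType) m (A : seq 'rV[R]_m) :
  all (fun a => a != 0) A -> exists x : 'cV[R]_m, forall b, b \in A -> b *m x != 0.
Proof.
elim: A => [|b A IH] /=; first by exists 0.
case/andP => b0 /IH [x hx].
have sc (c : 'M[R]_1) : (c == 0) = (c 0 0 == 0).
  by apply/eqP/eqP => [->|c0]; [rewrite mxE | apply/matrixP => i j; rewrite !ord1 c0 mxE].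
case: (eqVneq (b *m x) 0) => bx; last first.
  by exists x => c; rewrite inE => /predU1P [->|/hx].
have [y by1] := form_unit b0.
have [t ht] := fresh_point [seq - ((c *m y) 0 0 / (c *m x) 0 0) | c <- A].
exists (y + t *: x) => c; rewrite inE => /predU1P [->|cA].
  by rewrite mulmxDr -scalemxAr bx scaler0 addr0 by1 sc mxE oner_neq0.
rewrite sc mulmxDr -scalemxAr mxE [X in _ + X]mxE.
have cx := hx _ cA; rewrite sc in cx.
apply: contra ht => /eqP h; apply/mapP; exists c => //.
apply: (mulIf cx); rewrite mulNr mulfVK //; apply/eqP; rewrite -subr_eq0 opprK addrC.
exact/eqP.
Qed.

(** Coefficients for evaluation: operations with an exact zero test, which [cspec] relates to the
    field by an injective map. There is no division, so elimination is done by cross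
    multiplication. *)
Record cops (T : Type) := Cops
  { tzero : T; tone : T; tadd : T -> T -> T; tsub : T -> T -> T;
    tmul : T -> T -> T; teq0 : T -> bool }.

Record cspec (F : fieldType) T (o : cops T) (inj : T -> F) : Prop := Cspec
  { inj0 : inj (tzero o) = 0; inj1 : inj (tone o) = 1;
    injD : forall x y, inj (tadd o x y) = inj x + inj y;
    injB : forall x y, inj (tsub o x y) = inj x - inj y;
    injM : forall x y, inj (tmul o x y) = inj x * inj y;
    inj_eq0 : forall x, teq0 o x = (inj x == 0) }.

(** * Certificates of freeness *)

(* The conditionals below are spelled out because [&&] and [||] evaluate both
   arguments under call by value. *)
Section Checker.

Variables (T : Type) (o : cops T).

Fixpoint pivot (v : seq T) : nat :=
  if v is x :: v' then (if teq0 o x then (pivot v').+1 else 0%N) else 0%N.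

Fixpoint drop_at (p : nat) (v : seq T) : seq T :=
  if v is x :: v' then (if p is p'.+1 then x :: drop_at p' v' else v') else [::].

Fixpoint cross (x y : T) (u v : seq T) : seq T :=
  match u, v with
  | a :: u', b :: v' => tsub o (tmul o x b) (tmul o y a) :: cross x y u' v'
  | _, _ => [::]
  end.

(** Fraction-free elimination: the restriction of [v] to [ker a] in the coordinates other than the
    pivot, times the pivot entry of [a]. *)
Definition rst (a v : seq T) : seq T :=
  let p := pivot a in
  cross (nth (tzero o) a p) (nth (tzero o) v p) (drop_at p a) (drop_at p v).

Fixpoint vec0 (v : seq T) : bool :=
  if v is x :: v' then (if teq0 o x then vec0 v' else false) else true.

Fixpoint cross0 (x y : T) (u v : seq T) : bool :=
  match u, v with
  | a :: u', b :: v' =>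
    if teq0 o (tsub o (tmul o x b) (tmul o y a)) then cross0 x y u' v' else false
  | _, _ => true
  end.

Definition propv (u v : seq T) : bool :=
  let p := pivot u in cross0 (nth (tzero o) u p) (nth (tzero o) v p) u v.

Fixpoint has_prop (v : seq T) (L : seq (seq T)) : bool :=
  if L is u :: L' then (if propv u v then true else has_prop v L') else false.

Fixpoint reps (s : seq (seq T)) : seq (seq T) :=
  if s is v :: s' then
    let L := reps s' in if has_prop v L then L else v :: L
  else [::].

Definition mapr (a : seq T) (A : seq (seq T)) : seq (seq T) := map (rst a) A.

(** The new forms are restricted to one another's kernels in turn. They are independent if none of
    them becomes zero on the way, and a form of [A] vanishing on their common kernel would be zero
    at the end. *)
Fixpoint indep_off (n : nat) (asq A : seq (seq T)) : bool :=
  if n is n'.+1 then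
    if asq is a :: asq' then
      if vec0 a then false else indep_off n' (mapr a asq') (mapr a A)
    else false
  else all (fun v => ~~ vec0 v) A.

(* A certificate adds the forms numbered by its entries to a free arrangement [A]. [Cblk js] adds
   independent forms whose restrictions all have [|A| - d] hyperplanes, [d] being the largest
   exponent, when no form of [A] vanishes on the intersection of their kernels. [Csgl j c] adds one
   form with such a restriction when at most one exponent exceeds [d], or when a free part of the
   restriction, built by [c], has fewer exponents [<= d] than [A]. *)
Inductive cert := Cnil | Cblk of seq nat & cert | Csgl of nat & cert & cert.

Definition bump1 (d : nat) (es : seq nat) : option (seq nat) :=
  if d \in es then Some (d.+1 :: rem d es) else None.

Fixpoint bumps q (d : nat) (es : seq nat) : option (seq nat) :=
  if q is q'.+1 then
    (if bumps q' d es is Some es' then bump1 d es' else None)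
  else Some es.

(** [ix] holds the positions in [L] of the forms added so far, [es] their exponents. The inner
    certificate of [Csgl] starts from the empty arrangement in the restriction and may stop before
    exhausting it. *)
Fixpoint run (m : nat) (L : seq (seq T)) (c : cert) (ix es : seq nat) {struct c} :
    option (seq nat * seq nat) :=
  match c with
  | Cnil => Some (ix, es)
  | Cblk js c' =>
    let A := [seq nth [::] L i | i <- ix] in
    let asq := [seq nth [::] L j | j <- js] in
    let d := foldr maxn 0%N es in
    if [&& (0 < m)%N, all (fun j => (j < size L)%N && (j \notin ix)) js, uniq js,
           all (fun a => size A == d + size (reps (mapr a A)))%N asq & indep_off (size js) asq A]
    then (if bumps (size js) d es is Some es' then run m L c' (js ++ ix) es' else None)
    else None
  | Csgl j sub c' =>
    let A := [seq nth [::] L i | i <- ix] in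
    let a := nth [::] L j in
    let L' := reps (mapr a A) in
    let d := (size A - size L')%N in
    if [&& (0 < m)%N, (j < size L)%N & j \notin ix] then
      if (if (count (fun n => d < n) es <= 1)%N then true
          else if run m.-1 L' sub [::] (nseq m.-1 0%N) is Some (_, cs)
          then (count (fun n => n <= d) cs < count (fun n => n <= d) es)%N else false)
      then (if bump1 d es is Some es' then run m L c' (j :: ix) es' else None)
      else None
    else None
  end.

Variables (F : realFieldType) (inj : T -> F).
Hypothesis hinj : cspec o inj.

Definition rowT m (v : seq T) : 'rV[F]_m := \row_j inj (nth (tzero o) v j).

Lemma pivot_lt m a : size a = m -> rowT m a != 0 -> (pivot a < m)%N.
Proof.
move=> <-; apply: contraR; rewrite -leqNgt => h; apply/eqP/rowP => j; rewrite !mxE.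
have := leq_trans (ltn_ord j) h; move: (j : nat) => {j}; elim: a {h} => [|x a IH] i //=.
case: ifP => [|_ //]; rewrite (inj_eq0 hinj) => /eqP x0.
by case: i => [|i] //=; rewrite ltnS; apply: IH.
Qed.

Lemma pivot_neq0 m a (p : 'I_m) : size a = m -> p = pivot a :> nat -> rowT m a 0 p != 0.
Proof.
move=> sa pE; rewrite mxE pE; move: (ltn_ord p); rewrite pE -{}sa {p pE}.
elim: a => [|x a IH] //=; case: ifP => [_|]; first by rewrite ltnS.
by rewrite (inj_eq0 hinj) => ->.
Qed.

Lemma vec0E m v : size v = m -> vec0 v = (rowT m v == 0).
Proof.
move=> sv; apply/idP/eqP => [h|h].
  apply/rowP => j; rewrite !mxE; move: (j : nat) => {j sv}.
  elim: v h => [|x v IH] /=; first by move=> _ i; rewrite nth_nil (inj0 hinj).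
  by case: ifP => // x0 /IH h [|i] //=; apply/eqP; rewrite -(inj_eq0 hinj).
have {h} : forall i, (i < size v)%N -> inj (nth (tzero o) v i) = 0.
  by move=> i; rewrite sv => lti; move/rowP/(_ (Ordinal lti)): h; rewrite !mxE.
elim: {sv} v => [|x v IH] //= h; rewrite (inj_eq0 hinj) (h 0%N) // eqxx.
by apply: IH => i; apply: (h i.+1).
Qed.

Lemma nth_cross x y u v i : size u = size v -> (i < size u)%N ->
  nth (tzero o) (cross x y u v) i =
  tsub o (tmul o x (nth (tzero o) v i)) (tmul o y (nth (tzero o) u i)).
Proof.
elim: u v i => [|a u IH] [|b v] // [|i] //= [] suv; rewrite ltnS; exact: IH.
Qed.

Lemma size_cross x y u v : size u = size v -> size (cross x y u v) = size u.
Proof. by elim: u v => [|a u IH] [|b v] //= [] /IH ->. Qed.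

Lemma nth_drop_at p v i : nth (tzero o) (drop_at p v) i = nth (tzero o) v (bump p i).
Proof.
elim: v p i => [|x v IH] [|p] [|i] //=; rewrite ?nth_nil //.
  by rewrite IH /bump ltnS; case: (p <= i)%N.
Qed.

Lemma size_drop_at p v : (p < size v)%N -> size (drop_at p v) = (size v).-1.
Proof.
by elim: v p => [|x v IH] [|p] //=; rewrite ltnS => h; rewrite IH //; case: v h {IH}.
Qed.

Definition rst_mx k (a : 'rV[F]_k.+1) (p : 'I_k.+1) : 'M[F]_(k.+1, k) :=
  \matrix_(i, j) (a 0 p * (i == lift p j)%:R - a 0 (lift p j) * (i == p)%:R).

Lemma rst_mxE k (a v : 'rV[F]_k.+1) p j :
  (v *m rst_mx a p) 0 j = a 0 p * v 0 (lift p j) - a 0 (lift p j) * v 0 p.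
Proof.
rewrite mxE (eq_bigr (fun i => a 0 p * (v 0 i * (i == lift p j)%:R) -
   a 0 (lift p j) * (v 0 i * (i == p)%:R))); last first.
  by move=> i _; rewrite mxE mulrBr !(mulrCA (v 0 i)).
have S q : \sum_i v 0 i * (i == q)%:R = v 0 q.
  rewrite (bigD1 q) //= eqxx mulr1 big1 ?addr0 // => i /negPf ->.
  by rewrite mulr0.
by rewrite sumrB -!mulr_sumr !S.
Qed.

Lemma rst_hyper k (a : 'rV[F]_k.+1) p : a 0 p != 0 -> hyper (rst_mx a p) a.
Proof.
move=> ap; split.
  apply/row_fullP; exists (\matrix_(j, i) ((a 0 p)^-1 * (i == lift p j)%:R)).
  apply/matrixP => j j'; rewrite -row0E row_mul rst_mxE !row0E !mxE.
  rewrite (negPf (neq_lift _ _)) !mulr0 subr0 mulrA mulfV // mul1r.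
  by rewrite (inj_eq (@lift_inj _ p)) eq_sym.
move=> x; apply/eqP/sub_rVP => [h|[c ->]]; last first.
  by apply/rowP => j; rewrite rst_mxE !mxE mulrCA mulrA [a 0 (lift p j) * _]mulrC -!mulrA
     (mulrC (a 0 p)) subrr.
exists (x 0 p / a 0 p); apply/rowP => i; rewrite !mxE.
case: (unliftP p i) => [j ->|->]; last by rewrite mulfVK.
move/rowP/(_ j): h; rewrite rst_mxE mxE => /eqP; rewrite subr_eq0 => /eqP h.
by apply: (mulfI ap); rewrite h mulrC mulrCA mulrA mulfVK // mulrC mulrA.
Qed.

Lemma rstE k a v (p : 'I_k.+1) : size a = k.+1 -> size v = k.+1 -> p = pivot a :> nat ->
  rowT k (rst a v) = rowT k.+1 v *m rst_mx (rowT k.+1 a) p.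
Proof.
move=> sa sv pE; have pl : (pivot a < k.+1)%N by rewrite -pE.
have sd u : size u = k.+1 -> size (drop_at (pivot a) u) = k.
  by move=> su; rewrite size_drop_at su.
apply/rowP => j; rewrite rst_mxE !mxE /rst nth_cross ?sd //.
have lE : lift p j = bump (pivot a) j :> nat by rewrite /= pE.
by rewrite !nth_drop_at (injB hinj) !(injM hinj) lE pE [X in _ - X = _]mulrC.
Qed.

Lemma size_rst k a v (p : 'I_k.+1) : size a = k.+1 -> size v = k.+1 -> p = pivot a :> nat ->
  size (rst a v) = k.
Proof.
move=> sa sv pE; have pl : (pivot a < k.+1)%N by rewrite -pE.
by rewrite size_cross ?size_drop_at ?sa ?sv.
Qed.

Lemma cross0P x y u v : size u = size v ->
  reflect (forall i, (i < size u)%N ->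
    inj x * inj (nth (tzero o) v i) = inj y * inj (nth (tzero o) u i))
  (cross0 x y u v).
Proof.
elim: u v => [|a u IH] [|b v] //=; first by move=> _; apply: ReflectT.
case=> suv; rewrite (inj_eq0 hinj) (injB hinj) !(injM hinj) subr_eq0.
case: eqP => [h|h]; last by apply: ReflectF => /(_ 0%N isT).
apply: (iffP (IH v suv)) => h' i; last by apply: (h' i.+1).
by case: i => [|i] //=; rewrite ltnS; apply: h'.
Qed.

Lemma propvP m u v : size u = m -> size v = m -> rowT m u != 0 ->
  propv u v = (rowT m v <= rowT m u)%MS.
Proof.
move=> su sv u0; have pl := pivot_lt su u0; pose p := Ordinal pl.
have up : rowT m u 0 p != 0 by apply: (pivot_neq0 (p := p)).
apply/(cross0P _ _ (etrans su (esym sv)))/sub_rVP => [h|[c h] i].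
  exists (rowT m v 0 p / rowT m u 0 p); apply/rowP => j.
  apply: (mulfI up); rewrite [X in _ = _ * X]mxE mulrA mulrCA mulfV // mulr1.
  by have := h j; rewrite su => /(_ (ltn_ord j)); rewrite !mxE => ->; rewrite mulrC.
rewrite su => lti; have := congr1 (fun r : 'rV_m => r 0 (Ordinal lti)) h.
have := congr1 (fun r : 'rV_m => r 0 p) h; rewrite /= !mxE /= => -> ->.
by rewrite mulrCA mulrA.
Qed.

Definition rowsT m (L : seq (seq T)) : seq 'rV[F]_m := [seq rowT m v | v <- L].

Lemma has_propP m v L : size v = m -> all (fun u => size u == m) L ->
  all (fun u => rowT m u != 0) L ->
  has_prop v L = has (fun u => (rowT m v <= rowT m u)%MS) L.
Proof.
move=> sv; elim: L => [|u L IH] //= /andP [/eqP su sL] /andP [u0 L0].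
by rewrite (propvP su sv u0) IH //; case: (_ <= _)%MS.
Qed.

Lemma has_rowsT m L (P : pred 'rV[F]_m) :
  has (fun u => P (rowT m u)) L = has P (rowsT m L).
Proof. by rewrite /rowsT has_map. Qed.

Lemma reps_spec m s : all (fun u => size u == m) s -> all (fun u => rowT m u != 0) s ->
  [/\ all (fun u => size u == m) (reps s), arr (rowsT m (reps s)),
      {subset rowsT m (reps s) <= rowsT m s} &
      forall v, v \in rowsT m s -> exists2 u, u \in rowsT m (reps s) & (v <= u)%MS].
Proof.
elim: s => [|v s IH] //= /andP [/eqP sv ss] /andP [v0 s0].
have [h1 h2 h3 h4] := IH ss s0.
have r0 : all (fun u => rowT m u != 0) (reps s).
  rewrite -(all_map (rowT m) (fun r => r != 0)); apply/allP => u.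
  exact: (arr_neq0 h2).
rewrite (has_propP sv h1 r0) (has_rowsT _ (fun r => (rowT m v <= r)%MS)).
case: hasP => [[u uL vu]|nh].
  split=> // [w /h3|w]; first by rewrite inE orbC => ->.
  by rewrite inE => /predU1P [->|/h4 //]; exists u.
split=> /=.
- by rewrite sv eqxx.
- rewrite arr_cons v0 h2 andbT /=; apply/allP => u uL; apply/negP => vu.
  by apply: nh; exists u.
- by move=> w; rewrite !inE => /predU1P [->|/h3 ->]; rewrite ?eqxx ?orbT.
- move=> w; rewrite inE => /predU1P [->|/h4 [u uL wu]].
    by exists (rowT m v); rewrite ?mem_head.
  by exists u; rewrite // inE uL orbT.
Qed.

Lemma mapr_rows k a A (p : 'I_k.+1) : size a = k.+1 -> p = pivot a :> nat ->
  all (fun u => size u == k.+1) A ->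
  rowsT k (mapr a A) = [seq v *m rst_mx (rowT k.+1 a) p | v <- rowsT k.+1 A] /\
  all (fun u => size u == k) (mapr a A).
Proof.
move=> sa pE; elim: A => [|v A IH] //= /andP [/eqP sv sA].
have [h1 h2] := IH sA; rewrite h1 -(rstE sa sv pE); split=> //.
by rewrite h2 (size_rst sa sv pE) eqxx.
Qed.

Lemma restr_reps k a A (p : 'I_k.+1) :
  size a = k.+1 -> p = pivot a :> nat -> rowT k.+1 a 0 p != 0 ->
  all (fun u => size u == k.+1) A ->
  arr (rowT k.+1 a :: rowsT k.+1 A) ->
  let L := reps (mapr a A) in
  all (fun u => size u == k) L /\
  restr_to (fun b => b \in rowsT k.+1 A) (rst_mx (rowT k.+1 a) p) (rowsT k L).
Proof.
move=> sa pE ap sA hA L; have [rE rS] := mapr_rows sa pE sA.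
have r0 : all (fun u => rowT k u != 0) (mapr a A).
  rewrite -(all_map (rowT k) (fun r => r != 0)) -/(rowsT k _) rE all_map.
  by apply/allP => v /= vA; apply: (arr_restr_neq0 (rst_hyper ap) hA).
have [h1 h2 h3 h4] := reps_spec rS r0; split=> //; split=> //.
  move=> v vA; right; apply: h4; rewrite rE; exact: map_f.
by move=> l /h3; rewrite rE => /mapP [v vA ->]; exists v.
Qed.

Lemma vec0_all m A : all (fun u => size u == m) A ->
  all (fun v => ~~ vec0 v) A = all (fun a => a != 0) (rowsT m A).
Proof.
by elim: A => [|v A IH] //= /andP [/eqP sv sA]; rewrite IH // (vec0E sv).
Qed.

Lemma size_nth_eq (s : seq (seq T)) m j : all (fun u => size u == m) s ->
  (j < size s)%N -> size (nth [::] s j) = m.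
Proof.
by elim: s j => [|v s IH] [|j] //= /andP [/eqP sv ss] //; rewrite ltnS; apply: IH.
Qed.

Lemma indep_offP m n asq A : size asq = n -> all (fun u => size u == m) asq ->
  all (fun u => size u == m) A -> indep_off n asq A ->
  row_free (\matrix_(j < n) rowT m (nth [::] asq j)) /\
  point_off (rowsT m A) (fun j : 'I_n => rowT m (nth [::] asq j)).
Proof.
elim: n m asq A => [|n IH] m [|a asq] A //=.
  move=> _ _ sA; rewrite (vec0_all sA) => A0.
  split; first by rewrite /row_free flatmx0 mxrank0.
  by have [x hx] := @generic_point F m (rowsT m A) A0; exists x; split=> // -[].
case=> san /andP [/eqP sa sas] sA; case: ifP => // a0.
have {a0} a0 : rowT m a != 0 by rewrite -(vec0E sa) a0.
case: m sa a0 sas sA => [|k] sa a0 sas sA h.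
  by case/eqP: a0; apply/rowP => -[].
pose p := Ordinal (pivot_lt sa a0).
have ap : rowT k.+1 a 0 p != 0 by apply: (pivot_neq0 (p := p)).
have pE : p = pivot a :> nat by [].
set E := rst_mx (rowT k.+1 a) p.
have [rE rS] := mapr_rows sa pE sA; have [rE' rS'] := mapr_rows sa pE sas.
have [|fr [z [z1 z2]]] := IH k (mapr a asq) (mapr a A) _ rS' rS h; first by rewrite size_map.
have nthE (j : 'I_n) : rowT k (nth [::] (mapr a asq) j) = rowT k.+1 (nth [::] asq j) *m E.
  have js : (j < size asq)%N by rewrite san.
  rewrite (nth_map [::]) // (rstE sa _ pE) //; exact: size_nth_eq.
have aE : rowT k.+1 a *m E = 0.
  by case: (rst_hyper ap) => _ hE; apply/eqP; rewrite hE.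
split.
  apply: inj_row_free => v; rewrite mulmx_sum_row big_ord_recl.
  have rw j : row j (\matrix_(j0 < n.+1) rowT k.+1 (nth [::] (a :: asq) j0)) =
     rowT k.+1 (nth [::] (a :: asq) j) by apply/rowP => l; rewrite !mxE.
  rewrite rw /= => hv.
  have v1 : \row_(j < n) v 0 (lift ord0 j) = 0.
    apply: (row_free_inj fr); rewrite mul0mx mulmx_sum_row.
    move/(congr1 (mulmx^~ E)): hv; rewrite /= mulmxDl -scalemxAl aE scaler0 add0r mul0mx.
    rewrite mulmx_suml => hv; rewrite -[RHS]hv; apply: eq_bigr => j _.
    rewrite rw -scalemxAl mxE; congr (_ *: _); rewrite /= -nthE.
    by apply/rowP => l; rewrite !mxE.
  have vl j : v 0 (lift ord0 j) = 0 by move/rowP/(_ j): v1; rewrite !mxE.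
  move: hv; rewrite big1 ?addr0 => [|j _]; last by rewrite vl scale0r.
  move/eqP; rewrite scaler_eq0 (negPf a0) orbF => /eqP v0.
  by apply/rowP => j; rewrite [RHS]mxE; case: (unliftP ord0 j) => [i ->|->].
exists (E *m z); split.
  move=> j; case: (unliftP ord0 j) => [i ->|->]; rewrite mulmxA /= ?aE ?mul0mx //.
  by rewrite -nthE z1.
move=> b bA; rewrite mulmxA; apply: z2; rewrite rE; exact: map_f.
Qed.

Lemma bump1P d es es' : bump1 d es = Some es' ->
  perm_eq (es' ++ [:: d]) (es ++ [:: d.+1]).
Proof.
rewrite /bump1; case: ifP => // des [<-]; apply/seq.permP => q.
by rewrite !count_cat (seq.permP (perm_to_rem des)) /=; lia.
Qed.

Lemma bumpsP q d es es' : bumps q d es = Some es' ->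
  perm_eq (es' ++ nseq q d) (es ++ nseq q d.+1).
Proof.
elim: q es' => [|q IH] es' /=; first by case=> ->; rewrite perm_refl.
case E: bumps => [es1|] // /bump1P /seq.permP h1; have /seq.permP h2 := IH _ E.
by apply/seq.permP => x; move: (h1 x) (h2 x); rewrite !count_cat /=; lia.
Qed.

Lemma arr_sub m (L : seq 'rV[F]_m) s : arr L -> uniq s -> {subset s <= L} -> arr s.
Proof.
move=> aL us sL; apply: arrP => //; first by move=> a /sL; apply: arr_neq0.
by move=> a b /sL aa /sL bb; apply: arr_eq aL aa bb.
Qed.

Definition pick_rows m (L : seq (seq T)) (ix : seq nat) : seq 'rV[F]_m :=
  [seq rowT m (nth [::] L i) | i <- ix].

Lemma nth_rowsT m L i : (i < size L)%N -> rowT m (nth [::] L i) = nth 0 (rowsT m L) i.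
Proof. by move=> h; rewrite (nth_map [::]). Qed.

Lemma arr_pick m L ix : arr (rowsT m L) -> uniq ix -> all (fun i => i < size L)%N ix ->
  arr (pick_rows m L ix).
Proof.
move=> aL ui /allP li; apply: (arr_sub aL).
  rewrite map_inj_in_uniq // => i j /li iL /li jL; rewrite !nth_rowsT // => /eqP.
  by rewrite nth_uniq ?size_map ?arr_uniq // => /eqP.
by move=> a /mapP [i /li iL ->]; rewrite nth_rowsT // mem_nth // size_map.
Qed.

Lemma size_pick m (L : seq (seq T)) ix : all (fun u => size u == m) L -> all (fun i => i < size L)%N ix ->
  all (fun u => size u == m) [seq nth [::] L i | i <- ix].
Proof.
move=> sL /allP li; rewrite all_map; apply/allP => i /li iL /=.
by rewrite (size_nth_eq sL iL).
Qed.

Lemma pick_rowsE m L ix : rowsT m [seq nth [::] L i | i <- ix] = pick_rows m L ix.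
Proof. by rewrite /rowsT -map_comp. Qed.

Lemma free_exp_perm m (A B : seq 'rV[F]_m) es :
  perm_eq A B -> free_exp A es -> free_exp B es.
Proof.
move=> pAB [e [M [h1 h2 h3 h4]] pe]; exists e => //; exists M; split=> //.
  by move=> a; rewrite -(perm_mem pAB); apply: h2.
by rewrite h4 (perm_size pAB).
Qed.

Lemma single_setup k L ix j : all (fun u => size u == k.+1) L -> arr (rowsT k.+1 L) ->
  uniq ix -> all (fun i => i < size L)%N ix -> (j < size L)%N -> j \notin ix ->
  let A := [seq nth [::] L i | i <- ix] in
  let a := nth [::] L j in
  exists E : 'M[F]_(k.+1, k),
  [/\ all (fun u => size u == k) (reps (mapr a A)), hyper E (rowT k.+1 a),
      arr (rowT k.+1 a :: pick_rows k.+1 L ix) &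
      restr_to (fun b => b \in pick_rows k.+1 L ix) E (rowsT k (reps (mapr a A)))].
Proof.
move=> sL aL ui li jL nj A a.
have sa : size a = k.+1 by apply: size_nth_eq.
have hA : arr (rowT k.+1 a :: pick_rows k.+1 L ix).
  have /= := @arr_pick k.+1 L (j :: ix) aL; apply; first by rewrite /= nj ui.
  by rewrite /= jL li.
have a0 : rowT k.+1 a != 0 := arr_a_neq0 hA.
pose p := Ordinal (pivot_lt sa a0).
have ap : rowT k.+1 a 0 p != 0 by apply: (pivot_neq0 (p := p)).
have sA := size_pick sL li; rewrite -/A in sA.
have hA' : arr (rowT k.+1 a :: rowsT k.+1 A) by rewrite pick_rowsE.
have [h1 h2] := restr_reps sa (erefl : p = pivot a :> nat) ap sA hA'.
exists (rst_mx (rowT k.+1 a) p); split=> //; first exact: rst_hyper.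
by rewrite -pick_rowsE.
Qed.

Lemma restr_size_leq k (A : seq 'rV[F]_k.+1) a (E : 'M[F]_(k.+1, k)) L :
  hyper E a -> arr (a :: A) -> restr_to (fun b => b \in A) E L -> (size L <= size A)%N.
Proof. exact: restr_size_le. Qed.

Lemma run_sound m L c ix es ix' es' :
  all (fun u => size u == m) L -> arr (rowsT m L) ->
  uniq ix -> all (fun i => i < size L)%N ix -> free_exp (pick_rows m L ix) es ->
  run m L c ix es = Some (ix', es') ->
  [/\ uniq ix', all (fun i => i < size L)%N ix' & free_exp (pick_rows m L ix') es'].
Proof.
elim: c m L ix es ix' es' => [|js c IH|j sub IHs c IH] m L ix es ix' es' sL aL ui li fr /=.
- by case=> <- <-.
- case: ifP => // /and5P [m0 /allP jsh ujs dh ind].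
  case B: bumps => [es1|] // hr; case: m m0 sL aL fr ind hr => [|k] // _ sL aL fr ind hr.
  have jsL : all (fun i => i < size L)%N js by apply/allP => j /jsh /andP [].
  have ui' : uniq (js ++ ix).
    rewrite cat_uniq ujs ui andbT; apply/hasPn => i iix.
    by apply/negP => /jsh /andP [_]; rewrite iix.
  have li' : all (fun i => i < size L)%N (js ++ ix) by rewrite all_cat jsL li.
  apply: (IH k.+1 L (js ++ ix) es1) => //.
  set A := [seq nth [::] L i | i <- ix] in ind dh.
  set asq := [seq nth [::] L j | j <- js] in ind dh.
  pose q := size js; pose a (j : 'I_q) := rowT k.+1 (nth [::] asq j).
  pose jj (i : 'I_q) := nth 0%N js i.
  have jjs (i : 'I_q) : jj i \in js by rewrite mem_nth.
  have aj (i : 'I_q) : nth [::] asq i = nth [::] L (jj i).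
    by rewrite (nth_map 0%N).
  have j1 i : (jj i < size L)%N by case/andP: (jsh _ (jjs i)).
  have j2 i : jj i \notin ix by case/andP: (jsh _ (jjs i)).
  have S i := @single_setup k L ix (jj i) sL aL ui li (j1 i) (j2 i).
  have S' i : exists E : 'M[F]_(k.+1, k),
     [/\ hyper E (a i), arr (a i :: pick_rows k.+1 L ix) &
      restr_to (fun b => b \in pick_rows k.+1 L ix) E
        (rowsT k (reps (mapr (nth [::] L (jj i)) A)))].
    by have [E [_ h2 h3 h4]] := S i; exists E; rewrite /a aj.
  have [E hE] := fin_all_exists S'.
  have [|fr1 po] := indep_offP _ (size_pick sL jsL) (size_pick sL li) ind.
    by rewrite size_map.
  rewrite pick_rowsE in po.
  have := @add_block F k.+1 k (pick_rows k.+1 L ix) es es1 q a E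
    (fun i => rowsT k (reps (mapr (nth [::] L (jj i)) A))) (foldr maxn 0%N es) fr
    (arr_pick aL ui li) (fun i => let: And3 h _ _ := hE i in h)
    (fun i => let: And3 _ h _ := hE i in h) (fun i => let: And3 _ _ h := hE i in h).
  move=> AB; have {}AB := AB _ _ fr1 po (bumpsP B).
  apply: free_exp_perm (AB _ _).
  + rewrite perm_catC /pick_rows map_cat; apply: perm_cat => //.
    rewrite (_ : [seq a j | j <- enum 'I_q] = [seq rowT k.+1 (nth [::] L j) | j <- js]) //.
    rewrite -[in RHS](mkseq_nth 0%N js) /mkseq -val_enum_ord -!map_comp.
    by apply: eq_map => i; rewrite [LHS]/(rowT _ _) aj.
  + move=> i; have /allP/(_ (jj i) (jjs i)) : all (fun j => size A == foldr maxn 0%N es +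
       size (reps (mapr (nth [::] L j) A)))%N js by move: dh; rewrite all_map.
    by move/eqP; rewrite !size_map.
  + apply/allP; elim: (es) => [|x s IHs] n //=; rewrite inE => /predU1P [->|/IHs h].
      exact: leq_maxl.
    by rewrite leq_max h orbT.
- case: ifP => // /and3P [m0 jL nj]; case: ifP => // cond.
  case B: bump1 => [es1|] // hr; case: m m0 sL aL fr cond hr B => [|k] // _ sL aL fr cond hr B.
  have [E [sR hE hA hR]] := single_setup sL aL ui li jL nj.
  set A := [seq nth [::] L i | i <- ix] in cond hr B sR hR.
  set a := nth [::] L j in cond hr B sR hE hA hR; set L' := reps (mapr a A) in cond hr B sR hR.
  apply: (IH k.+1 L (j :: ix) es1) => //; rewrite /= ?nj ?jL //.
  have hd : (size (pick_rows k.+1 L ix) = (size A - size L') + size (rowsT k L'))%N.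
    have := restr_size_leq hE hA hR; rewrite !size_map => h; by rewrite subnK.
  have aR : arr (rowsT k L') by case: hR.
  have [|f1 _] := add_single fr hE hA hR hd.
    move: cond; case: ifP => [c1 _|_]; first by left.
    case R: run => [[ix1 cs]|] // lt; right.
    have [u1 l1 fr1] := IHs k L' [::] (nseq k 0%N) ix1 cs sR aR isT isT (free_exp0 F k) R.
    exists (pick_rows k L' ix1), cs; split=> //; last exact: arr_pick.
    by move=> x /mapP [i /(allP l1) iL ->]; rewrite nth_rowsT // mem_nth // size_map.
  by apply: free_exp_perm (f1 _ (bump1P B)); rewrite perm_catC.
Qed.

End Checker.

(** * From coefficient matrices to modules of derivations *)

Section Conversion.

Variable F : fieldType.

Lemma free_exp_coord m (L : seq 'rV[F]_m) es (g : 'M[F]_m) :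
  g \in unitmx -> free_exp L es -> free_exp [seq l *m g | l <- L] es.
Proof.
move=> gu [e [M [h1 h2 h3 h4]] pe]; exists e => //.
(* Coefficients are substituted and components transformed by the inverse transpose, so that the
   value on [l *m g] is the substituted value on [l]. *)
pose M' := map_mx (sub g) M *m liftm m (invmx g)^T.
have dE l i : dval M' (l *m g) i 0 = sub g (dval M l i 0).
  rewrite dval_mul -mulmxA -liftmM -trmx_mul -mulmxA mulmxV // mulmx1 map_dval.
  by [].
exists M'; split.
- move=> i j; rewrite mxE; apply: rpred_sum => l _.
  rewrite liftmE mulrC mul_mpolyC [map_mx _ _ _ _]mxE.
  by apply: homogZ; apply: sub_homog; apply: h1.
- by move=> _ /mapP [l lL ->] i; rewrite dE -sub_lin; apply: sub_pdvd; apply: h2.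
- have sub_inj (p : {mpoly F[m]}) : sub g p = 0 -> p = 0.
    move=> p0; rewrite -[p]sub1 -(mulmxV gu) -sub_comp p0; exact: raddf0.
  rewrite det_mulmx mulf_neq0 //.
    by rewrite det_map_mx; apply: contra h3 => /eqP /sub_inj ->.
  apply/negP => /eqP d0; have := congr1 determinant (liftm1 F m m).
  rewrite det1 -(trmx1 F m) -(mulmxV gu) trmx_mul liftmM det_mulmx d0 mul0r.
  by move/esym/eqP; rewrite oner_eq0.
- by rewrite size_map.
Qed.

(** The rows are permuted until their degrees come in the order of [es], because
    [free_with_exponents] indexes the basis by positions in the list. *)
Lemma free_exp_ord m (L : seq 'rV[F]_m) es : free_exp L es ->
  exists M, saito M L (fun j : 'I_m => nth 0%N es j).
Proof.
move=> [e [M [h1 h2 h3 h4]] pe].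
have sm : size [seq e i | i <- enum 'I_m] = m by rewrite size_map size_enum_ord.
have [Is pI esE] := perm_iotaP 0%N pe; rewrite sm in pI.
have sI : size Is = m by rewrite (perm_size pI) size_iota.
have ltI (j : 'I_m) : (nth 0%N Is j < m)%N.
  have : nth 0%N Is j \in Is by rewrite mem_nth // sI.
  by rewrite (perm_mem pI) mem_iota.
pose s0 (j : 'I_m) := Ordinal (ltI j).
have s_inj : injective s0.
  move=> j j' /(congr1 val) /= /eqP; rewrite nth_uniq ?sI //; last first.
    by rewrite (perm_uniq pI) iota_uniq.
  by move/eqP/val_inj.
pose s := perm s_inj.
have eE (j : 'I_m) : nth 0%N es j = e (s j).
  rewrite esE (nth_map 0%N) ?sI // permE.
  rewrite (nth_map (s0 j)) ?size_enum_ord ?ltI //.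
  by rewrite -[nth 0%N Is j]/(nat_of_ord (s0 j)) nth_ord_enum.
exists (row_perm s M); split=> [i j|a aL i||].
- by rewrite mxE eE; apply: h1.
- have := h2 a aL (s i); rewrite !dvalE; congr pdvd.
  by apply: eq_bigr => j _; rewrite mxE.
- by rewrite row_permE det_mulmx det_perm mulf_neq0 // signr_eq0.
- by rewrite -h4 [RHS](reindex_inj (@perm_inj _ s)); apply: eq_bigr => j _; rewrite eE.
Qed.

Section Derivations.

Variable m : nat.
Local Notation S := {mpoly F[m]}.

Definition der (w : 'rV[S]_m) (p : S) : S := \sum_i w 0 i * p^`M(i).

Lemma der_is_linear w : linear (der w).
Proof.
move=> c p q; rewrite /der scaler_sumr -big_split; apply: eq_bigr => i _ /=.
by rewrite mderivD mderivZ mulrDr scalerAr.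
Qed.

HB.instance Definition _ w :=
  GRing.isLinear.Build F S S *:%R (der w) (der_is_linear w).

Lemma der_leibniz w p q : der w (p * q) = der w p * q + p * der w q.
Proof.
rewrite /der mulr_suml mulr_sumr -big_split; apply: eq_bigr => i _ /=.
rewrite mderivM mulrDr; congr (_ + _); [by rewrite mulrA|by rewrite mulrCA].
Qed.

Lemma derX w i : der w 'X_i = w 0 i.
Proof.
rewrite /der (bigD1 i) //= mderivX mnm1E eqxx scale1r big1 => [|j ne].
  by rewrite (_ : (U_(i) - U_(i) = 0)%MM) ?mpolyX0 ?mulr1 ?addr0 //; apply/mnmP => k;
     rewrite mnmBE mnm0E subnn.
by rewrite mderivX mnm1E eq_sym (negPf ne) scale0r mulr0.
Qed.

Lemma der_lin w (a : 'rV[F]_m) : der w (lin a) = dval w a 0 0.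
Proof.
rewrite dvalE /lin linear_sum; apply: eq_bigr => j _.
by rewrite linearZ /= derX.
Qed.

Lemma derivation_ext (delta : {linear S -> S}) : (forall p q, delta (p * q) = delta p * q + p * delta q) ->
  forall p, delta p = der (\row_i delta 'X_i) p.
Proof.
move=> hd.
have d1 : delta 1 = 0.
  by have := hd 1 1; rewrite !mulr1 mul1r -[LHS]addr0 => /addrI.
elim/mpoly_alg_ind => [c|i|p q IHp IHq|p q IHp IHq].
- rewrite -[c%:MP]mulr1 mul_mpolyC !linearZ /= d1; congr (_ *: _).
  have := der_leibniz (\row_i delta 'X_i) 1 1.
  by rewrite !mulr1 mul1r -[LHS]addr0 => /addrI.
- by rewrite derX mxE.
- by rewrite !linearD /= IHp IHq.
- by rewrite hd der_leibniz IHp IHq.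
Qed.

End Derivations.

Definition cv (U : vectType F) (u : U) : 'cV[F]_(\dim {:U}) :=
  \col_i coord (vbasis {:U}) i u.

Definition vc (U : vectType F) (x : 'cV[F]_(\dim {:U})) : U :=
  \sum_i x i 0 *: (vbasis {:U})`_i.

Lemma vcK (U : vectType F) (x : 'cV[F]_(\dim {:U})) : cv (vc x) = x.
Proof.
apply/colP => i; rewrite mxE /vc linear_sum (bigD1 i) //= linearZ /=.
rewrite coord_free ?(basis_free (vbasisP _)) // eqxx mulr1 big1 ?addr0 // => j ne.
by rewrite linearZ /= coord_free ?(basis_free (vbasisP _)) // (negPf ne) mulr0.
Qed.

Lemma homog1_lin m (p : {mpoly F[m]}) : p \is 1.-homog -> exists a, p = lin a.
Proof.
move=> hp; exists (\row_i p@_(U_(i))%MM); apply/mpolyP => u; rewrite /lin linear_sum /=.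
case: (boolP (mdeg u == 1%N)) => [/mdeg1P [i /eqP ->]|nu].
  rewrite (bigD1 i) //= mcoeffZ mxE mcoeffXU eqxx mulr1 big1 ?addr0 // => j ne.
  by rewrite mcoeffZ mcoeffXU (negPf ne) mulr0.
rewrite (dhomog_nemf_coeff hp) // big1 // => j _; rewrite mcoeffZ mcoeffX.
case: eqP => [ju|]; last by rewrite mulr0.
by rewrite -ju mdeg1 in nu.
Qed.

Lemma ker_sub_form m (a b : 'rV[F]_m) :
  (forall x : 'cV_m, a *m x = 0 -> b *m x = 0) -> (b <= a)%MS.
Proof.
move=> h; case: (eqVneq a 0) => [a0|/form_unit [u au]].
  suff -> : b = 0 by apply: sub0mx.
  apply/rowP => j; have := h (delta_mx j 0); rewrite a0 mul0mx -colE => /(_ erefl).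
  by move/colP/(_ 0); rewrite !mxE.
have : b *m (1%:M - u *m a) = 0.
  apply: trmx_inj; apply/row_matrixP => i; rewrite trmx0 row0 -tr_col.
  apply: trmx_inj; rewrite trmxK trmx0 colE -mulmxA; apply: h.
  by rewrite mulmxA mulmxBr mulmx1 mulmxA au mul1mx subrr mul0mx.
rewrite mulmxBr mulmx1 mulmxA => /eqP; rewrite subr_eq0 => /eqP ->.
exact: submxMl.
Qed.

Lemma sc0 (c : 'M[F]_1) : (c == 0) = (c 0 0 == 0).
Proof.
by apply/eqP/eqP => [->|c0]; [rewrite mxE | apply/matrixP => i j; rewrite !ord1 c0 mxE].
Qed.

(** A defining form of a hyperplane has the same kernel as its representative in [L], hence is
    proportional to it, so tangency is independent of the choice. Generation comes from
    [saito_basis]; the coefficients are unique because [\det M] is nonzero. *)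
Lemma free_with_exponentsP (U : vectType F) (A : seq {vspace U})
    (L : seq 'rV[F]_(\dim {:U})) es :
  arr L -> free_exp L es -> size es = \dim {:U} ->
  (forall H, H \in A -> exists2 l, l \in L & forall u, (u \in H) = (l *m cv u == 0)) ->
  (forall l, l \in L -> exists2 H, H \in A & forall u, (u \in H) = (l *m cv u == 0)) ->
  free_with_exponents A es.
Proof.
move=> aL fr ses AL LA; have [M sM] := free_exp_ord fr.
have [he ht d0 se] := sM.
have evE (b : 'rV[F]_(\dim {:U})) u :
    ((lin b).@[fun i => coord (vbasis {:U}) i u] == 0) = (b *m cv u == 0).
  rewrite sc0 -meval_lin; congr (_ == 0); apply: meval_eq => i; by rewrite mxE.
have tangA w H alpha : (forall l, l \in L -> tang w l) -> H \in A ->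
    is_defining_form H alpha -> exists q, der w alpha = alpha * q.
  move=> tw HA [/homog1_lin [b ->] bH]; have [l lL lH] := AL H HA.
  have lb : (l <= b)%MS.
    apply: ker_sub_form => x bx; apply/eqP; rewrite -(vcK x) -lH bH evE vcK bx.
    by rewrite eqxx.
  have /sub_rVP [c lE] := lb.
  have c0 : c != 0.
    by apply: contraNneq (arr_neq0 aL lL) => c0; rewrite lE c0 scale0r.
  have bE : b = c^-1 *: l by rewrite lE scalerA mulVf // scale1r.
  rewrite der_lin bE; have := tangZ (_ : c^-1 != 0) (tw l lL); rewrite invr_eq0 => /(_ c0 0).
  by case=> q ->; exists q.
have tM i l : l \in L -> tang (row i M) l.
  by move=> lL j; rewrite ord1 dval_row; apply: ht.
have sumE (h : 'rV_(\dim {:U})) p :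
    \sum_i h 0 i * der (row i M) p = der (h *m M) p.
  rewrite /der; under eq_bigr do rewrite mulr_sumr; rewrite exchange_big /=.
  apply: eq_bigr => i _; rewrite mxE mulr_suml; apply: eq_bigr => j _.
  by rewrite mxE mulrA.
have cast_sum (f : 'I_(\dim {:U}) -> {mpoly F[\dim {:U}]}) :
    \sum_(j < size es) f (cast_ord ses j) = \sum_i f i.
  rewrite [RHS](reindex (cast_ord ses)) //; apply: onW_bij.
  exists (cast_ord (esym ses)); [exact: cast_ordK | exact: cast_ordKV].
exists (fun j : 'I_(size es) => der (row (cast_ord ses j) M) : {linear _ -> _}); split; last first.
  by move=> j i /=; rewrite derX mxE; apply: he.
split=> [j|delta [dd dA]].
  split; first exact: der_leibniz.
  by move=> H alpha HA hH; apply: tangA HA hH => l; apply: tM.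
pose w : 'rV_(\dim {:U}) := \row_i delta 'X_i.
have tw l : l \in L -> tang w l.
  move=> lL i; rewrite ord1 -der_lin -derivation_ext //.
  have [H HA lH] := LA l lL.
  have [|q ->] := dA H (lin l) HA; last by apply: pdvd_mulr; apply: pdvd_refl.
  by split; [apply: lin_homog | move=> v; rewrite lH evE].
have [h wE _] := saito_basis aL sM tw.
exists [ffun j : 'I_(size es) => h 0 (cast_ord ses j)]; split=> [p|g gE].
  rewrite derivation_ext // -/w wE -sumE -cast_sum.
  by apply: eq_bigr => j _; rewrite ffunE.
pose g' : 'rV_(\dim {:U}) := \row_i g (cast_ord (esym ses) i).
have g'M : g' *m M = w.
  apply/rowP => i; rewrite -(derX (g' *m M)) -sumE [RHS]mxE gE -cast_sum.
  by apply: eq_bigr => j _; rewrite mxE cast_ordK.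
apply/ffunP => j; rewrite ffunE.
have : (g' - h) *m M = 0 by rewrite mulmxBl g'M -wE subrr.
move=> gh; have : g' - h == 0.
  by apply: contraT => ne; case/negP: d0; apply/det0P; exists (g' - h).
rewrite subr_eq0 => /eqP <-; by rewrite mxE cast_ordK.
Qed.

End Conversion.

(** * Flats and chains of flats *)

Section Chains.

Variables (F : realFieldType) (n : nat) (Phi : 'rV[F]_n -> Prop).

(* A flat is represented by any of its generic points [x]: it is the space of
   all [v] killed by every form of [Phi] that kills [x]. *)
Definition in_flat (x v : 'cV[F]_n) : Prop :=
  forall r, Phi r -> r *m x = 0 -> r *m v = 0.

Definition flat (x : 'cV[F]_n) k (P : 'M[F]_(n, k)) : Prop :=
  row_full P /\ forall v, in_flat x v <-> exists z, v = P *m z.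

Definition free_at (x : 'cV[F]_n) (es : seq nat) : Prop :=
  exists k (P : 'M[F]_(n, k)) L,
    [/\ flat x P, restr_to Phi P L & free_exp L es].

(** A descending sequence of flats that loses its largest exponent at each step. As the number of
    exponents is the dimension, each step has codimension one. *)
Inductive chain : 'cV[F]_n -> seq nat -> Prop :=
| chain_nil x : (forall v, in_flat x v -> v = 0) -> chain x [::]
| chain_rcons x x' es e : sorted leq (rcons es e) -> free_at x (rcons es e) ->
    in_flat x x' -> chain x' es -> chain x (rcons es e).

Lemma in_flat_trans x y z : in_flat x y -> in_flat y z -> in_flat x z.
Proof. by move=> h1 h2 r hr rx; apply: h2 => //; apply: h1. Qed.

Lemma in_flat_refl x : in_flat x x.
Proof. by []. Qed.

Lemma chain_prefix x es d : chain x es -> (0 < d <= size es)%N ->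
  exists2 x', in_flat x x' & free_at x' (take d es).
Proof.
move=> c; elim: c d => {x es} [x _|x x' es e _ fx xx' _ IH] d.
  by case/andP=> d0; rewrite leqNgt d0.
rewrite size_rcons => /andP [d0]; rewrite leq_eqVlt => /orP [/eqP ->|].
  by exists x; rewrite // -(size_rcons es e) take_size.
rewrite ltnS => dle; have [|x'' h1 h2] := IH d; first by rewrite d0.
exists x''; first exact: in_flat_trans h1.
by rewrite -cats1 takel_cat.
Qed.

Lemma chain_free x es : chain x es -> free_at x es.
Proof.
case=> {x es} [x x0|//]; exists 0%N, 0, [::]; split.
- split=> [|v]; first by rewrite /row_full mxrank0.
  split=> [/x0 ->|[z ->]]; first by exists 0; rewrite mulmx0.
  by rewrite mul0mx => r _ _; rewrite mulmx0.
- by split=> // r _; left; rewrite mulmx0.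
- exact: free_exp0.
Qed.

Lemma chain_sorted x es : chain x es -> sorted leq es.
Proof. by case. Qed.

Lemma free_at_size x es k (P : 'M[F]_(n, k)) : flat x P -> free_at x es -> size es = k.
Proof.
move=> [Pf Px] [k' [P' [L [[P'f P'x] _ [e _ /perm_size]]]]].
rewrite size_map size_enum_ord => ->.
have sub k1 k2 (P1 : 'M[F]_(n, k1)) (P2 : 'M[F]_(n, k2)) :
    (forall v, in_flat x v <-> exists z, v = P1 *m z) ->
    (forall v, in_flat x v <-> exists z, v = P2 *m z) -> row_full P1 -> (k1 <= k2)%N.
  move=> h1 h2 /eqP r1; rewrite -r1 -mxrank_tr; apply: leq_trans (rank_leq_col P2).
  rewrite -[\rank P2]mxrank_tr; apply: mxrankS; apply/row_subP => i.
  have /h2 [z zE] : in_flat x (col i P1) by apply/h1; exists (delta_mx i 0); rewrite colE.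
  by rewrite -tr_col zE trmx_mul submxMl.
by apply/eqP; rewrite eqn_leq (sub _ _ _ _ P'x Px P'f) (sub _ _ _ _ Px P'x Pf).
Qed.

Section OneSpace.

Variables (U : vectType F) (iota : {linear U -> 'cV[F]_n}) (A : seq {vspace U}).
Variables (x : 'cV[F]_n) (es : seq nat).
Hypotheses (iinj : injective iota) (iflat : forall v, in_flat x v <-> exists u, v = iota u).
Hypothesis hA : forall H, H \in A -> exists r, [/\ Phi r,
  forall u, (u \in H) = (r *m iota u == 0) & exists u, r *m iota u != 0].
Hypothesis hPhi : forall r, Phi r -> (exists u, r *m iota u != 0) ->
  exists2 H, H \in A & forall u, (u \in H) = (r *m iota u == 0).

(** [Bm] and [P] are two bases of the same flat, so they differ by an invertible matrix [g], along
    which the free arrangement is moved to the coordinates of [U]. *)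
Lemma free_at_conv : free_at x es -> free_with_exponents A es /\ size es = \dim {:U}.
Proof.
move=> fx; have [k [P [L [[Pf Px] [aL PL LP] fL]]]] := fx.
pose Bm : 'M[F]_(n, \dim {:U}) := \matrix_(i, j) iota (vbasis {:U})`_j i 0.
have iE u : iota u = Bm *m cv u.
  rewrite [in LHS](coord_vbasis (memvf u)) linear_sum; apply/colP => i.
  rewrite summxE mxE; apply: eq_bigr => j _.
  by rewrite linearZ /= !mxE mulrC.
have Bfull : row_full Bm.
  rewrite /row_full -mxrank_tr -/(row_free _); apply: inj_row_free => v vB.
  have : iota (vc v^T) = 0.
    by rewrite iE vcK; apply: trmx_inj; rewrite trmx_mul trmxK vB trmx0.
  rewrite -(raddf0 iota) => /iinj /(congr1 (@cv F U)); rewrite vcK.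
  have -> : cv (0 : U) = 0 by apply/colP => i; rewrite !mxE linear0.
  by move=> vt; rewrite -[v]trmxK vt trmx0.
have Bflat : flat x Bm.
  split=> // v; rewrite iflat; split=> [[u ->]|[z ->]]; first by exists (cv u); rewrite iE.
  by exists (vc z); rewrite iE vcK.
have ses : size es = \dim {:U} := free_at_size Bflat fx.
have kE : k = \dim {:U} by rewrite -ses (free_at_size (conj Pf Px) fx).
split=> //; subst k.
have [g gE] : exists g, Bm = P *m g.
  have H j : exists z, col j Bm == P *m z.
    have /Px [z ->] : in_flat x (col j Bm).
      by apply/(proj2 Bflat); exists (delta_mx j 0); rewrite colE.
    by exists z.
  exists (\matrix_(i, j) xchoose (H j) i 0); apply/matrixP => i j.
  have /eqP/colP/(_ i) := xchooseP (H j); rewrite !mxE => ->.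
  by apply: eq_bigr => l _; rewrite !mxE.
have gu : g \in unitmx.
  rewrite -row_full_unit /row_full eqn_leq rank_leq_col /=.
  by apply: leq_trans (mxrankM_maxr P g); rewrite -gE (eqP Bfull).
have zE (r : 'rV_n) (l : 'rV_(\dim {:U})) u : l != 0 -> (r *m P <= l)%MS -> r *m P != 0 ->
    (l *m g *m cv u == 0) = (r *m iota u == 0).
  move=> l0 /sub_rVP [c rl] r0.
  have c0 : c != 0 by apply: contraNneq r0 => c0; rewrite rl c0 scale0r.
  by rewrite iE gE !mulmxA rl -!scalemxAl scaler_eq0 (negPf c0).
apply: (@free_with_exponentsP _ _ _ [seq l *m g | l <- L]) => //.
- apply: arrP => [|_ /mapP [l lL ->]|_ _ /mapP [l lL ->] /mapP [l' l'L ->]].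
  + by rewrite map_inj_uniq ?arr_uniq //; apply: (can_inj (mulmxK gu)).
  + apply: contra (arr_neq0 aL lL) => /eqP lg.
    by rewrite -(mulmxK gu l) lg mul0mx.
  + move/sub_rVP => [c h]; congr (_ *m g); apply: (arr_eq aL) => //.
    apply/sub_rVP; exists c; apply: (can_inj (mulmxK gu)).
    by rewrite h -scalemxAl.
- exact: free_exp_coord.
- move=> H /hA [r [hr Hr [u ru]]].
  have rP : r *m P != 0.
    by apply: contra ru => /eqP rP; rewrite iE gE !mulmxA rP !mul0mx.
  have [/eqP|[l lL rl]] := PL r hr; first by rewrite (negPf rP).
  exists (l *m g); first exact: map_f.
  by move=> u'; rewrite Hr (zE r) // (arr_neq0 aL).
- move=> _ /mapP [l lL ->]; have [r hr lr] := LP l lL.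
  have l0 := arr_neq0 aL lL; have rl := sub_row_sym l0 lr.
  have rP : r *m P != 0.
    by apply: contraNneq l0 => r0; have /sub_rVP [c ->] := lr; rewrite r0 scaler0.
  have [|H HA Hr] := hPhi hr; last by exists H => // u; rewrite Hr (zE r).
  have [w wE] := form_unit rP.
  exists (vc (invmx g *m w)); rewrite iE vcK gE !mulmxA mulmxK // wE.
  by rewrite sc0 mxE oner_neq0.
Qed.

End OneSpace.

Section Incl.

Variables (G : 'M[F]_n) (X : {vspace 'rV[F]_n}) (Y : {vspace (subvs_of X)}).

(** [G] will be the Gram matrix of the Coxeter form; it turns the hyperplane orthogonal to [r] into
    the zero set of the row [r]. The next two maps serve the restriction to a flat and the
    restriction of that restriction, which lives in a subspace of a subspace. *)
Definition incl0 (v : 'rV[F]_n) : 'cV[F]_n := G *m v^T.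
Definition incl1 (u : subvs_of X) : 'cV[F]_n := incl0 (vsval u).
Definition incl2 (u : subvs_of Y) : 'cV[F]_n := incl1 (vsval u).

Lemma incl0_linear : linear incl0.
Proof. by move=> c u v; rewrite /incl0 linearP mulmxDr -scalemxAr. Qed.

Lemma incl1_linear : linear incl1.
Proof. by move=> c u v; rewrite /incl1 linearP incl0_linear. Qed.

Lemma incl2_linear : linear incl2.
Proof. by move=> c u v; rewrite /incl2 linearP incl1_linear. Qed.

HB.instance Definition _ :=
  GRing.isLinear.Build F (subvs_of X) 'cV[F]_n *:%R incl1 incl1_linear.
HB.instance Definition _ :=
  GRing.isLinear.Build F (subvs_of Y) 'cV[F]_n *:%R incl2 incl2_linear.

End Incl.

(** In coordinates of [X] the hyperplanes not containing [X] are given by nonzero forms, and there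
    is a point off all of them. *)
Lemma generic_in_vspace (X : {vspace 'rV[F]_n}) (A : seq {vspace 'rV[F]_n}) :
  (forall H, H \in A -> exists a : 'rV[F]_n, forall v, (v \in H) = (a *m v^T == 0)) ->
  exists2 v0, v0 \in X & forall H, H \in A -> v0 \in H -> (X <= H)%VS.
Proof.
move=> hA.
have [rs hrs] : exists rs : seq 'rV[F]_n, forall H, H \in A ->
    exists2 a, a \in rs & forall v, (v \in H) = (a *m v^T == 0).
  elim: A hA => [|H A IH] hA; first by exists [::].
  have [|rs hrs] := IH; first by move=> H' H'A; apply: hA; rewrite inE H'A orbT.
  have [a ha] := hA H (mem_head _ _); exists (a :: rs) => H'.
  rewrite inE => /predU1P [->|/hrs [b bs hb]]; first by exists a; rewrite ?mem_head.
  by exists b; rewrite // inE bs orbT.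
pose Xb : 'M[F]_(\dim X, n) := \matrix_i (vbasis X)`_i.
have XbE v : v \in X -> v^T = Xb^T *m \col_i coord (vbasis X) i v.
  move=> vX; apply: trmx_inj; rewrite trmx_mul !trmxK {1}(coord_vbasis vX).
  by rewrite mulmx_sum_row; apply: eq_bigr => i _; rewrite !mxE rowK.
have [|z hz] := @generic_point F _ [seq a <- [seq a *m Xb^T | a <- rs] | a != 0].
  exact: filter_all.
exists (z^T *m Xb).
  rewrite mulmx_sum_row; apply: memv_suml => i _; rewrite rowK memvZ // vbasis_mem //.
  by rewrite mem_nth // size_tuple.
move=> H /hrs [a ars aH]; rewrite aH trmx_mul trmxK mulmxA => az.
have aX : a *m Xb^T = 0.
  apply/eqP; apply: contraLR az => ne; apply: hz; rewrite mem_filter ne; exact: map_f.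
by apply/subvP => v /XbE vE; rewrite aH vE mulmxA aX mul0mx.
Qed.

(** A generic vector of [X] represents [X] as a flat, and its chain provides flats of all smaller
    positive dimensions inside [X]. Each is cut out by the members of the restriction through its
    generic point, hence belongs to the lattice of the restriction. *)
Lemma accurate_of_chain (G : 'M[F]_n) (A : seq {vspace 'rV[F]_n}) (X : {vspace 'rV[F]_n}) :
  G \in unitmx ->
  (forall H, H \in A -> exists2 r, Phi r & forall v, (v \in H) = (r *m G *m v^T == 0)) ->
  (forall r, Phi r -> exists2 H, H \in A & forall v, (v \in H) = (r *m G *m v^T == 0)) ->
  (forall x, exists es, chain x es) ->
  in_intersection_lattice A X -> accurate (restriction A X).
Proof.
move=> Gu AP PA hc [B [BA XE]].
have io_inj : injective (@incl0 G).
  by move=> u v /(can_inj (mulKmx Gu)) /trmx_inj.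
have ioK y : incl0 G (invmx G *m y)^T = y by rewrite /incl0 trmxK mulKVmx.
have XB v : v \in X <-> (forall H, H \in B -> v \in H).
  rewrite XE; elim: B {BA XE} => [|H B IH]; first by rewrite big_nil memvf.
  rewrite big_cons memv_cap; split=> [/andP [vH /IH vB] H'|h].
    by rewrite inE => /predU1P [->|/vB].
  rewrite h ?mem_head //=; apply/IH => H' H'B; apply: h; by rewrite inE H'B orbT.
have [H HA|v0 v0X v0g] := @generic_in_vspace X A.
  by have [r _ Hr] := AP H HA; exists (r *m G).
pose x0 := incl0 G v0.
have flat0 v : in_flat x0 (incl0 G v) <-> v \in X.
  split=> [h|vX r hr rx].
    apply/XB => H HB; have [r hr Hr] := AP H (BA _ HB).
    rewrite Hr -mulmxA; apply/eqP; apply: h => //; apply/eqP; rewrite mulmxA -Hr.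
    by move/XB: v0X; apply.
  have [H HA Hr] := PA r hr.
  have v0H : v0 \in H by rewrite Hr -mulmxA -/(incl0 G v0) rx.
  have := subvP (v0g _ HA v0H) _ vX; rewrite Hr -mulmxA => /eqP; exact.
have [es ces] := hc x0.
pose AX := restriction A X.
have memR H' : H' \in AX -> exists r, [/\ Phi r,
    forall u, (u \in H') = (r *m incl1 G u == 0) &
      exists u : subvs_of X, r *m incl1 G u != 0].
  case/mapP => H; rewrite mem_filter => /andP [XH HA] ->.
  have [r hr Hr] := AP H HA; exists r; split=> // [u|].
    by rewrite -memv_preim lfunE /= Hr mulmxA.
  move/subvPn: XH => [u uX uH]; exists (vsproj X u).
  by rewrite /incl1 vsprojK // mulmxA -Hr.
have Rmem r : Phi r -> (exists u : subvs_of X, r *m incl1 G u != 0) ->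
    exists2 H' : {vspace subvs_of X}, H' \in AX &
      forall u, (u \in H') = (r *m incl1 G u == 0).
  move=> hr [u ru]; have [H HA Hr] := PA r hr.
  exists (linfun (vsval : subvs_of X -> 'rV[F]_n) @^-1: H)%VS.
    apply: map_f; rewrite mem_filter HA andbT; apply/negP => /subvP /(_ _ (subvsP u)).
    by rewrite Hr -mulmxA (negPf ru).
  by move=> u'; rewrite -memv_preim lfunE /= Hr mulmxA.
have i1inj : injective (@incl1 G X) by move=> u v /io_inj /subvs_inj.
have i1flat v : in_flat x0 v <-> exists u : subvs_of X, v = incl1 G u.
  split=> [|[u ->]]; last first.
    exact: (proj2 (flat0 (vsval u)) (subvsP u)).
  rewrite -(ioK v) => /flat0 vX; exists (vsproj X (invmx G *m v)^T).
  by rewrite /incl1 vsprojK.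
have [f1 s1] := free_at_conv i1inj i1flat memR Rmem (chain_free ces).
exists es; split=> // [|d]; first exact: chain_sorted ces.
rewrite -s1 => dle; have [x' x'flat fx'] := chain_prefix ces dle.
have [u' u'E] := (proj1 (i1flat x')) x'flat.
pose Bs := [seq H : {vspace subvs_of X} <- AX | u' \in H].
pose Y := (\bigcap_(H <- Bs) H)%VS.
have YB (u : subvs_of X) : u \in Y <-> (forall H, H \in Bs -> u \in H).
  rewrite /Y; elim: Bs {Y} => [|H B' IH]; first by rewrite big_nil memvf.
  rewrite big_cons memv_cap; split=> [/andP [vH /IH vB] H'|h].
    by rewrite inE => /predU1P [->|/vB].
  by rewrite h ?mem_head //=; apply/IH => H' H'B; apply: h; rewrite inE H'B orbT.
have Yflat (u : subvs_of X) : in_flat x' (incl1 G u) <-> u \in Y.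
  split=> [h|uY r hr rx'].
    apply/YB => H; rewrite mem_filter => /andP [u'H HA]; have [r [hr Hr _]] := memR H HA.
    by rewrite Hr; apply/eqP; apply: h => //; apply/eqP; rewrite u'E -Hr.
  case: (eqVneq (r *m incl1 G u) 0) => // ne.
  have [|H HA Hr] := Rmem r hr; first by exists u.
  apply/eqP; rewrite -Hr; move/YB: uY; apply.
  by rewrite mem_filter HA Hr -u'E rx' eqxx.
have i2inj : injective (@incl2 G X Y) by move=> u v /i1inj /subvs_inj.
have i2flat v : in_flat x' v <-> exists u : subvs_of Y, v = incl2 G u.
  split=> [h|[u ->]]; last exact: (proj2 (Yflat (vsval u)) (subvsP u)).
  have [u uE] := (proj1 (i1flat v)) (in_flat_trans x'flat h).
  rewrite uE in h *; exists (vsproj Y u); rewrite /incl2 vsprojK //; exact/Yflat.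
have [||f2 s2] := free_at_conv (A := restriction AX Y) i2inj i2flat _ _ fx'.
- move=> H' /mapP [H]; rewrite mem_filter => /andP [YH HA] ->.
  have [r [hr Hr _]] := memR H HA; exists r; split=> // [u|].
    by rewrite -memv_preim lfunE /= Hr.
  move/subvPn: YH => [u uY uH]; exists (vsproj Y u).
  by rewrite /= /incl2 vsprojK // -Hr.
- move=> r hr [u ru]; have [|H HA Hr] := Rmem r hr; first by exists (vsval u).
  exists (linfun (vsval : subvs_of Y -> subvs_of X) @^-1: H)%VS.
    apply: map_f; rewrite mem_filter HA andbT; apply/negP => /subvP /(_ _ (subvsP u)).
    by rewrite Hr (negPf ru).
  by move=> u2; rewrite -memv_preim lfunE /= Hr.
exists Y; split=> //; first by exists Bs; split=> // H; rewrite mem_filter => /andP [].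
have := s2; rewrite size_takel; last by case/andP: dle.
by move=> ->; rewrite dimvf.
Qed.

End Chains.

(** * Isomorphisms and products *)

Section Transport.

Variable F : realFieldType.

Definition hacc n (Phi : 'rV[F]_n -> Prop) : Prop := forall x, exists es, chain Phi x es.

Lemma free_at_ext n (Phi : 'rV[F]_n -> Prop) x y es :
  in_flat Phi x y -> in_flat Phi y x -> free_at Phi x es -> free_at Phi y es.
Proof.
move=> xy yx [k [P [L [[Pf Px] h2 h3]]]]; exists k, P, L; split=> //; split=> // v.
by rewrite -Px; split; apply: in_flat_trans.
Qed.

Lemma chain_ext n (Phi : 'rV[F]_n -> Prop) x y es :
  in_flat Phi x y -> in_flat Phi y x -> chain Phi x es -> chain Phi y es.
Proof.
move=> xy yx c; case: c xy yx => {x es} [x h|x x' es e se fx xx' cx'] xy yx.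
  by apply: chain_nil => v yv; apply: h; apply: in_flat_trans yv.
apply: (chain_rcons se _ _ cx'); first exact: free_at_ext fx.
exact: in_flat_trans xx'.
Qed.

Section Iso.

Variables (n n' : nat) (Phi : 'rV[F]_n -> Prop) (Phi' : 'rV[F]_n' -> Prop).
Variables (g : 'M[F]_(n, n')) (h : 'M[F]_(n', n)).
Hypotheses (gh : g *m h = 1%:M) (hg : h *m g = 1%:M).
Hypothesis h1 : forall r, Phi r -> exists2 c, c != 0 & Phi' (c *: (r *m g)).
Hypothesis h2 : forall r, Phi' r -> exists2 c, c != 0 & Phi (c *: (r *m h)).

Let scE (c : F) m (u : 'rV[F]_m) (v : 'cV[F]_m) : c != 0 -> (c *: u) *m v = 0 -> u *m v = 0.
Proof. by move=> c0; rewrite -scalemxAl => /eqP; rewrite scaler_eq0 (negPf c0) => /eqP. Qed.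

Lemma in_flat_iso x v : in_flat Phi x v <-> in_flat Phi' (h *m x) (h *m v).
Proof.
split=> H r hr rx.
  have [c c0 hr'] := h2 hr; rewrite mulmxA; apply: (scE c0); apply: H => //.
  by rewrite -scalemxAl -mulmxA rx scaler0.
have [c c0 hr'] := h1 hr; rewrite -[r]mulmx1 -gh mulmxA -mulmxA; apply: (scE c0).
apply: H => //; rewrite -scalemxAl mulmxA -(mulmxA r) gh mulmx1 rx scaler0 //.
Qed.

Lemma free_at_iso x es : free_at Phi' (h *m x) es -> free_at Phi x es.
Proof.
move=> [k [P [L [[/row_fullP [Q QP] Px] [aL PL LP] fL]]]].
exists k, (g *m P), L; split=> //.
  split; first by apply/row_fullP; exists (Q *m h); rewrite mulmxA -(mulmxA Q) hg mulmx1.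
  move=> v; rewrite in_flat_iso Px; split=> [] [z zE]; exists z.
    by rewrite -[LHS]mul1mx -gh -!mulmxA zE.
  by rewrite zE -mulmxA mulmxA hg mul1mx.
split=> // [r hr|l lL].
  have [c c0 hr'] := h1 hr; have [E|[l lL le]] := PL _ hr'.
    left; move/eqP: E; rewrite -scalemxAl scaler_eq0 (negPf c0) mulmxA => /eqP //.
  by right; exists l => //; move: le; rewrite -scalemxAl mulmxA eqmx_scale.
have [r hr lr] := LP l lL; have [c c0 hr'] := h2 hr; exists (c *: (r *m h)) => //.
by rewrite -scalemxAl mulmxA -(mulmxA r) hg mulmx1 eqmx_scale.
Qed.

Lemma chain_iso x es : chain Phi' (h *m x) es -> chain Phi x es.
Proof.
move=> c; have [y yE] : exists y, y = h *m x by exists (h *m x).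
rewrite -yE in c; elim: c x yE => {y es} [y y0|y y' es e se fy yy' _ IH] x yE.
  apply: chain_nil => v /in_flat_iso; rewrite -yE => /y0 hv.
  by rewrite -[v]mul1mx -gh -mulmxA hv mulmx0.
apply: (@chain_rcons _ _ _ x (g *m y')) => //; first by apply: free_at_iso; rewrite -yE.
  by apply/in_flat_iso; rewrite -yE mulmxA hg mul1mx.
by apply: IH; rewrite mulmxA hg mul1mx.
Qed.

Lemma hacc_iso : hacc Phi' -> hacc Phi.
Proof. by move=> H x; have [es /chain_iso c] := H (h *m x); exists es. Qed.

End Iso.

Lemma chain_leaf_max n (Phi : 'rV[F]_n -> Prop) x es e :
  chain Phi x (rcons es e) -> exists x', [/\ sorted leq (rcons es e),
    free_at Phi x (rcons es e), in_flat Phi x x' & chain Phi x' es].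
Proof.
move=> c; have [es1 E] : exists es1, es1 = rcons es e by exists (rcons es e).
rewrite -E in c *; case: c E => {x es1} [x _|x x' es1 e1 se fx xx' cx'].
  by case: es.
by move/eqP; rewrite eqseq_rcons => /andP [/eqP <- _]; exists x'.
Qed.

Lemma chain_nil_inv n (Phi : 'rV[F]_n -> Prop) x v :
  chain Phi x [::] -> in_flat Phi x v -> v = 0.
Proof.
move=> c; have [es E] : exists es : seq nat, es = [::] by exists [::].
rewrite -E in c; case: c E => {x es} [x h _|x x' es e _ _ _ _]; first exact: h.
by case: es.
Qed.

Section Product.

Variables (n1 n2 : nat) (Phi1 : 'rV[F]_n1 -> Prop) (Phi2 : 'rV[F]_n2 -> Prop).

Definition prodPhi (r : 'rV[F]_(n1 + n2)) : Prop :=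
  (exists2 r1, Phi1 r1 & r = row_mx r1 0) \/ (exists2 r2, Phi2 r2 & r = row_mx 0 r2).

Lemma in_flat_prod x1 x2 v1 v2 :
  in_flat prodPhi (col_mx x1 x2) (col_mx v1 v2) <-> in_flat Phi1 x1 v1 /\ in_flat Phi2 x2 v2.
Proof.
split=> [H|[H1 H2] r].
  split=> r hr rx.
    have := H (row_mx r 0); rewrite !mul_row_col !mul0mx !addr0; apply=> //.
    by left; exists r.
  have := H (row_mx 0 r); rewrite !mul_row_col !mul0mx !add0r; apply=> //.
  by right; exists r.
case=> [[r1 hr ->]|[r2 hr ->]]; rewrite !mul_row_col !mul0mx ?addr0 ?add0r.
  exact: H1.
exact: H2.
Qed.

Lemma free_exp_prod k1 k2 (L1 : seq 'rV[F]_k1) (L2 : seq 'rV[F]_k2) es1 es2 :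
  free_exp L1 es1 -> free_exp L2 es2 ->
  free_exp ([seq row_mx l 0 | l <- L1] ++ [seq row_mx 0 l | l <- L2]) (es1 ++ es2).
Proof.
move=> [e1 [M1 [a1 b1 c1 d1]] p1] [e2 [M2 [a2 b2 c2 d2]] p2].
pose E1 : 'M[F]_(k1, k1 + k2) := row_mx 1%:M 0.
pose E2 : 'M[F]_(k2, k1 + k2) := row_mx 0 1%:M.
have E1E (l : 'rV_k1) : l *m E1 = row_mx l 0 by rewrite mul_mx_row mulmx1 mulmx0.
have E2E (l : 'rV_k2) : l *m E2 = row_mx 0 l by rewrite mul_mx_row mulmx1 mulmx0.
pose e i := match split i with inl i1 => e1 i1 | inr i2 => e2 i2 end.
pose M := block_mx (map_mx (sub E1) M1) 0 0 (map_mx (sub E2) M2).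
exists e; last first.
  apply: perm_trans (perm_cat p1 p2) _.
  have pi : perm_eq (enum 'I_(k1 + k2))
      ([seq lshift k2 i | i <- enum 'I_k1] ++ [seq rshift k1 i | i <- enum 'I_k2]).
    apply: uniq_perm; first exact: enum_uniq.
      have il : injective (lshift k2 : 'I_k1 -> _) by apply: lshift_inj.
      have ir : injective (@rshift k1 k2) by apply: rshift_inj.
      rewrite cat_uniq (map_inj_uniq il) (map_inj_uniq ir) !enum_uniq andbT /=.
      apply/hasPn => _ /mapP [i _ ->]; apply/negP => /mapP [j _ /eqP].
      by rewrite eq_rlshift.
    move=> i; rewrite mem_enum mem_cat -(splitK i) inE; symmetry; apply/orP.
    by case: (split i) => j /=; [left | right]; apply/mapP; exists j; rewrite ?mem_enum.
  rewrite perm_sym; apply: perm_trans (perm_map e pi) _; rewrite map_cat -!map_comp.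
  apply: perm_cat; apply/seq.permP => q; congr count; apply: eq_map => i /=.
    by rewrite /e (unsplitK (inl i)).
  by rewrite /e (unsplitK (inr i)).
exists M; split.
- move=> i j; rewrite -(splitK i) -(splitK j) /e unsplitK.
  case: (split i) => i'; case: (split j) => j' /=; rewrite ?block_mxEul ?block_mxEur
    ?block_mxEdl ?block_mxEdr ?mxE ?dhomog0 //; apply: sub_homog; [exact: a1|exact: a2].
- move=> l; rewrite mem_cat => /orP [] /mapP [l' l'L ->] i; rewrite dvalE big_split_ord /=.
    rewrite [X in _ + X]big1 ?addr0 => [|j _]; last by rewrite row_mxEr mxE scale0r.
    rewrite -E1E -sub_lin; rewrite -(splitK i); case: (split i) => i' /=; last first.
      rewrite big1 => [|j _]; first exact: pdvd0.
      by rewrite E1E row_mxEl block_mxEdl mxE scaler0.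
    have := sub_pdvd E1 (b1 l' l'L i'); rewrite dvalE; congr pdvd; rewrite linear_sum.
    by apply: eq_bigr => j _; rewrite E1E row_mxEl block_mxEul mxE linearZ.
  rewrite big1 ?add0r => [|j _]; last by rewrite row_mxEl mxE scale0r.
  rewrite -E2E -sub_lin; rewrite -(splitK i); case: (split i) => i' /=.
    rewrite big1 => [|j _]; first exact: pdvd0.
    by rewrite E2E row_mxEr block_mxEur mxE scaler0.
  have := sub_pdvd E2 (b2 l' l'L i'); rewrite dvalE; congr pdvd; rewrite linear_sum.
  by apply: eq_bigr => j _; rewrite E2E row_mxEr block_mxEdr mxE linearZ.
- rewrite det_ublock mulf_neq0 //.
    rewrite det_map_mx; apply: contra c1 => /eqP h.
    rewrite -[\det M1]sub1; have -> : 1%:M = E1 *m col_mx 1%:M 0 :> 'M[F]_k1.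
      by rewrite mul_row_col mulmx1 mul0mx addr0.
    by rewrite -sub_comp h raddf0.
  rewrite det_map_mx; apply: contra c2 => /eqP h.
  rewrite -[\det M2]sub1; have -> : 1%:M = E2 *m col_mx 0 1%:M :> 'M[F]_k2.
    by rewrite mul_row_col mulmx1 mulmx0 add0r.
  by rewrite -sub_comp h raddf0.
- rewrite size_cat !size_map -d1 -d2 big_split_ord /=; congr (_ + _)%N.
    by apply: eq_bigr => i _; rewrite /e (unsplitK (inl i)).
  by apply: eq_bigr => i _; rewrite /e (unsplitK (inr i)).
Qed.

Lemma free_at_prod x1 x2 es1 es2 es : free_at Phi1 x1 es1 -> free_at Phi2 x2 es2 ->
  perm_eq es (es1 ++ es2) -> free_at prodPhi (col_mx x1 x2) es.
Proof.
move=> [k1 [P1 [L1 [[f1 g1] [a1 b1 c1] F1]]]] [k2 [P2 [L2 [[f2 g2] [a2 b2 c2] F2]]]] pes.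
have := free_exp_prod F1 F2; set L := _ ++ _ => - [e se pe].
exists (k1 + k2)%N, (block_mx P1 0 0 P2), L; split; last first.
- by exists e => //; apply: perm_trans pes pe.
- have rs1 (u v : 'rV[F]_k1) : (row_mx u (0 : 'rV_k2) <= row_mx v 0)%MS = (u <= v)%MS.
    apply/sub_rVP/sub_rVP => -[c h]; exists c.
      by move: h; rewrite scale_row_mx scaler0 => /eq_row_mx [].
    by rewrite h scale_row_mx scaler0.
  have rs2 (u v : 'rV[F]_k2) : (row_mx (0 : 'rV_k1) u <= row_mx 0 v)%MS = (u <= v)%MS.
    apply/sub_rVP/sub_rVP => -[c h]; exists c.
      by move: h; rewrite scale_row_mx scaler0 => /eq_row_mx [].
    by rewrite h scale_row_mx scaler0.
  have rn1 (u : 'rV[F]_k1) : (row_mx u (0 : 'rV_k2) == 0) = (u == 0).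
    by apply/eqP/eqP => [/(congr1 lsubmx)|->]; rewrite ?row_mx0 // row_mxKl linear0.
  have rn2 (u : 'rV[F]_k2) : (row_mx (0 : 'rV_k1) u == 0) = (u == 0).
    by apply/eqP/eqP => [/(congr1 rsubmx)|->]; rewrite ?row_mx0 // row_mxKr linear0.
  have aux1 r1 : row_mx r1 0 *m block_mx P1 0 0 P2 = row_mx (r1 *m P1) 0.
    by rewrite mul_row_block !mul0mx !mulmx0 !addr0.
  have aux2 r2 : row_mx 0 r2 *m block_mx P1 0 0 P2 = row_mx 0 (r2 *m P2).
    by rewrite mul_row_block !mul0mx !mulmx0 !add0r.
  split.
  + apply: arrP.
    * have i1 : injective (fun l : 'rV[F]_k1 => row_mx l (0 : 'rV_k2)).
        by move=> u v /eq_row_mx [].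
      have i2 : injective (fun l : 'rV[F]_k2 => row_mx (0 : 'rV_k1) l).
        by move=> u v /eq_row_mx [].
      rewrite cat_uniq (map_inj_uniq i1) (map_inj_uniq i2) (arr_uniq a1) (arr_uniq a2) andbT /=.
      apply/hasPn => _ /mapP [l2 l2L ->]; apply/negP => /mapP [l1 _ /eq_row_mx [_ l20]].
      by have := arr_neq0 a2 l2L; rewrite l20 eqxx.
    * move=> l; rewrite mem_cat => /orP [] /mapP [l' l'L ->]; rewrite ?rn1 ?rn2.
        exact: arr_neq0 l'L.
      exact: arr_neq0 l'L.
    * move=> u v; rewrite !mem_cat => /orP [] /mapP [u' u'L ->] /orP [] /mapP [v' v'L ->].
      - by rewrite rs1 => h; rewrite (arr_eq a1 u'L v'L h).
      - case/sub_rVP=> c; rewrite scale_row_mx scaler0 => /eq_row_mx [u0 _].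
        by have := arr_neq0 a1 u'L; rewrite u0 eqxx.
      - case/sub_rVP=> c; rewrite scale_row_mx scaler0 => /eq_row_mx [_ u0].
        by have := arr_neq0 a2 u'L; rewrite u0 eqxx.
      - by rewrite rs2 => h; rewrite (arr_eq a2 u'L v'L h).
  + move=> r [[r1 hr ->]|[r2 hr ->]]; rewrite ?aux1 ?aux2.
      have [->|[l lL le]] := b1 r1 hr; first by left; rewrite row_mx0.
      right; exists (row_mx l 0); rewrite ?rs1 // mem_cat; apply/orP; left.
      by apply/mapP; exists l.
    have [->|[l lL le]] := b2 r2 hr; first by left; rewrite row_mx0.
    right; exists (row_mx 0 l); rewrite ?rs2 // mem_cat; apply/orP; right.
    by apply/mapP; exists l.
  + move=> l; rewrite mem_cat => /orP [] /mapP [l' l'L ->].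
      have [r hr le] := c1 l' l'L; exists (row_mx r 0); first by left; exists r.
      by rewrite aux1 rs1.
    have [r hr le] := c2 l' l'L; exists (row_mx 0 r); first by right; exists r.
    by rewrite aux2 rs2.
split.
  have [Q1 Q1P] := row_fullP f1; have [Q2 Q2P] := row_fullP f2.
  apply/row_fullP; exists (block_mx Q1 0 0 Q2).
  rewrite mulmx_block !mul0mx !mulmx0 !addr0 !add0r Q1P Q2P.
  by rewrite -scalar_mx_block.
move=> v; rewrite -[v]vsubmxK in_flat_prod g1 g2; split.
  move=> [[z1 z1E] [z2 z2E]]; exists (col_mx z1 z2).
  by rewrite mul_block_col !mul0mx addr0 add0r z1E z2E.
case=> z; rewrite -[z]vsubmxK mul_block_col !mul0mx addr0 add0r => /eq_col_mx [h1 h2].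
by split; [exists (usubmx z) | exists (dsubmx z)].
Qed.

Lemma sorted_rcons_leq es e :
  sorted leq (rcons es e) = all (fun n => n <= e)%N es && sorted leq es.
Proof. by rewrite !(sorted_pairwise leq_trans) pairwise_rcons. Qed.

(** Induction on the total number of exponents: the factor holding the largest exponent passes to
    its next flat while the other one waits. *)
Lemma chain_prod x1 x2 es1 es2 : chain Phi1 x1 es1 -> chain Phi2 x2 es2 ->
  exists2 es, perm_eq es (es1 ++ es2) & chain prodPhi (col_mx x1 x2) es.
Proof.
move: {2}(size es1 + size es2)%N (leqnn (size es1 + size es2)) => N.
elim: N x1 x2 es1 es2 => [|N IH] x1 x2 es1 es2.
  rewrite leqn0 addn_eq0 => /andP [/nilP -> /nilP ->] c1 c2; exists [::] => //.
  apply: chain_nil => v; rewrite -[v]vsubmxK in_flat_prod => -[h1 h2].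
  by rewrite (chain_nil_inv c1 h1) (chain_nil_inv c2 h2) col_mx0.
move=> sN c1 c2; have f1 := chain_free c1; have f2 := chain_free c2.
have s1 := chain_sorted c1; have s2 := chain_sorted c2.
case: (lastP es1) sN c1 f1 s1 => [|t1 e1] sN c1 f1 s1.
  case: (lastP es2) sN c2 f2 s2 => [|t2 e2] sN c2 f2 s2; first exact: IH.
  have [x' [_ _ xx' cx']] := chain_leaf_max c2.
  have [|es pes ces] := IH x1 x' [::] t2 _ c1 cx'.
    by rewrite size_rcons in sN; move: sN; rewrite !add0n ltnS.
  have pes' : perm_eq (rcons es e2) ([::] ++ rcons t2 e2).
    by apply/seq.permP => q; rewrite -!cats1 !count_cat (seq.permP pes) ?count_cat /=; lia.
  exists (rcons es e2) => //; apply: (chain_rcons _ (free_at_prod f1 f2 pes') _ ces).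
    rewrite sorted_rcons_leq (chain_sorted ces) andbT (perm_all _ pes).
    by move: s2; rewrite sorted_rcons_leq => /andP [].
  by apply/in_flat_prod; split=> //; apply: in_flat_refl.
case: (boolP (all (fun n => n <= e1)%N es2)) => [h|].
  have [x' [_ _ xx' cx']] := chain_leaf_max c1.
  have [|es pes ces] := IH x' x2 t1 es2 _ cx' c2.
    by rewrite size_rcons addSn ltnS in sN.
  have pes' : perm_eq (rcons es e1) (rcons t1 e1 ++ es2).
    by apply/seq.permP => q; rewrite -!cats1 !count_cat (seq.permP pes) -?cats1 !count_cat /=; lia.
  exists (rcons es e1) => //; apply: (chain_rcons _ (free_at_prod f1 f2 pes') _ ces).
    rewrite sorted_rcons_leq (chain_sorted ces) andbT (perm_all _ pes) all_cat h andbT.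
    by move: s1; rewrite sorted_rcons_leq => /andP [].
  by apply/in_flat_prod; split=> //; apply: in_flat_refl.
rewrite -has_predC => /hasP [n nes /=]; rewrite -ltnNge => e1n.
case: (lastP es2) nes sN c2 f2 s2 => [//|t2 e2] nes sN c2 f2 s2.
have ne2 : (n <= e2)%N.
  move: nes; rewrite mem_rcons inE => /predU1P [->//|nt].
  by move: s2; rewrite sorted_rcons_leq => /andP [/allP/(_ n nt)].
have [x' [_ _ xx' cx']] := chain_leaf_max c2.
have [|es pes ces] := IH x1 x' (rcons t1 e1) t2 _ c1 cx'.
  by rewrite [size (rcons t2 e2)]size_rcons addnS ltnS in sN.
have pes' : perm_eq (rcons es e2) (rcons t1 e1 ++ rcons t2 e2).
  by apply/seq.permP => q; rewrite -!cats1 !count_cat (seq.permP pes) -?cats1 !count_cat /=; lia.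
exists (rcons es e2) => //; apply: (chain_rcons _ (free_at_prod f1 f2 pes') _ ces).
  rewrite sorted_rcons_leq (chain_sorted ces) andbT (perm_all _ pes) all_cat.
  apply/andP; split; last by move: s2; rewrite sorted_rcons_leq => /andP [].
  have le12 : (e1 <= e2)%N by apply: leq_trans (ltnW e1n) ne2.
  rewrite all_rcons le12; apply/allP => i it; apply: leq_trans le12.
  by move: s1; rewrite sorted_rcons_leq => /andP [/allP/(_ i it)].
by apply/in_flat_prod; split=> //; apply: in_flat_refl.
Qed.

Lemma hacc_prod : hacc Phi1 -> hacc Phi2 -> hacc prodPhi.
Proof.
move=> h1 h2 x; rewrite -[x]vsubmxK; have [es1 c1] := h1 (usubmx x).
have [es2 c2] := h2 (dsubmx x); have [es _ c] := chain_prod c1 c2; by exists es.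
Qed.

End Product.

End Transport.

(** * Roots of a finite Coxeter group *)

Section Roots.

Variables (F : realFieldType) (n : nat) (a : 'M[F]_n).

Definition refl i (r : 'rV[F]_n) : 'rV[F]_n := r - (r *m a) 0 i *: delta_mx 0 i.

(** The orbit of the simple roots, in coordinates with respect to them. The matrix may be
    nonsymmetric, which leaves room for rescaling simple roots until its entries are integral. *)
Inductive isroot : 'rV[F]_n -> Prop :=
| root_simple i : isroot (delta_mx 0 i)
| root_refl i r : isroot r -> isroot (refl i r).

End Roots.

Definition posdef (F : realFieldType) n (B : 'M[F]_n) : Prop :=
  forall u : 'rV[F]_n, u != 0 -> 0 < (u *m B *m u^T) 0 0.

Lemma posdef_unit (F : realFieldType) n (B : 'M[F]_n) : posdef B -> B \in unitmx.
Proof.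
move=> hB; rewrite -row_free_unit; apply: inj_row_free => v vB.
by apply/eqP; apply: contraT => /hB; rewrite vB mul0mx mxE ltxx.
Qed.

Definition coxmx (R : realType) n (m : 'I_n -> 'I_n -> nat) : 'M[R]_n :=
  \matrix_(i, j) - cos (pi / (m i j)%:R).

Section GroupToRoots.

Variables (R : realType) (W : finGroupType) (n : nat) (s : 'I_n -> W).
Hypothesis sinj : injective s.
Hypothesis s2 : forall i, #[s i]%g = 2%N.
Hypothesis sgen : <<[set s i | i : 'I_n]>>%g = [set: W].
Variable rG : mx_representation R [set: W] n.
Hypothesis hrG : is_reflection_representation s rG.

Let m i j := #[s i * s j]%g.
Let B : 'M[R]_n := coxmx R m.

Lemma gen_sq i : (s i * s i)%g = 1%g.
Proof. by have := expg_order (s i); rewrite s2. Qed.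

Lemma cox_ii i : m i i = 1%N.
Proof. by rewrite /m gen_sq order1. Qed.

Lemma gen_inv i : (s i)^-1%g = s i.
Proof. by apply: (mulgI (s i)); rewrite mulgV gen_sq. Qed.

Lemma cox_sym i j : m i j = m j i.
Proof. by rewrite /m -orderV invMg !gen_inv. Qed.

Lemma cox_ge2 i j : i != j -> (1 < m i j)%N.
Proof.
move=> ne; rewrite ltn_neqAle order_gt0 andbT eq_sym order_eq1.
apply: contra ne => /eqP h; rewrite -(inj_eq sinj); apply/eqP.
by apply: (mulIg (s j)); rewrite h gen_sq.
Qed.

Lemma cos_pi1 : cos (pi / 1%:R) = -1 :> R.
Proof. by rewrite divr1 cospi. Qed.

Lemma coxmx_sym : B^T = B.
Proof. by apply/matrixP => i j; rewrite !mxE cox_sym. Qed.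

Lemma coxmx_ii i : B i i = 1.
Proof. by rewrite mxE cox_ii cos_pi1 opprK. Qed.

Lemma coxeter_formE u v : coxeter_form s u v = (u *m B *m v^T) 0 0 :> R.
Proof.
rewrite /coxeter_form exchange_big /= [RHS]mxE; apply: eq_bigr => j _.
rewrite [(u *m B) 0 j]mxE [v^T _ _]mxE mulr_suml.
by apply: eq_bigr => i _; rewrite [B _ _]mxE mulrAC.
Qed.

Lemma form_sym (u v : 'rV[R]_n) : (u *m B *m v^T) 0 0 = (v *m B *m u^T) 0 0.
Proof.
by rewrite -[LHS]/((u *m B *m v^T) 0 0) -[in LHS](trmxK (u *m B *m v^T)) mxE
  !trmx_mul trmxK coxmx_sym mulmxA.
Qed.

Lemma rG_refl i v : v *m rG (s i) = refl (2 *: B) i v.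
Proof.
have vBi : (v *m B) 0 i = (v *m B *m (delta_mx 0 i : 'rV[R]_n)^T) 0 0.
  by rewrite trmx_delta -colE [RHS]mxE.
rewrite hrG /refl; congr (_ - _ *: _); rewrite -scalemxAr [RHS]mxE; congr (_ * _).
by rewrite vBi coxeter_formE form_sym.
Qed.

(** In a finite group a set containing 1 and closed under products is a subgroup, so inverses need
    no separate case. *)
Lemma group_ind (P : W -> Prop) :
  P 1%g -> (forall i, P (s i)) -> (forall x y, P x -> P y -> P (x * y)%g) -> forall w, P w.
Proof.
move=> P1 Ps PM w.
have gP : group_set [set x | `[< P x >]].
  apply/group_setP; split; first by rewrite inE; apply/asboolP.
  by move=> x y; rewrite !inE => /asboolP Px /asboolP Py; apply/asboolP/PM.
have : (<<[set s i | i : 'I_n]>> \subset Group gP)%g.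
  by rewrite gen_subG; apply/subsetP => _ /imsetP [i _ ->]; rewrite inE; apply/asboolP.
rewrite sgen => /subsetP /(_ w); rewrite !inE => /(_ isT) /asboolP; exact.
Qed.

Lemma rG_gen i : rG (s i) =
  1%:M - (2 *: B *m (delta_mx i 0 : 'cV_n)) *m (delta_mx 0 i : 'rV_n).
Proof.
apply/row_matrixP => j; rewrite rowE rG_refl rowE mulmxBr mulmx1 /refl; congr (_ - _).
rewrite !mulmxA; set u := delta_mx 0 j *m _.
by rewrite -colE; apply/rowP => k; rewrite !mxE big_ord1 !mxE.
Qed.

Lemma B_invariant w : rG w *m B *m (rG w)^T = B.
Proof.
elim/group_ind: w => [|i|x y Hx Hy].
- by rewrite repr_mx1 mul1mx trmx1 mulmx1.
- rewrite rG_gen; set c := _ *m delta_mx i 0; set d : 'rV_n := delta_mx 0 i.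
  have dB : d *m B = 2^-1 *: c^T.
    rewrite /c -scalemxAl linearZ /= scalerA mulVf ?pnatr_eq0 // scale1r.
    by rewrite trmx_mul coxmx_sym trmx_delta.
  have Bd : B *m d^T = 2^-1 *: c.
    by rewrite /c -scalemxAl scalerA mulVf ?pnatr_eq0 // scale1r trmx_delta.
  have dBd : d *m B *m d^T = 1%:M.
    by apply/matrixP => j k; rewrite !ord1 /d trmx_delta -colE -rowE [LHS]mxE [LHS]mxE coxmx_ii mxE eqxx.
  have -> : (1%:M - c *m d)^T = 1%:M - d^T *m c^T by rewrite linearB /= trmx1 trmx_mul.
  rewrite mulmxBl mul1mx mulmxBr mulmx1 mulmxBl (mulmxA B) Bd.
  rewrite -[c *m d *m B]mulmxA dB -scalemxAl -scalemxAr -scalemxAl.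
  have -> : c *m c^T *m (d^T *m c^T) = 2 *: (c *m c^T).
    rewrite -mulmxA (mulmxA c^T) (_ : c^T *m d^T = 2%:M) ?mul_scalar_mx ?scalemxAr //.
    have -> : c^T = 2 *: (d *m B) by rewrite dB scalerA mulfV ?pnatr_eq0 // scale1r.
    by rewrite -scalemxAl dBd scalemx1.
  rewrite scalerA mulVf ?pnatr_eq0 // scale1r; set C := c *m c^T.
  have E (X Y : 'M[R]_n) : X - 2^-1 *: Y - (2^-1 *: Y - Y) = X.
    by apply/matrixP => j k; rewrite !mxE; lra.
  exact: E.
rewrite repr_mxM ?inE // trmx_mul -!mulmxA (mulmxA B) (mulmxA (rG y)).
by rewrite (mulmxA (rG y)) Hy mulmxA.
Qed.

(** The sum [Q] over the group is invariant and positive definite. Invariance under [s i] forces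
    [Q i j = B i j * Q i i], and then by symmetry [Q i i = Q j j] whenever [B i j] is nonzero.
    Scaling each coordinate by the inverse square root of [Q i i] therefore turns [Q] into [B], also
    for a reducible group. *)
Lemma coxmx_posdef : posdef B.
Proof.
pose Q : 'M[R]_n := \sum_(w : W) rG w *m (rG w)^T.
have Qinv g : rG g *m Q *m (rG g)^T = Q.
  rewrite /Q mulmx_sumr mulmx_suml [RHS](reindex_inj (mulgI g)) /=.
  by apply: eq_bigr => w _; rewrite repr_mxM ?inE // trmx_mul !mulmxA.
have Qsym : Q^T = Q.
  by rewrite /Q linear_sum; apply: eq_bigr => w _; rewrite /= trmx_mul trmxK.
have dot (u : 'rV[R]_n) : (u *m u^T) 0 0 = \sum_j u 0 j ^+ 2.
  by rewrite mxE; apply: eq_bigr => j _; rewrite mxE expr2.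
have dot_ge0 (u : 'rV[R]_n) : 0 <= (u *m u^T) 0 0.
  by rewrite dot; apply: sumr_ge0 => j _; apply: sqr_ge0.
have Qpos (u : 'rV[R]_n) : u != 0 -> 0 < (u *m Q *m u^T) 0 0.
  move=> u0; rewrite /Q mulmx_sumr mulmx_suml summxE (bigD1 1%g) //=.
  have tE w : (u *m (rG w *m (rG w)^T) *m u^T) 0 0 =
     ((u *m rG w) *m (u *m rG w)^T) 0 0 by rewrite trmx_mul !mulmxA.
  apply: ltr_pwDl; last by apply: sumr_ge0 => w _; rewrite tE; apply: dot_ge0.
  rewrite tE repr_mx1 mulmx1 lt_neqAle dot_ge0 andbT eq_sym dot psumr_eq0; last first.
    by move=> j _; apply: sqr_ge0.
  apply: contra u0 => /allP h; apply/eqP/rowP => j; rewrite mxE.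
  by have := h j (mem_index_enum _); rewrite sqrf_eq0 => /eqP.
pose q i := Q i i.
have eQ i j : ((delta_mx 0 i : 'rV_n) *m Q *m (delta_mx 0 j : 'rV_n)^T) 0 0 = Q i j.
  by rewrite trmx_delta -colE -rowE [LHS]mxE [LHS]mxE.
have dB i j : ((delta_mx 0 j : 'rV_n) *m (2 *: B)) 0 i = 2 * B j i.
  by rewrite -rowE [LHS]mxE [LHS]mxE.
have Bs i j : B i j = B j i by rewrite -[in LHS]coxmx_sym mxE.
have QE i j : Q i j = B i j * q i.
  have := congr1 (fun X => ((delta_mx 0 i : 'rV_n) *m X *m (delta_mx 0 j : 'rV_n)^T) 0 0) (Qinv (s i)).
  rewrite !mulmxA rG_refl -(mulmxA _ (rG (s i))^T) -trmx_mul rG_refl /refl !dB coxmx_ii.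
  rewrite mulr1 (_ : delta_mx 0 i - 2 *: delta_mx 0 i = - delta_mx 0 i :> 'rV[R]_n); last first.
    by apply/rowP => k; rewrite !mxE; lra.
  rewrite linearB linearZ /= !mulNmx mulmxBr -scalemxAr.
  rewrite [LHS]mxE [X in - X]mxE [X in _ + X]mxE [X in _ - X]mxE !eQ (Bs i j) /q => h.
  by move: h; set x := Q i j; set y := Q i i; set z := B j i => h; lra.
have q_gt0 i : 0 < q i.
  have := Qpos (delta_mx 0 i); rewrite trmx_delta -colE -rowE !mxE; apply.
  by apply/rV0Pn; exists i; rewrite mxE !eqxx oner_neq0.
pose D : 'M[R]_n := diag_mx (\row_i (Num.sqrt (q i))^-1).
have BE : B = D *m Q *m D^T.
  have sq i : Num.sqrt (q i) != 0 by rewrite sqrtr_eq0 -ltNge q_gt0.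
  apply/matrixP => i j; rewrite tr_diag_mx mul_mx_diag [RHS]mxE mul_diag_mx.
  rewrite [X in _ = X * _]mxE [X in _ = X * _ * _]mxE [X in _ = _ * X]mxE.
  have Qji : Q i j = B i j * q j.
    by rewrite -[in LHS]Qsym mxE QE Bs.
  case: (eqVneq (B i j) 0) => [b0|b0]; first by rewrite QE b0 mul0r mulr0 mul0r.
  have -> : q j = q i by apply: (mulfI b0); rewrite -Qji QE.
  have qt : q i = Num.sqrt (q i) * Num.sqrt (q i) by rewrite -expr2 sqr_sqrtr // ltW.
  rewrite QE; move: (sq i) qt; set t := Num.sqrt _ => t0 ->.
  by field.
move=> u u0; rewrite BE !mulmxA -(mulmxA _ D^T) -trmx_mul; apply: Qpos.
apply: contra u0 => /eqP uD; apply/eqP/rowP => j; move/rowP/(_ j): uD.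
rewrite mul_mx_diag !mxE => /eqP; rewrite mulf_eq0 invr_eq0 sqrtr_eq0 leNgt q_gt0 orbF.
by move/eqP.
Qed.

Lemma root_rG r : isroot (2 *: B) r <-> exists w i, r = delta_mx 0 i *m rG w.
Proof.
split=> [|[w [i ->]]].
  elim=> [i|i r' _ [w [j ->]]]; first by exists 1%g, i; rewrite repr_mx1 mulmx1.
  by exists (w * s i)%g, j; rewrite repr_mxM ?inE // mulmxA rG_refl.
have : isroot (2 *: B) (delta_mx 0 i) by apply: root_simple.
move: (delta_mx 0 i) => u; elim/group_ind: w u => [|j|x y Hx Hy] u hu.
- by rewrite repr_mx1 mulmx1.
- by rewrite rG_refl; apply: root_refl.
- by rewrite repr_mxM ?inE // mulmxA; apply: Hy; apply: Hx.
Qed.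

Lemma roots_finite : exists S : seq 'rV[R]_n, forall r, isroot (2 *: B) r -> r \in S.
Proof.
exists [seq delta_mx 0 i *m rG w | i <- enum 'I_n, w <- enum W] => r /root_rG [w [i ->]].
by apply/allpairsP; exists (i, w); rewrite !mem_enum.
Qed.

Lemma reflection_hyperplane i w (v : 'rV[R]_n) :
  (v \in fixedSpace (linfun (mulmxr (rG (s i ^ w)%g)))) =
  (((delta_mx 0 i : 'rV_n) *m rG w) *m B *m v^T == 0).
Proof.
have -> : (v \in fixedSpace (linfun (mulmxr (rG (s i ^ w)%g)))) =
    (v *m rG (s i ^ w)%g == v).
  by apply/fixedSpaceP/eqP; rewrite lfunE.
have wV : rG w *m rG w^-1%g = 1%:M by rewrite -repr_mxM ?inE // mulgV repr_mx1.
have Vw : rG w^-1%g *m rG w = 1%:M by rewrite -repr_mxM ?inE // mulVg repr_mx1.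
rewrite conjgE !repr_mxM ?inE // !mulmxA; set u := v *m rG w^-1%g.
have vE : v = u *m rG w by rewrite -mulmxA Vw mulmx1.
have -> : (u *m rG (s i) *m rG w == v) = (u *m rG (s i) == u).
  apply/eqP/eqP => [h|->]; last by rewrite -vE.
  by rewrite -[LHS]mulmx1 -wV mulmxA h.
rewrite rG_refl /refl -subr_eq0 addrAC subrr add0r oppr_eq0 scaler_eq0.
have d0 : delta_mx 0 i != 0 :> 'rV[R]_n.
  by apply/rV0Pn; exists i; rewrite mxE !eqxx oner_neq0.
rewrite (negPf d0) orbF -scalemxAr mxE mulf_eq0 pnatr_eq0 /=.
have -> : (delta_mx 0 i : 'rV_n) *m rG w *m B *m v^T = delta_mx 0 i *m B *m u^T.
  by rewrite -[in RHS](B_invariant w) vE trmx_mul !mulmxA.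
by rewrite sc0 form_sym trmx_delta -colE [in RHS]mxE.
Qed.

Lemma arrangement_roots H : H \in coxeter_arrangement s rG ->
  exists2 r, isroot (2 *: B) r & forall v, (v \in H) = (r *m B *m v^T == 0).
Proof.
case/mapP => t; rewrite mem_enum => /imset2P [i w _ _ ->] ->.
exists (delta_mx 0 i *m rG w); first by apply/root_rG; exists w, i.
by move=> v; apply: reflection_hyperplane.
Qed.

Lemma roots_arrangement r : isroot (2 *: B) r ->
  exists2 H, H \in coxeter_arrangement s rG & forall v, (v \in H) = (r *m B *m v^T == 0).
Proof.
case/root_rG => w [i ->].
exists (fixedSpace (linfun (mulmxr (rG (s i ^ w)%g)))).
  by apply: map_f; rewrite mem_enum; apply/imset2P; exists i w.
by move=> v; apply: reflection_hyperplane.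
Qed.

End GroupToRoots.

(** * Conjugation into the dominant chamber *)

Section Reflections.

Variables (F : realFieldType) (n : nat) (a : 'M[F]_n).
Hypothesis a2 : forall i, a i i = 2.

Definition smx i : 'M[F]_n := 1%:M - col i a *m (delta_mx 0 i : 'rV_n).

Lemma reflE i r : refl a i r = r *m smx i.
Proof.
rewrite mulmxBr mulmx1 mulmxA /refl; congr (_ - _).
rewrite [r *m _ in RHS]mx11_scalar mul_scalar_mx; congr (_ *: _).
by rewrite !mxE; apply: eq_bigr => k _; rewrite mxE.
Qed.

Lemma smx2 i : smx i *m smx i = 1%:M.
Proof.
rewrite /smx mulmxBl mul1mx mulmxBr mulmx1.
rewrite mulmxA -(mulmxA _ (delta_mx 0 i)) -rowE -mulmxA.
have -> : row i (col i a) = 2%:M.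
  by apply/matrixP => x y; rewrite !ord1 [LHS]mxE [LHS]mxE a2 !mxE eqxx.
by rewrite mul_scalar_mx -scalemxAr opprB scaler_nat mulr2n [X in _ + X]addrAC subrr add0r subrK.
Qed.

Lemma chain_smx i x es : chain (isroot a) (smx i *m x) es -> chain (isroot a) x es.
Proof.
have step r : isroot a r -> exists2 c, c != 0 & isroot a (c *: (r *m smx i)).
  by move=> hr; exists 1; rewrite ?oner_neq0 // scale1r -reflE; apply: root_refl.
exact: (chain_iso (smx2 i) (smx2 i) step step).
Qed.

End Reflections.

Section RootList.

Variables (F : realFieldType) (n : nat) (a : 'M[F]_n) (P : seq 'rV[F]_n).
Hypothesis a2 : forall i, a i i = 2.
Hypothesis P_arr : arr P.
Hypothesis P_simple : forall i, delta_mx 0 i \in P.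
Hypothesis P_root : forall r, r \in P -> isroot a r.
Hypothesis P_ge0 : forall r i, r \in P -> 0 <= r 0 i.
Hypothesis P_refl : forall r i, r \in P -> exists2 u, u \in P & (refl a i r <= u)%MS.

Lemma smx_inj i : injective (fun r : 'rV[F]_n => r *m smx a i).
Proof.
by move=> r r' /= h; rewrite -[r]mulmx1 -(smx2 a2 i) mulmxA h -mulmxA (smx2 a2) mulmx1.
Qed.

Lemma root_rep r : isroot a r -> exists2 u, u \in P & (r <= u)%MS.
Proof.
elim=> [i|i {}r _ [u uP ru]]; first by exists (delta_mx 0 i); rewrite ?P_simple.
have [v vP uv] := P_refl i uP; exists v => //; apply: submx_trans uv.
by rewrite !reflE submxMr.
Qed.

Lemma sub_annihil (r u : 'rV[F]_n) k (X : 'M[F]_(n, k)) :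
  (r <= u)%MS -> u *m X = 0 -> r *m X = 0.
Proof. by case/sub_rVP => c -> h; rewrite -scalemxAl h scaler0. Qed.

Lemma in_flat_list x v :
  (forall r, r \in P -> r *m x = 0 -> r *m v = 0) -> in_flat (isroot a) x v.
Proof.
move=> H r /root_rep [u uP ru].
have [->|r0] := eqVneq r 0; first by rewrite !mul0mx.
move=> rx; apply: (sub_annihil ru); apply: H => //.
by apply: sub_annihil rx; apply: sub_row_sym.
Qed.

Lemma simple_val i (x : 'cV[F]_n) : ((delta_mx 0 i : 'rV_n) *m x) 0 0 = x i 0.
Proof. by rewrite -rowE mxE. Qed.

Lemma mx11_eq0 (A : 'M[F]_1) : (A == 0) = (A 0 0 == 0).
Proof.
apply/eqP/eqP => [->|h]; first by rewrite mxE.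
by apply/matrixP => i j; rewrite !ord1 h mxE.
Qed.

(** At a dominant point the value of a positive root is a sum of nonnegative terms, so it vanishes
    only if each term does: the flat is determined by the zero coordinates of [x]. *)
Lemma in_flat_dominant (x y : 'cV[F]_n) : (forall i, 0 <= x i 0) -> (forall i, x i 0 = 0 -> y i 0 = 0) ->
  in_flat (isroot a) x y.
Proof.
move=> x0 xy; apply: in_flat_list => r rP /eqP; rewrite mx11_eq0 mxE psumr_eq0; last first.
  by move=> i _; rewrite mulr_ge0 ?P_ge0.
move/allP => h; apply/eqP; rewrite mx11_eq0 mxE big1 // => i _.
have /implyP/(_ isT) := h i (mem_index_enum i); rewrite mulf_eq0 => /orP [/eqP ->|/eqP /xy ->].
  by rewrite mul0r.
by rewrite mulr0.
Qed.

Definition npos (x : 'cV[F]_n) := count (fun r : 'rV[F]_n => (r *m x) 0 0 < 0) P.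

(** The reflection [i] permutes the positive roots other than the simple root [i], up to positive
    scalars. The roots negative at the reflected point thus correspond to roots negative at [x]
    other than this simple root, which is itself negative at [x]. *)
Lemma npos_lt i (x : 'cV[F]_n) : x i 0 < 0 -> (npos (smx a i *m x) < npos x)%N.
Proof.
move=> xi; pose e : 'rV[F]_n := delta_mx 0 i.
have e0 : e != 0 by apply: (arr_neq0 P_arr); apply: P_simple.
have [s hs] : exists s : 'rV[F]_n -> 'rV[F]_n, forall r, r \in P ->
    s r \in P /\ (refl a i r <= s r)%MS.
  have /choice [s hs] : forall r, exists u, r \in P -> u \in P /\ (refl a i r <= u)%MS.
    move=> r; case: (boolP (r \in P)) => [rP|_]; last by exists 0.
    by have [u uP ru] := P_refl i rP; exists u.
  by exists s.
pose neg (x : 'cV[F]_n) (r : 'rV[F]_n) := (r *m x) 0 0 < 0.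
have eN : e *m smx a i = - e.
  by rewrite -reflE /refl /e -rowE mxE a2 scaler_nat mulr2n opprD addrA subrr sub0r.
have smx_neq0 r : r \in P -> r *m smx a i != 0.
  move=> rP; apply: contraNneq (arr_neq0 P_arr rP) => h.
  by apply/eqP/(@smx_inj i); rewrite /= h mul0mx.
have se r : r \in P -> r != e -> s r != e.
  move=> rP; apply: contraNneq => sr; have [_] := hs r rP; rewrite sr reflE => h.
  apply/eqP/(arr_eq P_arr rP (P_simple i)).
  have : (r *m smx a i *m smx a i <= e *m smx a i)%MS by rewrite submxMr.
  rewrite -mulmxA (smx2 a2) mulmx1 => /submx_trans; apply.
  by rewrite eN (eqmx_opp e).
have spos r : r \in P -> r != e -> neg (smx a i *m x) r -> neg x (s r).
  move=> rP re; rewrite /neg mulmxA -reflE; have [sP /sub_rVP [c cE]] := hs r rP.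
  rewrite cE -scalemxAl mxE.
  (* A positive root other than the simple root has a further positive coordinate, which the
     reflection leaves unchanged. *)
  have c_gt0 : 0 < c.
    have [j ji rj] : exists2 j, j != i & r 0 j != 0.
      apply: contra_neqP re => h; apply: (arr_eq P_arr rP (P_simple i)).
      apply/sub_rVP; exists (r 0 i); apply/rowP => j; rewrite !mxE eqxx /=.
      have [->|ne] := eqVneq j i; first by rewrite mulr1.
      rewrite mulr0; apply/eqP; apply: contraPT h => rj H.
      by apply: H; exists j.
    have : refl a i r 0 j = r 0 j by rewrite !mxE (negPf ji) andbF mulr0 subr0.
    rewrite cE mxE => cs; have r_gt0 : 0 < r 0 j by rewrite lt_neqAle eq_sym rj P_ge0.
    by rewrite -cs in r_gt0; move: r_gt0; rewrite pmulr_lgt0 // lt_neqAle P_ge0 // andbT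
       eq_sym; apply: contraNneq rj => h; rewrite -cs h mulr0.
  by rewrite pmulr_rlt0.
have uP := arr_uniq P_arr.
rewrite /npos -!size_filter; set A := filter _ P; set B := filter _ P.
have eB : e \in B by rewrite mem_filter P_simple simple_val xi.
have A_e r : r \in A -> [/\ r \in P, r != e & neg (smx a i *m x) r].
  rewrite mem_filter => /andP [nr rP]; split=> //; apply: contraTneq nr => ->.
  by rewrite mulmxA eN mulNmx mxE simple_val -leNgt oppr_ge0 ltW.
rewrite -(size_map s) (perm_size (perm_to_rem eB)) /= ltnS.
apply: uniq_leq_size.
  rewrite map_inj_in_uniq ?filter_uniq // => r r' /A_e [rP _ _] /A_e [rP' _ _] ss.
  have [sP h] := hs r rP; have [_ h'] := hs r' rP'; rewrite -ss in h'.
  apply: (arr_eq P_arr rP rP').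
  have : (refl a i r <= refl a i r')%MS.
    by apply: submx_trans h _; apply: sub_row_sym h'; rewrite reflE smx_neq0.
  rewrite !reflE => /(submxMr (smx a i)); rewrite -!mulmxA (smx2 a2) !mulmx1 //.
move=> u /mapP [r /A_e [rP re nr] ->]; have [sP _] := hs r rP.
by rewrite (mem_rem_uniq) ?filter_uniq // inE se //= mem_filter sP andbT; apply: spos.
Qed.

Lemma hacc_dominant :
  (forall x : 'cV[F]_n, (forall i, 0 <= x i 0) -> exists es, chain (isroot a) x es) -> hacc (isroot a).
Proof.
move=> H x; elim: {x}(npos x) {-2}x (leqnn (npos x)) => [|N IH] x hx.
  apply: H => i; rewrite leNgt; apply/negP => /npos_lt; lia.
have [/forallP h|] := boolP [forall i, 0 <= x i 0]; first exact: H.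
case/forallPn => i; rewrite -ltNge => xi; have [|es c] := IH (smx a i *m x).
  by have := npos_lt xi; lia.
by exists es; apply: chain_smx c.
Qed.

End RootList.

Lemma eqn_ord n (i : 'I_n) m (h : (m < n)%N) : ((i : nat) == m) = (i == Ordinal h).
Proof. by []. Qed.

Lemma hyper_ker (F : realFieldType) m k (E : 'M[F]_(m, k)) (u : 'rV[F]_m) (v : 'cV[F]_m) :
  hyper E u -> u *m v = 0 <-> exists z, v = E *m z.
Proof.
move=> [_ hE]; have uE : u *m E = 0 by apply/eqP; rewrite hE.
split=> [uv|[z ->]]; last by rewrite mulmxA uE mul0mx.
suff /submxP [D vD] : (v^T <= E^T)%MS.
  by exists D^T; rewrite -[v]trmxK vD trmx_mul trmxK.
rewrite submxE; set C := cokermx _.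
have CE : C^T *m E = 0 by apply: trmx_inj; rewrite trmx_mul trmxK mulmx_coker trmx0.
have /submxP [D CD] : (C^T <= u)%MS.
  by apply/row_subP => i; rewrite -hE -row_mul CE row0.
by rewrite -[v^T *m C]trmxK trmx_mul trmxK CD -mulmxA uv mulmx0 trmx0.
Qed.

Lemma size_reps T (o : cops T) s : (size (reps o s) <= size s)%N.
Proof. by elim: s => [|v s IH] //=; case: ifP => _ //=; apply: leq_trans IH _. Qed.

Lemma reps_id T (o : cops T) s : size s = size (reps o s) -> reps o s = s.
Proof.
elim: s => [|v s IH] //=; case: ifP => _ /= h; last by case: h => /IH ->.
by have := size_reps o s; rewrite -h ltnn.
Qed.

(** * Exceptional types *)

Section RunTop.

Variables (T : Type) (o : cops T) (F : realFieldType) (inj : T -> F).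
Hypothesis hinj : cspec o inj.

Lemma run_free m L c ix es : all (fun u => size u == m) L -> arr (rowsT o inj m L) ->
  run o m L c [::] (nseq m 0%N) = Some (ix, es) ->
  [/\ uniq ix, all (fun i => i < size L)%N ix & free_exp (pick_rows o inj m L ix) es].
Proof. by move=> sL aL R; apply: run_sound R => //; apply: free_exp0. Qed.

Lemma perm_pick m (L : seq (seq T)) ix : uniq ix -> all (fun i => i < size L)%N ix ->
  size ix = size L -> perm_eq (pick_rows o inj m L ix) (rowsT o inj m L).
Proof.
move=> uix lix six; have -> : rowsT o inj m L = pick_rows o inj m L (iota 0 (size L)).
  by rewrite -pick_rowsE -/(mkseq _ _) mkseq_nth.
apply: perm_map; apply: uniq_perm => //; first exact: iota_uniq.
apply: (uniq_min_size uix _ _).2; last by rewrite size_iota six.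
by move=> i /(allP lix); rewrite mem_iota.
Qed.

Lemma run_full m L c ix es : all (fun u => size u == m) L -> arr (rowsT o inj m L) ->
  run o m L c [::] (nseq m 0%N) = Some (ix, es) -> size ix = size L ->
  free_exp (rowsT o inj m L) es.
Proof.
by move=> sL aL /(run_free sL aL) [u l f] s; apply: free_exp_perm f; apply: perm_pick.
Qed.

(** The converse use of a single step: a certificate for hyperplanes other than number [i] yields
    the freeness of their restriction to hyperplane [i], with the exponent [d] removed. *)
Lemma run_hyper m L c ix es i : (0 < m)%N -> all (fun u => size u == m) L ->
  arr (rowsT o inj m L) -> run o m L c [::] (nseq m 0%N) = Some (ix, es) ->
  (i < size L)%N -> i \notin ix ->
  let A := [seq nth [::] L j | j <- ix] in
  let L' := reps o (mapr o (nth [::] L i) A) in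
  let d := (size A - size L')%N in
  d \in es -> (count (fun n => d < n)%N es <= 1)%N ->
  exists E : 'M[F]_(m, m.-1),
  [/\ hyper E (rowT o inj m (nth [::] L i)),
      restr_to (fun b => b \in pick_rows o inj m L ix) E (rowsT o inj m.-1 L') &
      free_exp (rowsT o inj m.-1 L') (rem d es)].
Proof.
case: m => // k _ sL aL R iL nix A L' d des cnt; have [uix lix fr] := run_free sL aL R.
have [E [sR hE hA hR]] := single_setup hinj sL aL uix lix iL nix.
exists E; split=> //.
have hd : (size (pick_rows o inj k.+1 L ix) = d + size (rowsT o inj k L'))%N.
  have := restr_size_leq hE hA hR; rewrite !size_map => h.
  by rewrite /d /A size_map subnK.
have [|_ f2] := add_single fr hE hA hR hd; first by left.
by apply: f2; rewrite perm_sym perm_to_rem.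
Qed.

End RunTop.

Section Table.

Variables (T : Type) (o : cops T) (tnonneg : T -> bool).
Variables (n : nat) (cart : seq (seq T)).

Fixpoint ldot (u v : seq T) : T :=
  match u, v with
  | x :: u', y :: v' => tadd o (tmul o x y) (ldot u' v')
  | _, _ => tzero o
  end.

Fixpoint upd (i : nat) (f : T -> T) (v : seq T) : seq T :=
  if v is x :: v' then (if i is i'.+1 then x :: upd i' f v' else f x :: v') else [::].

Definition lrefl i (r : seq T) : seq T :=
  let c := ldot r (nth [::] cart i) in upd i (fun x => tsub o x c) r.

Fixpoint axpy (c : T) (u v : seq T) : seq T :=
  match u, v with
  | x :: u', y :: v' => tsub o x (tmul o c y) :: axpy c u' v'
  | _, _ => [::]
  end.

(** Simple reflections act on points by the same matrices as on roots, but from the left. *)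
Definition lpoint i (y : seq T) : seq T :=
  axpy (nth (tzero o) y i) y (nth [::] cart i).

Definition lbasis i : seq T := mkseq (fun j => if i == j then tone o else tzero o) n.

(** The pair [(k, i)] appends the image of root number [k] under reflection [i], so that every
    member of the list is a root by construction. *)
Fixpoint build (gens : seq (nat * nat)) (P : seq (seq T)) : seq (seq T) :=
  if gens is (k, i) :: gens' then
    if (k < size P)%N then build gens' (rcons P (lrefl i (nth [::] P k))) else P
  else P.

Definition lroots gens := build gens (mkseq lbasis n).

Definition lmask (K : seq nat) : seq T :=
  mkseq (fun j => if j \in K then tone o else tzero o) n.

(** More than the 120 positive roots of E8: each reflection made by [anti] lowers the number of
    positive roots that are positive at the point. *)
Definition anti_fuel := 200%N.

(** Reflects at simple roots of [J] while a coordinate in [J] is positive; from a dominant point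
    this amounts to the longest element of the parabolic subgroup of [J]. Every intermediate point
    is conjugate to [y], so correctness is independent of where the loop stops. *)
Fixpoint anti fuel (J : seq nat) (y : seq T) : seq T :=
  if fuel is fuel'.+1 then
    let p i := let c := nth (tzero o) y i in
       if teq0 o c then false else tnonneg c in
    if filter p J is i :: _ then anti fuel' J (lpoint i y) else y
  else y.

Definition pick_cols (K : seq nat) (v : seq T) : seq T := [seq nth (tzero o) v j | j <- K].

(** On the flat where the coordinates outside [K] vanish, a form restricts to its entries in [K]. *)
Definition lrestr (P : seq (seq T)) (K : seq nat) :=
  reps o (filter (fun v => ~~ vec0 o v) (map (pick_cols K) P)).

Inductive entry :=
| Ecert of seq nat & cert & seq nat (* flat, certificate for its restriction, next flat *)
| Ehyp of nat & cert & seq nat (* omitted coordinate; certificate for all roots but one *)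
| Econj of seq nat & nat. (* flat conjugate to a previous one by the longest element of a parabolic subgroup *)

Definition state := seq (seq nat * seq nat).

Fixpoint lookup (st : state) (K : seq nat) : option (seq nat) :=
  if st is (K', es) :: st' then (if K == K' then Some es else lookup st' K) else None.

(** Registers the flat [K] if its largest exponent is the only one missing from the flat [K'] inside
    it, which must have been registered before. *)
Definition extend (st : state) (K es K' : seq nat) : option state :=
  if lookup st K' is Some es' then
    let es1 := sort leq es in
    if (subseq K' K && (es1 == rcons es' (last 0%N es1)))%N then Some ((K, es1) :: st) else None
  else None.

(** In the case [Econj], the longest element of the parabolic subgroup generated by [i] and the
    stabilizer of the flat carries that stabilizer to another standard parabolic subgroup. So [y]
    vanishes on the same roots as the dominant point with support [K']; this is tested rather than
    proved. *)
Definition step (P : seq (seq T)) (st : state) (e : entry) : option state :=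
  match e with
  | Ecert K c K' =>
    let L := lrestr P K in
    if subseq K (iota 0 n) then
      if run o (size K) L c [::] (nseq (size K) 0%N) is Some (ix, es) then
        if size ix == size L then extend st K es K' else None
      else None
    else None
  | Ehyp i c K' =>
    if run o n P c [::] (nseq n 0%N) is Some (ix, es) then
      let A := [seq nth [::] P j | j <- ix] in
      let d := (size A - size (reps o (mapr o (nth [::] P i) A)))%N in
      if [&& (size ix).+1 == size P, i \notin ix, (i < n)%N, d \in es &
          (count (fun n => d < n)%N es <= 1)%N]
      then extend st (rem i (iota 0 n)) (rem d es) K' else None
    else None
  | Econj K i =>
    if (i < n)%N then
      let y := anti anti_fuel (i :: [seq j <- iota 0 n | j \notin K]) (lmask K) in
      let K' := [seq j <- iota 0 n | ~~ teq0 o (nth (tzero o) y j)] in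
      let x' := lmask K' in
      if all (fun r => teq0 o (ldot r y) == teq0 o (ldot r x')) P then
        if lookup st K' is Some es then Some ((K, es) :: st) else None
      else None
    else None
  end.

Fixpoint steps P st es : option state :=
  if es is e :: es' then (if step P st e is Some st' then steps P st' es' else None)
  else Some st.

Fixpoint subs (s : seq nat) : seq (seq nat) :=
  if s is x :: s' then let r := subs s' in map (cons x) r ++ r else [:: [::]].

(** The equality of sizes says that no two members are proportional; the last clause is stability
    under the simple reflections up to scalars. *)
Definition roots_ok (P : seq (seq T)) : bool :=
  [&& all (fun r => ~~ vec0 o r) P, size P == size (reps o P), all (all tnonneg) P &
      all (fun r => all (fun i => has_prop o (lrefl i r) P) (iota 0 n)) P].

(** The state starts with the zero flat alone, and in the end every subset of the coordinates must
    have been reached, since these subsets are the supports of dominant points. *)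
Definition table_ok gens es : bool :=
  let P := lroots gens in
  if [&& (0 < n)%N, all (fun p => p.2 < n)%N gens & roots_ok P] then
    if steps P [:: ([::], [::])] es is Some st then
      all (fun K => lookup st K != None) (subs (iota 0 n))
    else false
  else false.

Definition cart_ok : bool :=
  [&& all (fun c => size c == n) cart, size cart == n &
      all (fun i => teq0 o (tsub o (nth (tzero o) (nth [::] cart i) i) (tadd o (tone o) (tone o))))
        (iota 0 n)].

Variables (F : realFieldType) (inj : T -> F).
Hypothesis hinj : cspec o inj.
Hypothesis inj_ge0 : forall x, tnonneg x -> 0 <= inj x.
Hypothesis cart_size : all (fun c => size c == n) cart.
Hypothesis cart_n : size cart = n.

(** The lists are the columns: reflection [i] pairs a root with list number [i]. *)
Definition cartmx : 'M[F]_n := \matrix_(j, i) inj (nth (tzero o) (nth [::] cart i) j).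

Local Notation rw := (rowT o inj).
Local Notation a := cartmx.

Lemma ldotE (u v : seq T) : size u = n -> size v = n ->
  inj (ldot u v) = (rw n u *m (rw n v)^T) 0 0.
Proof.
move=> su sv; rewrite mxE; under eq_bigr do rewrite !mxE.
rewrite -{}su in sv *; rewrite -(big_mkord xpredT (fun i => inj (nth (tzero o) u i) * inj (nth (tzero o) v i))).
elim: u v sv => [|x u IH] [|y v] //= => [_|[suv]]; first by rewrite big_nil (inj0 hinj).
by rewrite big_nat_recl //= (injD hinj) (injM hinj) IH.
Qed.

Lemma size_upd i f v : size (upd i f v) = size v.
Proof. by elim: v i => [|x v IH] [|i] //=; rewrite IH. Qed.

Lemma nth_upd i f v j : (i < size v)%N ->
  nth (tzero o) (upd i f v) j = if i == j then f (nth (tzero o) v j) else nth (tzero o) v j.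
Proof. by elim: v i j => [|x v IH] [|i] [|j] //=; rewrite ltnS eqSS; apply: IH. Qed.

Lemma lreflE (i : 'I_n) r : size r = n -> size (lrefl i r) = n /\
  rw n (lrefl i r) = refl a i (rw n r).
Proof.
move=> sr; split; first by rewrite size_upd.
have sc : size (nth [::] cart i) = n by rewrite (size_nth_eq cart_size) ?cart_n.
apply/rowP => j; rewrite [LHS]mxE nth_upd ?sr // /refl.
have -> : (rw n r *m a) 0 i = inj (ldot r (nth [::] cart i)).
  by rewrite ldotE // !mxE; apply: eq_bigr => k _; rewrite !mxE.
rewrite !mxE eqxx /= -[j == i]/(nat_of_ord j == nat_of_ord i) [nat_of_ord j == _]eq_sym.
by case: eqP => _; rewrite ?(injB hinj) ?mulr1 ?mulr0 ?subr0.
Qed.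

Lemma lpointE (i : 'I_n) y : size y = n -> size (lpoint i y) = n /\
  (rw n (lpoint i y))^T = smx a i *m (rw n y)^T.
Proof.
move=> sy; have sc : size (nth [::] cart i) = n by rewrite (size_nth_eq cart_size) ?cart_n.
have sa c u v : size u = size v -> size (axpy c u v) = size u /\ forall j, (j < size u)%N ->
    inj (nth (tzero o) (axpy c u v) j) =
    inj (nth (tzero o) u j) - inj c * inj (nth (tzero o) v j).
  elim: u v => [|x u IH] [|z v] //= [/IH [-> h]]; split=> // -[_|j] /=.
    by rewrite (injB hinj) (injM hinj).
  exact: h.
have [s1 s2] := sa (nth (tzero o) y i) y (nth [::] cart i) (etrans sy (esym sc)).
split; first by rewrite s1.
apply/colP => j; rewrite [LHS]mxE [LHS]mxE s2 ?sy // /smx mulmxBl mul1mx -mulmxA -rowE.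
by rewrite !mxE big_ord1 !mxE mulrC.
Qed.

Lemma lbasisE (i : 'I_n) : size (lbasis i) = n /\ rw n (lbasis i) = delta_mx 0 i.
Proof.
split; first by rewrite size_mkseq.
apply/rowP => j; rewrite !mxE nth_mkseq // eqxx /= -(inj_eq val_inj) /= eq_sym.
by case: eqP => _; rewrite ?(inj0 hinj) ?(inj1 hinj).
Qed.

Lemma buildP gens P : all (fun p => p.2 < n)%N gens ->
  all (fun u => size u == n) P ->
  (forall r, r \in rowsT o inj n P -> isroot a r) ->
  exists Q, [/\ build gens P = P ++ Q, all (fun u => size u == n) (P ++ Q) &
     forall r, r \in rowsT o inj n (P ++ Q) -> isroot a r].
Proof.
elim: gens P => [|[k i] gens IH] P /=; first by exists [::]; rewrite cats0.
case/andP => ltin hg sP rP; case: ifP => kP; last by exists [::]; rewrite cats0.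
have [s1 s2] := @lreflE (Ordinal ltin) _ (size_nth_eq sP kP).
have [||Q [h1 h2 h3]] := IH (rcons P (lrefl i (nth [::] P k))) hg.
- by rewrite all_rcons s1 eqxx.
- move=> r; rewrite /rowsT map_rcons mem_rcons inE => /predU1P [->|/rP //].
  by rewrite s2; apply: root_refl; apply: rP; rewrite nth_rowsT // mem_nth // size_map.
by exists (lrefl i (nth [::] P k) :: Q); rewrite h1 -cat_rcons.
Qed.

Hypothesis a2 : forall i, a i i = 2.

Section Flats.

Variable P : seq (seq T).
Hypothesis P_size : all (fun u => size u == n) P.
Hypothesis P_basis : forall i, (i < n)%N -> nth [::] P i = lbasis i /\ (i < size P)%N.
Hypothesis P_root : forall r, r \in rowsT o inj n P -> isroot a r.
Hypothesis P_ok : roots_ok P.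

Local Notation RP := (rowsT o inj n P).

Lemma P_row k : (k < size P)%N -> rw n (nth [::] P k) \in RP.
Proof. by move=> kP; rewrite (nth_rowsT o inj) // mem_nth // size_map. Qed.

Lemma P_rowP r : r \in RP -> exists2 k, (k < size P)%N & r = rw n (nth [::] P k).
Proof.
case/(nthP 0) => k; rewrite size_map => kP <-; exists k => //.
by rewrite nth_rowsT.
Qed.

Lemma P_neq0 : all (fun u => rw n u != 0) P.
Proof.
by rewrite -(all_map (rw n) (fun r => r != 0)) -(vec0_all hinj P_size); case/and4P: P_ok.
Qed.

Lemma P_arr : arr RP.
Proof.
have [_ h _ _] := reps_spec hinj P_size P_neq0.
by case/and4P: P_ok => _ /eqP /reps_id hP _ _; rewrite hP in h.
Qed.

Lemma P_simple i : delta_mx 0 i \in RP.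
Proof.
have [pE pl] := P_basis (ltn_ord i); have [_ <-] := lbasisE i.
by rewrite -pE P_row.
Qed.

Lemma P_ge0 r i : r \in RP -> 0 <= r 0 i.
Proof.
case/P_rowP => k kP ->; rewrite mxE; apply: inj_ge0.
case/and4P: P_ok => _ _ /(all_nthP [::]) /(_ k kP) /(all_nthP (tzero o)) h _.
by apply: h; rewrite (size_nth_eq P_size).
Qed.

Lemma P_refl r i : r \in RP -> exists2 u, u \in RP & (refl a i r <= u)%MS.
Proof.
case/P_rowP => k kP ->; have sk := size_nth_eq P_size kP.
have [sl <-] := lreflE i sk.
have : has_prop o (lrefl i (nth [::] P k)) P.
  case/and4P: P_ok => _ _ _ h; have := all_nthP [::] h k kP.
  by move/allP/(_ (val i)); apply; rewrite mem_iota /= add0n.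
by rewrite (has_propP hinj sl P_size P_neq0) has_rowsT => /hasP [u uP ru]; exists u.
Qed.

Local Notation flat_dom := (in_flat_dominant P_simple P_ge0 P_refl).

Definition pt (y : seq T) : 'cV[F]_n := (rw n y)^T.

Lemma lmaskE K (i : 'I_n) : pt (lmask K) i 0 = ((i : nat) \in K)%:R.
Proof.
by rewrite !mxE nth_mkseq //; case: (_ \in K); rewrite ?(inj0 hinj) ?(inj1 hinj).
Qed.

Lemma lmask_ge0 K i : 0 <= pt (lmask K) i 0.
Proof. by rewrite lmaskE ler0n. Qed.

Lemma in_flat_lmask K v :
  in_flat (isroot a) (pt (lmask K)) v <-> forall i : 'I_n, (i : nat) \notin K -> v i 0 = 0.
Proof.
split=> [h i iK|h].
  have := h (delta_mx 0 i) (root_simple a i); rewrite -!rowE => H.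
  have /H/rowP/(_ 0) : row i (pt (lmask K)) = 0.
    by apply/rowP => z; rewrite !ord1 row0E lmaskE (negPf iK) mxE.
  by rewrite row0E mxE.
apply: flat_dom => [i|i]; first exact: lmask_ge0.
by rewrite lmaskE => /eqP; rewrite pnatr_eq0 eqb0 => /h.
Qed.

Definition proved (st : state) := forall K es, lookup st K = Some es ->
  chain (isroot a) (pt (lmask K)) es.

Lemma proved_cons st K es : chain (isroot a) (pt (lmask K)) es -> proved st ->
  proved ((K, es) :: st).
Proof. by move=> c h K' es' /=; case: eqP => [-> [<-]|_ /h]. Qed.

Lemma free_at_perm x es es' : perm_eq es es' -> free_at (isroot a) x es ->
  free_at (isroot a) x es'.
Proof.
move=> p [k [Q [L [h1 h2 [e se pe]]]]]; exists k, Q, L; split=> //.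
by exists e => //; apply: perm_trans pe; rewrite perm_sym.
Qed.

Lemma extendP st K es K' st' : proved st -> free_at (isroot a) (pt (lmask K)) es ->
  extend st K es K' = Some st' -> proved st'.
Proof.
move=> hst fK; rewrite /extend; case l: lookup => [es'|] //; case: ifP => // /andP [sK /eqP E].
case=> <-; apply: proved_cons => //.
have so : sorted leq (sort leq es) by apply: sort_sorted; apply: leq_total.
rewrite E in so *; apply: (chain_rcons so _ _ (hst _ _ l)).
  by rewrite -E; apply: free_at_perm fK; rewrite perm_sym perm_sort.
by apply/in_flat_lmask => i iK; rewrite lmaskE;
  case: (boolP (_ \in K')) => // /(mem_subseq sK) h; rewrite h in iK.
Qed.

Lemma restr_isroot k (E : 'M[F]_(n, k)) L (B : 'rV[F]_n -> Prop) :
  restr_to B E L -> (forall r, B r -> isroot a r) ->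
  (forall r, r \in RP -> r *m E = 0 \/ B r) -> restr_to (isroot a) E L.
Proof.
move=> [aL h1 h2] hB hP; split=> // [r hr|l lL]; last first.
  by have [r /hB hr lr] := h2 l lL; exists r.
have [u uP ru] := root_rep P_simple P_refl hr.
case: (hP u uP) => [uE|/h1 [uE|[l lL ul]]].
- by left; apply: sub_annihil ru uE.
- by left; apply: sub_annihil ru uE.
- by right; exists l => //; apply: submx_trans ul; apply: submxMr.
Qed.

Lemma Ecert_free K c ix es : subseq K (iota 0 n) ->
  run o (size K) (lrestr P K) c [::] (nseq (size K) 0%N) = Some (ix, es) ->
  size ix = size (lrestr P K) -> free_at (isroot a) (pt (lmask K)) es.
Proof.
move=> sK R sL; set k := size K in R *.
have uK : uniq K := subseq_uniq sK (iota_uniq 0 n).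
have ltK j : (j < k)%N -> (nth 0%N K j < n)%N.
  by move=> jk; have := mem_subseq sK (mem_nth 0%N jk); rewrite mem_iota.
pose E : 'M[F]_(n, k) := \matrix_(i, j) ((i : nat) == nth 0%N K j)%:R.
have EE v : size v = n -> rw k (pick_cols K v) = rw n v *m E.
  move=> sv; apply/rowP => j; rewrite !mxE (nth_map 0%N) //.
  rewrite (bigD1 (Ordinal (ltK j (ltn_ord j)))) //= !mxE eqxx mulr1 big1 ?addr0 // => i ne.
  by rewrite [E _ _]mxE (eqn_ord _ (ltK j (ltn_ord j))) (negPf ne) mulr0.
have E1 : E^T *m E = 1%:M.
  apply/matrixP => j j'; rewrite !mxE (bigD1 (Ordinal (ltK j (ltn_ord j)))) //= big1 => [|i ne].
    by rewrite !mxE /= eqxx mul1r addr0 nth_uniq.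
  by rewrite !mxE (eqn_ord _ (ltK j (ltn_ord j))) (negPf ne) mul0r.
pose Q := filter (fun v => ~~ vec0 o v) (map (pick_cols K) P).
have sQ0 : all (fun u => size u == k) (map (pick_cols K) P).
  by rewrite all_map; apply/allT => v /=; rewrite size_map.
have sQ : all (fun u => size u == k) Q.
  by rewrite all_filter; apply: sub_all sQ0 => v /= ->; rewrite implybT.
have Q0 : all (fun u => rw k u != 0) Q.
  rewrite -(all_map (rw k) (fun r => r != 0)) -(vec0_all hinj sQ); exact: filter_all.
have [h1 h2 h3 h4] := reps_spec hinj sQ Q0.
have mQ r : r \in rowsT o inj k Q <-> r != 0 /\ exists2 u, u \in RP & r = u *m E.
  suff -> : rowsT o inj k Q = [seq u <- [seq u *m E | u <- RP] | u != 0].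
    rewrite mem_filter; split=> [/andP [r0 /mapP [u uP rE]]|[r0 [u uP rE]]].
      by split=> //; exists u.
    by rewrite r0; apply/mapP; exists u.
  rewrite /Q; elim: (P) P_size => [|u P' IH] //= /andP [/eqP su /IH {}IH].
  rewrite (vec0E hinj (m := k)) ?size_map // EE //.
  by case: eqP => _; rewrite /= IH // EE.
exists k, E, (rowsT o inj k (lrestr P K)); split.
- split; first by apply/row_fullP; exists E^T.
  move=> v; rewrite in_flat_lmask; split=> [h|[z ->] i iK]; last first.
    rewrite mxE big1 // => j _; rewrite mxE (_ : (_ == _) = false) ?mul0r //.
    by apply: contraNF iK => /eqP ->; apply: mem_nth.
  exists (E^T *m v); apply/colP => i; rewrite mxE.
  case: (boolP ((i : nat) \in K)) => [iK|iK]; last first.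
    rewrite h // big1 // => j _; rewrite mxE (_ : (_ == _) = false) ?mul0r //.
    by apply: contraNF iK => /eqP ->; apply: mem_nth.
  have jk : (index (i : nat) K < k)%N by rewrite index_mem.
  rewrite (bigD1 (Ordinal jk)) //= big1 ?addr0 => [|j ne].
    rewrite mxE /= nth_index // eqxx mul1r mxE (bigD1 i) //= big1 ?addr0 => [|i' ne].
      by rewrite !mxE /= nth_index // eqxx mul1r.
    by rewrite !mxE /= nth_index // (eqn_ord i' (ltn_ord i)) (_ : (_ == _) = false) ?mul0r //;
       apply: contraNF ne => /eqP ->; apply/eqP/val_inj.
  rewrite mxE (_ : (_ == _) = false) ?mul0r //; apply: contraNF ne => /eqP iE.
  by apply/eqP/val_inj; rewrite /= iE index_uniq.
- split=> // [r hr|l /h3 /mQ [_ [u uP ->]]]; last by exists u; rewrite ?submx_refl //; apply: P_root.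
  have [u uP ru] := root_rep P_simple P_refl hr.
  have [uE|uE] := eqVneq (u *m E) 0; first by left; apply: sub_annihil ru uE.
  have [|l lL ul] := h4 (u *m E); first by apply/mQ; split=> //; exists u.
  by right; exists l => //; apply: submx_trans ul; apply: submxMr.
- exact: run_full h1 h2 R sL.
Qed.

Lemma Ehyp_free i c ix es : (0 < n)%N -> (i < n)%N ->
  run o n P c [::] (nseq n 0%N) = Some (ix, es) ->
  let A := [seq nth [::] P j | j <- ix] in
  let d := (size A - size (reps o (mapr o (nth [::] P i) A)))%N in
  (size ix).+1 = size P -> i \notin ix -> d \in es ->
  (count (fun n => d < n)%N es <= 1)%N ->
  free_at (isroot a) (pt (lmask (rem i (iota 0 n)))) (rem d es).
Proof.
move=> n0 lti R A d six nix des cnt; have [uix lix _] := run_free hinj P_size P_arr R.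
have [iE iP] := P_basis lti.
have [E [hE hR fR]] := run_hyper hinj n0 P_size P_arr R iP nix des cnt.
have [_ eE] := lbasisE (Ordinal lti); rewrite /= in eE.
rewrite iE eE in hE.
exists n.-1, E, (rowsT o inj n.-1 (reps o (mapr o (nth [::] P i) A))); split=> //.
  split; first by case: hE.
  move=> v; rewrite in_flat_lmask -(hyper_ker v hE) -rowE; split=> [h|h j].
    by apply/rowP => z; rewrite !ord1 row0E mxE h // (mem_rem_uniq _ (iota_uniq 0 n)) !inE eqxx.
  rewrite (mem_rem_uniq _ (iota_uniq 0 n)) inE mem_iota /= add0n ltn_ord andbT negbK.
  by move=> /eqP ji; have := congr1 (fun r : 'rV_1 => r 0 0) h; rewrite row0E mxE => <-;
     congr (v _ 0); apply: val_inj.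
apply: (restr_isroot hR) => [r /mapP [j /(allP lix) jP ->]|r /P_rowP [k kP ->]].
  by apply: P_root; apply: P_row.
have [->|ki] := eqVneq k i.
  by left; apply/eqP; rewrite iE eE; case: hE => _ ->.
right; apply/mapP; exists k => //.
(* [ix] has one element less than the list of roots and misses [i], so it contains all the other
   positions. *)
have : perm_eq (i :: ix) (iota 0 (size P)).
  apply: uniq_perm; rewrite ?iota_uniq //= ?nix //.
  apply: (uniq_min_size _ _ _).2; rewrite /= ?nix ?size_iota ?six // => j.
  by rewrite inE mem_iota => /predU1P [->|/(allP lix)].
by move/perm_mem/(_ k); rewrite inE (negPf ki) /= mem_iota => ->.
Qed.

Lemma antiP fuel J y es : all (fun i => i < n)%N J -> size y = n ->
  size (anti fuel J y) = n /\
  (chain (isroot a) (pt (anti fuel J y)) es -> chain (isroot a) (pt y) es).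
Proof.
move=> /allP hJ; elim: fuel y => [|f IH] y sy //=; case E: filter => [|i s] //.
have lti : (i < n)%N.
  by apply: hJ; have := mem_head i s; rewrite -E mem_filter => /andP [].
have [s1 s2] := @lpointE (Ordinal lti) _ sy; have [s3 h] := IH _ s1.
by split=> // /h; rewrite /pt s2; apply: chain_smx.
Qed.

Arguments anti : simpl never.

Lemma stepP st e st' : (0 < n)%N -> proved st -> step P st e = Some st' -> proved st'.
Proof.
move=> n0 hst; case: e => [K c K'|i c K'|K i] /=.
- case: ifP => // sK; case R: run => [[ix es]|] //; case: eqP => // six.
  by apply: extendP hst _; apply: Ecert_free R six.
- case R: run => [[ix es]|] //; case: ifP => // /and5P [/eqP six nix lti des cnt].
  by apply: extendP hst _; apply: Ehyp_free R _ _ _ _.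
- case: ifP => // lti; set J := i :: _; set y := anti _ _ _; set K' := filter _ _.
  case: ifP => // hy; case l: lookup => [es|] // [<-]; apply: proved_cons => //.
  have hJ : all (fun i => i < n)%N J.
    rewrite /= lti; apply/allP => j; rewrite mem_filter mem_iota add0n.
    by case/and3P.
  have [sy h] := antiP anti_fuel es hJ (size_mkseq _ _ : size (lmask K) = n).
  apply: h; rewrite -/y in sy *.
  have dotP k z : (k < size P)%N -> size z = n ->
      (rw n (nth [::] P k) *m pt z == 0) = teq0 o (ldot (nth [::] P k) z).
    by move=> kP sz; rewrite mx11_eq0 (inj_eq0 hinj) ldotE // (size_nth_eq P_size).
  have sm : size (lmask K') = n by rewrite size_mkseq.
  have hk k : (k < size P)%N -> (rw n (nth [::] P k) *m pt y == 0) =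
      (rw n (nth [::] P k) *m pt (lmask K') == 0).
    by move=> kP; rewrite !dotP //; apply/eqP; apply: (all_nthP [::] hy).
  apply: chain_ext (hst _ _ l); apply: (in_flat_list P_simple P_refl) => r /P_rowP [k kP ->] /eqP.
    by rewrite -hk // => /eqP.
  by rewrite hk // => /eqP.
Qed.

Lemma stepsP st es st' : (0 < n)%N -> proved st -> steps P st es = Some st' -> proved st'.
Proof.
move=> n0; elim: es st => [|e es IH] st hst /=; first by case=> <-.
by case E: step => [st1|] //; apply: IH; apply: stepP E.
Qed.

End Flats.

Lemma subs_filter (p : pred nat) s : filter p s \in subs s.
Proof.
elim: s => [|x s IH] //=; rewrite mem_cat; case: (p x); last by rewrite IH orbT.
by rewrite map_f.
Qed.

(** Every point can be moved to a dominant one, whose flat is that of the point with entries 0 and 1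
    and the same support. *)
Lemma table_sound gens es : table_ok gens es -> hacc (isroot a).
Proof.
rewrite /table_ok; case: ifP => // /and3P [n0 hg hP]; case R: steps => [st|] // /allP tab.
have [|r|Q [PE sP rP]] := @buildP gens (mkseq lbasis n) hg.
- by apply/(all_nthP [::]) => i; rewrite size_mkseq => lti; rewrite nth_mkseq // size_mkseq.
- case/(nthP 0) => i; rewrite size_map size_mkseq => lti <-.
  rewrite (nth_map [::]) ?size_mkseq // nth_mkseq //.
  have [_ ->] := lbasisE (Ordinal lti); exact: root_simple.
rewrite -/(lroots gens) in PE; rewrite -PE in sP rP.
have bP i : (i < n)%N -> nth [::] (lroots gens) i = lbasis i /\ (i < size (lroots gens))%N.
  move=> lti; rewrite PE nth_cat size_cat size_mkseq lti nth_mkseq //; split=> //.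
  exact: ltn_addr.
have simp := P_simple bP; have ge0 := P_ge0 sP hP; have hr := P_refl sP hP.
have pst : proved st.
  apply: (stepsP sP bP rP hP n0 _ R) => K es' /=; case: eqP => [-> [<-]|] //.
  apply: chain_nil => v /(in_flat_lmask sP bP hP) h; apply/colP => i.
  by rewrite h // mxE.
apply: (hacc_dominant a2 (P_arr sP hP) simp ge0 hr) => x x0.
pose p j := if insub j is Some i then x i 0 != 0 else false.
have pE (i : 'I_n) : p i = (x i 0 != 0) by rewrite /p valK.
have KE (i : 'I_n) : ((i : nat) \in filter p (iota 0 n)) = (x i 0 != 0).
  by rewrite mem_filter pE mem_iota add0n /= ltn_ord andbT.
have := tab _ (subs_filter p (iota 0 n)); case l: lookup => [es'|] // _.
exists es'; apply: chain_ext (pst _ _ l); apply: (in_flat_dominant simp ge0 hr) => // i.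
- by rewrite lmaskE ler0n.
- by rewrite lmaskE KE; case: eqP => // _ /eqP; rewrite oner_eq0.
- by rewrite lmaskE KE => ->; rewrite eqxx.
Qed.

End Table.

Lemma table_hacc T (o : cops T) (tnonneg : T -> bool) n (cart : seq (seq T)) gens es
    (F : realFieldType) (inj : T -> F) :
  cspec o inj -> (forall x, tnonneg x -> 0 <= inj x) -> cart_ok o n cart ->
  table_ok o tnonneg n cart gens es -> hacc (isroot (cartmx o n cart inj)).
Proof.
move=> hinj h0 /and3P [h1 /eqP h2 /allP h3]; apply: (table_sound hinj) => // i.
have := h3 (val i); rewrite mem_iota /= add0n ltn_ord => /(_ isT).
by rewrite (inj_eq0 hinj) (injB hinj) (injD hinj) (inj1 hinj) subr_eq0 mxE => /eqP.
Qed.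

(** * Exact coefficients *)

Definition zops : cops BinNums.Z :=
  Cops BinNums.Z0 (BinNums.Zpos BinNums.xH) BinInt.Z.add BinInt.Z.sub BinInt.Z.mul (BinInt.Z.eqb BinNums.Z0).

Definition zinj (F : realFieldType) (z : BinNums.Z) : F := (int_of_Z z)%:~R.

Lemma zinjD (F : realFieldType) x y : zinj F (BinInt.Z.add x y) = zinj F x + zinj F y.
Proof. by rewrite /zinj -rmorphD -(rmorphD int_of_Z). Qed.

Lemma zinjB (F : realFieldType) x y : zinj F (BinInt.Z.sub x y) = zinj F x - zinj F y.
Proof. by rewrite /zinj -rmorphB -(rmorphB int_of_Z). Qed.

Lemma zinjM (F : realFieldType) x y : zinj F (BinInt.Z.mul x y) = zinj F x * zinj F y.
Proof. by rewrite /zinj -rmorphM -(rmorphM int_of_Z). Qed.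

Lemma zinj_eq0 (F : realFieldType) x : BinInt.Z.eqb BinNums.Z0 x = (zinj F x == 0).
Proof.
rewrite /zinj intr_eq0; apply/idP/eqP => [/BinInt.Z.eqb_eq <- //|h].
by apply/BinInt.Z.eqb_eq; rewrite -[x]int_of_ZK h.
Qed.

Lemma zinj_ge0 (F : realFieldType) x : BinInt.Z.leb BinNums.Z0 x -> 0 <= zinj F x.
Proof. by rewrite /zinj ler0z; case: x. Qed.

Lemma zspec (F : realFieldType) : cspec zops (zinj F).
Proof.
split=> //; [exact: zinjD|exact: zinjB|exact: zinjM|exact: zinj_eq0].
Qed.

(** Pairs [(a, b)] stand for [a + b phi] with [phi ^ 2 = phi + 1]. *)
Definition gops : cops (BinNums.Z * BinNums.Z) :=
  Cops (BinNums.Z0, BinNums.Z0) (BinNums.Zpos BinNums.xH, BinNums.Z0)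
    (fun x y => (BinInt.Z.add x.1 y.1, BinInt.Z.add x.2 y.2)) (fun x y => (BinInt.Z.sub x.1 y.1, BinInt.Z.sub x.2 y.2))
    (fun x y => (BinInt.Z.add (BinInt.Z.mul x.1 y.1) (BinInt.Z.mul x.2 y.2),
       BinInt.Z.add (BinInt.Z.add (BinInt.Z.mul x.1 y.2) (BinInt.Z.mul x.2 y.1)) (BinInt.Z.mul x.2 y.2)))
    (fun x => if BinInt.Z.eqb BinNums.Z0 x.1 then BinInt.Z.eqb BinNums.Z0 x.2 else false).

Definition z2 := BinNums.Zpos (BinNums.xO BinNums.xH).
Definition z1n := BinNums.Zneg BinNums.xH.
Definition z2n := BinNums.Zneg (BinNums.xO BinNums.xH).

(** For nonzero [b] the exponent of 5 would be even on the left and odd on the right. *)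
Lemma sqrt5_irrational (a b : nat) : (a * a = 5 * (b * b))%N -> b = 0%N.
Proof.
case: (posnP b) => // b0 E; have := congr1 (fun n => odd (logn 5 n)) E.
have a0 : (0 < a)%N by case: a E => // E; nia.
by rewrite !lognM ?muln_gt0 ?b0 // (logn_prime 5 (isT : prime 5)) /= !oddD !addbb.
Qed.

Section Golden.

Variables (F : realFieldType) (phi : F).
Hypothesis phi2 : phi ^+ 2 = phi + 1.
Hypothesis phi_ge0 : 0 <= phi.

Definition ginj (x : BinNums.Z * BinNums.Z) : F := zinj F x.1 + zinj F x.2 * phi.

(** Since [2 phi - 1] squares to 5, a relation [a + b phi = 0] gives [(2 a + b) ^ 2 = 5 b ^ 2], and
    irrationality of the square root of 5 yields [b = 0]. *)
Lemma ginj_eq0 x : teq0 gops x = (ginj x == 0).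
Proof.
rewrite /ginj; case: x => a b; rewrite [(a, b).1]/= [(a, b).2]/=.
have -> : teq0 gops (a, b) = (zinj F a == 0) && (zinj F b == 0) by rewrite -!zinj_eq0.
apply/andP/eqP => [[/eqP -> /eqP ->]|h]; first by rewrite mul0r addr0.
suff b0 : zinj F b = 0.
  by move: h; rewrite b0 mul0r addr0 => ->; rewrite eqxx.
pose x := int_of_Z a; pose y := int_of_Z b.
have E : (2 * zinj F a + zinj F b) ^+ 2 = 5 * zinj F b ^+ 2.
  have -> : zinj F a = - (zinj F b * phi) by apply/eqP; rewrite -addr_eq0 h.
  have -> : (2 * - (zinj F b * phi) + zinj F b) ^+ 2 =
     zinj F b ^+ 2 * (4 * phi ^+ 2 - 4 * phi + 1) by ring.
  by rewrite phi2; ring.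
have {}E : (2 * x + y) ^+ 2 = 5 * y ^+ 2.
  by apply: (@intr_inj F); rewrite /= !expr2 !rmorphM rmorphD rmorphM -!expr2.
have := @sqrt5_irrational (absz (2 * x + y)) (absz y).
rewrite -!abszM -!expr2 E !abszM => /(_ erefl) /eqP; rewrite absz_eq0 /y => /eqP y0.
by rewrite /zinj y0.
Qed.

Lemma ginjD x y : ginj (tadd gops x y) = ginj x + ginj y.
Proof. by rewrite /ginj [in LHS]/= !zinjD; ring. Qed.

Lemma ginjB x y : ginj (tsub gops x y) = ginj x - ginj y.
Proof. by rewrite /ginj [in LHS]/= !zinjB; ring. Qed.

Lemma ginjM x y : ginj (tmul gops x y) = ginj x * ginj y.
Proof.
rewrite /ginj [in LHS]/= !(zinjD, zinjM) [RHS](_ : _ = zinj F x.1 * zinj F y.1 +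
  zinj F x.2 * zinj F y.2 * phi ^+ 2 +
  (zinj F x.1 * zinj F y.2 + zinj F x.2 * zinj F y.1) * phi); last by ring.
by rewrite phi2; ring.
Qed.

Lemma gspec : cspec gops ginj.
Proof.
split; [by rewrite /ginj mul0r addr0|by rewrite /ginj mul0r addr0|..].
- exact: ginjD.
- exact: ginjB.
- exact: ginjM.
- exact: ginj_eq0.
Qed.

(** Sufficient for nonnegativity but not necessary; the listed positive roots of types H3 and H4
    have coordinates of this kind. *)
Definition gnonneg (x : BinNums.Z * BinNums.Z) : bool := if BinInt.Z.leb BinNums.Z0 x.1 then BinInt.Z.leb BinNums.Z0 x.2 else false.

Lemma ginj_ge0 x : gnonneg x -> 0 <= ginj x.
Proof.
rewrite /gnonneg; case: ifP => // /(zinj_ge0 F) h1 /(zinj_ge0 F) h2.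
by rewrite addr_ge0 // mulr_ge0.
Qed.

End Golden.

(* Diagrams, roots and certificates of the exceptional types *)
Declare Scope code_scope.
Delimit Scope code_scope with code.
Number Notation BinNums.N BinNat.N.of_num_uint BinNat.N.to_num_uint : code_scope.

Fixpoint bits (p : BinNums.positive) : bitseq :=
  match p with
  | BinNums.xH => [::]
  | BinNums.xO q => false :: bits q
  | BinNums.xI q => true :: bits q
  end.

Fixpoint bytes (s : bitseq) : seq nat :=
  if s is [:: b0, b1, b2, b3, b4, b5, b6, b7 & s'] then
    foldr (fun (b : bool) v => (b + v.*2)%N) 0%N [:: b0; b1; b2; b3; b4; b5; b6; b7] :: bytes s'
  else [::].

(* Prefix code of a certificate: [j < 120] adds the single form [j], [120 + k] adds the block of
   the next [k] forms, [130 + j] adds [j] after the certificate read next, [120] ends. *)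
Fixpoint read_cert fuel (s : seq nat) : cert * seq nat :=
  if fuel is f.+1 then
    if s is v :: s' then
      if (v < 120)%N then let: (c, r) := read_cert f s' in (Csgl v Cnil c, r)
      else if (v == 120)%N then (Cnil, s')
      else if (v < 130)%N then
        let: (c, r) := read_cert f (drop (v - 120)%N s') in (Cblk (take (v - 120)%N s') c, r)
      else let: (c', r') := read_cert f s' in
        let: (c, r) := read_cert f r' in (Csgl (v - 130)%N c' c, r)
    else (Cnil, [::])
  else (Cnil, [::]).

(* The codes are the bytes of the numbers, least significant first, below a leading digit 1. *)
Definition cert_of (s : seq BinNums.N) : cert :=
  let c := flatten [seq if x is BinNums.Npos p then bytes (bits p) else [::] | x <- s] in
  (read_cert (size c) c).1.

(** The symmetric entry at the double bond would be minus the square root of 2. Rescaling the simple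
    roots on one side of the bond by this root makes the two entries -1 and -2. *)
Definition cart_F4 : seq (seq BinNums.Z) :=
  [:: [:: z2; z1n; BinNums.Z0; BinNums.Z0]; [:: z1n; z2; z1n; BinNums.Z0]; [:: BinNums.Z0; z2n; z2;
   z1n]; [:: BinNums.Z0; BinNums.Z0; z1n; z2]].

Definition gens_F4 : seq (nat * nat) :=
  [:: (0, 1); (1, 2); (2, 1); (2, 3); (4, 2); (5, 3); (6, 0); (6, 3); (8, 1); (8, 3); (10, 3); (11,
   2); (12, 3); (14, 2); (16, 2); (17, 1); (18, 1); (19, 2); (20, 0); (21, 3)]%N.

Definition table_F4 : seq entry :=
  [:: Ecert [:: 3] (cert_of [:: 0x100]%code) [::];
      Ecert [:: 2] (cert_of [:: 0x100]%code) [::];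
      Ecert [:: 1] (cert_of [:: 0x100]%code) [::];
      Ecert [:: 0] (cert_of [:: 0x100]%code) [::];
      Ecert [:: 2; 3] (cert_of [:: 0x10105030002047a]%code) [:: 3];
      Ecert [:: 1; 3] (cert_of [:: 0x10105030002047a]%code) [:: 3];
      Econj [:: 1; 2] 2;
      Econj [:: 0; 2] 0;
      Ecert [:: 0; 3] (cert_of [:: 0x1030100027a]%code) [:: 3];
      Ecert [:: 0; 1] (cert_of [:: 0x10105030002047a]%code) [:: 1];
      Ecert [:: 1; 2; 3] (cert_of [:: 0x1010c00067a03047a02077a09057a080a0b7b]%code) [:: 2; 3];
      Econj [:: 0; 2; 3] 0;
      Ecert [:: 0; 1; 3] (cert_of [:: 0x1060509027a030a7a070b7a01087a040c007b]%code) [:: 1; 3];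
      Econj [:: 0; 1; 2] 2;
      Ecert [:: 0; 1; 2; 3] (cert_of [::
   0x11100060b010f7a140e7a050a137b0d15097b0c04177b0312087b161002077c]%code) [:: 1; 2; 3]]%N.

(** The entry [(BinNums.Z0, z1n)] is [- phi], that is [- 2 cos (pi / 5)]. *)
Definition cart_H3 : seq (seq (BinNums.Z * BinNums.Z)) :=
  [:: [:: (z2, BinNums.Z0); (BinNums.Z0, z1n); (BinNums.Z0, BinNums.Z0)]; [:: (BinNums.Z0, z1n);
   (z2, BinNums.Z0); (z1n, BinNums.Z0)]; [:: (BinNums.Z0, BinNums.Z0); (z1n, BinNums.Z0); (z2,
   BinNums.Z0)]].

Definition gens_H3 : seq (nat * nat) :=
  [:: (0, 1); (1, 0); (1, 2); (3, 0); (3, 2); (4, 2); (6, 2); (8, 1); (9, 1); (10, 0); (11, 0);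
   (13, 1)]%N.

Definition table_H3 : seq entry :=
  [:: Ecert [:: 2] (cert_of [:: 0x100]%code) [::];
      Ecert [:: 1] (cert_of [:: 0x100]%code) [::];
      Ecert [:: 0] (cert_of [:: 0x100]%code) [::];
      Ecert [:: 1; 2] (cert_of [:: 0x10105030002047a]%code) [:: 2];
      Econj [:: 0; 2] 0;
      Econj [:: 0; 1] 1;
      Ecert [:: 0; 1; 2] (cert_of [:: 0x105060004070c7a08027a030d7a0e0b7a090a017b]%code) [:: 1;
   2]]%N.

Definition cart_H4 : seq (seq (BinNums.Z * BinNums.Z)) :=
  [:: [:: (z2, BinNums.Z0); (BinNums.Z0, z1n); (BinNums.Z0, BinNums.Z0); (BinNums.Z0, BinNums.Z0)];
   [:: (BinNums.Z0, z1n); (z2, BinNums.Z0); (z1n, BinNums.Z0); (BinNums.Z0, BinNums.Z0)]; [::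
   (BinNums.Z0, BinNums.Z0); (z1n, BinNums.Z0); (z2, BinNums.Z0); (z1n, BinNums.Z0)]; [::
   (BinNums.Z0, BinNums.Z0); (BinNums.Z0, BinNums.Z0); (z1n, BinNums.Z0); (z2, BinNums.Z0)]].

Definition gens_H4 : seq (nat * nat) :=
  [:: (0, 1); (1, 0); (1, 2); (2, 3); (4, 0); (4, 2); (5, 2); (6, 3); (8, 2); (9, 3); (10, 1); (10,
   3); (12, 1); (12, 3); (14, 0); (14, 3); (16, 0); (16, 3); (18, 3); (19, 2); (20, 1); (20, 3);
   (21, 2); (22, 2); (24, 3); (25, 2); (27, 1); (28, 2); (29, 1); (30, 0); (31, 1); (32, 0); (33,
   1); (34, 0); (35, 1); (36, 2); (37, 1); (38, 2); (39, 3); (40, 0); (40, 2); (41, 3); (43, 2);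
   (44, 3); (46, 1); (46, 3); (48, 0); (48, 3); (50, 3); (51, 2); (52, 2); (54, 1); (55, 0); (56,
   1); (57, 2); (58, 3)]%N.

Definition table_H4 : seq entry :=
  [:: Ecert [:: 3] (cert_of [:: 0x100]%code) [::];
      Ecert [:: 2] (cert_of [:: 0x100]%code) [::];
      Ecert [:: 1] (cert_of [:: 0x100]%code) [::];
      Ecert [:: 0] (cert_of [:: 0x100]%code) [::];
      Ecert [:: 2; 3] (cert_of [:: 0x1090305040001020608077a]%code) [:: 3];
      Ecert [:: 1; 3] (cert_of [:: 0x1000a03050b070402080609017a]%code) [:: 3];
      Econj [:: 1; 2] 2;
      Econj [:: 0; 2] 0;
      Ecert [:: 0; 3] (cert_of [:: 0x1000a03050b070402080609017a]%code) [:: 3];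
      Econj [:: 0; 1] 1;
      Ecert [:: 1; 2; 3] (cert_of [::
   0x117010a0c1e10131c08157a001b7a19097a14077a1105040f7a031d7a0e1a7a0b027a160d7a1806127b]%code) [::
   1; 3];
      Econj [:: 0; 2; 3] 0;
      Econj [:: 0; 1; 3] 1;
      Econj [:: 0; 1; 2] 2;
      Ecert [:: 0; 1; 2; 3] (cert_of [::
   0x1b2121d780a057a010c7a08027a00047a0306097b9036233300341b7a3a13257b20352a7b2216037b02173b1a7c;
   0x10c7baa21321e78010b0703050610007a020a7a080c7a0e0d097b89780d0f060b7a04037a00010a097a08100c7b;
   0x101117a0c09080b0f13020a7a12077a10047a050d0e7b8e780203041112077a13057a0e0b7a0a017a0f097a1008;
   0x17a0a127a0c0f017b9b0878150b0a100e0500147a0806010d7a07117a0c127a13047a0309027bad11277803067a;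
   0x17a15387a390f7a26107a2f247a2c0d7a0b097a14067a78000313050d087a0e0906047a151116077a02147a100b;
   0x118010531291c04372e1f2d0a]%code) [:: 1; 2; 3]]%N.

Definition cart_E6 : seq (seq BinNums.Z) :=
  [:: [:: z2; BinNums.Z0; BinNums.Z0; z1n; BinNums.Z0; BinNums.Z0]; [:: BinNums.Z0; z2; z1n;
   BinNums.Z0; BinNums.Z0; BinNums.Z0]; [:: BinNums.Z0; z1n; z2; z1n; BinNums.Z0; BinNums.Z0]; [::
   z1n; BinNums.Z0; z1n; z2; z1n; BinNums.Z0]; [:: BinNums.Z0; BinNums.Z0; BinNums.Z0; z1n; z2;
   z1n]; [:: BinNums.Z0; BinNums.Z0; BinNums.Z0; BinNums.Z0; z1n; z2]].

Definition gens_E6 : seq (nat * nat) :=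
  [:: (0, 3); (1, 2); (2, 3); (3, 4); (4, 5); (6, 2); (6, 4); (7, 3); (8, 4); (9, 5); (11, 1); (11,
   4); (12, 5); (13, 4); (14, 5); (16, 4); (17, 3); (17, 5); (19, 5); (21, 3); (21, 5); (22, 5);
   (25, 2); (25, 5); (27, 4); (28, 5); (29, 4); (31, 4); (33, 3); (34, 0)]%N.

(** In codimension one, the entry [Ehyp] builds the arrangement without hyperplane number 0 and
    obtains the restriction to it from the last addition; the other hyperplanes among the standard
    flats are conjugate to this one. Types E7 and E8 proceed likewise. *)
Definition table_E6 : seq entry :=
  [:: Ecert [:: 5] (cert_of [:: 0x100]%code) [::];
      Econj [:: 1] 1;
      Ecert [:: 4] (cert_of [:: 0x100]%code) [::];
      Econj [:: 2] 2;
      Ecert [:: 3] (cert_of [:: 0x100]%code) [::];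
      Ecert [:: 0] (cert_of [:: 0x100]%code) [::];
      Ecert [:: 4; 5] (cert_of [:: 0x1030100027a]%code) [:: 5];
      Econj [:: 0; 5] 0;
      Econj [:: 0; 1] 1;
      Econj [:: 1; 2] 2;
      Ecert [:: 3; 5] (cert_of [:: 0x104030001027a]%code) [:: 5];
      Econj [:: 3; 4] 4;
      Econj [:: 2; 4] 2;
      Econj [:: 2; 3] 3;
      Econj [:: 1; 3] 1;
      Ecert [:: 2; 5] (cert_of [:: 0x1030100027a]%code) [:: 5];
      Econj [:: 0; 2] 0;
      Econj [:: 0; 4] 4;
      Econj [:: 1; 4] 1;
      Ecert [:: 1; 5] (cert_of [:: 0x10102007a]%code) [:: 5];
      Ecert [:: 0; 3] (cert_of [:: 0x10105030002047a]%code) [:: 3];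
      Ecert [:: 3; 4; 5] (cert_of [:: 0x10109027a07067a03087a0500047b]%code) [:: 3; 5];
      Econj [:: 2; 4; 5] 2;
      Econj [:: 0; 2; 5] 0;
      Econj [:: 0; 3; 5] 3;
      Econj [:: 0; 2; 3] 3;
      Econj [:: 0; 3; 4] 4;
      Econj [:: 0; 1; 3] 1;
      Econj [:: 0; 1; 4] 1;
      Econj [:: 1; 2; 4] 2;
      Econj [:: 1; 2; 3] 3;
      Ecert [:: 2; 3; 5] (cert_of [:: 0x10801097a04077a06057a0003027b]%code) [:: 3; 5];
      Econj [:: 1; 3; 5] 1;
      Econj [:: 2; 3; 4] 4;
      Econj [:: 1; 3; 4] 4;
      Econj [:: 0; 2; 4] 0;
      Ecert [:: 1; 4; 5] (cert_of [:: 0x10600017a07027a0403057b]%code) [:: 4; 5];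
      Econj [:: 0; 4; 5] 0;
      Econj [:: 0; 1; 5] 1;
      Econj [:: 0; 1; 2] 2;
      Econj [:: 1; 2; 5] 5;
      Ecert [:: 2; 3; 4; 5] (cert_of [:: 0x1100d0c0f7a0b010e7b00090a7b0406087b030705027c]%code) [::
   3; 4; 5];
      Econj [:: 1; 3; 4; 5] 1;
      Econj [:: 0; 2; 4; 5] 0;
      Econj [:: 0; 2; 3; 5] 3;
      Econj [:: 0; 1; 3; 5] 1;
      Econj [:: 0; 2; 3; 4] 4;
      Econj [:: 0; 1; 3; 4] 4;
      Econj [:: 0; 1; 2; 4] 2;
      Econj [:: 1; 2; 3; 4] 3;
      Econj [:: 1; 2; 3; 5] 5;
      Ecert [:: 1; 2; 4; 5] (cert_of [::
   0x10c78000809057a04027a0703067b8b020d017a0003057b070a047b0b0e08067c]%code) [:: 2; 4; 5];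
      Econj [:: 0; 1; 4; 5] 0;
      Econj [:: 0; 1; 2; 5] 0;
      Econj [:: 0; 3; 4; 5] 3;
      Econj [:: 0; 1; 2; 3] 3;
      Ehyp 0 (cert_of [::
   0x1231a15177a1011127b0b030c7b210906087c1f200f0e0d7d1c1d1e14137d07191b0a187d0201160504227e]%code)
   [:: 2; 3; 4; 5];
      Econj [:: 0; 1; 2; 4; 5] 0;
      Econj [:: 0; 1; 3; 4; 5] 3;
      Econj [:: 0; 1; 2; 3; 5] 3;
      Econj [:: 0; 2; 3; 4; 5] 2;
      Econj [:: 0; 1; 2; 3; 4] 4;
      Ecert [:: 0; 1; 2; 3; 4; 5] (cert_of [::
   0x1051f1d1a1b7a1817047b1412097b230f0c0e7c22100a11137d210d0b16157d20070806197d1e010203001c7e]%code)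
   [:: 1; 2; 3; 4; 5]]%N.

Definition cart_E7 : seq (seq BinNums.Z) :=
  [:: [:: z2; BinNums.Z0; BinNums.Z0; z1n; BinNums.Z0; BinNums.Z0; BinNums.Z0]; [:: BinNums.Z0; z2;
   z1n; BinNums.Z0; BinNums.Z0; BinNums.Z0; BinNums.Z0]; [:: BinNums.Z0; z1n; z2; z1n; BinNums.Z0;
   BinNums.Z0; BinNums.Z0]; [:: z1n; BinNums.Z0; z1n; z2; z1n; BinNums.Z0; BinNums.Z0]; [::
   BinNums.Z0; BinNums.Z0; BinNums.Z0; z1n; z2; z1n; BinNums.Z0]; [:: BinNums.Z0; BinNums.Z0;
   BinNums.Z0; BinNums.Z0; z1n; z2; z1n]; [:: BinNums.Z0; BinNums.Z0; BinNums.Z0; BinNums.Z0;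
   BinNums.Z0; z1n; z2]].

Definition gens_E7 : seq (nat * nat) :=
  [:: (0, 3); (1, 2); (2, 3); (3, 4); (4, 5); (5, 6); (7, 2); (7, 4); (8, 3); (9, 4); (10, 5); (11,
   6); (13, 1); (13, 4); (14, 5); (15, 4); (16, 5); (17, 6); (19, 4); (20, 3); (20, 5); (21, 6);
   (22, 5); (23, 6); (25, 3); (25, 5); (26, 5); (27, 6); (29, 6); (31, 2); (31, 5); (32, 6); (33,
   4); (33, 6); (36, 5); (37, 4); (37, 6); (39, 6); (41, 4); (41, 6); (42, 6); (44, 5); (45, 3);
   (45, 6); (47, 5); (49, 0); (49, 6); (50, 5); (52, 6); (53, 5); (55, 5); (56, 4); (57, 4); (59,
   3); (60, 2); (61, 1)]%N.

Definition table_E7 : seq entry :=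
  [:: Ecert [:: 6] (cert_of [:: 0x100]%code) [::];
      Ecert [:: 5] (cert_of [:: 0x100]%code) [::];
      Ecert [:: 4] (cert_of [:: 0x100]%code) [::];
      Ecert [:: 3] (cert_of [:: 0x100]%code) [::];
      Ecert [:: 2] (cert_of [:: 0x100]%code) [::];
      Ecert [:: 1] (cert_of [:: 0x100]%code) [::];
      Ecert [:: 0] (cert_of [:: 0x100]%code) [::];
      Ecert [:: 5; 6] (cert_of [:: 0x1030100027a]%code) [:: 6];
      Econj [:: 1; 6] 1;
      Ecert [:: 4; 6] (cert_of [:: 0x104030001027a]%code) [:: 6];
      Econj [:: 2; 6] 2;
      Econj [:: 4; 5] 5;
      Econj [:: 0; 2] 0;
      Econj [:: 0; 5] 0;
      Ecert [:: 3; 6] (cert_of [:: 0x10105030002047a]%code) [:: 6];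
      Econj [:: 3; 4] 4;
      Econj [:: 2; 4] 2;
      Ecert [:: 3; 5] (cert_of [:: 0x10105030002047a]%code) [:: 5];
      Ecert [:: 2; 5] (cert_of [:: 0x10105030002047a]%code) [:: 5];
      Econj [:: 2; 3] 3;
      Econj [:: 1; 3] 1;
      Ecert [:: 1; 5] (cert_of [:: 0x1030100027a]%code) [:: 5];
      Ecert [:: 1; 4] (cert_of [:: 0x10105030002047a]%code) [:: 4];
      Econj [:: 0; 4] 0;
      Econj [:: 0; 3] 3;
      Ecert [:: 1; 2] (cert_of [:: 0x10105030002047a]%code) [:: 2];
      Ecert [:: 0; 6] (cert_of [:: 0x1030100027a]%code) [:: 6];
      Econj [:: 0; 1] 1;
      Ecert [:: 4; 5; 6] (cert_of [:: 0x10109027a07067a03087a0500047b]%code) [:: 4; 6];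
      Econj [:: 0; 5; 6] 0;
      Econj [:: 0; 1; 6] 1;
      Econj [:: 1; 2; 6] 2;
      Econj [:: 0; 1; 2] 2;
      Ecert [:: 3; 5; 6] (cert_of [:: 0x1090c000b7a030a7a02017a06077a0805047b]%code) [:: 3; 6];
      Econj [:: 3; 4; 6] 4;
      Econj [:: 2; 4; 6] 2;
      Econj [:: 3; 4; 5] 5;
      Econj [:: 2; 3; 6] 3;
      Econj [:: 2; 4; 5] 5;
      Econj [:: 1; 3; 6] 1;
      Econj [:: 2; 3; 4] 4;
      Econj [:: 0; 2; 5] 0;
      Econj [:: 1; 3; 4] 4;
      Econj [:: 0; 2; 4] 0;
      Econj [:: 0; 3; 5] 3;
      Ecert [:: 2; 5; 6] (cert_of [:: 0x100067a0a027a07057a04097a0301087b]%code) [:: 2; 5];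
      Econj [:: 0; 2; 6] 0;
      Econj [:: 0; 4; 6] 4;
      Econj [:: 0; 2; 3] 3;
      Econj [:: 1; 4; 6] 1;
      Econj [:: 0; 4; 5] 5;
      Econj [:: 0; 1; 3] 1;
      Econj [:: 1; 4; 5] 5;
      Econj [:: 0; 1; 5] 1;
      Ecert [:: 2; 3; 5] (cert_of [:: 0x1020903047a01077a00057a08067a0c0a0b7b]%code) [:: 3; 5];
      Econj [:: 1; 3; 5] 1;
      Ecert [:: 1; 5; 6] (cert_of [:: 0x1080006047a02037a0105077b]%code) [:: 5; 6];
      Ecert [:: 1; 2; 5] (cert_of [:: 0x10b0004057a07097a020a7a030c7a0106087b]%code) [:: 2; 5];
      Econj [:: 1; 2; 3] 3;
      Ecert [:: 1; 2; 4] (cert_of [:: 0x10206010c7a0b077a03007a090a7a0805047b]%code) [:: 2; 4];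
      Econj [:: 0; 1; 4] 0;
      Econj [:: 0; 3; 4] 3;
      Econj [:: 0; 3; 6] 6;
      Ecert [:: 3; 4; 5; 6] (cert_of [::
   0x113030f7a00147a11050c7b09120e7b0110067b080d047b0b07020a7c]%code) [:: 3; 5; 6];
      Econj [:: 2; 4; 5; 6] 2;
      Econj [:: 0; 2; 5; 6] 0;
      Econj [:: 0; 3; 5; 6] 3;
      Econj [:: 0; 2; 3; 6] 3;
      Econj [:: 0; 3; 4; 6] 4;
      Econj [:: 0; 1; 3; 6] 1;
      Econj [:: 0; 2; 3; 4] 4;
      Econj [:: 0; 1; 4; 6] 1;
      Econj [:: 0; 3; 4; 5] 5;
      Econj [:: 0; 1; 3; 4] 4;
      Econj [:: 1; 2; 4; 6] 2;
      Econj [:: 0; 1; 4; 5] 5;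
      Econj [:: 0; 1; 2; 4] 2;
      Econj [:: 1; 2; 3; 6] 3;
      Econj [:: 1; 2; 4; 5] 5;
      Econj [:: 0; 1; 2; 5] 2;
      Econj [:: 1; 2; 3; 4] 3;
      Ecert [:: 2; 3; 5; 6] (cert_of [::
   0x1001104147a0e0f7a0506157b1012017b0c070a7b0b13097b0d0302087c]%code) [:: 3; 5; 6];
      Econj [:: 1; 3; 5; 6] 1;
      Econj [:: 2; 3; 4; 6] 4;
      Econj [:: 1; 3; 4; 6] 4;
      Econj [:: 0; 2; 4; 6] 0;
      Econj [:: 2; 3; 4; 5] 5;
      Econj [:: 1; 3; 4; 5] 5;
      Econj [:: 0; 2; 4; 5] 5;
      Econj [:: 0; 2; 3; 5] 3;
      Econj [:: 0; 1; 3; 5] 1;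
      Ecert [:: 1; 4; 5; 6] (cert_of [::
   0x10c0278000801047a06057a03097a020a077b820a0f7a1107017b100b097b0805047b0d06030e7c]%code) [:: 1;
   4; 6];
      Econj [:: 0; 4; 5; 6] 0;
      Econj [:: 0; 1; 5; 6] 1;
      Econj [:: 0; 1; 2; 6] 2;
      Econj [:: 1; 2; 5; 6] 5;
      Econj [:: 0; 1; 2; 3] 3;
      Ecert [:: 1; 2; 3; 5] (cert_of [::
   0x1060a000d0c0f7a0e027a0509087b1716047b140b017b0710127b150311137c]%code) [:: 2; 3; 5];
      Ecert [:: 2; 3; 4; 5; 6] (cert_of [::
   0x109087a0c070b7b0d0f0a7b100e11127ca11114150c05037b1c120d007c1d0f0e077c171b0b207c190109041e7d;
   0x1107b0f07097b05010e037c95787801037a0908020600057a070a047b880478070609057a03017a0002087b8205;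
   0x1100a78067800057a020b7a0a017a09077a0308067b930a040d7a78080503027a04077a0001067b8d00127a020c;
   0x17a000a7a0609077b8f7806017a05077a09087a02040a7b8a04137a0a077a0603147b0201117b1015050e7c8a1a;
   0x10618160278000f7a0c0b7a78080104030502]%code) [:: 2; 3; 5; 6];
      Econj [:: 1; 3; 4; 5; 6] 1;
      Econj [:: 0; 2; 4; 5; 6] 0;
      Econj [:: 0; 2; 3; 5; 6] 3;
      Econj [:: 0; 1; 3; 5; 6] 1;
      Econj [:: 0; 2; 3; 4; 6] 4;
      Econj [:: 0; 1; 3; 4; 6] 4;
      Econj [:: 0; 2; 3; 4; 5] 5;
      Econj [:: 0; 1; 2; 4; 6] 2;
      Econj [:: 0; 1; 3; 4; 5] 5;
      Econj [:: 1; 2; 3; 4; 6] 3;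
      Econj [:: 0; 1; 2; 4; 5] 5;
      Econj [:: 1; 2; 3; 5; 6] 5;
      Econj [:: 1; 2; 3; 4; 5] 5;
      Econj [:: 0; 1; 2; 3; 5] 3;
      Ecert [:: 1; 2; 4; 5; 6] (cert_of [::
   0x17a0d03147b0210097b08130a077c9205190d00080e09177b060b1c037c1b1a120c7c0f0a181d7c14041611077d;
   0x110057b09060e037c83787801030a0900027a06087a0407057b860e0b7a78040208017a05067a0700037b8e000f;
   0x1780878040602017a08097a0b077a0a03057b8678010b02047a030a7a0705097b840c0b0f7a14077a0a13007b0d;
   0x17a05027a0104067b82070f02147a7806007a030504077a0802017b860b097a1101067b0a10137b0e0c080d7c95;
   0x115027812057800097a0a037a080c]%code) [:: 2; 4; 5; 6];
      Econj [:: 0; 1; 4; 5; 6] 0;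
      Econj [:: 0; 1; 2; 5; 6] 0;
      Econj [:: 0; 3; 4; 5; 6] 3;
      Econj [:: 0; 1; 2; 3; 6] 3;
      Econj [:: 0; 1; 2; 3; 4] 4;
      Ehyp 0 (cert_of [::
   0x1100f7d18323317167d2d1e2e2f301d7e292a232b2c317e2425273528127e081f210b380c7e02011a05043a067f;
   0x13b393734267a20227a191b1c7b1314157b3e0d030e7c3d0a07097c363c11]%code) [:: 2; 3; 4; 5; 6];
      Econj [:: 0; 1; 2; 4; 5; 6] 0;
      Econj [:: 0; 1; 3; 4; 5; 6] 3;
      Econj [:: 0; 1; 2; 3; 5; 6] 3;
      Econj [:: 0; 2; 3; 4; 5; 6] 2;
      Econj [:: 0; 1; 2; 3; 4; 6] 4;
      Econj [:: 0; 1; 2; 3; 4; 5] 5;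
      Ecert [:: 0; 1; 2; 3; 4; 5; 6] (cert_of [::
   0x11b1d7d0c3b1f21207d39273a191a257e38132a1614297e360f0d2d100e7e33080907310a7e300102030034047f;
   0x1063735322e2f7a2b2c7a2628057b23220b7b3e1e1c117c3d1815177c3c2412]%code) [:: 1; 2; 3; 4; 5;
   6]]%N.

Lemma table_F4_ok : cart_ok zops 4 cart_F4 &&
  table_ok zops (BinInt.Z.leb BinNums.Z0) 4 cart_F4 gens_F4 table_F4.
Proof. by vm_compute. Qed.

Lemma table_E6_ok : cart_ok zops 6 cart_E6 &&
  table_ok zops (BinInt.Z.leb BinNums.Z0) 6 cart_E6 gens_E6 table_E6.
Proof. by vm_compute. Qed.

Lemma table_E7_ok : cart_ok zops 7 cart_E7 &&
  table_ok zops (BinInt.Z.leb BinNums.Z0) 7 cart_E7 gens_E7 table_E7.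
Proof. by vm_compute. Qed.

Lemma table_H3_ok : cart_ok gops 3 cart_H3 &&
  table_ok gops gnonneg 3 cart_H3 gens_H3 table_H3.
Proof. by vm_compute. Qed.

Lemma table_H4_ok : cart_ok gops 4 cart_H4 &&
  table_ok gops gnonneg 4 cart_H4 gens_H4 table_H4.
Proof. by vm_compute. Qed.

Definition cart_E8 : seq (seq BinNums.Z) :=
  [:: [:: z2; BinNums.Z0; BinNums.Z0; z1n; BinNums.Z0; BinNums.Z0; BinNums.Z0; BinNums.Z0]; [::
   BinNums.Z0; z2; z1n; BinNums.Z0; BinNums.Z0; BinNums.Z0; BinNums.Z0; BinNums.Z0]; [::
   BinNums.Z0; z1n; z2; z1n; BinNums.Z0; BinNums.Z0; BinNums.Z0; BinNums.Z0]; [:: z1n; BinNums.Z0;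
   z1n; z2; z1n; BinNums.Z0; BinNums.Z0; BinNums.Z0]; [:: BinNums.Z0; BinNums.Z0; BinNums.Z0; z1n;
   z2; z1n; BinNums.Z0; BinNums.Z0]; [:: BinNums.Z0; BinNums.Z0; BinNums.Z0; BinNums.Z0; z1n; z2;
   z1n; BinNums.Z0]; [:: BinNums.Z0; BinNums.Z0; BinNums.Z0; BinNums.Z0; BinNums.Z0; z1n; z2; z1n];
   [:: BinNums.Z0; BinNums.Z0; BinNums.Z0; BinNums.Z0; BinNums.Z0; BinNums.Z0; z1n; z2]].

Definition gens_E8 : seq (nat * nat) :=
  [:: (0, 3); (1, 2); (2, 3); (3, 4); (4, 5); (5, 6); (6, 7); (8, 2); (8, 4); (9, 3); (10, 4); (11,
   5); (12, 6); (13, 7); (15, 1); (15, 4); (16, 5); (17, 4); (18, 5); (19, 6); (20, 7); (22, 4);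
   (23, 3); (23, 5); (24, 6); (25, 5); (26, 6); (27, 7); (29, 3); (29, 5); (30, 5); (31, 6); (32,
   7); (33, 6); (34, 7); (36, 2); (36, 5); (37, 6); (38, 4); (38, 6); (39, 7); (41, 7); (43, 5);
   (44, 4); (44, 6); (45, 7); (46, 6); (47, 7); (50, 4); (50, 6); (51, 6); (52, 7); (54, 5); (54,
   7); (56, 3); (56, 6); (57, 7); (58, 5); (58, 7); (60, 7); (62, 0); (62, 6); (63, 5); (63, 7);
   (65, 7); (67, 6); (68, 6); (69, 5); (69, 7); (70, 7); (72, 6); (74, 5); (74, 7); (75, 4); (75,
   7); (77, 6); (79, 4); (79, 7); (81, 7); (82, 6); (84, 3); (84, 7); (85, 6); (86, 6); (88, 2);
   (88, 7); (89, 6); (91, 5); (92, 1); (92, 7); (93, 6); (94, 5); (96, 7); (97, 6); (98, 5); (100,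
   6); (101, 5); (102, 4); (103, 5); (104, 4); (106, 4); (107, 3); (108, 3); (109, 0); (110, 0);
   (110, 2); (112, 2); (114, 3); (115, 4); (116, 5); (117, 6); (118, 7)]%N.

Definition table_E8 : seq entry :=
  [:: Ecert [:: 7] (cert_of [:: 0x100]%code) [::];
      Ecert [:: 6] (cert_of [:: 0x100]%code) [::];
      Ecert [:: 5] (cert_of [:: 0x100]%code) [::];
      Ecert [:: 4] (cert_of [:: 0x100]%code) [::];
      Ecert [:: 3] (cert_of [:: 0x100]%code) [::];
      Ecert [:: 2] (cert_of [:: 0x100]%code) [::];
      Ecert [:: 1] (cert_of [:: 0x100]%code) [::];
      Ecert [:: 0] (cert_of [:: 0x100]%code) [::];
      Ecert [:: 6; 7] (cert_of [:: 0x10105030002047a]%code) [:: 7];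
      Ecert [:: 5; 7] (cert_of [:: 0x10105030002047a]%code) [:: 7];
      Econj [:: 5; 6] 6;
      Econj [:: 1; 6] 1;
      Ecert [:: 4; 7] (cert_of [:: 0x103060005070201047a]%code) [:: 7];
      Econj [:: 4; 5] 5;
      Econj [:: 0; 5] 0;
      Econj [:: 0; 3] 3;
      Ecert [:: 4; 6] (cert_of [:: 0x103060005070201047a]%code) [:: 6];
      Econj [:: 2; 6] 2;
      Econj [:: 2; 3] 3;
      Econj [:: 1; 3] 1;
      Ecert [:: 3; 7] (cert_of [:: 0x103060005070201047a]%code) [:: 7];
      Econj [:: 3; 4] 4;
      Econj [:: 2; 4] 2;
      Econj [:: 2; 5] 5;
      Ecert [:: 3; 6] (cert_of [:: 0x103060005070201047a]%code) [:: 6];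
      Econj [:: 3; 5] 5;
      Ecert [:: 2; 7] (cert_of [:: 0x10105030002047a]%code) [:: 7];
      Econj [:: 0; 2] 0;
      Econj [:: 0; 6] 6;
      Ecert [:: 1; 7] (cert_of [:: 0x1030100027a]%code) [:: 7];
      Ecert [:: 1; 5] (cert_of [:: 0x10105030002047a]%code) [:: 5];
      Ecert [:: 1; 4] (cert_of [:: 0x103060005070201047a]%code) [:: 4];
      Econj [:: 0; 4] 0;
      Ecert [:: 1; 2] (cert_of [:: 0x10105030002047a]%code) [:: 2];
      Econj [:: 0; 1] 0;
      Econj [:: 0; 7] 7;
      Ecert [:: 5; 6; 7] (cert_of [:: 0x10c0105007a04027a07037a06097a080a0b7b]%code) [:: 6; 7];
      Econj [:: 1; 6; 7] 1;
      Ecert [:: 4; 6; 7] (cert_of [:: 0x1010d007a0f027a090a7a07087a05047a060c7a030e0b7b]%code) [::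
   4; 7];
      Econj [:: 2; 6; 7] 2;
      Econj [:: 4; 5; 7] 5;
      Econj [:: 0; 2; 7] 0;
      Econj [:: 0; 5; 7] 0;
      Econj [:: 4; 5; 6] 6;
      Econj [:: 0; 2; 3] 3;
      Econj [:: 0; 5; 6] 6;
      Econj [:: 0; 1; 3] 1;
      Econj [:: 0; 1; 6] 1;
      Econj [:: 1; 2; 6] 2;
      Econj [:: 1; 2; 3] 3;
      Ecert [:: 3; 6; 7] (cert_of [:: 0x1040a02120c0d7a000f7a030e7a09077a10067a01087a11050b7b]%code)
   [:: 3; 7];
      Econj [:: 3; 4; 7] 4;
      Econj [:: 2; 4; 7] 2;
      Econj [:: 3; 4; 5] 5;
      Econj [:: 2; 4; 5] 5;
      Econj [:: 0; 2; 5] 0;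
      Econj [:: 0; 3; 5] 3;
      Econj [:: 0; 3; 6] 6;
      Ecert [:: 3; 5; 7] (cert_of [:: 0x104090e0f060c7a0d027a03007a080b7a05127a11077a01100a7b]%code)
   [:: 3; 7];
      Econj [:: 3; 5; 6] 6;
      Econj [:: 3; 4; 6] 4;
      Econj [:: 2; 4; 6] 2;
      Econj [:: 2; 3; 6] 3;
      Econj [:: 1; 3; 6] 1;
      Econj [:: 2; 3; 5] 5;
      Econj [:: 1; 3; 5] 5;
      Ecert [:: 2; 5; 7] (cert_of [:: 0x10e0c0f087a020b7a0a107a00037a0d047a07097a0605017b]%code) [::
   2; 5];
      Econj [:: 2; 3; 7] 3;
      Econj [:: 2; 5; 6] 6;
      Econj [:: 1; 3; 7] 1;
      Econj [:: 2; 3; 4] 4;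
      Econj [:: 0; 2; 6] 0;
      Econj [:: 1; 3; 4] 4;
      Econj [:: 0; 2; 4] 0;
      Econj [:: 0; 4; 6] 4;
      Econj [:: 1; 4; 6] 1;
      Ecert [:: 1; 5; 7] (cert_of [:: 0x1040301007a09087a070b7a0c0a7a0205067b]%code) [:: 5; 7];
      Econj [:: 1; 5; 6] 6;
      Ecert [:: 1; 4; 7] (cert_of [:: 0x10109050a7a000d7a07107a0f087a0b027a03047a0c060e7b]%code) [::
   4; 7];
      Econj [:: 0; 4; 7] 0;
      Econj [:: 1; 4; 5] 5;
      Econj [:: 0; 3; 7] 3;
      Econj [:: 0; 4; 5] 5;
      Econj [:: 0; 3; 4] 4;
      Econj [:: 0; 1; 5] 1;
      Econj [:: 0; 1; 4] 1;
      Econj [:: 1; 2; 4] 2;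
      Econj [:: 1; 2; 5] 5;
      Ecert [:: 1; 2; 7] (cert_of [:: 0x1080107047a000b7a03097a0a0c7a0205067b]%code) [:: 2; 7];
      Econj [:: 0; 1; 2] 0;
      Econj [:: 0; 1; 7] 7;
      Econj [:: 0; 6; 7] 6;
      Ecert [:: 4; 5; 6; 7] (cert_of [::
   0x10608007a0d0e7a0a017a0b0f7a0509077b8404180c7a110d0500087b0f15097b0610127b13070e7b140b0a167c;
   0x103177801037a06080c0a0e0d7a090f7a04077a050b027b837804]%code) [:: 4; 6; 7];
      Econj [:: 0; 5; 6; 7] 0;
      Econj [:: 0; 1; 6; 7] 1;
      Econj [:: 1; 2; 6; 7] 2;
      Econj [:: 0; 1; 2; 7] 2;
      Econj [:: 0; 1; 2; 3] 3;
      Ecert [:: 3; 5; 6; 7] (cert_of [::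
   0x1021d00030c1613050a12011c067b150d187b09141e7b0e1b047b1f1a0f7b1707197b11100b087c]%code) [:: 3;
   6; 7];
      Econj [:: 3; 4; 6; 7] 4;
      Econj [:: 2; 4; 6; 7] 2;
      Econj [:: 3; 4; 5; 7] 5;
      Econj [:: 2; 3; 6; 7] 3;
      Econj [:: 2; 4; 5; 7] 5;
      Econj [:: 3; 4; 5; 6] 6;
      Econj [:: 1; 3; 6; 7] 1;
      Econj [:: 2; 3; 4; 7] 4;
      Econj [:: 0; 2; 5; 7] 0;
      Econj [:: 2; 4; 5; 6] 6;
      Econj [:: 1; 3; 4; 7] 4;
      Econj [:: 0; 2; 4; 7] 0;
      Econj [:: 2; 3; 4; 5] 5;
      Econj [:: 0; 3; 5; 7] 3;
      Econj [:: 0; 2; 5; 6] 6;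
      Econj [:: 1; 3; 4; 5] 5;
      Econj [:: 0; 2; 4; 5] 5;
      Econj [:: 0; 3; 5; 6] 6;
      Econj [:: 0; 2; 3; 6] 3;
      Econj [:: 0; 2; 3; 5] 3;
      Econj [:: 0; 3; 4; 6] 4;
      Econj [:: 0; 1; 3; 6] 1;
      Econj [:: 0; 1; 3; 5] 1;
      Econj [:: 0; 1; 4; 6] 1;
      Econj [:: 1; 2; 4; 6] 2;
      Econj [:: 1; 2; 3; 6] 3;
      Econj [:: 1; 2; 3; 5] 5;
      Ecert [:: 2; 5; 6; 7] (cert_of [::
   0x1080709067a05017a04030a7b9978070400097a05087a030a067b951610090b7a0103117b08070a7b06050c047c;
   0x11b151a147a02187a120f007b0e0d197b780002]%code) [:: 2; 5; 7];
      Econj [:: 0; 2; 6; 7] 0;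
      Econj [:: 0; 4; 6; 7] 4;
      Econj [:: 0; 2; 3; 7] 3;
      Econj [:: 1; 4; 6; 7] 1;
      Econj [:: 0; 4; 5; 7] 5;
      Econj [:: 0; 1; 3; 7] 1;
      Econj [:: 0; 2; 3; 4] 4;
      Econj [:: 1; 4; 5; 7] 5;
      Econj [:: 0; 1; 5; 7] 1;
      Econj [:: 0; 4; 5; 6] 6;
      Econj [:: 0; 1; 3; 4] 4;
      Econj [:: 1; 4; 5; 6] 6;
      Econj [:: 0; 1; 5; 6] 6;
      Econj [:: 0; 1; 2; 4] 2;
      Econj [:: 0; 1; 2; 6] 2;
      Econj [:: 1; 2; 3; 4] 3;
      Econj [:: 1; 2; 5; 6] 5;
      Econj [:: 1; 2; 3; 7] 7;
      Econj [:: 1; 2; 5; 7] 7;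
      Ecert [:: 2; 3; 5; 7] (cert_of [::
   0x1171c07111b02160f7a051d7a0619137b091e007b151f127b0b040d7b1a08147b0301187b0e0c100a7c]%code) [::
   3; 5; 7];
      Econj [:: 1; 3; 5; 7] 1;
      Econj [:: 2; 3; 5; 6] 6;
      Econj [:: 1; 3; 5; 6] 6;
      Econj [:: 2; 3; 4; 6] 4;
      Econj [:: 1; 3; 4; 6] 4;
      Econj [:: 0; 2; 4; 6] 0;
      Ecert [:: 1; 5; 6; 7] (cert_of [::
   0x11307080f04177a0b157a1403007b0906017b10120d7b050a027b160e0c117c]%code) [:: 5; 6; 7];
      Ecert [:: 1; 2; 4; 7] (cert_of [::
   0x17b9b0f78060501007a02097a080c0b03070d0a7b9c0d17110c1c087b06021d7b0704057b0910017b15121b167c;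
   0x1130014030b180e0a7a780a007a060803097a0c0d0b027a0e077a010405]%code) [:: 2; 4; 7];
      Econj [:: 0; 1; 4; 7] 0;
      Econj [:: 1; 2; 4; 5] 5;
      Econj [:: 0; 3; 4; 7] 3;
      Econj [:: 0; 1; 4; 5] 5;
      Econj [:: 0; 1; 2; 5] 0;
      Econj [:: 0; 3; 6; 7] 6;
      Econj [:: 0; 3; 4; 5] 5;
      Ecert [:: 3; 4; 5; 6; 7] (cert_of [::
   0x10b7b0203097b0a0504017c8b0207780602097b070a047b010300087c871f20191e7b04212d0e7c2500231b017d;
   0x1017b020a0b0e7ca67878020401037a07067a0500087b8204090602087b0c0b017b03070e057ca80b78000c0607;
   0x10803017b07020e7b120506107c9414171c0c2778040d78000205047a01037a0706087b8b07007a0c05067b0308;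
   0x112097b0b05100c7c927878070406090a037a00057a0201087b8d78080a7a02047a01037a0005097b95040a140c;
   0x191780d7801037a0a097a05087a02067a0b00047b967803050a017a06077a04080b7b830f110408030a060e7b07;
   0x112077b0c03047b111301067cae130d1128167814137a010e0d06047b0005077b02090b7b080a037b0c0f11127c;
   0x10c070b7b8f10197a78030a01067a08057a04007a0702097b8c0b78050702047a08037a0109007b9109081b7a14;
   0x10a07047b9d0b0002157a01190c7b0f17137b0a11067b030e07057cab787808067a0a037a09017a05007a02047a;
   0x1017a0b0e7a09000c7b9a7800067a010d7a09057a0c037a080b7a070e0a7b94090878030806057a00017a0c097a;
   0x17a0c040e7b99161b1107130103057b0a08197b14060b7b0e0f047b180209127c9c78780308040a0d077a020506;
   0x11804007b0e021b137ca478107803000c020f080406070b7a0a097a0d050e7b9778010f050a000d7a0b087a0709;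
   0x10911037807017a050a7a060908037a000b027b8a0f1906127a7805017a080206037a0704007b8c1407050b167b;
   0x1780c10780204030b060e7a08097a0d007a010a7a0c0f057b9978020a0d067a050e7a0f087a0b09040c077b9701;
   0x1037b9a03177809037a0b060a077a02087a0500047b820919077a0512017b1a04147b08100b7b1b0a110c7c9f2b;
   0x11516060e1378070a050b0e017a0c007a03087a02047a0f0d097b911c0278000c01050a067a0d047a0b077a0809;
   0x1041e027a780100030905027a08077a06040a7b8d09197a0e0f187b061b1a7b0d141f7b150801167c882a151878;
   0x117071c7a780c0a08050b0e09010d077a04007a0302067b8c0078000109027a03047a05077a0a0d7a0b0c067b87;
   0x103080a7810031d130c]%code) [:: 3; 5; 6; 7];
      Econj [:: 2; 4; 5; 6; 7] 2;
      Econj [:: 0; 2; 5; 6; 7] 0;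
      Econj [:: 0; 3; 5; 6; 7] 3;
      Econj [:: 0; 2; 3; 6; 7] 3;
      Econj [:: 0; 3; 4; 6; 7] 4;
      Econj [:: 0; 1; 3; 6; 7] 1;
      Econj [:: 0; 2; 3; 4; 7] 4;
      Econj [:: 0; 1; 4; 6; 7] 1;
      Econj [:: 0; 3; 4; 5; 7] 5;
      Econj [:: 0; 1; 3; 4; 7] 4;
      Econj [:: 0; 2; 3; 4; 5] 5;
      Econj [:: 1; 2; 4; 6; 7] 2;
      Econj [:: 0; 1; 4; 5; 7] 5;
      Econj [:: 0; 3; 4; 5; 6] 6;
      Econj [:: 0; 1; 2; 4; 7] 2;
      Econj [:: 0; 1; 3; 4; 5] 5;
      Econj [:: 1; 2; 3; 6; 7] 3;
      Econj [:: 1; 2; 4; 5; 7] 5;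
      Econj [:: 0; 1; 2; 5; 7] 2;
      Econj [:: 0; 1; 4; 5; 6] 6;
      Econj [:: 1; 2; 3; 4; 7] 3;
      Econj [:: 0; 1; 2; 4; 5] 5;
      Econj [:: 1; 2; 4; 5; 6] 6;
      Econj [:: 0; 1; 2; 5; 6] 6;
      Econj [:: 1; 2; 3; 4; 5] 5;
      Econj [:: 0; 1; 2; 3; 5] 3;
      Econj [:: 0; 1; 2; 3; 6] 3;
      Ecert [:: 2; 3; 5; 6; 7] (cert_of [::
   0x1017a0607047b967803047a0c077a08017a09020b067cb001197a0c217a150a271a7c261d2b0d7c1c2509120b7d;
   0x1070601027a08037a0405007b9211137a0f09057b0d0b0e7b001204017c8a292d0311241f78030a0c0b00087a02;
   0x113060e7c9878780007020805067a01037a040a097b8f06047a11140b7b1302007b0112157b030e050f7c927878;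
   0x178000102047a0a057a08067a0703097b857800047a060709037a010a087b8b081415127a0b050a7b110f047b0d;
   0x10a087a0007017b8478060901087a0a007a0705047b8e050f13117a160d097b0e0b047b100103127ca57802017a;
   0x10c7b1410067b11130e7b000a12167c8878780504010b000c06037a090a7a0807027b8a1514780209060403057a;
   0x11003177b0e0012137caa052a0e0f7802780107030a7a0b0d7a04007a0c057a0908067b97090b04050f037b070d;
   0x101087a09077a0504037b97117807057a08067a01037a0209007b8914187800037a02057a0604017b9c1b02057a;
   0x1017a040a057b9d1602000901140b7b120a137b070d187b100c1a087ca07801080c7b190f067b7800067a020a7a;
   0x17a02010803060a7a0b0d7a050e0c7b9b780e0500020d0c07067a040a7a0b08097b91111778000908020b0c7a06;
   0x106037b9d0278080705017a09047a0006027b890d13167a091a057b0b18047b120e17147cae7804157804070900;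
   0x109027a070c057b8578030c020e7a0b007a09087a0d057a0a06047b8e06117a0800780204050a08007a07097a01;
   0x104037a0205007b961104070a1c7b081d161f7cb113180702780f017a0a107a780806040b7a0e0d0a037a01007a;
   0x104100a7a0f077a0b09027b82061312197a1b780506090b04027a010a7a0008077b9c0d171e7a0c18157b780601;
   0x17b1a1d177b110607047c86780f09030e7810017a07007a0d0c06040e0a0f087a09030b7b8778010c7a0e0d7a03;
   0x17a05047a00017a030c0a7b8d131b150d167802017a03000b087a0a077a0405097b8b181c147a02010f7b050008;
   0x11b001720302278030e0a0c12197807060d1003087a000e7a05027a0a097a0c0f0b7ba17807060d0b7a0910]%code)
   [:: 3; 5; 6; 7];
      Econj [:: 1; 3; 5; 6; 7] 1;
      Econj [:: 2; 3; 4; 6; 7] 4;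
      Econj [:: 1; 3; 4; 6; 7] 4;
      Econj [:: 0; 2; 4; 6; 7] 0;
      Econj [:: 2; 3; 4; 5; 7] 5;
      Econj [:: 1; 3; 4; 5; 7] 5;
      Econj [:: 0; 2; 4; 5; 7] 5;
      Econj [:: 2; 3; 4; 5; 6] 6;
      Econj [:: 1; 3; 4; 5; 6] 6;
      Econj [:: 0; 2; 3; 5; 7] 3;
      Econj [:: 0; 2; 4; 5; 6] 6;
      Econj [:: 0; 1; 3; 5; 7] 1;
      Econj [:: 0; 2; 3; 5; 6] 6;
      Econj [:: 0; 1; 3; 5; 6] 6;
      Econj [:: 0; 2; 3; 4; 6] 4;
      Econj [:: 0; 1; 3; 4; 6] 4;
      Econj [:: 0; 1; 2; 4; 6] 2;
      Econj [:: 1; 2; 3; 4; 6] 3;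
      Econj [:: 1; 2; 3; 5; 6] 5;
      Econj [:: 1; 2; 3; 5; 7] 7;
      Ecert [:: 1; 4; 5; 6; 7] (cert_of [::
   0x1027a0107057b900001087a030a067b0f0509107ca1262827132423107b081d151c7c1e14040e7c1b010b02207d;
   0x1007c8b780b0f7a10047a0607057b01090e7b0d0302087c887878000401037a05027a0806077b86077806037a04;
   0x10008040207017a030a7a0906057b850c1078000204067a05077a0308017b9005087a040f067b0d09117b0a070b;
   0x10d7b0b09137b11000e7b0c0a06077c947805120c0e017b10070a7b0213097b0f0d117b00060b087c9c18167878;
   0x17b1900077b05041a027c87070c21170f197a78040378020a7a05067a010c7a09087a07030b7b8a0f0512021001;
   0x102047b8b1b7801067a0907040a0b037a0500087b8f7808040b037a0a017a0705097b8a1203157a06117a0e1317;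
   0x17a06040b7b9200120a047a0803187b1a0d017b130e197b1b1115077c9378780a0809007a070601037a0b057a0c;
   0x10c7a0e017a0d007a0b0203070a7b8b0f7806040c01090807057a0b027a0d000a7b87067802000a0c09087a0507;
   0x1047b87060e197809077a03007a05087a0601027b951204070b01037b09000c7b0d0a18177c8278780608090405;
   0x1057a03017a0609077b92780d007a05017a0e060a020f070403087b9811021b7806087a0a0205017a07007a0903;
   0x17a020a7a08067a0300097b8c02037a0916067b19050d7b1b00087b150e01147ca7780f780e0c08020a040f0d00;
   0x10f0107080b05047a00097a03020e7b99041878020b05060c097a0a017a040d7a0308077b9c1312117804070501;
   0x1030a0d22780f0c7a07780d0c7a06]%code) [:: 1; 4; 6; 7];
      Econj [:: 0; 4; 5; 6; 7] 0;
      Econj [:: 0; 1; 5; 6; 7] 1;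
      Econj [:: 0; 1; 2; 6; 7] 2;
      Econj [:: 1; 2; 5; 6; 7] 5;
      Econj [:: 0; 1; 2; 3; 7] 3;
      Econj [:: 0; 1; 2; 3; 4] 4;
      Ecert [:: 2; 3; 4; 5; 6; 7] (cert_of [::
   0x1047a070205017c8e0a047a0508077b0d09020e017d883c0c167a22102d11127d27092b14347d1a4029393e247e;
   0x1097a000403057c8f780001097b060802037c8c0906107a13030c7b0f120211057d8a1c301878000f7a78030006;
   0x108067c9105147a10070a7b0b090d137c03120611007d9d787806007a050402037a0708090a7c90007807087a02;
   0x178067806027a03077a0500017b8c030b7804007a0102037b87010908020007047c8e7800010b7b090a027b0703;
   0x10514137b09030f7b0d0c07067c9078787802017a000708060405037b8307090408037b0b06057b0c0a00027c84;
   0x1780304027b050706007c8a151807127b06160502177d992c2333780478070108047a06027a0509007b93020a10;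
   0x1067a000a7a030804097c8f1478030602077a04007a010b090a7c931000097a7806017a08047a030205007c8c0b;
   0x102057a060b070a7c8378080a077b03090c067c981509060708187b020e107b030d040a177db978780205010c07;
   0x100087c820b037a0e19047b01070518147d89780578090b7a040100037a08077a020a0c067c8212147808090401;
   0x100027a04037a0506017b8c07040001057b020603097c8e150d1078050403067a010802077c8c780106037b0204;
   0x1060078060205017a0304007b8a0a0b7a0402037b010d050c7c9478060700040c7b0a01057b0b0309027c987878;
   0x108050d0a7800017a06037a0402057b8909017a0b02047b0c0306007c991a7878030600027a08017a0504077b8b;
   0x1030007047a0905067b84057800027a07047a05087a0301097b860903077a0e08017b0b0f0a7b0d0c00067c9578;
   0x1097a020a08077c8a120e0c7a78020005067a0403017b8b14067a1301027b030a0419077d84787878080a7a0201;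
   0x1031d28781518160578010203067a050a7a04077a000b09087c91780b000a7b010207037c920b78010604037a05;
   0x104057a0600037b080102077c98780201067b070008047c9a0e7803007a0605017b8d15140a7a03110c00097d91;
   0x1870609047a00030b7b0c010a027c831910787803007a04017a0605027b8300037a0504087b060907027c990f78;
   0x1077b8c0f0c7a7804057a03027a0600017b90080b0d01067b030502097c941e1a78087806037a01047a0502077b;
   0x10b7808017a04097a03027a0705067b890605090e0f007b01040a7b02030c087c957878060308007a05017a0402;
   0x1037a010a7a0604057b8678070a7a09017a08027a0306007b8f060a1100010c0b7b09070f7b0e1008057c861d78;
   0x1097b8406057802067a00047a0307017b8f0f090a7a7800017a0403027b8e07100b0801007c8878780208000907;
   0x10d11170f7c1f14021c1d7d9b0a7878040e780008060204077a0a057a0901037b851178010204087a06057a0307;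
   0x19278057806037a01057a0704027b8404077804007a0203017b8d0c01080a03090d7c98070806127a191a0e097c;
   0x17b8e06097a020d017b0e070b007c957878010200077a03067a0805047b8804020301077b0c0b007b08050d0a7c;
   0x17a03017a05067a0208007b8404077a0603097b050d0b7b08000a0f7ca02078050a03047803017a04057a020006;
   0x106037b82040211030e01067b0c10097b0d0b05087c970b7878010a06037a090807057a0200047b90100c780407;
   0x17b8608000d0e02097b01120f0c7c8c780a0f7802037a050607087a00097a01040a7b8978020809017a07007a0a;
   0x10b7801007a0a037a080206077a0b04057b920a0706780008050104067a0702037b93037807067a02037a040001;
   0x1090207087c88031705207b15180e127c11011400027da77878780b0506017a0a027a07037a0c087a0004097b87;
   0x178060105027a0400037b8c04097a020b017b050807007c9110787805067a04007a0103027b8c00057a0104067b;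
   0x17a04027a0306087b8609027a7802007a04057a0603017b920a037a0e0d017b0f0807007c8a1a1c161b7803067a;
   0x102040b7a0501037b1100107b0e08060f7c8b7806057a090a7a02080e7b040c0d7b0f070b037c9f787805010007;
   0x1037a1304087b070c11007c9b0704787800050702010604087a0a03097b890d78030208007a07047a0605017b8b;
   0x108090a7a04037a02057a0001067b8f7802097a0406080a7a0307007b83060e0a78000207057a0301067b870b0f;
   0x1027a0b03087b8b0204780301090508067a0704027b850611007a0a0f137b0e07107b0812050c7c8c7809127807;
   0x10c037b0a04090b7c9f1408207a1812090e7c1513041a7c1f010b0d027d877878010d0b78040609007a0a077a05;
   0x17c997878060807047a02017a0005037b8600057a0a0b017b0e07067b090f030d7c921106167807010006027b05;
   0x10f0a780f007a78010302077a00087a0504067b8f0e7804067a02007a0301057b870c06107a0407097b0a080301;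
   0x17b8478080203097a00077a0106047b930c04057801007a04077a0503067b96070a000e100b7b091203067c9e00;
   0x17a02037a09047a0105067b92110e0b7a07030c7b04090d7b130801057c9d7878010806047a0a0005077a020903;
   0x106027b890f0c7a0a00117b0408107b051409037c9b7814780003060b7a02087a05047a09070a7b88000f780800;
   0x17c0a18141d127da3780c7813027803080a027a060c7a07097a0005017b94010e0d0b7a7804017a070305007a08;
   0x17b8d0d007a7800027a03017a0504067b9002080c03017b0609040a7c83081900071a0e7c0913170c7c2011161f;
   0x101077a0806007b8f040205100f7b0106087b0b0e097b00030c0a7c92027805077a78030406017a08057a020007;
   0x1110f097a0208137b78060302017a0500047b89100b7a120d047b05140e0a7c91051c150d787803097a0a050204;
   0x10d7b7801047a06057a0203007b82080e7a0a0b037b020f07137c9d780178000701040b0a7a08097a0206037b88;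
   0x114167b110b150e7c0a13201f1e7d957806041e7809010c78020803067a0a0704057a010b007b961006127a1104;
   0x10603027b820b047a03070a7b090805027c92780802007b7802047a0103007b8905017a0903060a7ca312197a1b;
   0x17878030600087a05017a0207047b8f090f010b0e7b0805007b10060c047c990f1a0d237801067800057a04017a;
   0x1027a0401037b92070108060e7b0c0d097b020504007c8e780d017a1004037b0e060c7b0508007b070b0a097c82;
   0x182100d0a0107087b030b097b0405060c7c9f0778780a01040802097a07037a0506007b930a0f78050800067a07;
   0x1090a0c7b0401130f7c9a02780f780b0a02077a06007a03057a0401087b940e0278020504017a09077a0803007b;
   0x17c85780d101203780704030602017a00097a0a08057b900500780708010604057a0200037b8a07067a020b117b;
   0x1077b8f087804087a00077a05037a0201067b87140e7807017a00037a0206057b910b07047a0912067b110a100c;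
   0x10d057a0b0e140f7c887878070c000304080b057a01097a02060a7b8303137a78030609087a02007a05047a010a;
   0x10a077b8b78070900087a03017a0602047b927805047a00037a0107087b8a7807087a0a09067b85121513070211;
   0x17a060a0c0007090b040e7b8300067805020a03040708090b0c7a0001067b860a0c780406090302057a08017a00;
   0x17a7800060a037a08017a050b09077c9004137a170b201e7c1b0922127c1f140611157d867878780308010d0502;
   0x17801057a04067a0702007b900510010f0a067b11040c0d7c9f780d0c050e08010f047a0a0b00037c820d071018;
   0x10207047a00037a0806057b8900090106050b7b1110087b020c0d037c9b7878040801077a05007a0302067b8909;
   0x10509017b8c05110b127a00020d7b040e037b01070f087c9e1678780a0807017a050200097a0604037b860e7809;
   0x10e02047b0f12007b060a0d117c8c230f78100c7a780a09020405087a06007a0103077b8b78070a04007a08027a;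
   0x1067a000c087b85150c7a780504060203007a0a077a0109087b92080b78020506077a00087a0401037b9609077a;
   0x1070004017a03027a050a097b84091410057a0b060d7b1304007b0c110a087c9c7878010309057a070a040b7a02;
   0x1121407057c87780e077809010c0608040b0207007a05030a7b9712037803080a0001077a02047a0509067b8378;
   0x10978040007017a03087a060a7a0502097b8d0d0e7805007a04017a08037a0706027b831511000c167b0a06107b;
   0x1a308787809077a01027a000c7a08040a0b060e7a0d03057b9104780104080b7a03060a0d00090502077b851308;
   0x1040b037b8b0e03007a78000804090a077a05017a0603027b9208057a0d0b157b0201167b17110f7b121307147c;
   0x11f23077dbf78780c047809030700060b0a0102047a050d7a0e0c087b880a7805007a09067a0c0a01027a070d7a;
   0x188081c78000105090b077a060804027ca302780004017b0205077b0a0803097c94170e18037b0900190b7c220f;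
   0x1030007027a08057a0104067b840c07080d007b0f010b7b030405067c9378070b080d060a7a00017a0309020c7c;
   0x102047a09017a05060a7b8d0803780107050300087a0406027b8201077a060a0f7b0d0e0c7b020504097c987878;
   0x1027a0003087b91080b0a7a78030205017a0600047b8405047a11030c7b09060e077c9d1314787807087a03007a;
   0x17b930112100c027b070d087b060b03007ca278000178000805060a047a09077a0102037b8f1078010506097a07;
   0x1050306010a090b7a0800027b910904780a04080700037a01020605097b8c0e057808017a05037a04077a060002;
   0x17a08027a0403007b951011087a78000301047a0602057b8c1402030c097b0e01150b7c871e150c7a78780c0704;
   0x178060801020c057a0a037a00077a0b09047b860d7800077a05037a0a0b7a06087a0209047b8712077806010905;
   0x17a0004087b8916110578030700097a04017a0205087b8d09170f1815147b0800137b0e0d0c037c8c041d780600;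
   0x10709037a080e05007a0a02017b83780a0c050908027a0e007a010b0d06037b8c0412780b0a02067a09057a0c01;
   0x17a090b027b84120e0b780006080901050203047b8e0708180f10137b0905157b141606177c9278780d060b0c04;
   0x17a080c7a030b7a010a0f7b837801027a0d0904067a0f0c0a057a0e080b7b820311047801047a030c06087a070a;
   0x1097a04057a00030a7b8e10067a110e097b050d167b040f177b191215027c9c0d780a78070e0d047a06097a0005;
   0x1000d070902057a04067a080b0e7b831878010c030a7a020d070b7a09057a0804007b89000b0a7a780208070601;
   0x10407097c8d780106037b050008077ca51b010e7a1720037b021a140f1c7db30d20787813030814780c017a0a03;
   0x112257a7802060a07007b080b097b050401037c957807010a7b020b097b040506087ca3227808027a0506017b00;
   0x17878010304027a00067a0507087b88070a7a7801047a00057a0306027b8b050c7a01100f7b0e020d007ca6101d;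
   0x10b7b06020f057c981e7800097a7800017a05077a03047a0608027b8504057a070a087b02060e7b0f0d0b017c9a;
   0x1060a7a0701027b8b10037a7803007a01027a06047a0708057b897802007a03017a0806057b8e010411087a120d;
   0x107047b8308780004080905037a0706027b920d09057a0302127b11070c7b060f0a007c9778780005030809047a;
   0x1097a7803027a05067a0001047b85070d7a15060a7b001005137c93190d1f780b04780309050a01087a02067a00;
   0x106097c87000c781101080278060009017a02057a030a7a0407087b94147805027a030706047a0801007b910c0b;
   0x10b007a0a097a07067a0305027b847808007a0b027a05047a0903067b9a0e190d07177a0514047b0b080c7b0a15;
   0x17a0706087b9a1017060904087a0b197a030f0e0d7c8b7878000a7a0603080b07017a040905020c7b8512780104;
   0x178050a040803067a01027a0700097b9578010a03087a05047a0607097b967809087a00067a0702017b8e780a01;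
   0x1787804060d017a03080b0c09057a0a0e7a0700027b831116780709010205007a0c087a040a7a03060b7b8c0507;
   0x106007a02017a050b087b9b090378030604087a00097a0205077b8f0b0e077a0512167b14080c7b011104177c88;
   0x17a03040e087a01097a05007a0a0c0d7b8878070d0c017a0803060904027a0a0e057b970f1318780a077a09037a;
   0x178020a04077a06030b087a0100057b93191807000f037b1312097b080c047b050b06167c8978000a78060b0702;
   0x10110027803090a0006017a080d0b027a04057a070c0f7b970d1417780a0c03070b06050908027a0100047b900a;
   0x17b010204057c8703780907007b03060a7b050801047ca6261f160d7b130c10217c1204140e1a7da13678040878;
   0x1037a0400027b8b010a0207037b040b0c7b000d05067c882578007803017a06007a0405077b89030a067a080b09;
   0x1001101107c9b1d0f78010c0378000103027a0507047b8a060a077a0e020d7b050b04007ca01578780805060701;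
   0x17a02037a09000a7b8d0e7807007a090403067a0205087b8509077804057a02067a0103007b870f0d0a020c087b;
   0x1067a07027a0503087b890b037806047a01020005037b8409107a120e0a7b000f110d7c991c7878060807040501;
   0x1017b8f140b127a0901077b080e0f027c8b271878047801037a0807060b7a05047a02000a7b8e05060878010004;
   0x11378040c7a080507037a000b7a0a01027b880a030c780102070604097a0503087b9200117803057a04007a0706;
   0x1030004057a02077a0106087b8e10127807027a03057a0601047b8c150e097a0d06027b081805137c93071b7805;
   0x1047c8d787805060a077a02037a04087a010b7a090c007b910478030500047a09067a07087a020a017b85010b78;
   0x1060c05020b017b9a147803027a040b01097a060a7a0508077b910a12107a0013037b01150d7b050b0e7b070c08;
   0x1187b160d0e7b020917137ca47878000205010b060a0903040c0e7a080d077b9902097a7800087a090304077a0a;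
   0x178090b7a01027a0c0a060407080003057b9103780a0b02097a00017a03067a0508077b8d0811070610007b0414;
   0x11a160b14007b1004037b19020f137c822023780c780307000d02067a08017a0b0f7a04057a0a090e7b83151205;
   0x105047a0a0c7a0103087b88157802037a0a0108007a060b7a0705047b90780601030702087a0a05097b8a0d0911;
   0x17b1901120e7c8a01780118780b020009040d7a01080c0703067a10050e7b9907120a057a780607000b7a09027a;
   0x105130a78090200017a07067a08057a0a04037b89140b780405010706037a0208007b8a10027a1b00037b041109;
   0x11778010d7a0c007a0f067a02037a04097a05077a0a0e0b7b9878000c0b0d02037a0a0509087a06070e7b97180c;
   0x1067a0d04057b0209077b0b000c017c8a2011211f7a150d0f177c100c181a7c28190b03097d8d2a78780f0d1a06;
   0x17a01027a00070e047c9f787806017a00057a08037a0204077b8805037a000d0b7b0401087b0a0e0c097c957808;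
   0x17b860b78000501087a09047a0206037b84080e071113007b010f127b0c0a0d107c890501140a7805090b0d0c06;
   0x1060a0507000109037b90040009010c7b120a077b0d13087b0205030f7ca578780601000809027a07037a040a05;
   0x17a05027a0009017b93080c1278060501027a0304007b9505047a090d0b7b0a0207067c947806117a7802087a04;
   0x1107a0e140f7b0511087b010a09157ca87810007802017a0a007a09080b047a060c037b830f030e7803077a0406;
   0x17a060c7a070a057b850b78060a040801077a030209050b7b867802037a010b7a05097a0004087b841307007a0d;
   0x1100a0f78010502047a08097a0307067b890c150b7a0006087b0e03047b091311147c9d7878000204010b090803;
   0x10109067b940278000a09017a07047a0d027a03087a05060b7b870d7803047a00067a01097a050a7a0c07087b83;
   0x101097a0207047b951117127a060e047b100a077b18050c157ca70e1c22787808070e0c02007a030b040a0d057a;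
   0x10403060c01090b007a08027a0a0d057b98010f0b78090703047a01057a00087a060a027b8f087808007a06037a;
   0x109187a1013177b0e14167b1a1b19117c86161e24780203780603000c050409080d0a7a0e017a02070b7b960978;
   0x17a0203007b97120b0c0d78010800047a05027a0a097a0b07067b910605087a78060403027a05077a0800017b89;
   0x17a267806027804020a7805027a04017a00087a09067a070e0c0f7a0b0d0a7b85780c0a0b0d7a0f047a070e0809;
   0x17c95780209047b0d05017b0607000c7c9b01082007307a1c172b7b181b120f7c1506051d117dc315002e3b1e01;
   0x108067b8505070a0b7a0601087b00040e0c7ca378097803047a06007a0105077b830b07067a08040c7b050a0e00;
   0x1077a0406057b867801067a04027a0503007b8d0e0910077a0506037b0f0c0a087ca77802097804017a02007a07;
   0x10407087a02037a0106057b890a0378060405007a0302017b8704091008027b00010e067cab7878000108027a03;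
   0x1057b8a780b047a06087a03070105097b8b120e0f020c0a050b7b0410037b010607117c8c2822780f0d0c7b7800;
   0x104077a09017a0205067b8b150a050b107a1112027b0c160e007ca82e0424780d78030b040902087a07007a0a01;
   0x108027a090a7a0b060c7b96130678020400067a010903087a05070a7b8f0878010309077a02007a0405087b9178;
   0x104057b877802080a047a01097a0703057b900814090d7a0f0a067b1200167b020b01077ca17878030100040507;
   0x108050a7a020f187b0016097b0b15107b14010e0c7c8f2c1e230c7815047a031078060300077a02087a01097a0a;
   0x10c7a0609057b9c0478050200097a030608047a0b0d7a070a0c7b85121b780a05080b01067a09037a0702007b95;
   0x10009087b8f17067a0305077b0c1b157b1418127b0109087b10020a0e7c9c7878040a02077a010b030d000e7a08;
   0x1080f7c92781378020d7a03057a0a010c070f0b7a06097a0e08047b9819040f780201040a7a0c0703067a050b7a;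
   0x10407067b851b1878030905027a07047a0108007b9714127803017a06007a0704027b8b1700107a05010b7b020d;
   0x12a780c117a190e060a167b78080300017a0c047a07027a0a0b7a0605097b86077805097a0a037a0b007a02087a;
   0x17b850f100878050304067a00087a0701027b830c1a7805017a02037a0600047b8d041517180a7b130d09027c90;
   0x1047a01080b7b891c0e14780a080c02010d7a05067a07047a030b097b98110678020409077a060b03017a080a00;
   0x17a01040a7b901c0d070b7a081b117b101d097b0f0513017c8d2d781b19050078050c020e03097a0a0d0f107a06;
   0x1007a08057a01067a0d097a0b0f0c7b9916190a00037801030a0208077a09067a0504007b8878000603087a0207;
   0x17a19257a16072930117db7787818150c0402141a78000c7a0e090a0607050b047a0d017a0f08037b947802030a;
   0x17b070b06017c9a7804057a03087a020700017caa780904037b00070a017cb17806087a090107007ca610172101;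
   0x1007b8f03070e057a010b7a060f04097ca478030b06020d7b070e087b01050c0a7ca52c152678030a087b050400;
   0x108097b0c010b7b040e0d067c9f78780204080501037a0600077b8e7800017a06057a0703087b8c7805037a0406;
   0x178040300057a0607027b8d021008010d0a7b04060c057ca2780078090602057a08007a0703017b85070f0a7a05;
   0x10d03027b040c010e7cb02b78780a08030504097a07067a0002017b850f097808017a020300057a0407067b9000;
   0x17c910e78060978010307067a04057a08007a09020a7b8a7804017a0506070a7a0300027b89000f100b050a117b;
   0x1057a02037a06077a0801007b917806017a08037a0407057b8f7808027a0103067b9202070b1113067a040e0c0a;
   0x18403147878080203010c0a06007a05047a0b07097b83037808090a007a040302067a0105077b8a0905127a7804;
   0x10506047a01027a070a007b970f7808037a00097a05067a0407027b9004120b7a0d07097b1002137b010a00117c;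
   0x103097a0b04007b8217110e7a1815107b0309077b0216127b041a080f7c821a0609122a78081403057a78080903;
   0x109030e017a00077a0504067b8c010d7a780a0b03087a0c067a020907047a0001057b8e0678080507027a060a7a;
   0x17803097a040c7a08067a070b0a7b9a13030a167a171a7a12150d7b1014097b000711047c8a7878080c0b0a020d;
   0x17a0108067b9178000602087a0b0907047a03057a0e0a0c7b90080c7809037a04057a06017a070a7a0c0b087b88;
   0x10e137a0805117b10150d7b190f1a7b14180b7b041603177c95780b197a780e05070c0a027a03047a00097a0d0b;
   0x1091b78010c04070e0b7a05027a00067a090d7a080a037b8e78030209067a0408050b7a0e077a0d0c0a7b8c0712;
   0x1077a030b7a080c0a7b8c7807017a04007a060c027b8b15041218171a19137a0b161b7b011411077c8f2d780102;
   0x17b8a0d0e78030d070900017a08047a020a7a050b067b91107808010b040a057a03067a0702007b8e7802057a06;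
   0x11c197a0d02047b0910087b140f07037ca9041b7800051c0302780e050f0d7a070b7a080a01007a0c097a040302;
   0x105067a0b027a0c07087b9d1a780008020a7a0b0903047a0607057ba078010b0008070a7a0406097b9a160b157a;
   0x178057801137a0a0c7a05121d067801080c007a09057a040d7a0e027a060a7a0b03077b930e1778010a04000903;
   0x105017a0002047b8309087a0e040d7b0a0c07067c8a0d1b24262b047c05302c177c0a28141f7c2e1512211a7db4;
   0x17b020a057b0c080e7b00100f7b0d060b117caf2220780078070800027a01057a0403067b850b02057a7803067a;
   0x17b7805097800030604090a7a02077a0801057b8804117a0c01107b0b00087b030a0f7b07020d0e7c9278010704;
   0x17a0602087b987809067a05007a0203047b937807037a0409027b960a00120c0f130e020701157c83270f252a19;
   0x1780a0001027a0c040609030b7a0507087b8b061078000a030609017a05047a0702087b8a0d78090100057a0403;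
   0x108057a03017a0002077b85780209010a7a05067a0803007b8400150c047a0d16137b0a140f7b090e17067cab78;
   0x1000903060d070b050c047a0e0a087b8d780e0908057a010d7a040a070b7a0306007b940507111078060a7a0904;
   0x1077b8c7802077a00057a090a7a03010b7b9317130c01120e1b0b7b1a15027b141819107c950c06111c78780201;
   0x17a09027a00030b7b98080478020c000a0b0907037a060d7a0501087b880f0578090a03087a0b067a04027a0100;
   0x1007a090a067b93131719057a0d010f7b0815167b1a070b7b18020e097c847803780406010f7a07050a087a0e0d;
   0x11004057a00087a010c0e7b8c78060f0b0c7a0304020a7a0e087a10090d7b96001b060478010c04057a08077a03;
   0x101007a03047a020a077b8f111c0008027b0b03107b051d137b1a140c0a7c85160978100c78020f060d07097a0b;
   0x1040109070605030d7a00087a0b020e7b830f0478050a00017a080c040709037a06020b7b8b18157808057a0609;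
   0x1017a0407027b9a1a7805027a08007a0107047b8707140c1b081d127b1006150f7c9f7812067a16071b17780c0a;
   0x17a78010709000802040c7a0a0b7a0503067b93170b7807050a0409087a03017a0602007b841378050008097a03;
   0x1383f42432f3a782f1e1807780001160a090d03780900020d05047a030c7a06017a0b087a070e0a7b86190e1c]%code)
   [:: 2; 3; 5; 6; 7];
      Econj [:: 1; 3; 4; 5; 6; 7] 1;
      Econj [:: 0; 2; 4; 5; 6; 7] 0;
      Econj [:: 0; 2; 3; 5; 6; 7] 3;
      Econj [:: 0; 1; 3; 5; 6; 7] 1;
      Econj [:: 0; 2; 3; 4; 6; 7] 4;
      Econj [:: 0; 1; 3; 4; 6; 7] 4;
      Econj [:: 0; 2; 3; 4; 5; 7] 5;
      Econj [:: 0; 1; 2; 4; 6; 7] 2;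
      Econj [:: 0; 1; 3; 4; 5; 7] 5;
      Econj [:: 0; 2; 3; 4; 5; 6] 6;
      Econj [:: 1; 2; 3; 4; 6; 7] 3;
      Econj [:: 0; 1; 2; 4; 5; 7] 5;
      Econj [:: 0; 1; 3; 4; 5; 6] 6;
      Econj [:: 1; 2; 3; 5; 6; 7] 5;
      Econj [:: 1; 2; 3; 4; 5; 7] 5;
      Econj [:: 0; 1; 2; 3; 5; 7] 3;
      Econj [:: 0; 1; 2; 4; 5; 6] 6;
      Econj [:: 1; 2; 3; 4; 5; 6] 6;
      Econj [:: 0; 1; 2; 3; 5; 6] 6;
      Econj [:: 0; 1; 2; 3; 4; 6] 4;
      Ecert [:: 1; 2; 4; 5; 6; 7] (cert_of [::
   0x17d952c27032506382e2d7b200c097b140d39237c1c291d10117d3c36280b007d17010f2f2a7d1f0e1a3b21317e;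
   0x10704020b060d007c930e780103090c0b7b0705087b0206000a7c8703100b151b19007c0207131e7c1704091408;
   0x17a0004067b910c01090d0e7b020a05007c8f780c09057803007a01067a0207057b8a7806017a0207057b850a01;
   0x17b8202780706050809047a0102007b830406057a080a077b090f037b0d0e0b0c7c887803040b7b7805037a0201;
   0x18803077a090a087b050200017c93041719127b080a1c0e7c1a0900061f7dbc78787800060307040a0905020801;
   0x195030c0b7a78077802047a03077a0105067b82050b017a0802047b0306090a7c87157878030405017a0006027b;
   0x1080e0a7a0302047b00050b0f7c927878040203057a01077a0006087b8e02047a03060f7b05000e7b08070d0a7c;
   0x1070c7b06050f7b01090e0a7c960f78077807067a00037a01097a0508027b88090d7800027a06057a0307017b8e;
   0x1087b0a060e017c8978780302050609047a01007a08070a7b8f78070008097a03057a010a067b85020b11087a10;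
   0x101047a06037a0200087b8f020b7801057a000704037a0608027b85071178020504017a0003067b870c097a0f10;
   0x109077c8d091b117a7804020608000105037c891f157a08020f137c040c1c12107d8c7878000478070a7a05097a;
   0x1017c85051e78020a7a0c07017b09050b7b030806047c99787801027a04057a0603007b880a017a030c0b7b0208;
   0x1050c0f067c827878020100047a03057a0607087b8f097801047a06037a0007057b8a0a050e7a0304067b0b0c02;
   0x110010a080b7b09000e7b060d050f7c967801027a7801037a00087a06050704027b8d070e7a0a04097b0d03087b;
   0x17b0f090e7b040608007c9f1a16787801030809070a7a04057a0600027b850704780207030500067a0104087b84;
   0x1027b01090c7b10040e7b11070b137c9b067812780a06070204087a00097a03010b7b8d030a070d110c7b100502;
   0x11a131f177c1d070e0b7c09051b06187d89787806081278010b02057a080a7a04077a0906037b870d0a037a000f;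
   0x17a05017a0307027b8d080d0309047b0a06057b010c07027c970d7809050804037b0b07007b0601020a7c940108;
   0x102780b080d7803067a05027a0107047b847807027a0501047b8b06000e0a077a0405010c7c9b11787808000604;
   0x1057a09087a0a07047b837807037a04067a0a097a0201087b840f007a10067a0e040c7b05090a7b0b0d03087ca0;
   0x1017b871306127a0102077b78050106037a0200047b8d040c7a03110f7b080d090e7c9604100f78780006030201;
   0x17a0c057a0b01077b85100e0a0901047a120d0f7b0513077b110b020c7c8c780a78080b0a047a030509027a0700;
   0x11c1e181900037c0810070e1a7db2167816037a7800087806047a0109020c7a070b7a0805037b887803067a090a;
   0x101050b087ca2780503017b7801027a0003047b8d08047a070a06007c93137802087a0703017b040500067c8c14;
   0x1787800077a04087a06057a0102037b880c00040b087b0d0e077b0201030a7c840c09780907000a047b0602037b;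
   0x10012027c97040f127a051f78030178060804007a02057a0701037b8405007a040e0c7b0b090d7b0706080a7c98;
   0x17878020a010506097a00037a0704087b8a0b7804097a030501067a0802007b870f030e7a0904117b070a067b14;
   0x105090e7c9f7810780a0008090b057a01047a0703027b8f0912007a0502117b030e0c7b07140a7b0f040b087c88;
   0x1332218781b017a0b781201780c04090205007a03087a0b01077b84080713037a0f060d7b140a107b0b110c7b04;
   0x17a78070203087a0601047b99780407087b050300027c8e7804007a060107057ca00f2712000a0224200e7dc01b;
   0x17a020e077b09040a037c8b78000b077b080a027b040905067c9d040878080009070406027b03010a057c87250d;
   0x1060e0d08090b017b04070c057ca5787808067a04017a03027a0007057b8e000b78000502017a0603047b8f0608;
   0x17a05067a0900087b860978000406017a08037a0702057b8c020f06000d0b7b0807107b030e05017c9e22780302;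
   0x17a02067a0501007b920e0a7a78040602037a0105007b8d070c0006037b050109027c85117878010203047a070a;
   0x17b870f017a06110e7b080a0b7b12090d047c9a780d780a0b080304077a02067a0109057b910804117807080304;
   0x104070c09037a050b0a08067b9200077801007a0407060809057a030a027b84030c78030408027a00067a070501;
   0x105097c9b780008057b060407037c897803067a070804057c980d0f037a20250c0e0b12057d8a78787802017a00;
   0x17a0104037b0a0608097c937878050401027a0006037b850a057a0402097b070100067ca11a78070604017a0002;
   0x106007c9e7878020704017a06057a0300087b860c03000a0e7b05070b7b0d1006087c991b1e09067a7807020b05;
   0x107067a040a7a0809057b8207130f0a7a0612107b0b11087b040d05037c8c1815780e0d010a08037a070c7a0410;
   0x105027a07067a0301047b8c0403107a0b01137b000f0e0d7ca5787807020501060803007a090a047b837802037a;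
   0x1117b0d08040a7c83780878090400030b087a0a077a0605027b8b1206057a780405030102077a0600087b890c78;
   0x17b820c7807007a0402090a7a0b067a0803057b94780b070a067a08057a0102047b9205030e071309010b7b1406;
   0x10504067a0301007b88027800057a0401037b8e130b107a070300147ca97878040805097a0b0102030a0706000c;
   0x1027ca878120a780a0305027a090c070b7a0804067b8a0d04057801047a09037a07087a0005067b830f110e7802;
   0x106057a0a030d7b940c077802010a0703057a0b087a0604097b9508110d7a1000157b05090f7b06040a7b0b0114;
   0x1071e267c251b1f05187da878787801030b090e000a0c08067a07057a02040d7b850e78080102077a04090b0c7a;
   0x1057a03017a0002067b880b077a0304097b0a0502017ca6780005097b0603087b0a0701047c8a200e120f277b0c;
   0x1007c857878000308067a05077a0401027b86050e0a0f107b010b067b0c0d07087c83091c0a157a7808007a7804;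
   0x10b077c9978047800057a090804037a0602077b8e0b017802057a00037a0104067b920e0d067a0807027b0a0509;
   0x11a78780a0209007a04077a08060503017b8a01040c03027b7802007a05037a0406017b880d097a0e00057b100f;
   0x10f7808077a090401037a0602007b947802057a00047a0607017b8b13050e7a0a080004077b0c03060b7c86110d;
   0x1087b8c7801067a0703087b8e03077a0d090b0f7a110810047c82780211780702060804007a05037a010a097b96;
   0x1140612780a0509067a01027a08047a0700037b82051378060500037a08027a0107047b907804017a06037a0702;
   0x178010809067a03027a0a04007b897807027a03007a080a017b8e141215050b100306007b110816017ca5027801;
   0x11215170a7c9b7878090300047a070a7a0b087a01057a0c06027b950e02780002030607047a09087a050a017b8c;
   0x1070d7807057a0a0402037a010b7a0908067b8b0503780802090301057a0400067b88160c14100f047b020b0e7b;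
   0x10a147c927878040c010d0508070e02007a03097a0b0a067b957806017a02037a0c050b09070a7a080d0e7b8211;
   0x178030005067a0a027a07087a0904017b92060978030102047a00087a0506077b8400041312017b150c0b7b1108;
   0x17803177800070b030e0a7a0209080c0d017a0406057b8f0578090b0a0c7a060305077a08020d04017b91160e07;
   0x105010b7c9a04271d78050003077a010206087ca01a780401007b030602077ca71b1119217b2628171f237dad78;
   0x1047b0d03000c7c907800070c02057b010a0b7b060403097ca47878000602047a0105037b8a03047a0206097b0c;
   0x100107b0f0b017b04060c7b050a0e0d7c84140c12787800027a05017a08047a0603077b870a077a080b067b0901;
   0x10407057b8a78020004097a07067a080a017b8202090704060d0f7b13120a7b0103050c7c8c0100037803077a02;
   0x192130f780605020104087a0903077b8c03120c110d097b060b077b140108027c88787801030902000a7a08067a;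
   0x10f7a7803017a00057a0604027b8900137a010e097b0a0205087c8f7804780b0106047a0a037a02077a0508097b;
   0x17c890809780d1478030a7a08057a07067a04097a020c0b7b8d100c11067a7808067a050201037a0004077b9403;
   0x10a03070801097a05067a0400027b85780a0705027a03007a0801047b8909050c161310027b0b0f127b04180d06;
   0x104077b900902047a0d160a7b0810037b070600117ca278780b08020601057a0a037a04097a070c007b83080e78;
   0x10b0804010c7a07097a0e030d7b91171378000601080a047a07027a090c0b7b940b050178080501067a02037a09;
   0x10b130e160c01087b04100a7b02110f0d7c92787801050a07040e7a000c7a08027a06097a030d0b7b8e780a0602;
   0x10d087a0b070a7b8b1506187a0703780009080a01057a02047a0703067b8778000a7a03047a08097a0507027b99;
   0x10b037b0f1910117c8d0578007809017a00030206050a7a080d7a0f077a0b0e0c7b9678020c09007a06050f037a;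
   0x108027a07057a0306017b84780a0206087a05037a0100047b8f12070c057a78000402017a0605037b990e167a14;
   0x17a0f027a01077a09087a0e060a7b8b7807007a0e080c0a7a050603097a0d040b7b8c0806187a010478000a0904;
   0x105097b0604037b070208007ca70d187a1c15277b08220e1d7c11101305237d87787800131578000d7a03050b0c;
   0x1010e0b7b1005020d7ca021061a0f7a780b067800037a05017a0402067b8407057a0008097b030a04017c8c780a;
   0x1007a0306087b82070e0f08060c7b0b0a0d7b031002047c9678780401050802037a0706007b85070f7a0a00067b;
   0x18a0e7807007a06047a05027a0108097b8902100d0311047b0f05097b010b0c137c851b20780578090504077a01;
   0x17a03047a0607017b920f117800027a0403057b89040a0c030d12137c8b78780502080a07037a01047a0006097b;
   0x109127c84780678040200057a07037a09017a0a0b067b82780a037a02047a0b067a0508097b8d05090208780005;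
   0x1030b05007a060a7a04027a0701097b8e050a780105060400097a0308027b8f0002067a1101077b04100f7b030b;
   0x1097b95060478000102057a07047a0603087b9b17050e010c7b0d16037b0f0902077c9b120c17047a7808130e78;
   0x1140c197b070d03087ca878780c05020b000a080603047a0701097b8a0014780a077a02087a04007a06017a0305;
   0x1097b8311161778040a020500017a03067a0709087b94057800097a03047a01057a0806077b8613180e0206107b;
   0x10912197ca678780b05040a0e0302097a01007a08077a0d0c067b8b0b78030207017a05067a040c7a0a0d7a0b08;
   0x10b0609020a7a0c017a0503077b937801067a05007a0c087a0207047b99040d0e0f14037a0510157b180b137b0a;
   0x1067a78000104060a0703020e0b7a0d097a080c057b8a780d017a0a040c030e007a0b057a0608027b8e02167800;
   0x109037b8b0c06780208070501037a04067a00090a7b9501171504167b0a000b7b0305127b0f081a077ca10b7800;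
   0x116780d197a110e780203050a060b0d007a0c077a010e7a0908047b8410187800040a0205087a060b7a010c7a07;
   0x1027b0a08037b000609017c862722007801087a0402057b030607097c961529050f210c0a7c19160907137db978;
   0x17b9001037a050c097b0002070b7caa78060478040601037a0002057b8b0c0b7a0708007b0d05010a7c9078070b;
   0x17a0205047b8a0a0c0309010b7b060702057c9a78780207040503007a0801067b8a06047806057a00047a010302;
   0x105027a0700017b850d047a7806017a03057a0004027b880c057a0a02077b090f010b7c9c78000d047800030706;
   0x10407027a0911067b0a0b0c7b0e030f0d7c941b0278780a010405080702037a0600097b9000087a78080603047a;
   0x1017b050e11077c8803231f780078090a060807047a05027a000b037b87080178000209077a05047a0306087b92;
   0x17a0a017a0905037b9678060800057a02077a09040a7b8e060d0b137a7805017a04067a0300027b8512047a020a;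
   0x107047a08067a0003057b9604097a13030c7b01160e7b110d060f7ca0010d7a1c780f08091078000406077a0208;
   0x114037ca778780005090c0b08010607037a040a027b8419780b05090801067a04037a070a027b82100708780102;
   0x10a057a010803027a06047a0009077b990e78020804037a05007a0706017b98090c137a010a127b0b06057b0015;
   0x17878060b08090001020c07037a050e7a040a0d7b8a78060d09010a007a08057a02047a030b0c7b9b110f0d0778;
   0x10e161478080302047a01067a0705007b8a037806087a01027a0504007b86120b180a7a090d017b0f17130c7c8d;
   0x1037a060b017b9b150778000406077a0809020d050b7a010c037b931078060c7a02080b007a04097a050a017b84;
   0x1907807067a0a040b7b9302060d0b131617181419050801077c9978007805007a0f097a0c027a0a047a08077a0d;
   0x1040f127806017a0804020c7a09000b050a7b8578020a7a00067a03077a0b01047b8c7803057a09007a08040c7b;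
   0x1780c027a060e7a0d0508007a040a7a070f7a030b097b8278000d7a0f057a09027a01107a08077a030b047b9215;
   0x10203057b8a157806047a00017a0502037b937801067a0302047b9104061805097a070116107c93201d7a78090c;
   0x10e04057a08097a030c0a7b8f0c0a0278010a0703080c7a0b027a0609047b82191213037a78070408007a06017a;
   0x10616222308140d197d9478781b1a170b14780f037a020c0508060a0e077a0b097a0400017b9078060d7a070102;
   0x1037b0007060a7c91187800037a0401077b050906087ca3780902047b070506087c9e17207804057a0102067ba7;
   0x1087805047a07037a0206007b820509067a0704017b03020b0a7caa787801027a06047a0005037b8b02087a0b01;
   0x178780002010806047a0507037b860f78000306077a0201047b830a08027a070d097b0003100c7c87090e071b78;
   0x17a03077a0504097b830f7802017a07007a0308057b8e7808077a0506047b920a04050e7a03087a090b07067c8d;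
   0x1087a03067a0009027b93080a7807067a03007a0102047b8701090e7a0c00107b020604077c8478007800060802;
   0x105107a0807117b0b0c0d7b15120a037c86150a131f787800057a06037a070802017a0a09047b8d0d7804057a07;
   0x109127b081501057c85780f0e780501080203077a000a0904067b8b7801077a04057a09037a0006087b8306147a;
   0x10b0f157b100107037ca9017814107a0f7801097a060a040705027a0803007b93030b0d7a0e0a027b0407137b0c;
   0x10a0907017a0804007b980d0e7808097a05007a03047a0206017b95110c7800057a07037a0201047b860906087a;
   0x106107a0205087b0a12157b130916077c9f787806090b017a0a047a07007a02037a0c05087b990a780305060b7a;
   0x17a02037a0e0c0a7b8217140b7802080703060a7a050b7a0904017b9a780b020a077a03017a0806007b8f010e0c;
   0x1097a1810157b0003027b0414170e7c9478780005040a060d0b090c077a08020e03017b93780407050609080d0b;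
   0x103017a0b02057b980a010d0b06780300060705027a04017a0a08097b8e05780801070903007a0605047b890813;
   0x10a7b130703197c9310267812780a057a0e027a01097a040f0b067a030d7a080c007b93780e07060d04090a007a;
   0x10c080b7809017a03077a040a7a0b067a0200087b8612140d7a160e057b78010605047a0300027b990f117a0906;
   0x1781810011a78080007057a090e7a0d027a010b06047a0a030c7b8278050d0e0408027a0107090c7a030a067b97;
   0x1ad150678000301067a02070a7b050b09047c870f11181601267b000a1c077c040c22251d7d971e347824297a1e;
   0x111087b10060a127cac20142478030209077a010e7a0508067b0d0a0b0c7c95780901077b0e0c067b0b0004057c;
   0x109087b880d120c7a0904077b05110b7b0e0010087c907878020408057a06037a0100077b8f13097a010e0b7b04;
   0x1077b950409027a00010f7b1106070b7c8f7878080601070a027a04057a0003097b950278010005047a06027a07;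
   0x10378000b01077a060a7a02037a0409057b9212057807087a050904067a0100027b8a0a0d7803007a02047a0501;
   0x102067a07057a030a017b8478060800097a04077a0205037b960c050e037a080a077b0f0d047b060912117cae78;
   0x108057b060e137b0400127b0b0a10147ca0787802090704010b0a057a080c7a0003067b8210137800087a04097a;
   0x102780d7801097a0a020d0b03077a0c067a0504087b830f0c78000b050309027a0a077a0406017b890309027a11;
   0x1947804000a077a01027a0903057b9903070c057a78020503017a0604007b97140f7a1601097b080211047ca112;
   0x10b7a0506037b8c7809080d060c0503017a0e02040b077b900d067a0b007a7809070a007a03017a04080602057b;
   0x107037a0500087b987807037a0604017b991012017a050a130f0d0907067c9b1b7878010d08020e040c070a0009;
   0x17a0b09047b841808047a780a0005027a080604037a0907017b850b7808067a070503047a0209007b8e7809017a;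
   0x1037c8d170827780e7809007a0c0f7a040d060b050e0a087a0103077b821514780d0207007a0a087a03067a010c;
   0x17803020a0809017a07007a0506047b880d78010900057a08047a0203077b8619131b170f097b180a107b080714;
   0x17a010f050710037a0b0c7a0d067a0e080a7b947804030f000d057a0b107a06097a080a017b840c1a110b7a1505;
   0x107017b907806077a02057a0a0b7a0409017b8d12170f16140d1b197b10151c7b11131a0c7caa10780016780900;
   0x106057a020a007b8978050a09037a010b7a08007a0c0d7a0402067b8409180a780b007a02037a06087a05097a0a;
   0x1097a0408067b931b041300031d7b02140a7b071719017c8b21780306010508047803080904070b0c017a0e0d7a;
   0x10d057a0a0209107a0e07007b8b0b0f10150d167a7804010a067a070903087a0002057b881c7801027a03057a07;
   0x17c0b241d14257d847878181a120e08057808010a0e060d7a030f7a10077a0c0b7a0905047b8e7803087a0b0c7a;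
   0x105027b8f0811020b0a7b01050f7b12090c7b0e0003077ca40e1b0a050d077b06112a1c7c2c162b047c28121318;
   0x1077a0304097b94040e78050607027a0004017b930d000a060c087b010902057c8e7878090301040807060a7a00;
   0x10911047b0f00157b0e12060b7c9702261e780b0778000603097a01057a07027a08040a7b920f78060502017a00;
   0x11a20780107021478000601027a050a7a07037a0908047b8a7803077a09027a06087a050a047b850d057a0a0c7a;
   0x10809017a00037a06040a7b9209780709050806010402007b8f19150a7a1a04117b121b0e7b0f050b017cab1f10;
   0x1880107107a15121a7b16170c7b0e05090a7ca578780902000a030507087a06047a0c0b017b8916137807027a05;
   0x102010c04037a0a090b7b96181b780907040b0c017a06037a020a087b850813007801007a020704097a0608037b;
   0x10002067b8d10091500027b0e1a16067ca9787803050b00080c09047a0a0d7a0e077a0206017b93780d08050e06;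
   0x108780304090706057a080b7a0c0a017b8611130f147a78070603017a04087a0200057b8e0d1b7803047a01057a;
   0x1780a017a78000c010e7a020b050903067a0d077a040a087b891878080b0a090c007a01037a020d7a0407067b9b;
   0x18b100513780007080905067a0301027b97020f167a7805037a00047a0106027b8d06031a17007b070d1b0a7c8a;
   0x10f01037b837807097a030b020810017a000a7a0f040e7b8e110e0408780a0b7a02087a05097a04067a07030c7b;
   0x17b8e141015167a010d097b0a111c7b1819137b080b07067ca319781914780e0b0c0607000d027a080a7a10097a;
   0x10e0f020b7a040d017b851b0f78030a010605020d090b007a0c04077b861278060c07047a000a7a010b7a030205;
   0x17a050008027a0601047b8e0a1a1c0717007b1412087b101d03157c8b0378020e00057a1778000c030a05070608;
   0x1050f0c000b017a100a7a07087a0e06027b9005110d047804067a0c0802037a070b7a0109057b8409130b780907;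
   0x17c250c161d7c11261c080d7db4780017780106161b0f1978010f0408090e7a10007a0d0b07057a060a037b9a78;
   0x108057a0706047b840e7806007a04057a0307017b89060d087a0c0a037b0b0109057c8901051e2c247b040a2a1f;
   0x1047b030d0a067ca4107800050378050702017a0300067b90040b097a020a017b070d0c067c9c7878000102037a;
   0x1157878060701047a020a7a00087a0509037b840b7802067a01037a08057a0409077b910c09107a0801007b0e05;
   0x1037800037a06087a09017a0205077b940b057804037a00027a0105067b820611097a0c040d7b020a100f7c9618;
   0x1067a07057a0002037b841309147a0c0f107b0e12070a7c9d132078017800050b0704037a02067a010a097b890e;
   0x128127a2b7808007a0d117806090a0002057a03077a0408017b86050678000804057a07017a0302067b830b7801;
   0x1047a03087a0a0b057b88150e780005010607097a0402037b91041a037a0007187b1711127b0810090a7c820b0e;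
   0x10018147a1101157b0d17027b19050e0f7cab7878030b060c02097a010a7a04057a0007087b8d0c780900020706;
   0x102047a060b7a0801097b8a1678030b090a07027a00067a0c08057b8d0c100378000902037a07057a0601087b88;
   0x11416027b1806057b1a170b107c85787807010803020e04057a0a067a0d0c7a0b09007b950978000d7a0c050a07;
   0x1067b850104190a7800017a0b07030a7a06047a0208057b9478070408067a0a007a0b09057b89091b0e7a15087a;
   0x17b170e14087c8b780078090f08040e067a00037a0b017a0a057a0c020d7b95780f0800090b020c077a0d0e0a03;
   0x10913157801097a00060a047a02057a0708037b9d0d780305000207067a0409017b870b0f167a110c1a7b191218;
   0x102040378040907050a037a0b0f7a0c0e7a02007a0806017b8c780103090f07080c027a060a7a040e0b7b830607;
   0x1057a090a037b900b180c0f7a78010605007a02037a0807047b851a017a131b117b170d147b0405161c7c9b0678;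
   0x10706037a0e0d7a08040b7b8c7805020a0e7a03097a04007a0b0c7a080d077b9415100878010c7a070b00067a02;
   0x17a0405067b8d7800087a0204097b9c091c1b1e100e0f7a150708177c91022378000207091978000a0f0901050c;
   0x17a0a04097b9f1319780801050604027a00077a03090a7b941678060902047a05017a0708037b9a7807017a0203;
   0x17a02147a06057a0d780c020d0b0003080a070f7a090e7a0506047b860c110a7a780b0108027a0607050c7a0300;
   0x11904353d2478272117780300]%code) [:: 2; 4; 5; 6; 7];
      Econj [:: 0; 1; 4; 5; 6; 7] 0;
      Econj [:: 0; 1; 2; 5; 6; 7] 0;
      Econj [:: 0; 3; 4; 5; 6; 7] 3;
      Econj [:: 0; 1; 2; 3; 6; 7] 3;
      Econj [:: 0; 1; 2; 3; 4; 7] 4;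
      Econj [:: 0; 1; 2; 3; 4; 5] 5;
      Ehyp 0 (cert_of [::
   0x14142437f5b393b383a3c3d7f5f32343733361c7f6d2b2c2f152e147f6e0924260d0e0c7f7102011e0506070480;
   0x11a196a6b7d2322216768697e2a29643e65667e3160456153627e4c5c4b4d5d4e7e515246584748497f5640573f;
   0x17a54557a4f507a4a357a442d307b2527287b1d1f20777c161718767c0f0310757c0b080a747c131273116c7d1b;
   0x172706f635e5a59]%code) [:: 2; 3; 4; 5; 6; 7];
      Econj [:: 0; 1; 2; 4; 5; 6; 7] 0;
      Econj [:: 0; 1; 3; 4; 5; 6; 7] 3;
      Econj [:: 0; 1; 2; 3; 5; 6; 7] 3;
      Econj [:: 0; 2; 3; 4; 5; 6; 7] 2;
      Econj [:: 0; 1; 2; 3; 4; 6; 7] 4;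
      Econj [:: 0; 1; 2; 3; 4; 5; 7] 5;
      Econj [:: 0; 1; 2; 3; 4; 5; 6] 6;
      Ecert [:: 0; 1; 2; 3; 4; 5; 6; 7] (cert_of [::
   0x12425267f545b215a1d1e1f7f5857191a1617187f5c531112130f107f604e090a0b0c087f764901020304050080;
   0x12f2d6e6f7d0e36346c6d447e3c3a6a396b3e7e41673f6869387e4665456632337e4a4b622b632c2e7f4f5f515e;
   0x17a50527a4c4d7a47487a4042437b3b3d067b35370d757c313014747c2a281b737c232022727c1c277129707d15;
   0x1077764615d595655]%code) [:: 1; 2; 3; 4; 5; 6; 7]]%N.

Lemma table_E8_ok : cart_ok zops 8 cart_E8 &&
  table_ok zops (BinInt.Z.leb BinNums.Z0) 8 cart_E8 gens_E8 table_E8.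
Proof. by vm_compute. Qed.

Definition signs (F : realFieldType) (t : bool) : seq F := if t then [:: 1; -1] else [:: 1].

Lemma signsP (F : realFieldType) t (s : F) : s \in signs F t -> s = 1 \/ s = -1 /\ t.
Proof.
by case: t; rewrite !inE; [case/orP|] => /eqP ->; [left|right|left].
Qed.

Lemma sign_sq (F : realFieldType) t (s : F) : s \in signs F t -> s * s = 1.
Proof. by case/signsP => [->|[-> _]]; rewrite ?mulrNN mulr1. Qed.

Lemma sign_neq0 (F : realFieldType) t (s : F) : s \in signs F t -> s != 0.
Proof. by case/signsP => [->|[-> _]]; rewrite ?oppr_eq0 oner_eq0. Qed.

(** * Classical types *)

Section Classical.

Variables (F : realFieldType) (k : nat).

Definition form_diff (s : F) (a b : 'I_k) : 'rV[F]_k := delta_mx 0 a - s *: delta_mx 0 b.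

(** For [t] false and full [J] this is the arrangement of type A_k in k coordinates, an additional
    coordinate being set to zero. For [t] true it is type D_k enlarged by the coordinate hyperplanes
    in [J], hence type B_k for full [J]. *)
Definition classical_forms (t : bool) (J : pred 'I_k) : seq 'rV[F]_k :=
  [seq delta_mx 0 a | a <- enum J] ++
  [seq form_diff s p.1 p.2 | s <- signs F t, p <- enum [pred p : 'I_k * 'I_k | p.1 < p.2]%N].

(** A normalization under which proportional forms are equal, so that distinct forms give distinct
    hyperplanes. *)
Definition leading (v : 'rV[F]_k) : Prop :=
  exists a : 'I_k, v 0 a = 1 /\ forall b : 'I_k, (b < a)%N -> v 0 b = 0.

Lemma leading_eq u v : leading u -> leading v -> (u <= v)%MS -> u = v.
Proof.
move=> [a [ua u0]] [b [vb v0]] /sub_rVP [c uv].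
have ab : a = b.
  apply/val_inj/eqP; case: (ltngtP a b) => // lt.
    by have := v0 _ lt; move: ua; rewrite uv mxE => /[swap] ->; rewrite mulr0 => /eqP;
      rewrite eq_sym oner_eq0.
  have := u0 _ lt; rewrite uv mxE vb mulr1 => c0.
  by move: ua; rewrite uv c0 scale0r mxE => /eqP; rewrite eq_sym oner_eq0.
by move: ua; rewrite uv mxE ab vb mulr1 => ->; rewrite scale1r.
Qed.

Lemma form_diff_inj (s s' : F) (a b a' b' : 'I_k) : (a < b)%N -> (a' < b')%N -> s != 0 -> s' != 0 ->
  form_diff s a b = form_diff s' a' b' -> [/\ s = s', a = a' & b = b'].
Proof.
move=> ab ab' s0 s0' E.
have ne : (a == b) = false by apply/negbTE; rewrite neq_ltn ab.
have ne' : (a' == b') = false by apply/negbTE; rewrite neq_ltn ab'.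
have V (r : F) (x y : 'I_k) z : form_diff r x y 0 z = (z == x)%:R - r * (z == y)%:R.
  by rewrite !mxE.
have Ez z : (z == a)%:R - s * (z == b)%:R = (z == a')%:R - s' * (z == b')%:R.
  by rewrite -!V E.
have aa : a = a'.
  apply/eqP; have := Ez a; rewrite eqxx ne mulr0 subr0; case: eqP => // _.
  rewrite sub0r; case: (a =P b') => [ab1|_]; last by rewrite mulr0 oppr0 => /eqP; rewrite oner_eq0.
  have := Ez a'; rewrite eqxx ne' mulr0 subr0; case: (a' =P a) => [aa|_]; first by move: ab'; rewrite aa ab1 ltnn.
  case: (a' =P b) => [ba|_]; last by rewrite mulr0 subr0 => /eqP; rewrite eq_sym oner_eq0.
  by move: ab ab'; rewrite ba ab1 => h1 h2; have := ltn_trans h1 h2; rewrite ltnn.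
have bb : b = b'.
  apply/eqP; have := Ez b; rewrite eqxx -aa [b == a]eq_sym ne mulr1; case: eqP => // _.
  by rewrite mulr0 subr0 sub0r => /eqP; rewrite oppr_eq0 (negPf s0).
split=> //; have := Ez b; rewrite -aa -bb eqxx [b == a]eq_sym ne !mulr1 !sub0r.
exact: oppr_inj.
Qed.

Lemma delta_leading a : leading (delta_mx 0 a).
Proof.
by exists a; rewrite mxE !eqxx; split=> // b lt; rewrite mxE eqxx /= -val_eqE ltn_eqF.
Qed.

Lemma form_diff_leading s (a b : 'I_k) : (a < b)%N -> leading (form_diff s a b).
Proof.
move=> ab; exists a; rewrite !mxE !eqxx /= (_ : (a == b) = false) ?mulr0 ?subr0; last first.
  by apply/negbTE; rewrite neq_ltn ab.
split=> // c ca; rewrite !mxE /= -!val_eqE (ltn_eqF ca) (ltn_eqF (ltn_trans ca ab)).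
by rewrite mulr0 subr0.
Qed.

Lemma classical_formsP t (J : pred 'I_k) (r : 'rV[F]_k) : reflect
  ((exists2 a : 'I_k, J a & r = delta_mx 0 a) \/
   exists s (p : 'I_k * 'I_k), [/\ s \in signs F t, (p.1 < p.2)%N & r = form_diff s p.1 p.2])
  (r \in classical_forms t J).
Proof.
rewrite mem_cat; apply: (iffP orP) => -[].
- by case/mapP => a; rewrite mem_enum => Ja ->; left; exists a.
- by case/allpairsP => -[s p] /= [hs]; rewrite mem_enum => hp ->; right; exists s, p.
- by case=> a Ja ->; left; rewrite map_f // mem_enum.
- case=> s [p [hs hp ->]]; right; apply/allpairsP; exists (s, p); split=> //=.
  by rewrite mem_enum.
Qed.

Lemma classical_arr t J : arr (classical_forms t J).
Proof.
have ld r : r \in classical_forms t J -> leading r.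
  case/classical_formsP => [[a _ ->]|[s [p [_ lt ->]]]]; first exact: delta_leading.
  exact: form_diff_leading.
apply: arrP; last first.
- by move=> u v /ld hu /ld hv; apply: leading_eq.
- move=> r /ld [a [ra _]]; apply: contra_eq_neq ra => ->; rewrite mxE eq_sym; exact: oner_neq0.
rewrite cat_uniq; apply/and3P; split.
- rewrite map_inj_uniq ?enum_uniq // => a b /rowP/(_ a); rewrite !mxE !eqxx /=.
  by case: eqP => // _ /eqP; rewrite oner_eq0.
- apply/hasPn => r /allpairsP [[s p] /= [hs]]; rewrite mem_enum inE => lt ->.
  apply/negP => /mapP [a _] /rowP E; have := E p.2; have := E p.1.
  rewrite !mxE !eqxx /= -!val_eqE /= (ltn_eqF lt) (gtn_eqF lt) mulr0 subr0 mulr1 sub0r.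
  case: eqP => [<-|_]; last by move/eqP; rewrite oner_eq0.
  rewrite (gtn_eqF lt) => _ /eqP; rewrite oppr_eq0; exact/negP/(sign_neq0 hs).
- apply: allpairs_uniq; first by rewrite /signs; case: (t) => //=; rewrite inE andbT eq_sym lt_eqF // (lt_trans (ltrN10 F) ltr01).
    exact: enum_uniq.
  move=> [s p] [s' p'] /allpairsP [[u q] /= [hu hq []]] -> -> /allpairsP.
  move=> [[u' q'] /= [hu' hq' []]] -> ->; rewrite !mem_enum !inE in hq hq'.
  case: q q' hq hq' => [a b] [a' b'] /= hq hq' E.
  by have [-> -> ->] := form_diff_inj hq hq' (sign_neq0 hu) (sign_neq0 hu') E.
Qed.

Lemma size_classical t J :
  size (classical_forms t J) = (#|J| + (if t then 2 else 1) * 'C(k, 2))%N.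
Proof.
rewrite size_cat size_map -cardE size_allpairs -cardE; congr (_ + _ * _)%N; first by case: t.
rewrite -sum1_card (eq_bigl (fun p : 'I_k * 'I_k => true && (p.1 < p.2)%N)) //.
rewrite -(pair_big_dep xpredT (fun i j : 'I_k => (i < j)%N) (fun _ _ => 1%N)) /=.
rewrite (exchange_big_dep xpredT) //= -bin2_sum big_mkord; apply: eq_bigr => j _.
by rewrite (big_ord_narrow (ltnW (ltn_ord j))) sum1_card card_ord.
Qed.

End Classical.

Section ClassicalFree.

Variables (F : realFieldType) (n : nat).
Local Notation X i := ('X_i : {mpoly F[n]}).

Lemma vandermonde_neq0 (R : idomainType) m (Y : 'I_m -> R) :
  injective Y -> \det (\matrix_(i, j) Y j ^+ i) != 0.
Proof.
move=> injY; have := det_Vandermonde (\row_j Y j).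
rewrite (_ : Vandermonde m _ = \matrix_(i, j) Y j ^+ i); last first.
  by apply/matrixP => i j; rewrite !mxE.
move=> ->; apply/prodf_neq0 => i _; apply/prodf_neq0 => j ij; rewrite !mxE subr_eq0.
by apply/eqP => /injY ji; rewrite ji ltnn in ij.
Qed.

Lemma mpolyX_inj : injective (fun i : 'I_n => X i).
Proof.
move=> i j /= /(congr1 (fun p => p@_U_(i)%MM)); rewrite !mcoeffX eqxx.
case: eqP => [/(congr1 (fun m : 'X_{1.. n} => m i))|_ /eqP]; last by rewrite oner_eq0.
by rewrite !mnm1E eqxx; case: eqP => // _ _.
Qed.

Lemma diag_mul_det m (M : 'M[{mpoly F[n]}]_m) (d : 'I_m -> {mpoly F[n]}) :
  \det (\matrix_(i, j) (M i j * d j)) = \det M * \prod_j d j.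
Proof.
rewrite (_ : \matrix_(i, j) _ = M *m diag_mx (\row_j d j)); last first.
  by apply/matrixP => i j; rewrite mul_mx_diag !mxE.
by rewrite det_mulmx det_diag; congr (_ * _); apply: eq_bigr => i _; rewrite mxE.
Qed.

Lemma prodX_neq0 (P : pred 'I_n) : \prod_(i | P i) X i != 0.
Proof. by apply/prodf_neq0 => i _; rewrite -lin_delta lin_eq0; apply/eqP => /rowP/(_ i)/eqP; rewrite !mxE !eqxx oner_eq0. Qed.

Lemma dval_delta m (M : 'M[{mpoly F[n]}]_(m, n)) a i : dval M (delta_mx 0 a) i 0 = M i a.
Proof.
rewrite dvalE (bigD1 a) //= big1 ?addr0 => [|j /negPf ja]; rewrite mxE eqxx ?ja ?scale0r //.
by rewrite eqxx scale1r.
Qed.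

Lemma dval_diff m (M : 'M[{mpoly F[n]}]_(m, n)) s a b i :
  dval M (form_diff s a b) i 0 = M i a - s *: M i b.
Proof.
rewrite -!dval_delta /form_diff !dvalE scaler_sumr -sumrB; apply: eq_bigr => j _.
by rewrite !mxE scalerBl scalerA.
Qed.

Lemma lin_diff s (a b : 'I_n) : lin (form_diff s a b) = X a - s *: X b.
Proof. by rewrite /form_diff linearB linearZ /= !lin_delta. Qed.

(** For the sign -1 an odd exponent lets the sign move inside the power; a difference of powers then
    has the difference of the bases as a factor. *)
Lemma pdvd_powers t s (a b : 'I_n) d : s \in signs F t -> (t -> odd d) ->
  pdvd (lin (form_diff s a b)) (X a ^+ d - s *: X b ^+ d).
Proof.
move=> hs hd; have -> : s *: X b ^+ d = (s *: X b) ^+ d.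
  rewrite exprZn; congr (_ *: _); case: (signsP hs) => [->|[-> /hd od]]; first by rewrite expr1n.
  by rewrite -signr_odd od.
by rewrite lin_diff subrXX; apply: pdvd_mulr; apply: pdvd_refl.
Qed.

Lemma homogX_exp (i : 'I_n) d : X i ^+ d \is d.-homog.
Proof.
have hX : X i \is 1.-homog by rewrite dhomogX /= mdeg1.
by elim: d => [|d IH]; rewrite ?expr0 ?dhomog1 // exprS -add1n; apply: dhomogM.
Qed.

(** The derivations with coefficients [x_j ^ (i + 1)]: their determinant is a Vandermonde
    determinant times the product of the coordinates. *)
Lemma free_typeA : free_exp (classical_forms F (k := n) false xpredT) (iota 1 n).
Proof.
exists (fun i : 'I_n => i.+1); last first.
  by rewrite (iotaDl 1 0) -val_enum_ord -map_comp; apply: perm_refl.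
exists (\matrix_(i < n, j < n) (X j ^+ i.+1)); split.
- by move=> i j; rewrite mxE; apply: homogX_exp.
- move=> r /classical_formsP [[a _ ->]|[s [p [hs _ ->]]]] i.
    by rewrite dval_delta lin_delta mxE exprS; apply: pdvd_mulr; apply: pdvd_refl.
  by rewrite dval_diff !mxE; apply: pdvd_powers hs _.
- rewrite (_ : \matrix_(i, j) _ = \matrix_(i, j) ((\matrix_(i, j) (X j ^+ i)) i j * X j)).
    by rewrite diag_mul_det mulf_neq0 ?prodX_neq0 // vandermonde_neq0 //; apply: mpolyX_inj.
  by apply/matrixP => i j; rewrite !mxE exprSr.
- rewrite size_classical mul1n cardT size_enum_ord -bin2_sum big_mkord.
  under eq_bigr do rewrite -addn1.
  by rewrite big_split /= sum_nat_const card_ord muln1 addnC.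
Qed.

(** The exponents of type D_k enlarged by [j] coordinate hyperplanes: [k - 1 + j] and the odd
    numbers up to [2 k - 3]. *)
Definition exps_typeD (k j : nat) : seq nat :=
  if k is k'.+1 then (k' + j)%N :: [seq i.*2.+1 | i <- iota 0 k'] else [::].

End ClassicalFree.

Lemma prod_if0 (R : comPzRingType) k (c : R) :
  \prod_(i < k.+1) (if i == 0 then c else 1) = c.
Proof. by rewrite big_ord_recl eqxx big1 ?mulr1. Qed.

Section FreeD.

Variables (F : realFieldType) (k' : nat) (J : pred 'I_k'.+1).
Local Notation k := k'.+1.
Local Notation X i := ('X_i : {mpoly F[k]}).

(** Odd powers are tangent to both [x_a - x_b] and [x_a + x_b]. Row 0 has as entry in column [j] the
    product of the coordinates other than [x_j], times [QJ]: entries [a] and [b] combine to a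
    multiple of [x_a - s x_b], and the factor [QJ] makes the row tangent to the coordinate
    hyperplanes in [J]. *)
Lemma free_typeD : free_exp (classical_forms F true J) (exps_typeD k #|J|).
Proof.
pose e (i : 'I_k) := if i == 0 then (k' + #|J|)%N else i.*2.-1.
pose QJ := \prod_(l | J l) X l; pose Q j := \prod_(l | l != j) X l.
have hX (i : 'I_k) : X i \is 1.-homog by rewrite dhomogX /= mdeg1.
have hprod (P : pred 'I_k) : \prod_(l | P l) X l \is #|P|.-homog.
  rewrite -sum1_card; elim/big_rec2: _ => [|i d p _ hp]; first exact: dhomog1.
  by apply: dhomogM.
pose M : 'M[{mpoly F[k]}]_k := \matrix_(i, j) (if i == 0 then Q j * QJ else X j ^+ i.*2.-1).
exists e; last first.
  rewrite (enum_ordSl k') /= {1}/e eqxx perm_cons -map_comp (iotaDl 0 0) -val_enum_ord -map_comp.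
  by rewrite -map_comp (eq_map (g := e \o lift ord0)) // => i; rewrite /e /= doubleS.
exists M; split.
- move=> i j; rewrite mxE /e; case: eqP => _; last first.
    exact: homogX_exp.
  have hc : #|predC1 j| = k' by rewrite cardC1 card_ord.
  by apply: dhomogM; last exact: hprod; have := hprod (predC1 j); rewrite hc.
- move=> r /classical_formsP [[a Ja ->]|[s [p [hs lt ->]]]] i.
    rewrite dval_delta lin_delta mxE; case: eqP => [_|/eqP i0].
      by rewrite /QJ (bigD1 a) //= mulrCA; apply: pdvd_mulr; apply: pdvd_refl.
    rewrite (_ : i.*2.-1 = i.*2.-2.+1) ?exprS; last by have : i != 0%N :> nat by []; lia.
    by apply: pdvd_mulr; apply: pdvd_refl.
  rewrite dval_diff !mxE; case: eqP => [_|/eqP i0]; last first.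
    apply: pdvd_powers hs _ => _; have : i != 0%N :> nat by [].
    by case: (i : nat) => // m _; rewrite doubleS /= odd_double.
  have ne : p.2 != p.1 by rewrite neq_ltn lt orbT.
  rewrite scalerAl -mulrBl; apply: pdvd_mulr; rewrite /Q (bigD1 p.2) //= [Y in _ - _ *: Y](bigD1 p.1) 1?eq_sym //=.
  rewrite (eq_bigl (fun i => (i != p.2) && (i != p.1))) => [|l]; last by rewrite andbC.
  rewrite scalerAl -mulrBl; apply: pdvd_mulr.
  rewrite (_ : _ - _ = - s *: lin (form_diff s p.1 p.2)); first by apply: pdvdZ; apply: pdvd_refl.
  by rewrite lin_diff scalerBr scalerA mulNr (sign_sq hs) !scaleNr scale1r opprK addrC.
(* Multiplying column [j] by [x_j] makes all entries of row 0 equal and turns row [i] into the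
   powers [x_j ^ (2 i)]: up to a factor this is a Vandermonde matrix in the squares. *)
- have E : \det M * \prod_j X j = (\prod_j X j * QJ) * \det (\matrix_(i < k, j < k) (X j ^+ 2) ^+ i).
    rewrite -diag_mul_det.
    rewrite (_ : \matrix_(i, j) _ = diag_mx (\row_i (if i == 0 then \prod_j X j * QJ else 1)) *m
       \matrix_(i < k, j < k) (X j ^+ 2) ^+ i); last first.
      apply/matrixP => i j; rewrite mul_diag_mx !mxE; case: eqP => [->|/eqP i0].
        by rewrite expr0 mulr1 mulrAC (bigD1 j) //= [in RHS](mulrC (X j)).
      rewrite mul1r -exprM -exprSr mul2n; congr (_ ^+ _).
      by have : i != 0%N :> nat by []; case: (i : nat).
    rewrite det_mulmx det_diag; congr (_ * _).
    by rewrite -[RHS](@prod_if0 _ k'); apply: eq_bigr => i _; rewrite mxE.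
  suff : \det M * \prod_j X j != 0 by rewrite mulf_eq0 negb_or => /andP [].
  rewrite E !mulf_neq0 ?prodX_neq0 // vandermonde_neq0 // => i j /eqP.
  rewrite -subr_eq0 subr_sqr mulf_eq0 subr_eq0 => /orP [/eqP /mpolyX_inj //|].
  move/eqP => /(congr1 (fun p => p@_U_(i)%MM)); rewrite mcoeffD !mcoeffX eqxx mcoeff0 => /eqP.
  by rewrite -natrD pnatr_eq0.
- rewrite size_classical big_ord_recl /e eqxx.
  rewrite (eq_bigr (fun i : 'I_k' => i.*2.+1)) => [|i _]; last first.
    by rewrite lift0 doubleS.
  have -> : (\sum_(i < k') i.*2.+1 = 2 * 'C(k', 2) + k')%N.
    rewrite -bin2_sum big_mkord big_distrr /=; under eq_bigr do rewrite -addn1 -mul2n.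
    by rewrite big_split /= sum_nat_const card_ord muln1.
  by rewrite binS bin1; lia.
Qed.

End FreeD.

Section Signed.

Variables (F : realFieldType) (t : bool).

(** [nu] is the invariant of a number under the allowed signs, and [sgn] the sign that recovers the
    number from it. For [t] false the only allowed sign is 1. *)
Definition nu (x : F) : F := if t then `|x| else x.
Definition sgn (x : F) : F := if t then Num.sg x else 1.

Lemma nu_eq0 x : (nu x == 0) = (x == 0).
Proof. by rewrite /nu; case: t; rewrite ?normr_eq0. Qed.

Lemma sgn_nu x : sgn x * nu x = x.
Proof. by rewrite /sgn /nu; case: t; rewrite ?mul1r // -numEsg. Qed.

Lemma sgn_sign x : x != 0 -> sgn x \in signs F t.
Proof.
rewrite /sgn /signs; case: t; rewrite !inE ?eqxx // => x0.
by move: x0; rewrite neq_lt => /orP [] h; rewrite ?(ltr0_sg h) ?(gtr0_sg h) eqxx ?orbT.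
Qed.

Lemma sign_mul s s' : s \in signs F t -> s' \in signs F t -> s * s' \in signs F t.
Proof.
rewrite /signs; case: t; rewrite !inE; [move=> /orP [] /eqP -> /orP [] /eqP ->|move=> /eqP -> /eqP ->];
  by rewrite ?mulrNN ?mul1r ?mulr1 eqxx ?orbT.
Qed.

Lemma sgn_mul x : x != 0 -> sgn x * x = nu x.
Proof. by move=> x0; rewrite -{2}(sgn_nu x) mulrA (sign_sq (sgn_sign x0)) mul1r. Qed.

Lemma nu_sign s x : s \in signs F t -> nu (s * x) = nu x.
Proof.
by case/signsP => [->|[-> ht]]; rewrite ?mul1r // /nu ht mulN1r normrN.
Qed.

Lemma nu_inj x y : nu x = nu y -> y != 0 -> x = (sgn x * sgn y) * y.
Proof. by move=> h y0; rewrite -mulrA sgn_mul // -h sgn_nu. Qed.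

Lemma sgn_sign_mul s x : s \in signs F t -> x != 0 -> sgn (s * x) = s * sgn x.
Proof.
case/signsP => [->|[-> ht]] x0; rewrite ?mul1r // !mulN1r /sgn ht sgrN //.
Qed.

End Signed.

Lemma bool_em (c : bool) : c \/ ~~ c.
Proof. by case: c; [left|right]. Qed.

Definition odds k := [seq i.*2.+1 | i <- iota 0 k].

Lemma oddsS k : odds k.+1 = rcons (odds k) k.*2.+1.
Proof. by rewrite /odds -addn1 iotaD map_cat cats1. Qed.

Lemma odds_le k m : m \in odds k -> (m.+1 <= k.*2)%N.
Proof. by case/mapP => i; rewrite mem_iota => lt ->; lia. Qed.

Lemma exps_full k : perm_eq (exps_typeD k k) (odds k).
Proof.
case: k => // k; rewrite oddsS perm_sym /exps_typeD (_ : (k + k.+1 = k.*2.+1)%N); last by lia.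
by rewrite perm_rcons.
Qed.

Section ClassicalFlats.

Variables (F : realFieldType) (n : nat) (t b : bool).
Hypothesis tb : t || b.

Local Notation nu := (nu (F := F) t).
Local Notation sgn := (sgn (F := F) t).

(* Types A, B and D are [(t, b)] = (false, true), (true, true) and (true, false). *)
Definition cl_form (r : 'rV[F]_n) : Prop :=
  (b /\ exists i, r = delta_mx 0 i) \/
  exists s i j, [/\ s \in signs F t, i != j & r = form_diff s i j].

Implicit Types (x : 'cV[F]_n) (w : F).

Definition vals (x : 'cV[F]_n) : seq F :=
  undup [seq nu (x i 0) | i <- enum 'I_n & x i 0 != 0].

Lemma valsP x w : reflect (exists2 i, x i 0 != 0 & nu (x i 0) = w) (w \in vals x).
Proof.
rewrite mem_undup; apply: (iffP mapP) => [[i]|[i xi <-]].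
  by rewrite mem_filter => /andP [xi _] ->; exists i.
by exists i; rewrite // mem_filter xi mem_enum.
Qed.

Lemma vals_uniq x : uniq (vals x).
Proof. exact: undup_uniq. Qed.

Lemma vals_neq0 x w : w \in vals x -> w != 0.
Proof. by case/valsP => i xi <-; rewrite nu_eq0. Qed.

Definition has0 (x : 'cV[F]_n) := [exists i, x i 0 == 0].
Definition bsize (x : 'cV[F]_n) w := #|[pred i | nu (x i 0) == w]|.
(** Whether the coordinate hyperplane of the block [w] occurs in the restriction: from a coordinate
    form, from a pair with a zero coordinate, or from a sum or difference within a block of at least
    two coordinates. *)
Definition Jv x w := [|| b, has0 x | (1 < bsize x w)%N].
(** In type D a lone zero coordinate varies freely on the flat of [x], since no root vanishing at
    [x] involves it. Such points are set aside here and replaced by others in [hacc_classical]. *)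
Definition nolone (x : 'cV[F]_n) :=
  b \/ forall i, x i 0 = 0 -> exists2 j, j != i & x j 0 = 0.

Lemma form_diffE s (i j : 'I_n) k (P : 'M[F]_(n, k)) :
  form_diff s i j *m P = row i P - s *: row j P.
Proof. by rewrite mulmxBl -scalemxAl -!rowE. Qed.

Lemma form_diff_eq0 s (i j : 'I_n) (x : 'cV[F]_n) :
  form_diff s i j *m x = 0 <-> x i 0 = s * x j 0.
Proof.
rewrite form_diffE; split=> [/rowP/(_ 0)/eqP|h].
  by rewrite !mxE subr_eq0 => /eqP.
by apply/rowP => z; rewrite !ord1 !mxE h subrr.
Qed.

Lemma delta_eq0 (i : 'I_n) (x : 'cV[F]_n) :
  (delta_mx 0 i : 'rV_n) *m x = 0 <-> x i 0 = 0.
Proof.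
rewrite -rowE; split=> [/rowP/(_ 0)|h]; first by rewrite !mxE.
by apply/rowP => z; rewrite !ord1 !mxE.
Qed.

Section Flat.

Variable x : 'cV[F]_n.
Hypothesis hx : nolone x.

Let k := size (vals x).
Let val (a : 'I_k) := nth 0 (vals x) a.

Definition Jk : pred 'I_(size (vals x)) := fun a => Jv x (nth 0 (vals x) a).

Definition Pcl : 'M[F]_(n, size (vals x)) :=
  \matrix_(i, a) (if nu (x i 0) == nth 0 (vals x) a then sgn (x i 0) else 0).

Lemma row_zero i : x i 0 = 0 -> row i Pcl = 0.
Proof.
move=> xi; apply/rowP => a; rewrite row0E !mxE; case: eqP => // E.
have /vals_neq0 : nth 0 (vals x) a \in vals x by apply: mem_nth.
by rewrite -E xi nu_eq0 eqxx.
Qed.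

Lemma row_nonzero i : x i 0 != 0 ->
  exists2 a : 'I_k, val a = nu (x i 0) & row i Pcl = sgn (x i 0) *: delta_mx 0 a.
Proof.
move=> xi; have iv : nu (x i 0) \in vals x by apply/valsP; exists i.
have ik : (index (nu (x i ord0)) (vals x) < k)%N by rewrite index_mem.
exists (Ordinal ik); first by rewrite /val nth_index.
apply/rowP => a; rewrite row0E !mxE eqxx /= -{1}(nth_index 0 iv) nth_uniq ?vals_uniq //.
by rewrite eq_sym -val_eqE /=; case: eqP => _; rewrite ?mulr1 ?mulr0.
Qed.

Lemma val_rep (a : 'I_k) : exists2 i, x i 0 != 0 & row i Pcl = sgn (x i 0) *: delta_mx 0 a.
Proof.
have /valsP [i xi iE] : val a \in vals x by apply: mem_nth.
exists i => //; have [a' a'E ->] := row_nonzero xi; congr (_ *: delta_mx _ _).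
have : val a' == val a by rewrite a'E iE.
by rewrite /val nth_uniq ?vals_uniq // => /eqP /ord_inj.
Qed.

(** Coordinates in the same block are tied by a sign on the whole flat, so one representative
    [rep a] per block determines the vector. *)
Lemma flat_Pcl : flat cl_form x Pcl.
Proof.
have H (a : 'I_k) : exists i, x i 0 != 0 /\ row i Pcl = sgn (x i 0) *: delta_mx 0 a.
  by have [i h1 h2] := val_rep a; exists i.
have [rep hrep] := fin_all_exists H.
split.
  apply/row_fullP; exists (\matrix_(a, i) (sgn (x i 0) * (i == rep a)%:R)).
  apply/row_matrixP => a; rewrite row_mul row1.
  have -> : row a (\matrix_(a0, i) (sgn (x i 0) * (i == rep a0)%:R)) =
      sgn (x (rep a) 0) *: delta_mx 0 (rep a).
    apply/rowP => i; rewrite !mxE eqxx /=; case: eqP => [->|_] //.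
    by rewrite !mulr0.
  have [x0 rE] := hrep a; rewrite -scalemxAl -rowE rE scalerA (sign_sq (sgn_sign _ x0)) scale1r.
  by [].
move=> v; split=> [h|[z ->]].
  exists (\col_a (sgn (x (rep a) 0) * v (rep a) 0)); apply/row_matrixP => i; rewrite row_mul.
  have [xi|xi] := eqVneq (x i 0) 0.
    rewrite row_zero // mul0mx; apply/rowP => z; rewrite !ord1 row0E mxE.
    (* Two coordinates vanishing at [x] are tied by [v_i = v_j] and, without coordinate forms, by
       [v_i = - v_j] as well, so both are zero on the flat. *)
    case: hx => [hb|/(_ i xi) [j ji xj]].
      by apply/delta_eq0; apply: h; [left; split=> //; exists i|apply/delta_eq0].
    have h1 : v i 0 = 1 * v j 0.
      apply/form_diff_eq0; apply: h; last by apply/form_diff_eq0; rewrite xi xj mulr0.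
      by right; exists 1, i, j; rewrite eq_sym; split=> //; rewrite /signs; case: (t); rewrite mem_head.
    case: (boolP b) => hb.
      by apply/delta_eq0; apply: h; [left; split=> //; exists i|apply/delta_eq0].
    have ht : t by move: tb; rewrite (negPf hb) orbF.
    have h2 : v i 0 = -1 * v j 0.
      apply/form_diff_eq0; apply: h; last by apply/form_diff_eq0; rewrite xi xj mulr0.
      by right; exists (-1), i, j; rewrite eq_sym; split=> //; rewrite /signs ht !inE eqxx orbT.
    apply/eqP; move: h2; rewrite mulN1r -[v j 0]mul1r -h1 => /eqP; rewrite -subr_eq0 opprK.
    by rewrite -mulr2n mulrn_eq0.
  have [a aE ->] := row_nonzero xi; have [xr rE] := hrep a.
  rewrite -scalemxAl -rowE; apply/rowP => z; rewrite !ord1 !mxE mulrA.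
  have nE : nu (x i 0) = nu (x (rep a) 0).
    have [a' a'E] := row_nonzero xr; rewrite rE => /rowP/(_ a); rewrite !mxE !eqxx /=.
    case: eqP => [E|_]; first by rewrite -aE -a'E -E.
    by rewrite mulr1 mulr0 => /eqP; rewrite (negPf (sign_neq0 (sgn_sign _ xr))).
  have [->|ne] := eqVneq i (rep a); first by rewrite (sign_sq (sgn_sign _ xr)) mul1r.
  apply/form_diff_eq0; apply: h; last by apply/form_diff_eq0; apply: nu_inj.
  by right; exists (sgn (x i 0) * sgn (x (rep a) 0)), i, (rep a); split=> //; apply: sign_mul; apply: sgn_sign.
move=> r [[hb [i ->]]|[s [i [j [hs ij ->]]]]].
  by move/delta_eq0 => xi; rewrite mulmxA -rowE row_zero // mul0mx.
move/form_diff_eq0 => xij; rewrite mulmxA form_diffE.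
have [xj|xj] := eqVneq (x j 0) 0.
  by rewrite !row_zero ?xij ?xj ?mulr0 // scaler0 subr0 mul0mx.
rewrite (_ : row i Pcl = s *: row j Pcl) ?subrr ?mul0mx //.
apply/rowP => a; rewrite !mxE xij nu_sign //; case: eqP => _; last by rewrite mulr0.
exact: sgn_sign_mul.
Qed.

Lemma cl_formN s i j : s \in signs F t -> i != j -> cl_form (form_diff s i j).
Proof. by move=> hs ij; right; exists s, i, j. Qed.

Lemma restr_Pcl : restr_to cl_form Pcl (classical_forms F t Jk).
Proof.
split; first exact: classical_arr.
- have deltaJ a c : Jk a ->
      exists2 l, l \in classical_forms F t Jk & (c *: (delta_mx 0 a : 'rV[F]_k) <= l)%MS.
    move=> Ja; exists (delta_mx 0 a); last exact: scalemx_sub.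
    by apply/(classical_formsP t Jk); left; exists a.
  move=> r [[hb [i ->]]|[s [i [j [hs ij ->]]]]].
    rewrite -rowE; have [xi|xi] := eqVneq (x i 0) 0; first by left; apply: row_zero.
    by right; have [a _ ->] := row_nonzero xi; apply: deltaJ; rewrite /Jk /Jv hb.
  rewrite form_diffE; have [xi|xi] := eqVneq (x i 0) 0; have [xj|xj] := eqVneq (x j 0) 0.
  + by left; rewrite !row_zero // scaler0 subr0.
  + right; have [a _ ->] := row_nonzero xj; rewrite row_zero // sub0r scalerA -scaleNr.
    by apply: deltaJ; rewrite /Jk /Jv; apply/or3P; constructor 2; apply/existsP; exists i; apply/eqP.
  + right; have [a _ ->] := row_nonzero xi; rewrite row_zero // scaler0 subr0.
    by apply: deltaJ; rewrite /Jk /Jv; apply/or3P; constructor 2; apply/existsP; exists j; apply/eqP.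
  have [a aE ->] := row_nonzero xi; have [a' a'E ->] := row_nonzero xj; rewrite scalerA.
  have hsi := sgn_sign t xi; have hsj := sgn_sign t xj.
  pose s' := s * (sgn (x i 0) * sgn (x j 0)).
  have hs' : s' \in signs F t by apply: sign_mul => //; apply: sign_mul.
  right; case: (ltngtP a a') => [lt|lt|/val_inj E].
  * exists (form_diff s' a a'); first by apply/(classical_formsP t Jk); right; exists s', (a, a').
    rewrite (_ : _ - _ = sgn (x i 0) *: form_diff s' a a') ?scalemx_sub //.
    rewrite scalerBr scalerA; congr (_ - _ *: _).
    by rewrite /s' mulrCA (mulrA (sgn (x i 0))) (sign_sq hsi) mul1r.
  * exists (form_diff s' a' a); first by apply/(classical_formsP t Jk); right; exists s', (a', a).
    rewrite (_ : _ - _ = - (s * sgn (x j 0)) *: form_diff s' a' a) ?scalemx_sub //.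
    rewrite scalerBr scalerA mulNr !scaleNr opprK [in RHS]addrC /s'; congr (_ *: _ - _).
    by rewrite mulrACA (sign_sq hs) mul1r mulrCA (sign_sq hsj) mulr1.
  * rewrite -E -scalerBl; case: (bool_em t) => ht; last first.
      by apply: deltaJ; rewrite /Jk /Jv; move: tb; rewrite (negPf ht) /= => ->.
    apply: deltaJ; rewrite /Jk /Jv; apply/or3P; constructor 3.
    rewrite /bsize (cardD1 i) (cardD1 j) !inE -/(val a) aE eqxx -aE E a'E eqxx eq_sym ij.
    by [].
- move=> l /(classical_formsP t Jk) [[a Ja ->]|[s [[a a'] /= [hs lt ->]]]].
    have [i xi iE] := val_rep a; have hsi := sgn_sign t xi.
    have dE c : c != 0 -> ((delta_mx 0 a : 'rV[F]_k) <= c *: (delta_mx 0 a : 'rV[F]_k))%MS.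
      by move=> c0; rewrite (eqmx_scale _ c0) submx_refl.
    have s1 : 1 \in signs F t by rewrite /signs; case: (t); rewrite mem_head.
    case/or3P: Ja => [hb|/existsP [j /eqP xj]|].
    - exists (delta_mx 0 i); first by left; split=> //; exists i.
      by rewrite -rowE iE; apply: dE; apply: sign_neq0 hsi.
    - exists (form_diff 1 i j).
        by apply: cl_formN => //; apply: contraNneq xi => ->; rewrite xj.
      by rewrite form_diffE iE row_zero // scaler0 subr0; apply: dE; apply: sign_neq0 hsi.
    - have aE : nu (x i 0) = val a.
        have [a' <- ] := row_nonzero xi; rewrite iE => /rowP/(_ a); rewrite !mxE !eqxx /=.
        case: eqP => [->|_] //; rewrite mulr1 mulr0 => /eqP; by rewrite (negPf (sign_neq0 hsi)).
      rewrite /bsize (cardD1 i) inE -/(val a) -aE eqxx ltnS => /card_gt0P [j].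
      rewrite !inE => /andP [ji /eqP jE].
      have xj : x j 0 != 0 by rewrite -(nu_eq0 t) jE nu_eq0.
      have [a' a'E jR] := row_nonzero xj; have aa : a' = a.
        have : val a' == val a by rewrite a'E jE aE.
        by rewrite /val nth_uniq ?vals_uniq // => /eqP /ord_inj.
      have hsj := sgn_sign t xj.
      case: (boolP b) => hb.
        exists (delta_mx 0 i); first by left; split=> //; exists i.
        by rewrite -rowE iE; apply: dE; apply: sign_neq0 hsi.
      have ht : t by move: tb; rewrite (negPf hb) orbF.
      have sN : -1 \in signs F t by rewrite /signs ht !inE eqxx orbT.
      exists (form_diff (-1 * (sgn (x i 0) * sgn (x j 0))) i j).
        by apply: cl_formN; rewrite 1?eq_sym //; apply: sign_mul => //; apply: sign_mul.
      rewrite form_diffE iE jR aa scalerA -!mulrA (sign_sq hsj) mulr1 mulN1r scaleNr opprK.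
      by rewrite -scalerDl; apply: dE; rewrite -mulr2n mulrn_eq0 /= (sign_neq0 hsi).
  have [i xi iE] := val_rep a; have [j xj jE] := val_rep a'.
  have hsi := sgn_sign t xi; have hsj := sgn_sign t xj.
  pose s' := s * (sgn (x i 0) * sgn (x j 0)).
  have hs' : s' \in signs F t by apply: sign_mul => //; apply: sign_mul.
  exists (form_diff s' i j).
    apply: cl_formN => //; apply: contraTneq lt => ij; rewrite -ij in jE.
    suff -> : a = a' by rewrite ltnn.
    move: jE; rewrite iE => /rowP/(_ a); rewrite !mxE !eqxx /=.
    by case: eqP => // _; rewrite mulr1 mulr0 => /eqP; rewrite (negPf (sign_neq0 hsi)).
  rewrite form_diffE iE jE (_ : _ - _ = sgn (x i 0) *: form_diff s a a').
    rewrite (eqmx_scale _ (sign_neq0 hsi)) submx_refl //.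
  rewrite scalerBr !scalerA /s'; congr (_ - _ *: _).
  by rewrite -!mulrA (sign_sq hsj) mulr1 mulrC.
Qed.

End Flat.

End ClassicalFlats.

Section ClassicalChains.

Variables (F : realFieldType) (n : nat) (t b : bool).
Hypothesis tb : t || b.
Hypothesis n2 : b || (1 < n)%N.

Local Notation nu := (nu (F := F) t).
Local Notation cl_form := (cl_form (F := F) (n := n) t b).
Local Notation vals := (vals (n := n) t).
Local Notation Jv := (Jv t b).
Implicit Types (x : 'cV[F]_n) (w : F).

Definition cl_exps x : seq nat :=
  if t then exps_typeD (size (vals x)) (count (Jv x) (vals x)) else iota 1 (size (vals x)).

Lemma cl_expsT x : t -> cl_exps x = exps_typeD (size (vals x)) (count (Jv x) (vals x)).
Proof. by rewrite /cl_exps => ->. Qed.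

Lemma cl_expsF x : ~~ t -> cl_exps x = iota 1 (size (vals x)).
Proof. by rewrite /cl_exps => /negPf ->. Qed.

Lemma card_Jk x : #|@Jk F n t b x| = count (Jv x) (vals x).
Proof.
by rewrite -sum1_card -sum1_count (big_nth 0) big_mkord.
Qed.

Lemma cl_free x : nolone b x -> free_at cl_form x (cl_exps x).
Proof.
move=> hx; exists (size (vals x)), (Pcl t x), (classical_forms F t (@Jk F n t b x)); split.
- exact: flat_Pcl.
- exact: restr_Pcl.
case: (bool_em t) => ht.
  rewrite cl_expsT // -card_Jk; have ht' : t = true := ht.
  move: (@Jk F n t b x); case: (size (vals x)) => [|k] J; last by rewrite ht'; exact: free_typeD.
  rewrite (_ : classical_forms _ _ _ = [::]); first exact: free_exp0.
  by apply/size0nil; rewrite size_classical eq_card0 ?muln0 // => -[].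
have hb : b by move: tb; rewrite (negPf ht).
rewrite cl_expsF //.
rewrite (_ : classical_forms _ _ _ = classical_forms F false xpredT); first exact: free_typeA.
rewrite /classical_forms /signs (negPf ht); congr (map _ _ ++ _); apply: eq_enum => a.
by rewrite -!topredE /= /Jk /Jv hb.
Qed.

Definition kill w x : 'cV[F]_n := \col_i (if nu (x i 0) == w then 0 else x i 0).

Lemma kill_vals w x : perm_eq (vals (kill w x)) (rem w (vals x)).
Proof.
apply: uniq_perm; rewrite ?rem_uniq ?vals_uniq // => w'.
rewrite mem_rem_uniq ?vals_uniq // inE; apply/valsP/andP => [[i]|[ne /valsP [i xi iE]]].
  rewrite !mxE; case: (nu (x i 0) =P w) => [_|/eqP ne xi <-]; first by rewrite eqxx.
  by split=> //; apply/valsP; exists i.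
by exists i; rewrite !mxE iE (negPf ne).
Qed.

Lemma nu_opp_sign s (y z : F) : s \in signs F t -> y = s * z -> nu y = nu z.
Proof. by move=> hs ->; apply: nu_sign. Qed.

Lemma kill_flat w x : w != 0 -> in_flat cl_form x (kill w x).
Proof.
move=> w0 r [[hb [i ->]]|[s [i [j [hs ij ->]]]]].
  by move/delta_eq0 => xi; apply/delta_eq0; rewrite mxE xi if_same.
move/form_diff_eq0 => xij; apply/form_diff_eq0; rewrite !mxE (nu_opp_sign hs xij).
by case: eqP => _; rewrite ?mulr0.
Qed.

Lemma kill_has0 w x : w \in vals x -> has0 (kill w x).
Proof. by case/valsP => i xi iE; apply/existsP; exists i; rewrite mxE iE eqxx. Qed.

Lemma kill_nolone w x : w \in vals x -> nolone b x -> Jv x w -> nolone b (kill w x).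
Proof.
move=> wx hx; case/or3P => [hb|/existsP [z /eqP xz]|big]; first by left.
  case: hx => [hb|hx]; [by left|right=> i]; rewrite mxE.
  have [iE _|ne xi] := eqVneq (nu (x i 0)) w.
    exists z; last by rewrite mxE xz if_same.
    by apply: contraTneq (vals_neq0 wx) => zi; rewrite -iE -zi xz negbK nu_eq0.
  by have [j ji xj] := hx i xi; exists j; rewrite // mxE xj if_same.
right=> i _; have [j [ji jE]] : exists j, j != i /\ nu (x j 0) == w.
  pose B := [pred i0 | nu (x i0 0) == w].
  have : (1 < #|B|)%N by []; rewrite (cardD1 i) => big'.
  have /card_gt0P [j] : (0 < #|[predD1 B & i]|)%N.
    by move: big'; case: (i \in B); rewrite ?add0n ?add1n ?ltnS // => /ltnW.
  by rewrite !inE => /andP [ji jE]; exists j.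
by exists j; rewrite // mxE jE.
Qed.

Lemma count_all_true (T : eqType) (p : pred T) s : {in s, forall z, p z} -> count p s = size s.
Proof. by move=> h; apply/eqP; rewrite -all_count; apply/allP. Qed.

Lemma cl_exps_has0 x : has0 x -> t -> perm_eq (cl_exps x) (odds (size (vals x))).
Proof.
move=> x0 ht; rewrite cl_expsT // count_all_true ?exps_full // => w _.
by rewrite /Jv x0 orbT.
Qed.

(** When at least [k] of the [k + 1] blocks have their coordinate hyperplane, the exponent
    [k + count] exceeds the odd ones. Setting such a block to zero makes all coordinate hyperplanes
    occur in the new restriction, which is of type B and has the odd numbers as exponents. In type A
    any block serves, as the exponents are consecutive. *)
Lemma kill_step x k : nolone b x -> size (vals x) = k.+1 ->
  (t -> exists2 w, w \in vals x & Jv x w) -> (t -> k <= count (Jv x) (vals x))%N ->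
  exists x' e, [/\ in_flat cl_form x x', nolone b x', size (vals x') = k,
    perm_eq (cl_exps x) (e :: cl_exps x') & all (fun m => m <= e)%N (cl_exps x')].
Proof.
move=> hx sk ex big; have [w wx Jw] : exists2 w, w \in vals x & Jv x w.
  case: (bool_em t) => [/ex //|ht]; case: (vals x) sk => // w s _; exists w; rewrite ?mem_head //.
  by move: tb; rewrite /Jv (negPf ht) /= => ->.
have sk' : size (vals (kill w x)) = k by rewrite (perm_size (kill_vals w x)) size_rem // sk.
case: (bool_em t) => ht; last first.
  exists (kill w x), k.+1; split=> //; [exact/kill_flat/(vals_neq0 wx)|exact: kill_nolone|..].
    by rewrite !cl_expsF // sk sk' -[k.+1]addn1 iotaD perm_catC addnC addn1.
  by rewrite cl_expsF // sk'; apply/allP => m; rewrite mem_iota; lia.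
exists (kill w x), (k + count (Jv x) (vals x))%N.
have pe := cl_exps_has0 (kill_has0 wx) ht; rewrite sk' in pe.
split=> //; [exact/kill_flat/(vals_neq0 wx)|exact: kill_nolone|..].
  by rewrite [cl_exps x]cl_expsT // sk /exps_typeD perm_cons perm_sym.
rewrite (perm_all _ pe); apply/allP => m /odds_le.
by have := big ht; lia.
Qed.

(** Now the largest exponent is the largest odd one. Two blocks without coordinate hyperplane are
    single coordinates, and no coordinate is zero; identifying the two creates one block with a
    coordinate hyperplane. There is one block less and one coordinate hyperplane more, so the
    exponent [k + count] survives and the largest odd one disappears. *)
Lemma merge_step x k : nolone b x -> size (vals x) = k.+1 -> t ->
  (count (Jv x) (vals x) < k)%N ->
  exists x' e, [/\ in_flat cl_form x x', nolone b x', size (vals x') = k,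
    perm_eq (cl_exps x) (e :: cl_exps x') & all (fun m => m <= e)%N (cl_exps x')].
Proof.
move=> hx sk ht small.
have [w1 [w2 [w1x w2x w12 J1 J2]]] : exists w1 w2,
    [/\ w1 \in vals x, w2 \in vals x, w1 != w2, ~~ Jv x w1 & ~~ Jv x w2].
  have : (1 < size (filter (predC (Jv x)) (vals x)))%N.
    by rewrite size_filter; have := count_predC (Jv x) (vals x); rewrite sk; lia.
  have := filter_uniq (predC (Jv x)) (vals_uniq t x).
  have : {subset filter (predC (Jv x)) (vals x) <= [pred w | (w \in vals x) && ~~ Jv x w]}.
    by move=> w; rewrite mem_filter inE andbC.
  case: filter => [|w1 [|w2 s]] // sub /= /andP [w1s _] _; exists w1, w2.
  have /andP [h1 h2] := sub _ (mem_head _ _).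
  have /andP [h3 h4] : w2 \in [pred w | (w \in vals x) && ~~ Jv x w].
    by apply: sub; rewrite !inE eqxx orbT.
  by split=> //; move: w1s; rewrite inE negb_or => /andP [].
have [hb z0] : ~~ b /\ ~~ has0 x by move: J1; rewrite /Jv !negb_or => /and3P [].
have xn0 i : x i 0 != 0 by apply: contraNneq z0 => xi; apply/existsP; exists i; rewrite xi.
have single w i j : ~~ Jv x w -> nu (x i 0) = w -> nu (x j 0) = w -> i = j.
  rewrite /Jv (negPf hb) (negPf z0) /= -leqNgt => le1 iE jE.
  by apply: (card_le1_eqP le1); rewrite inE ?iE ?jE eqxx.
have /valsP [i1 _ i1E] := w1x; have /valsP [i2 _ i2E] := w2x.
have ne12 : i1 != i2 by apply: contra_neq w12 => E; rewrite -i1E -i2E E.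
pose x' : 'cV[F]_n := \col_i (if i == i2 then x i1 0 else x i 0).
have x'E i : nu (x' i 0) = if i == i2 then w1 else nu (x i 0) by rewrite mxE; case: eqP.
have x'n0 i : x' i 0 != 0 by rewrite mxE; case: ifP.
have pv : perm_eq (vals x') (rem w2 (vals x)).
  apply: uniq_perm; rewrite ?rem_uniq ?vals_uniq // => w.
  rewrite mem_rem_uniq ?vals_uniq // inE; apply/valsP/andP => [[i _]|[ne /valsP [i xi iE]]].
    rewrite x'E; case: eqP => [_ <-|/eqP ne <-]; first by rewrite w12.
    split; last by apply/valsP; exists i.
    by apply: contraNneq ne => E; apply/eqP; apply: (single w2).
  exists i => //; rewrite x'E; case: eqP => // ii; rewrite ii i2E in iE.
  by rewrite iE eqxx in ne.
have z0' : ~~ has0 x' by apply/existsP => -[i]; rewrite (negPf (x'n0 i)).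
have sk' : size (vals x') = k by rewrite (perm_size pv) size_rem // sk.
have bs w : w != w1 -> w != w2 -> Jv x' w = Jv x w.
  move=> n1 n2'; rewrite /Jv (negPf z0) (negPf z0') (negPf hb) /=; congr (1 < _)%N.
  apply: eq_card => i; rewrite !inE x'E; case: (i =P i2) => [->|//].
  by rewrite i2E eq_sym (negPf n1) eq_sym (negPf n2').
have J1' : Jv x' w1.
  apply/or3P; constructor 3; rewrite /bsize (cardD1 i1) (cardD1 i2) !inE !x'E eqxx.
  by rewrite (negPf ne12) i1E eqxx eq_sym ne12.
have cnt : count (Jv x') (vals x') = (count (Jv x) (vals x)).+1.
  have w1r : w1 \in rem w2 (vals x) by rewrite mem_rem_uniq ?vals_uniq // inE w12.
  rewrite (seq.permP pv) (seq.permP (perm_to_rem w1r)) /= J1' add1n; congr _.+1.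
  rewrite (seq.permP (perm_to_rem w2x)) /= (negPf J2) add0n.
  rewrite [RHS](seq.permP (perm_to_rem w1r)) /= (negPf J1) add0n.
  apply: eq_in_count => w; rewrite mem_rem_uniq ?rem_uniq ?vals_uniq // inE => /andP [n1].
  by rewrite mem_rem_uniq ?vals_uniq // inE => /andP [n2' _]; apply: bs.
case: k sk sk' small => // k sk sk' small.
exists x', k.*2.+1; split=> //.
- move=> r [[hb' _]|[s [i [j [hs ij ->]]]]]; first by rewrite hb' in hb.
  move/form_diff_eq0 => xij; apply/form_diff_eq0; rewrite !mxE.
  have nE := nu_opp_sign hs xij.
  have [ii|ii] := eqVneq i i2.
    by case/eqP: ij; rewrite ii; apply: (single w2); rewrite // -nE ii.
  have [jj|jj] := eqVneq j i2; last by [].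
  by case/eqP: ij; rewrite jj; apply: (single w2); rewrite // nE jj.
- by right=> i xi; have := x'n0 i; rewrite xi eqxx.
- rewrite !cl_expsT // sk sk' cnt /exps_typeD -/(odds k.+1) -/(odds k) oddsS addSnnS.
  by rewrite -rcons_cons perm_rcons.
- rewrite cl_expsT // sk' cnt /= -/(odds k); apply/andP; split.
    by move: (count _ _) small => q; rewrite ltnS -addnn addnS ltnS leq_add2l.
  by apply/allP => m /odds_le h; apply: leqW (ltnW h).
Qed.

Lemma cl_chain x : nolone b x -> exists2 es, perm_eq es (cl_exps x) & chain cl_form x es.
Proof.
move sk: (size (vals x)) => k; elim: k x sk => [|k IH] x sk hx.
  exists [::]; first by rewrite /cl_exps sk; case: ifP.
  apply: chain_nil => v; have [_ h] := flat_Pcl tb hx; rewrite h => -[z ->].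
  by apply/colP => i; rewrite !mxE big1 // => a; have := ltn_ord a; rewrite {2}sk.
have [x' [e [xx' hx' sk' pe /allP le]]] : exists x' e, [/\ in_flat cl_form x x', nolone b x',
    size (vals x') = k, perm_eq (cl_exps x) (e :: cl_exps x') &
    all (fun m => m <= e)%N (cl_exps x')].
  case: (leqP k (count (Jv x) (vals x))) => [big|small]; last first.
    case: (bool_em t) => ht; first exact: merge_step.
    by apply: kill_step => // h; rewrite h in ht.
  apply: kill_step => // ht; case: (posnP k) => [k0|k0]; last first.
    have hw : has (Jv x) (vals x) by rewrite has_count (leq_trans k0 big).
    by have /hasP [w wx Jw] := hw; exists w.
  case: (vals x) (@valsP _ _ t x) sk => [|w s] // hv; rewrite k0 => -[/size0nil s0].
  exists w; rewrite ?mem_head //; apply/or3P.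
  case: (boolP (has0 x)) => [|z0]; first by constructor 2.
  case: (bool_em b) => hb; first by constructor 1.
  (* There is one nonzero value and no zero coordinate, so the block consists of all [n]
     coordinates, more than one in type D. *)
  constructor 3; move: n2; rewrite (negPf hb) /= => n1; rewrite s0 in hv.
  rewrite /bsize (eq_card (B := predT)) ?card_ord // => i; rewrite !inE.
  have /hv : exists2 i0, x i0 0 != 0 & nu (x i0 0) = nu (x i 0).
    by exists i => //; apply: contraNneq z0 => xi; apply/existsP; exists i; rewrite xi.
  by rewrite inE => /eqP ->; rewrite eqxx.
have [es' pes c] := IH x' sk' hx'; exists (rcons es' e).
  by rewrite perm_sym (perm_trans pe) // perm_sym perm_rcons perm_cons.
apply: (chain_rcons _ _ xx' c).
  by rewrite sorted_rcons_leq (chain_sorted c) andbT (perm_all _ pes); apply/allP.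
have [kk [Q [L [h1 h2 [e0 se p0]]]]] := cl_free hx; exists kk, Q, L; split=> //.
exists e0 => //; apply: perm_trans p0.
by rewrite perm_sym (perm_trans pe) // perm_sym perm_rcons perm_cons.
Qed.

Lemma hacc_classical : hacc cl_form.
Proof.
move=> x; case: (bool_em b) => hb.
  by have [es _ c] := @cl_chain x (or_introl hb); exists es.
case: (boolP [exists i, (x i 0 == 0) && [forall j, (j != i) ==> (x j 0 != 0)]]); last first.
  move/existsPn => h; have [|es _ c] := @cl_chain x; last by exists es.
  right=> i xi; have := h i; rewrite xi eqxx /= => /forallPn [j].
  by rewrite negb_imply negbK => /andP [ji /eqP xj]; exists j.
case/existsP => i0 /andP [/eqP x0 /forallP xn].
have {}xn j : j != i0 -> x j 0 != 0 by move=> h; apply: (implyP (xn j)).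
(* A value larger than all absolute values; put in place of the lone zero coordinate, it leaves the
   set of vanishing roots unchanged. *)
pose c := 1 + \sum_j `|x j 0|.
have c_gt0 : 0 < c by rewrite ltr_pwDl // sumr_ge0.
have c_gt j s : s \in signs F t -> x j 0 != s * c.
  move=> hs; apply/eqP => E; have : `|x j 0| = c.
    rewrite E normrM (ger0_norm (ltW c_gt0)).
    by case: (signsP hs) => [->|[-> _]]; rewrite ?normrN normr1 mul1r.
  rewrite /c (bigD1 j) //= addrCA => /eqP; rewrite eq_sym -subr_eq0 addrAC subrr add0r.
  by rewrite gt_eqF // ltr_pwDl // sumr_ge0.
have c0 : c != 0 by rewrite gt_eqF.
pose y : 'cV[F]_n := \col_i (if i == i0 then c else x i 0).
have yn0 j : y j 0 != 0 by rewrite mxE; case: (j =P i0) => // /eqP /xn.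
have [|es _ ch] := @cl_chain y; first by right=> i yi; have := yn0 i; rewrite yi eqxx.
have key r : cl_form r -> (r *m x = 0 \/ r *m y = 0) ->
    exists s i j, [/\ r = form_diff s i j, i != i0 & j != i0].
  case=> [[hb' _]|[s [i [j [hs ij ->]]]]]; first by rewrite hb' in hb.
  move=> H; exists s, i, j; split=> //; apply/eqP => E; rewrite {}E in ij H.
    have ji : j != i0 by rewrite eq_sym.
    case: H => /form_diff_eq0; first by rewrite x0 => /eqP; rewrite eq_sym mulf_eq0 (negPf (sign_neq0 hs)) (negPf (xn _ ji)).
    rewrite !mxE eqxx (negPf ji) => E; have /eqP := c_gt j s hs; apply.
    by rewrite E mulrA (sign_sq hs) mul1r.
  case: H => /form_diff_eq0; first by rewrite x0 mulr0 => /eqP; rewrite (negPf (xn _ ij)).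
  by rewrite !mxE eqxx (negPf ij) => E; have /eqP := c_gt i s hs; apply.
exists es; apply: chain_ext ch => r hr r0.
  have [s [i [j [rE hi hj]]]] := key r hr (or_intror r0); move: r0; rewrite rE.
  by rewrite !form_diff_eq0 !mxE (negPf hi) (negPf hj).
have [s [i [j [rE hi hj]]]] := key r hr (or_introl r0); move: r0; rewrite rE.
by rewrite !form_diff_eq0 !mxE (negPf hi) (negPf hj).
Qed.

End ClassicalChains.

(** * Root systems in adapted coordinates *)

Section RootIso.

Variable F : realFieldType.

Lemma hacc_eq n (Phi Phi' : 'rV[F]_n -> Prop) :
  (forall r, Phi r <-> Phi' r) -> hacc Phi' -> hacc Phi.
Proof.
move=> h; apply: (@hacc_iso _ _ _ _ _ 1%:M 1%:M); rewrite ?mul1mx // => r hr;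
  by exists 1; rewrite ?oner_neq0 // mulmx1 scale1r; apply/h.
Qed.

(** The map [g] sends simple root [i] to [d i] times simple root [s i]; the equation between the two
    matrices says that it intertwines the simple reflections. *)
Lemma hacc_reindex n n' (a : 'M[F]_n) (a' : 'M[F]_n') (s : 'I_n -> 'I_n') (t : 'I_n' -> 'I_n)
    (d : 'I_n -> F) :
  cancel s t -> cancel t s -> (forall i, d i != 0) ->
  (forall k i, d k * a' (s k) (s i) = a k i * d i) ->
  hacc (isroot a') -> hacc (isroot a).
Proof.
move=> st ts d0 hd.
pose g : 'M[F]_(n, n') := \matrix_(i, j) (d i * (j == s i)%:R).
pose h : 'M[F]_(n', n) := \matrix_(j, i) ((d (t j))^-1 * (i == t j)%:R).
have rg i : row i g = d i *: delta_mx 0 (s i) by apply/rowP => j; rewrite !mxE eqxx.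
have rh j : row j h = (d (t j))^-1 *: delta_mx 0 (t j) by apply/rowP => i; rewrite !mxE eqxx.
have gh : g *m h = 1%:M.
  apply/row_matrixP => i; rewrite row_mul rg -scalemxAl -rowE rh st scalerA mulfV // scale1r.
  by rewrite row1.
have hg : h *m g = 1%:M.
  apply/row_matrixP => i; rewrite row_mul rh -scalemxAl -rowE rg ts scalerA mulVf // scale1r.
  by rewrite row1.
have ga : g *m a' = \matrix_(k, j) (a k (t j) * d (t j)).
  by apply/row_matrixP => k; rewrite row_mul rg -scalemxAl -rowE; apply/rowP => j;
    rewrite !mxE -hd ts.
have rga (r : 'rV[F]_n) i : (r *m g *m a') 0 (s i) = (r *m a) 0 i * d i.
  rewrite -mulmxA ga !mxE mulr_suml; apply: eq_bigr => k _.
  by rewrite !mxE st mulrA.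
have refl_g i r : refl a' (s i) (r *m g) = refl a i r *m g.
  by rewrite /refl rga mulmxBl -scalemxAl -rowE rg scalerA.
apply: (hacc_iso gh hg) => r.
  elim=> [i|i {}r _ [c c0 hr]].
    exists (d i)^-1; rewrite ?invr_eq0 // -rowE rg scalerA mulVf // scale1r.
    exact: isroot_simple || exact: root_simple.
  exists c => //; have := root_refl (s i) hr.
  suff -> : refl a' (s i) (c *: (r *m g)) = c *: (refl a i r *m g) by [].
  by rewrite -refl_g /refl scalerBr scalerA -scalemxAl mxE.
elim=> [j|j {}r _ [c c0 hr]].
  exists (d (t j)); rewrite ?d0 // -rowE rh scalerA mulfV // scale1r; exact: root_simple.
exists c => //; have := root_refl (t j) hr.
suff -> : refl a (t j) (c *: (r *m h)) = c *: (refl a' j r *m h) by [].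
have -> : refl a' j r *m h = refl a (t j) (r *m h).
  by rewrite -[RHS]mulmx1 -gh mulmxA -refl_g -mulmxA hg mulmx1 ts.
by rewrite /refl scalerBr scalerA -scalemxAl mxE.
Qed.

Lemma hacc_block n1 n2 (a1 : 'M[F]_n1) (a2 : 'M[F]_n2) :
  hacc (isroot a1) -> hacc (isroot a2) -> hacc (isroot (block_mx a1 0 0 a2)).
Proof.
move=> h1 h2; apply: hacc_eq (hacc_prod h1 h2) => r.
have bl (r1 : 'rV[F]_n1) (r2 : 'rV[F]_n2) :
    row_mx r1 r2 *m block_mx a1 0 0 a2 = row_mx (r1 *m a1) (r2 *m a2).
  by rewrite mul_row_block !mulmx0 addr0 add0r.
have dl i : delta_mx 0 (lshift n2 i) = row_mx (delta_mx 0 i) 0 :> 'rV[F]_(n1 + n2) by rewrite -delta_mx_lshift.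
have dr i : delta_mx 0 (rshift n1 i) = row_mx 0 (delta_mx 0 i) :> 'rV[F]_(n1 + n2) by rewrite -delta_mx_rshift.
split=> [|[[r1 hr ->]|[r2 hr ->]]]; last 2 first.
- elim: hr => [i|i {}r1 _ IH]; first by rewrite -dl; apply: root_simple.
  have := root_refl (lshift n2 i) IH; rewrite /refl bl row_mxEl dl.
  by rewrite scale_row_mx scaler0 opp_row_mx add_row_mx subr0.
- elim: hr => [i|i {}r2 _ IH]; first by rewrite -dr; apply: root_simple.
  have := root_refl (rshift n1 i) IH; rewrite /refl bl row_mxEr dr.
  by rewrite scale_row_mx scaler0 opp_row_mx add_row_mx subr0.
elim=> [i|i {}r _ [[r1 hr ->]|[r2 hr ->]]].
- rewrite -(splitK i); case: (split i) => j /=; [left|right]; exists (delta_mx 0 j);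
    rewrite ?dl ?dr //; exact: root_simple.
- rewrite /refl bl mul0mx -(splitK i); case: (split i) => j /=; left.
    exists (refl a1 j r1); first exact: root_refl.
    by rewrite row_mxEl dl scale_row_mx scaler0 opp_row_mx add_row_mx subr0.
  by exists r1 => //; rewrite row_mxEr mxE scale0r subr0.
- rewrite /refl bl mul0mx -(splitK i); case: (split i) => j /=; right.
    by exists r2 => //; rewrite row_mxEl mxE scale0r subr0.
  exists (refl a2 j r2); first exact: root_refl.
  by rewrite row_mxEr dr scale_row_mx scaler0 opp_row_mx add_row_mx subr0.
Qed.

Section Model.

Variables (n : nat) (g w : 'M[F]_n) (Phi : 'rV[F]_n -> Prop).

(* Row [i] of [g] is the [i]-th simple root and column [i] of [w] its coroot, in other coordinates. *)
Definition mrefl i (v : 'rV[F]_n) : 'rV[F]_n := v - (v *m w) 0 i *: row i g.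
Definition upto (v : 'rV[F]_n) : Prop := exists2 c, c != 0 & Phi (c *: v).
Definition mroot (v : 'rV[F]_n) : Prop :=
  exists2 c, c != 0 & exists2 r, isroot (g *m w) r & c *: v = r *m g.

Lemma mreflZ i c v : mrefl i (c *: v) = c *: mrefl i v.
Proof. by rewrite /mrefl -scalemxAl mxE scalerBr scalerA. Qed.

Lemma mreflD i u v : mrefl i (u + v) = mrefl i u + mrefl i v.
Proof. by rewrite /mrefl mulmxDl mxE scalerDl opprD addrACA. Qed.

Lemma refl_model i r : refl (g *m w) i r *m g = mrefl i (r *m g).
Proof. by rewrite /refl /mrefl mulmxBl -scalemxAl -rowE mulmxA. Qed.

Lemma mroot_row i : mroot (row i g).
Proof.
exists 1; rewrite ?oner_neq0 //; exists (delta_mx 0 i); first exact: root_simple.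
by rewrite scale1r rowE.
Qed.

Lemma mroot_mrefl i v : mroot v -> mroot (mrefl i v).
Proof.
move=> [c c0 [r hr E]]; exists c => //; exists (refl (g *m w) i r); first exact: root_refl.
by rewrite refl_model -E mreflZ.
Qed.

Lemma mrootZ c v : c != 0 -> mroot v -> mroot (c *: v).
Proof.
move=> c0 [d d0 [r hr E]]; exists (d / c); first by rewrite mulf_neq0 // invr_eq0.
by exists r => //; rewrite scalerA divfK.
Qed.

(** The roots and the forms of the model agree up to scalars: the forms contain the simple roots and
    are stable under the reflections, and conversely each form is a root. *)
Lemma hacc_model : g *m w \in unitmx -> (forall i, upto (row i g)) ->
  (forall i v, Phi v -> upto (mrefl i v)) -> (forall v, Phi v -> mroot v) ->
  hacc Phi -> hacc (isroot (g *m w)).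
Proof.
rewrite unitmx_mul => /andP [gU _] h1 h2 h3.
apply: (hacc_iso (mulmxV gU) (mulVmx gU)) => r.
  elim=> [i|i {}r _ [c c0 hr]]; first by rewrite -rowE; apply: h1.
  have [d d0 hd] := h2 i _ hr; exists (d * c); first by rewrite mulf_neq0.
  by rewrite refl_model -scalerA -mreflZ.
move/h3 => [c c0 [u hu E]]; exists c => //.
by rewrite scalemxAl E mulmxK.
Qed.

End Model.

End RootIso.

Section ClassicalRoots.

Variables (F : realFieldType) (n' : nat).
Local Notation n := n'.+1.

(** Unit vectors numbered by natural numbers and zero out of range, so that successors and
    predecessors of indices carry no proofs. *)
Definition En (k : nat) : 'rV[F]_n := \row_j ((j : nat) == k)%:R.

Lemma En_delta (i : 'I_n) : delta_mx 0 i = En i.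
Proof. by apply/rowP => j; rewrite !mxE eqxx. Qed.

Lemma En_mul k (lt : (k < n)%N) (w : 'M[F]_n) : En k *m w = row (Ordinal lt) w.
Proof. by rewrite -(En_delta (Ordinal lt)) rowE. Qed.

Definition sdiff (s : F) (i j : nat) : 'rV[F]_n := En i - s *: En j.

Lemma cl_formE t b r : cl_form t b r <->
  (b /\ exists2 i, (i < n)%N & r = En i) \/
  exists s i j, [/\ s \in signs F t, (i < n)%N, (j < n)%N, i != j & r = sdiff s i j].
Proof.
split=> [[[hb [i ->]]|[s [i [j [hs ij ->]]]]]|[[hb [i lti ->]]|[s [i [j [hs lti ltj ij ->]]]]]].
- by left; split=> //; exists i; rewrite ?En_delta.
- by right; exists s, i, j; split=> //; rewrite /form_diff !En_delta.
- by left; split=> //; exists (Ordinal lti); rewrite En_delta.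
- by right; exists s, (Ordinal lti), (Ordinal ltj); split=> //; rewrite /form_diff !En_delta.
Qed.

Variables (t b : bool) (g w : 'M[F]_n).
Local Notation mr := (mrefl g w).
Local Notation mroot := (mroot g w).

Lemma upto_cl (c : F) (v : 'rV[F]_n) : c != 0 -> cl_form t b v -> upto (cl_form t b) (c *: v).
Proof. by move=> c0 hv; exists c^-1; rewrite ?invr_eq0 // scalerA mulVf // scale1r. Qed.

Lemma upto_sdiff c s i j : c != 0 -> s \in signs F t -> (i < n)%N -> (j < n)%N -> i != j ->
  upto (cl_form t b) (c *: sdiff s i j).
Proof. by move=> c0 *; apply: upto_cl => //; apply/cl_formE; right; exists s, i, j. Qed.

Lemma upto_En c i : b -> c != 0 -> (i < n)%N -> upto (cl_form t b) (c *: En i).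
Proof. by move=> hb c0 lti; apply: upto_cl => //; apply/cl_formE; left; split=> //; exists i. Qed.

Lemma signed_perm_closed k (eps : nat -> F) (p : nat -> nat) :
  (forall i, (i < n)%N -> [/\ (p i < n)%N, eps i \in signs F t & mr k (En i) = eps i *: En (p i)]) ->
  (forall i j, (i < n)%N -> (j < n)%N -> p i = p j -> i = j) ->
  forall v, cl_form t b v -> upto (cl_form t b) (mr k v).
Proof.
move=> hp pinj v /cl_formE [[hb [i lti ->]]|[s [i [j [hs lti ltj ij ->]]]]].
  by have [pi ei ->] := hp i lti; apply: upto_En => //; apply: sign_neq0 ei.
have [pi ei Ei] := hp i lti; have [pj ej Ej] := hp j ltj.
rewrite /sdiff -scaleNr mreflD mreflZ Ei Ej.
rewrite (_ : _ + _ = eps i *: sdiff (s * (eps i * eps j)) (p i) (p j)).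
  apply: upto_sdiff => //; [exact: sign_neq0 ei|by do 2 apply: sign_mul => //|].
  by apply: contra_neq ij; apply: pinj.
rewrite /sdiff scalerBr !scalerA mulNr scaleNr; congr (_ - _ *: _).
by rewrite mulrCA (mulrA (eps i)) (sign_sq ei) mul1r.
Qed.

(** The transposition of [t - 1] and [t], by which the simple reflection at [e_t - e_(t-1)] permutes
    the unit vectors. *)
Definition swp (t i : nat) : nat := if i == t then t.-1 else if i == t.-1 then t else i.

Lemma swpr k : swp k k = k.-1.
Proof. by rewrite /swp eqxx. Qed.

Lemma swpl k : swp k k.-1 = k.
Proof. by rewrite /swp eqxx; have [->|] := eqVneq k.-1 k. Qed.

Lemma swp_id k i : i != k -> i != k.-1 -> swp k i = i.
Proof. by rewrite /swp => /negPf -> /negPf ->. Qed.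

Lemma swpK k : involutive (swp k).
Proof.
move=> i; have [->|ne] := eqVneq i k; first by rewrite swpr swpl.
have [->|ne'] := eqVneq i k.-1; first by rewrite swpl swpr.
by rewrite !swp_id.
Qed.

Lemma swp_lt k i : (k < n)%N -> (i < n)%N -> (swp k i < n)%N.
Proof.
move=> lt lti; have [->|ne] := eqVneq i k; first by rewrite swpr (leq_ltn_trans (leq_pred k)).
by have [->|ne'] := eqVneq i k.-1; rewrite ?swpl // swp_id.
Qed.

Lemma mrefl_swap k i (lt : (k < n)%N) : (0 < k)%N -> (i < n)%N ->
  row (Ordinal lt) g = En k - En k.-1 ->
  (forall j : 'I_n, w j (Ordinal lt) = ((j : nat) == k)%:R - ((j : nat) == k.-1)%:R) ->
  mr (Ordinal lt) (En i) = En (swp k i).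
Proof.
move=> k0 lti hg hw; rewrite /mrefl (En_mul lti) row0E hw hg /= /swp.
have kk : (k == k.-1) = false by rewrite gtn_eqF // prednK.
have [->|ik] := eqVneq i k; first by rewrite kk subr0 scale1r opprB addrCA subrr addr0.
have [->|ik'] := eqVneq i k.-1; last by rewrite subr0 scale0r subr0.
by rewrite sub0r scaleNr scale1r opprK addrC subrK.
Qed.

Hypothesis g_succ : forall k (lt : (k < n)%N), (0 < k)%N -> row (Ordinal lt) g = En k - En k.-1.
Hypothesis w_succ : forall k (lt : (k < n)%N), (0 < k)%N ->
  forall j : 'I_n, w j (Ordinal lt) = ((j : nat) == k)%:R - ((j : nat) == k.-1)%:R.

Lemma swap_closed k (lt : (k < n)%N) v : (0 < k)%N ->
  cl_form t b v -> upto (cl_form t b) (mr (Ordinal lt) v).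
Proof.
move=> k0; apply: (@signed_perm_closed _ (fun=> 1) (swp k)) => [i lti|i j _ _]; last exact: (can_inj (@swpK k)).
split; [exact: swp_lt|by rewrite /signs; case: (t); rewrite mem_head|].
by rewrite scale1r (mrefl_swap k0 lti (g_succ lt k0) (w_succ lt k0)).
Qed.

Lemma mroot_swap k v v' : (0 < k < n)%N -> (forall lt : (k < n)%N, v' = mr (Ordinal lt) v) ->
  mroot v -> mroot v'.
Proof. by move=> /andP [k0 lt] h; rewrite (h lt); apply: mroot_mrefl. Qed.

Lemma swap_En k i (lt : (k < n)%N) : (0 < k)%N -> (i < n)%N -> mr (Ordinal lt) (En i) = En (swp k i).
Proof. by move=> k0 lti; apply: mrefl_swap => //; [apply: g_succ|apply: w_succ]. Qed.

Lemma swap_sdiff k s i j (lt : (k < n)%N) : (0 < k)%N -> (i < n)%N -> (j < n)%N ->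
  mr (Ordinal lt) (sdiff s i j) = sdiff s (swp k i) (swp k j).
Proof. by move=> k0 lti ltj; rewrite /sdiff -scaleNr mreflD mreflZ !swap_En // scaleNr. Qed.

Lemma mroot_En i : mroot (En 0) -> (i < n)%N -> mroot (En i).
Proof.
move=> h0; elim: i => [|i IH] // lti; apply: (@mroot_swap i.+1 (En i)); rewrite ?lti //; last exact: IH (ltnW lti).
by move=> lt; rewrite swap_En ?(ltnW lti) // (swpl i.+1).
Qed.

Lemma mroot_opp v : mroot (- v) -> mroot v.
Proof. by move=> h; rewrite -[v]opprK -scaleN1r; apply: mrootZ; rewrite ?oppr_eq0 ?oner_neq0. Qed.

Lemma mroot_diff_lt i j : (j < i)%N -> (i < n)%N -> mroot (sdiff 1 i j).
Proof.
elim: i => [|i IH] // ji lti; case: (j =P i) => [->|ne].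
  have := mroot_row g w (Ordinal lti); rewrite g_succ //= => h.
  by rewrite /sdiff scale1r.
apply: (@mroot_swap i.+1 (sdiff 1 i j)); rewrite ?lti //; last first.
  by apply: IH; [move: ji; rewrite ltnS leq_eqVlt => /orP [/eqP|]|exact: ltnW].
move=> lt; rewrite swap_sdiff ?(ltnW lti) ?(ltn_trans ji) // (swpl i.+1) swp_id //; last exact/eqP.
by rewrite ltn_eqF.
Qed.

Lemma mroot_diff i j : (i < n)%N -> (j < n)%N -> i != j -> mroot (sdiff 1 i j).
Proof.
move=> lti ltj; rewrite neq_ltn => /orP [lt|lt]; last exact: mroot_diff_lt.
apply: mroot_opp; rewrite (_ : - _ = sdiff 1 j i); first exact: mroot_diff_lt.
by rewrite /sdiff !scale1r opprB.
Qed.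

Lemma mroot_sum_lt i j : (forall i, (0 < i < n)%N -> mroot (sdiff (-1) i 0)) ->
  (j < i)%N -> (i < n)%N -> mroot (sdiff (-1) i j).
Proof.
move=> h0; elim: j => [|j IH] ji lti; first by apply: h0; rewrite ji lti.
apply: (@mroot_swap j.+1 (sdiff (-1) i j)); [by rewrite /= (ltn_trans ji)| |by apply: IH => //; apply: ltnW].
move=> lt; rewrite swap_sdiff ?(ltnW lt) // (swpl j.+1) swp_id // ?(gtn_eqF ji) //.
by rewrite gtn_eqF // ltnW.
Qed.

Lemma mroot_sum i j : (forall i, (0 < i < n)%N -> mroot (sdiff (-1) i 0)) ->
  (i < n)%N -> (j < n)%N -> i != j -> mroot (sdiff (-1) i j).
Proof.
move=> h0 lti ltj; rewrite neq_ltn => /orP [lt|lt]; last exact: mroot_sum_lt.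
rewrite (_ : sdiff _ _ _ = sdiff (-1) j i); first exact: mroot_sum_lt.
by rewrite /sdiff !scaleN1r !opprK addrC.
Qed.

(** The reflections at the nodes with positive index are adjacent transpositions. They preserve the
    classical forms and reach every form from a few starting ones, so the hypotheses concern only
    node 0 and those starting forms. *)
Lemma hacc_classical_model : t || b -> b || (1 < n)%N -> g *m w \in unitmx ->
  upto (cl_form t b) (row ord0 g) ->
  (forall v, cl_form t b v -> upto (cl_form t b) (mr ord0 v)) ->
  (b -> mroot (En 0)) -> (t -> forall i, (0 < i < n)%N -> mroot (sdiff (-1) i 0)) ->
  hacc (isroot (g *m w)).
Proof.
move=> tb n2 gw g0 c0 hb ht; apply: (@hacc_model _ _ _ _ (cl_form t b)) => //.
- move=> i; case: (posnP i) => [i0|i0]; first by rewrite (_ : i = ord0) //; apply: val_inj.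
  rewrite (_ : i = Ordinal (ltn_ord i)) ?g_succ //=; last exact: val_inj.
  rewrite -[_ - _]scale1r -[En i.-1]scale1r; apply: upto_sdiff; rewrite ?oner_neq0 //.
  + by rewrite /signs; case: (t); rewrite mem_head.
  + by rewrite (leq_ltn_trans (leq_pred i)).
  + by rewrite gtn_eqF // prednK.
- move=> i v; case: (posnP i) => [i0|i0]; first by rewrite (_ : i = ord0) //; [apply: c0|apply: val_inj].
  rewrite (_ : i = Ordinal (ltn_ord i)); last exact: val_inj.
  exact: swap_closed.
- move=> v /cl_formE [[b1 [i lti ->]]|[s [i [j [hs lti ltj ij ->]]]]]; first exact: mroot_En (hb b1) _.
  case: (signsP hs) => [->|[-> t1]]; first exact: mroot_diff.
  exact: mroot_sum (ht t1) _ _ _.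
exact: hacc_classical.
Qed.

End ClassicalRoots.

(** * Cosines of small fractions of pi *)

Section CosValues.

Variable R : realType.

Definition cosm (m : nat) : R := cos (pi / m%:R).

Lemma cosm_ge0 m : (1 < m)%N -> 0 <= cosm m.
Proof.
move=> m1; have p0 := pi_gt0 R; have m0 : 0 < m%:R :> R by rewrite ltr0n; lia.
apply: cos_ge0_pihalf; apply/andP; split.
  by rewrite (@le_trans _ _ 0) // ?oppr_le0 divr_ge0 ?ltW // ltr0n.
by rewrite ler_pM2l // lef_pV2 ?posrE // (ler_nat R 2).
Qed.

Lemma cosm_gt0 m : (2 < m)%N -> 0 < cosm m.
Proof.
move=> m2; have p0 := pi_gt0 R; have m0 : 0 < m%:R :> R by rewrite ltr0n; lia.
apply: cos_gt0_pihalf; apply/andP; split.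
  by rewrite (@lt_trans _ _ 0) // ?oppr_lt0 divr_gt0 // ltr0n.
by rewrite ltr_pM2l // ltf_pV2 ?posrE // (ltr_nat R 2).
Qed.

Lemma cosm_mono m m' : (0 < m)%N -> (m <= m')%N -> cosm m <= cosm m'.
Proof.
move=> m0 mm; have p0 := pi_gt0 R.
have h k : (0 < k)%N -> (pi / k%:R : R) \in `[0, pi]%R.
  move=> k0; rewrite in_itv /=; apply/andP; split; first by rewrite divr_ge0 ?ltW // ltr0n.
  by rewrite ler_pdivrMr ?ltr0n //; apply: ler_peMr; [exact: ltW|rewrite ler1n].
have m0' := leq_trans m0 mm.
by rewrite /cosm leNgt ltr_cos ?h // -leNgt ler_pM2l // lef_pV2 ?posrE ?ltr0n // ler_nat.
Qed.

Lemma cosm1 : cosm 1 = -1.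
Proof. by rewrite /cosm divr1 cospi. Qed.

Lemma cosm2 : cosm 2 = 0.
Proof. exact: cos_pihalf. Qed.

Lemma cos2x (x : R) : cos (x *+ 2) = 2 * cos x ^+ 2 - 1.
Proof. by rewrite cos_mulr2n -mulr_natl. Qed.

Lemma cosm4_sq : cosm 4 ^+ 2 = 2^-1.
Proof.
have := cos2x (pi / 4%:R : R); have -> : pi / 4%:R *+ 2 = pi / 2%:R :> R by lra.
by rewrite cos_pihalf -/(cosm 4) => h; lra.
Qed.

Lemma cosm3 : cosm 3 = 2^-1.
Proof.
set c := cosm 3; have c0 : 0 < c by apply: cosm_gt0.
have h2 := cos2x (pi / 3%:R : R); rewrite -/(cosm 3) -/c in h2.
have : cos (pi / 3%:R *+ 2 : R) = - c.
  rewrite (_ : _ *+ 2 = pi - pi / 3%:R); last by lra.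
  by rewrite cosB cospi sinpi mul0r addr0 mulN1r.
rewrite h2 => E; have /eqP : (c + 1) * (2 * c - 1) = 0 by nra.
rewrite mulf_eq0 => /orP [] /eqP; lra.
Qed.

(** For [x = pi / 5] the angles [4 x] and [x] are supplementary, and the double angle formula gives
    an equation of degree four for [c]. Two of its factors are excluded by [c > 0] and by [c] being
    at least [cos (pi / 4)]. *)
Lemma cosm5 : 4 * cosm 5 ^+ 2 = 2 * cosm 5 + 1.
Proof.
set c := cosm 5; have c0 : 0 < c by apply: cosm_gt0.
pose d : R := cos (pi / 5%:R *+ 2).
have dE : d = 2 * c ^+ 2 - 1 by rewrite /d cos2x.
have : cos (pi / 5%:R *+ 2 *+ 2 : R) = - c.
  have -> : pi / 5%:R *+ 2 *+ 2 = pi - pi / 5%:R :> R by lra.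
  by rewrite cosB cospi sinpi mul0r addr0 mulN1r.
rewrite cos2x -/d dE => E.
have /eqP : (c + 1) * (2 * c - 1) * (4 * c ^+ 2 - 2 * c - 1) = 0 by nra.
rewrite !mulf_eq0 => /orP [/orP []|] /eqP; [lra| |lra].
have h4 : cosm 4 <= c by apply: cosm_mono.
have h40 : 0 < cosm 4 by apply: cosm_gt0.
by have := cosm4_sq; nra.
Qed.

Lemma cosm6_sq : cosm 6 ^+ 2 = 3 / 4.
Proof.
have := cos2x (pi / 6%:R : R); have -> : pi / 6%:R *+ 2 = pi / 3%:R :> R by lra.
by rewrite -/(cosm 3) -/(cosm 6) cosm3 => h; lra.
Qed.

End CosValues.

Definition adjp (i j : nat) := (i.+1 == j) || (j.+1 == i).

(* The Coxeter matrices of a path 0 - 1 - 2 - ... whose first edge has label [p], and of a path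
   1 - 2 - 3 - ... with a node 0 attached to [k]. *)
Definition pathM p (i j : nat) : nat :=
  if i == j then 1 else if adjp i j then (if (i == 0) || (j == 0) then p else 3) else 2.

Definition forkM k (i j : nat) : nat :=
  if i == j then 1 else if i == 0 then (if j == k then 3 else 2)
  else if j == 0 then (if i == k then 3 else 2) else if adjp i j then 3 else 2.

Section StdClassical.

Variables (R : realType) (n' : nat).
Local Notation n := n'.+1.

(** The simple roots as rows: [e_i - e_(i-1)] for positive [i] in every classical type, while row 0
    depends on the type. *)
Definition gmx (g0 : nat -> R) : 'M[R]_n :=
  \matrix_(i, j) (if i == 0 then g0 j
                  else ((j : nat) == i)%:R - ((j : nat) == i.-1)%:R).

Definition wmx (w0 : nat -> R) : 'M[R]_n := (gmx w0)^T.

Lemma gmx_succ g0 k (lt : (k < n)%N) : (0 < k)%N -> row (Ordinal lt) (gmx g0) = En R n' k - En R n' k.-1.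
Proof. by move=> k0; apply/rowP => j; rewrite !mxE /= -val_eqE /= gtn_eqF. Qed.

Lemma wmx_succ w0 k (lt : (k < n)%N) : (0 < k)%N ->
  forall j : 'I_n, wmx w0 j (Ordinal lt) = ((j : nat) == k)%:R - ((j : nat) == k.-1)%:R.
Proof. by move=> k0 j; rewrite !mxE -val_eqE /= gtn_eqF. Qed.

Lemma wmx0 w0 (j : 'I_n) : wmx w0 j ord0 = w0 j.
Proof. by rewrite !mxE eqxx. Qed.

Lemma Cartan_path k l : (k == l)%:R - (k.+1 == l)%:R - ((k == l.+1)%:R - (k == l)%:R) =
  (if k == l then 2 else if adjp k l then -1 else 0) :> R.
Proof.
rewrite /adjp [l.+1 == k]eq_sym; have [->|ne] := eqVneq k l.
  by rewrite (gtn_eqF (ltnSn l)) (ltn_eqF (ltnSn l)) /=; lra.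
have [E|_] := eqVneq k.+1 l; first by rewrite -E (ltn_eqF (ltnW (ltnSn k.+1))) /=; lra.
by case: (k == l.+1) => /=; lra.
Qed.

Lemma gw_succ g0 w0 k l (lk : (k.+1 < n)%N) (ll : (l.+1 < n)%N) :
  (gmx g0 *m wmx w0) (Ordinal lk) (Ordinal ll) =
  (if k == l then 2 else if adjp k l then -1 else 0).
Proof.
rewrite -row0E row_mul gmx_succ // mulmxBl !(En_mul lk) (En_mul (ltnW lk)) !mxE /=.
by rewrite -Cartan_path !eqSS; case: l ll => [|l] ll; rewrite ?eqSS //=.
Qed.

Lemma gw_col0 g0 w0 k (lk : (k.+1 < n)%N) :
  (gmx g0 *m wmx w0) (Ordinal lk) ord0 = w0 k.+1 - w0 k.
Proof.
by rewrite -row0E row_mul gmx_succ // mulmxBl !(En_mul lk) (En_mul (ltnW lk)) !mxE eqxx.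
Qed.

Lemma cox2_unit (m : 'I_n -> 'I_n -> nat) : posdef (coxmx R m) -> 2 *: coxmx R m \in unitmx.
Proof. by move/posdef_unit => h; rewrite unitmxZ // unitfE pnatr_eq0. Qed.

Lemma cox2E (m : 'I_n -> 'I_n -> nat) i j : (2 *: coxmx R m) i j = - 2 * cosm R (m i j).
Proof. by rewrite !mxE mulrN mulNr. Qed.

Lemma gmx_ind (A : 'M[R]_n) g0 w0 :
  (forall k l (lk : (k.+1 < n)%N) (ll : (l.+1 < n)%N),
     A (Ordinal lk) (Ordinal ll) = if k == l then 2 else if adjp k l then -1 else 0) ->
  (forall k (lk : (k.+1 < n)%N), A (Ordinal lk) ord0 = w0 k.+1 - w0 k) ->
  (forall l (ll : (l.+1 < n)%N), A ord0 (Ordinal ll) = (row ord0 (gmx g0) *m wmx w0) 0 (Ordinal ll)) ->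
  A ord0 ord0 = (row ord0 (gmx g0) *m wmx w0) 0 ord0 ->
  A = gmx g0 *m wmx w0.
Proof.
move=> h1 h2 h3 h4; have e0 (lt : (0 < n)%N) : Ordinal lt = ord0 by apply: val_inj.
apply/matrixP => -[[|k] lk] [[|l] ll]; rewrite ?e0.
- by rewrite h4 -row_mul row0E.
- by rewrite h3 -row_mul row0E.
- by rewrite h2 gw_col0.
- by rewrite h1 gw_succ.
Qed.

Lemma row0_gmx g0 : row ord0 (gmx g0) = \row_(j < n) g0 j.
Proof. by apply/rowP => j; rewrite !mxE eqxx. Qed.

Lemma En_row0 c : \row_(j < n) (c * ((j : nat) == 0)%:R) = c *: En R n' 0.
Proof. by apply/rowP => j; rewrite !mxE. Qed.

Lemma hacc_typeA (m : 'I_n -> 'I_n -> nat) : (forall i j, m i j = pathM 3 i j) ->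
  posdef (coxmx R m) -> hacc (isroot (2 *: coxmx R m)).
Proof.
(* Type A_n in n coordinates, the additional one being zero: the first simple root is [e_0]. Its
   reflection negates [e_0] and subtracts it from every other unit vector, whence the coroot
   [(2, 1, ..., 1)]. *)
move=> hm /cox2_unit; pose g0 (j : nat) : R := 1 * (j == 0)%:R; pose w0 (j : nat) : R := if j == 0 then 2 else 1.
have g0E : row ord0 (gmx g0) = En R n' 0 by rewrite row0_gmx En_row0 scale1r.
have -> : 2 *: coxmx R m = gmx g0 *m wmx w0.
  apply: gmx_ind => [k l lk ll|k lk|l ll|]; rewrite cox2E hm /pathM /=.
  - rewrite eqSS /adjp !eqSS -/(adjp k l); case: eqP => _; first by rewrite cosm1; lra.
    by case: ifP => _; rewrite ?cosm3 ?cosm2; lra.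
  - by rewrite /adjp /= /w0; case: k lk => [|k] lk /=; rewrite ?cosm3 ?cosm2; lra.
  - rewrite g0E (En_mul (ltn0Sn n')) !mxE /= /adjp /=.
    by case: l ll => [|l] ll /=; rewrite ?cosm3 ?cosm2; lra.
  - by rewrite g0E (En_mul (ltn0Sn n')) !mxE /= cosm1; lra.
move=> uni.
have mE i : (i < n)%N -> mrefl (gmx g0) (wmx w0) ord0 (En R n' i) =
    En R n' i - (if i == 0 then 2 else 1) *: En R n' 0.
  by move=> lti; rewrite /mrefl (En_mul lti) row0E wmx0 g0E.
apply: (hacc_classical_model (t := false) (b := true) (@gmx_succ g0) (@wmx_succ w0)) => //.
- by rewrite g0E -[En _ _ _]scale1r; apply: upto_En; rewrite ?oner_neq0.
- move=> v /cl_formE [[_ [i lti ->]]|[s [i [j [hs lti ltj ij ->]]]]].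
    rewrite mE //; case: eqP => [->|/eqP i0].
      rewrite (_ : _ - _ = -1 *: En R n' 0); first by apply: upto_En; rewrite ?oppr_eq0 ?oner_neq0.
      by apply/rowP => x; rewrite !mxE; lra.
    rewrite scale1r (_ : _ - _ = 1 *: sdiff n' 1 i 0); last by rewrite /sdiff !scale1r.
    by apply: upto_sdiff; rewrite ?oner_neq0 ?mem_head.
  have {hs} -> : s = 1 by move: hs; rewrite inE => /eqP.
  rewrite /sdiff -scaleNr mreflD mreflZ !mE // scaleN1r opprB.
  case: (i =P 0) ij => [->|/eqP i0] ij; case: (j =P 0) ij => [->|/eqP j0] ij //.
  + rewrite (_ : _ + _ = -1 *: En R n' j); first by apply: upto_En; rewrite ?oppr_eq0 ?oner_neq0.
    by apply/rowP => x; rewrite !mxE; lra.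
  + rewrite (_ : _ + _ = 1 *: En R n' i); first by apply: upto_En; rewrite ?oner_neq0.
    by apply/rowP => x; rewrite !mxE; lra.
  + rewrite (_ : _ + _ = 1 *: sdiff n' 1 i j); first by apply: upto_sdiff; rewrite ?oner_neq0 ?mem_head.
    by apply/rowP => x; rewrite !mxE; lra.
- by move=> _; rewrite -g0E; apply: mroot_row.
Qed.

Lemma hacc_typeB (m : 'I_n -> 'I_n -> nat) : (forall i j, m i j = pathM 4 i j) ->
  posdef (coxmx R m) -> hacc (isroot (2 *: coxmx R m)).
Proof.
(* [c] is the square root of 2: the symmetric form gives all simple roots the same length, so [e_0]
   is stretched by [c]. *)
move=> hm /cox2_unit; pose c : R := 2 * cosm R 4.
have c2 : c * c = 2 by have := cosm4_sq R; rewrite /c; nra.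
have c0 : c != 0 by apply: contra_eq_neq c2 => ->; rewrite mul0r eq_sym pnatr_eq0.
pose g0 (j : nat) : R := c * (j == 0)%:R.
have g0E : row ord0 (gmx g0) = c *: En R n' 0 by rewrite row0_gmx En_row0.
have -> : 2 *: coxmx R m = gmx g0 *m wmx g0.
  apply: gmx_ind => [k l lk ll|k lk|l ll|]; rewrite cox2E hm /pathM /=.
  - rewrite eqSS /adjp !eqSS -/(adjp k l); case: eqP => _; first by rewrite cosm1; lra.
    by case: ifP => _; rewrite ?cosm3 ?cosm2; lra.
  - by rewrite /adjp /= /g0 /c; case: k lk => [|k] lk /=; rewrite ?cosm2; lra.
  - rewrite g0E -scalemxAl (En_mul (ltn0Sn n')) !mxE /= /adjp /= /c.
    by case: l ll => [|l] ll /=; rewrite ?cosm2; lra.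
  - rewrite g0E -scalemxAl (En_mul (ltn0Sn n')) !mxE /= cosm1 /g0 /= mulr1 c2; lra.
move=> uni.
have mE i : (i < n)%N -> mrefl (gmx g0) (wmx g0) ord0 (En R n' i) =
    (if i == 0 then -1 else 1) *: En R n' i.
  move=> lti; rewrite /mrefl (En_mul lti) row0E wmx0 g0E scalerA /g0 /= mulrAC c2.
  case: (i =P 0) => [->|_]; last by rewrite mulr0 scale0r subr0 scale1r.
  by apply/rowP => x; rewrite !mxE mulr1; lra.
apply: (hacc_classical_model (t := true) (b := true) (@gmx_succ g0) (@wmx_succ g0)) => //.
- by rewrite g0E; apply: upto_En.
- apply: (@signed_perm_closed _ _ _ _ _ _ _ (fun i => if i == 0 then -1 else 1) id) => // i lti.
  by split; rewrite ?mE //; case: eqP => _; rewrite !inE eqxx ?orbT.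
- move=> _; have := mroot_row (gmx g0) (wmx g0) ord0; rewrite g0E => /(mrootZ (c := c^-1)).
  by rewrite scalerA mulVf // scale1r invr_eq0; apply.
- move=> _ i /andP [i0 lti].
  have := @mroot_diff _ _ _ _ (@gmx_succ g0) (@wmx_succ g0) i 0 lti (ltn0Sn n').
  rewrite gtn_eqF // => /(_ isT) /(mroot_mrefl ord0).
  have -> : mrefl (gmx g0) (wmx g0) ord0 (sdiff n' 1 i 0) = sdiff n' (-1) i 0; last by [].
  by rewrite /sdiff -scaleNr mreflD mreflZ !mE // gtn_eqF //=; apply/rowP => x; rewrite !mxE; lra.
Qed.

Lemma hacc_typeD (m : 'I_n -> 'I_n -> nat) : (2 <= n')%N -> (forall i j, m i j = forkM 2 i j) ->
  posdef (coxmx R m) -> hacc (isroot (2 *: coxmx R m)).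
Proof.
move=> n2 hm /cox2_unit; have l1 : (1 < n)%N by rewrite ltnS ltnW.
pose g0 (j : nat) : R := (j == 0)%:R + (j == 1)%:R.
have g0E : row ord0 (gmx g0) = En R n' 0 + En R n' 1.
  by rewrite row0_gmx; apply/rowP => j; rewrite !mxE.
have -> : 2 *: coxmx R m = gmx g0 *m wmx g0.
  apply: gmx_ind => [k l lk ll|k lk|l ll|]; rewrite cox2E hm /forkM /=.
  - rewrite eqSS /adjp !eqSS -/(adjp k l); case: eqP => _; first by rewrite cosm1; lra.
    by case: ifP => _; rewrite ?cosm3 ?cosm2; lra.
  - by rewrite /g0; case: k lk => [|[|k]] lk /=; rewrite ?cosm3 ?cosm2; lra.
  - rewrite g0E mulmxDl (En_mul (ltn0Sn n')) (En_mul l1) !mxE /=.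
    by case: l ll => [|[|l]] ll /=; rewrite ?cosm3 ?cosm2; lra.
  - by rewrite g0E mulmxDl (En_mul (ltn0Sn n')) (En_mul l1) !mxE /= cosm1 /g0 /=; lra.
move=> uni.
have mE i : (i < n)%N -> mrefl (gmx g0) (wmx g0) ord0 (En R n' i) =
    (if (i < 2)%N then -1 else 1) *: En R n' (swp 1 i).
  move=> lti; rewrite /mrefl (En_mul lti) row0E wmx0 g0E /g0.
  case: i lti => [|[|i]] lti /=; apply/rowP => x; rewrite !mxE; lra.
apply: (hacc_classical_model (t := true) (b := false) (@gmx_succ g0) (@wmx_succ g0)) => //.
- rewrite g0E (_ : _ + _ = 1 *: sdiff n' (-1) 0 1); last by rewrite /sdiff scale1r scaleN1r opprK.
  by apply: upto_sdiff; rewrite ?oner_neq0 // !inE eqxx orbT.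
- apply: (@signed_perm_closed _ _ _ _ _ _ _ (fun i => if (i < 2)%N then -1 else 1) (swp 1)) => [i lti|i j _ _].
    by split; rewrite ?mE ?swp_lt //; case: ifP => _; rewrite !inE eqxx ?orbT.
  exact: (can_inj (@swpK 1)).
- move=> _ i /andP [i0 lti]; elim: i i0 lti => [|[|i] IH] // _ lti.
    rewrite (_ : sdiff _ _ _ _ = row ord0 (gmx g0)); first exact: mroot_row.
    by rewrite g0E /sdiff scaleN1r opprK addrC.
  apply: (@mroot_swap _ _ _ _ i.+2 (sdiff n' (-1) i.+1 0)); rewrite ?lti //; last exact: IH (ltnW lti).
  move=> lt; rewrite swap_sdiff ?(ltnW lti) // ?(swpl i.+2) //.
  + exact: gmx_succ.
  + exact: wmx_succ.
Qed.

End StdClassical.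

(** * Matching the exceptional diagrams with their tables *)

Section Exceptional.

Variable R : realType.

Lemma hacc_cart_scale n (m : 'I_n -> 'I_n -> nat) (M : nat -> nat -> nat) (T : eqType) (o : cops T) cart (inj : T -> R) (d : 'I_n -> R) :
  (forall i j, m i j = M i j) -> (forall i, d i != 0) ->
  (forall k i : 'I_n, d k * inj (nth (tzero o) (nth [::] cart i) k) = - 2 * cosm R (M k i) * d i) ->
  hacc (isroot (cartmx o n cart inj)) -> hacc (isroot (2 *: coxmx R m)).
Proof.
move=> hm d0 h; apply: (@hacc_reindex _ _ _ _ _ id id d) => // k i.
by rewrite mxE h !mxE hm mulrN; congr (_ * _); rewrite mulNr.
Qed.

Lemma hacc_cart n (m : 'I_n -> 'I_n -> nat) (M : nat -> nat -> nat) (T : eqType) (o : cops T) cart (inj : T -> R) (code : nat -> T) (labels : seq nat) :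
  (forall i j, m i j = M i j) ->
  (forall p, p \in labels -> inj (code p) = - 2 * cosm R p) ->
  all (fun i => all (fun k => (M k i \in labels) && (nth (tzero o) (nth [::] cart i) k == code (M k i)))
    (iota 0 n)) (iota 0 n) ->
  hacc (isroot (cartmx o n cart inj)) -> hacc (isroot (2 *: coxmx R m)).
Proof.
move=> hm hc h; apply: (@hacc_cart_scale _ _ M _ _ _ _ (fun _ => 1)) => // [i|k i]; first exact: oner_neq0.
move: h => /allP /(_ i); rewrite mem_iota ltn_ord => /(_ isT) /allP /(_ k).
by rewrite mem_iota ltn_ord => /(_ isT) /andP [/hc E /eqP ->]; rewrite E mul1r mulr1.
Qed.

Lemma zinjE : (zinj R BinNums.Z0 = 0) * (zinj R (BinNums.Zpos BinNums.xH) = 1) * (zinj R z2 = 2) * (zinj R z1n = -1) * (zinj R z2n = -2).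
Proof. by do !split; rewrite /zinj ?(_ : int_of_Z z2 = 2) ?(_ : int_of_Z z1n = -1) ?(_ : int_of_Z z2n = -2) // rmorphN. Qed.

Definition zcode (p : nat) := if p is 1%N then z2 else if p is 2%N then BinNums.Z0 else z1n.

Lemma zcodeE p : p \in [:: 1; 2; 3]%N -> zinj R (zcode p) = - 2 * cosm R p.
Proof.
by rewrite !inE => /or3P [] /eqP ->; rewrite !zinjE ?cosm1 ?cosm2 ?cosm3; lra.
Qed.

Definition gcode (p : nat) := if p is 5%N then (BinNums.Z0, z1n) else (zcode p, BinNums.Z0).

Lemma gcodeE p : p \in [:: 1; 2; 3; 5]%N -> ginj (2 * cosm R 5) (gcode p) = - 2 * cosm R p.
Proof.
by rewrite !inE => /or4P [] /eqP ->; rewrite /ginj /gcode /zcode /= !zinjE ?cosm1 ?cosm2 ?cosm3; lra.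
Qed.

Lemma hacc_E6 (m : 'I_6 -> 'I_6 -> nat) : (forall i j, m i j = forkM 3 i j) -> hacc (isroot (2 *: coxmx R m)).
Proof.
move=> hm; apply: (hacc_cart hm zcodeE (o := zops) (cart := cart_E6)); first by vm_compute.
by have /andP [h1 h2] := table_E6_ok; apply: table_hacc h1 h2; [exact: zspec|exact: zinj_ge0].
Qed.

Lemma hacc_E7 (m : 'I_7 -> 'I_7 -> nat) : (forall i j, m i j = forkM 3 i j) -> hacc (isroot (2 *: coxmx R m)).
Proof.
move=> hm; apply: (hacc_cart hm zcodeE (o := zops) (cart := cart_E7)); first by vm_compute.
by have /andP [h1 h2] := table_E7_ok; apply: table_hacc h1 h2; [exact: zspec|exact: zinj_ge0].
Qed.

Lemma hacc_E8 (m : 'I_8 -> 'I_8 -> nat) : (forall i j, m i j = forkM 3 i j) -> hacc (isroot (2 *: coxmx R m)).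
Proof.
move=> hm; apply: (hacc_cart hm zcodeE (o := zops) (cart := cart_E8)); first by vm_compute.
by have /andP [h1 h2] := table_E8_ok; apply: table_hacc h1 h2; [exact: zspec|exact: zinj_ge0].
Qed.

(** The golden ratio is [2 cos (pi / 5)]. *)
Lemma golden_cosm : (2 * cosm R 5) ^+ 2 = 2 * cosm R 5 + 1.
Proof. by have := cosm5 R; rewrite !expr2; lra. Qed.

Lemma golden_ge0 : 0 <= 2 * cosm R 5.
Proof. by have := cosm_ge0 R (isT : (1 < 5)%N); lra. Qed.

Lemma hacc_H3 (m : 'I_3 -> 'I_3 -> nat) : (forall i j, m i j = pathM 5 i j) -> hacc (isroot (2 *: coxmx R m)).
Proof.
move=> hm; apply: (hacc_cart hm gcodeE (o := gops) (cart := cart_H3)); first by vm_compute.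
have /andP [h1 h2] := table_H3_ok; apply: table_hacc h1 h2; first exact: (gspec golden_cosm).
exact: (ginj_ge0 golden_ge0).
Qed.

Lemma hacc_H4 (m : 'I_4 -> 'I_4 -> nat) : (forall i j, m i j = pathM 5 i j) -> hacc (isroot (2 *: coxmx R m)).
Proof.
move=> hm; apply: (hacc_cart hm gcodeE (o := gops) (cart := cart_H4)); first by vm_compute.
have /andP [h1 h2] := table_H4_ok; apply: table_hacc h1 h2; first exact: (gspec golden_cosm).
exact: (ginj_ge0 golden_ge0).
Qed.

Definition pathF4 (i j : nat) : nat :=
  if i == j then 1 else if adjp i j then (if (i + j == 3)%N then 4 else 3) else 2.

Lemma hacc_F4 (m : 'I_4 -> 'I_4 -> nat) : (forall i j, m i j = pathF4 i j) -> hacc (isroot (2 *: coxmx R m)).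
Proof.
move=> hm; pose c : R := 2 * cosm R 4.
have c2 : c * c = 2 by have := cosm4_sq R; rewrite /c; nra.
have c0 : c != 0 by apply: contra_eq_neq c2 => ->; rewrite mul0r eq_sym pnatr_eq0.
(* The simple roots 2 and 3, on one side of the double bond, are rescaled by the square root of 2 to
   match the integral matrix. *)
apply: (hacc_cart_scale hm (o := zops) (cart := cart_F4) (inj := zinj R) (d := fun i => if (i < 2)%N then 1 else c)).
- by move=> i; case: ifP => _; rewrite ?oner_neq0.
- by case=> [[|[|[|[|k]]]] lk] // [[|[|[|[|i]]]] li] //=; rewrite /pathF4 /= !zinjE ?cosm1 ?cosm2 ?cosm3 /c; have := cosm4_sq R; nra.
have /andP [h1 h2] := table_F4_ok; apply: table_hacc h1 h2; [exact: zspec|exact: zinj_ge0].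
Qed.

End Exceptional.

(** * Arrangements in the plane *)

Section RankTwo.

Variable F : realFieldType.

Lemma arr_extract m (a : 'rV[F]_m) (s : seq 'rV[F]_m) : a != 0 -> exists L,
  [/\ arr (a :: L), {subset L <= s} &
      forall b, b \in s -> b = 0 \/ exists2 l, l \in a :: L & (b <= l)%MS].
Proof.
move=> a0; elim: s => [|c s [L [h1 h2 h3]]]; first by exists [::]; split=> //; rewrite arr_cons a0.
have [c0|c0] := eqVneq c 0.
  exists L; split=> // [b /h2|b]; first by rewrite inE orbC => ->.
  by rewrite inE => /predU1P [->|/h3]; [left|].
have [/hasP [l lL cl]|hn] := boolP (has (fun l => c <= l)%MS (a :: L)).
  exists L; split=> // [b /h2|b]; first by rewrite inE orbC => ->.
  by rewrite inE => /predU1P [->|/h3]; [right; exists l|].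
exists (c :: L); move: hn => /= /norP [ca cL]; split.
- move: h1; rewrite !arr_cons /= c0 => /and3P [_ -> ->]; rewrite a0 -all_predC in cL *.
  by rewrite cL !andbT; apply: contra ca; apply: sub_row_sym.
- by move=> b; rewrite !inE => /predU1P [->|/h2 ->]; rewrite ?eqxx ?orbT.
move=> b; rewrite inE => /predU1P [->|/h3 [->|[l lL bl]]]; [right|by left|right].
  by exists c; rewrite ?inE ?eqxx ?orbT.
by exists l => //; move: lL; rewrite !inE => /orP [->|->]; rewrite ?orbT.
Qed.

Lemma free_exp_nth m (A : seq 'rV[F]_m) (es : seq nat) (M : 'M[{mpoly F[m]}]_m) : size es = m ->
  saito M A (fun i => nth 0%N es i) -> free_exp A es.
Proof.
move=> se sM; exists (fun i : 'I_m => nth 0%N es i); first by exists M.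
rewrite (map_comp (nth 0%N es) val) val_enum_ord -se map_nth_iota0 // take_size.
exact: perm_refl.
Qed.

Lemma mpolyX_neq0 m (j : 'I_m) : ('X_j : {mpoly F[m]}) != 0.
Proof. by rewrite -msupp_eq0 msuppX. Qed.

Lemma free_exp_line : free_exp [:: (1 : 'rV[F]_1)] [:: 1%N].
Proof.
apply: (@free_exp_nth _ _ _ ('X_0)%:M) => //; split.
- by move=> i j; rewrite !ord1 mxE eqxx /= dhomogX /= mdeg1.
- move=> a; rewrite mem_seq1 => /eqP -> i; rewrite !ord1 dvalE big_ord1 !mxE eqxx scale1r.
  exists 1; rewrite mulr1 /lin big_ord1 !mxE scale1r //.
- by rewrite det_scalar1 mpolyX_neq0.
- by rewrite big_ord_recl big_ord0.
Qed.

(** The Euler derivation together with [q d/dx_1], where [q] is the product of the forms other than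
    [x_0]; the second derivation kills [x_0]. *)
Lemma free_exp_plane (L : seq 'rV[F]_2) : arr (delta_mx 0 0 :: L) ->
  free_exp (delta_mx 0 0 :: L) [:: 1%N; size L].
Proof.
move=> hL; pose q := \prod_(a <- L) lin a.
pose M : 'M[{mpoly F[2]}]_2 := \matrix_(i, j) if i == 0 then 'X_j else if j == 0 then 0 else q.
apply: (@free_exp_nth _ _ _ M) => //; split.
- move=> i j; rewrite mxE; case: (unliftP 0 i) => [k ->|->]; last by rewrite eqxx dhomogX /= mdeg1.
  rewrite [k]ord1 /=; case: ifP => _; first exact: dhomog0.
  exact: prod_lin_homog.
- move=> a aL i; rewrite dvalE; case: (unliftP 0 i) => [k ->|->]; last first.
    by exists 1; rewrite mulr1; apply: eq_bigr => j _; rewrite mxE eqxx.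
  rewrite [k]ord1 !big_ord_recl big_ord0 !mxE /= scaler0 add0r addr0.
  move: aL; rewrite inE => /predU1P [->|aL]; first by rewrite mxE /= scale0r; apply: pdvd0.
  exists (a 0 (lift 0 0) *: \prod_(b <- rem a L) lin b).
  by rewrite /q (big_rem _ aL) /= scalerAr.
- rewrite -det_tr det_trig; last first.
    by apply/is_trig_mxP => i j; rewrite !mxE; case: (unliftP 0 i) (unliftP 0 j) => [k ->|->] [l ->|->] //; rewrite ?[k]ord1 ?[l]ord1.
  rewrite !big_ord_recl big_ord0 !mxE /= mulr1 mulf_neq0 ?mpolyX_neq0 //.
  by apply: prod_lin_neq0; move: hL; rewrite arr_cons => /and3P [].
- by rewrite !big_ord_recl big_ord0 /= addn0 add1n.
Qed.

Lemma delta0_neq0 n (i : 'I_n) : (delta_mx 0 i : 'rV[F]_n) != 0.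
Proof. by apply/eqP => /matrixP /(_ 0 i); rewrite !mxE !eqxx => /eqP; rewrite oner_eq0. Qed.

Lemma in_flat_simple n (Phi : 'rV[F]_n -> Prop) (x v : 'cV[F]_n) i :
  Phi (delta_mx 0 i) -> in_flat Phi x v -> x i 0 = 0 -> v i 0 = 0.
Proof.
move=> hi h; have e (y : 'cV[F]_n) : ((delta_mx 0 i : 'rV_n) *m y == 0) = (y i 0 == 0).
  by rewrite mx11_eq0 -rowE mxE.
by move/eqP; rewrite -e => /eqP /(h _ hi) /eqP; rewrite e => /eqP.
Qed.

(** A line has the single exponent 1, which is also the smaller exponent of the plane, so a line of
    the arrangement continues the chain. The argument works with any finite set of forms, which
    treats all dihedral types together. *)
Lemma hacc_rank2 (Phi : 'rV[F]_2 -> Prop) (S : seq 'rV[F]_2) :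
  (forall r, Phi r -> r \in S) -> (forall i, Phi (delta_mx 0 i)) -> hacc Phi.
Proof.
move=> hS hd.
have c0 (x : 'cV[F]_2) : x = 0 -> chain Phi x [::].
  move=> ->; apply: chain_nil => v h; apply/matrixP => i j.
  by rewrite ord1 (in_flat_simple (hd i) h) !mxE.
have c1 (x : 'cV[F]_2) (r : 'rV_2) : Phi r -> r != 0 -> r *m x = 0 -> x != 0 -> chain Phi x [:: 1%N].
  move=> hr r0 rx x0; apply: (@chain_rcons _ _ _ _ 0 [::]) => //; last exact: c0.
    exists 1%N, x, [:: 1]; split; last exact: free_exp_line.
    - split=> [|v]; first by rewrite /row_full -mxrank_tr rank_rV -(inj_eq trmx_inj) trmx0 trmxK x0.
      split=> [h|[z -> s _ sx]]; last by rewrite mulmxA sx mul0mx.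
      have kx : (x^T <= kermx r^T)%MS by apply/sub_kermxP; rewrite -trmx_mul rx trmx0.
      have kv : (v^T <= kermx r^T)%MS by apply/sub_kermxP; rewrite -trmx_mul (h r hr rx) trmx0.
      have rk : \rank (kermx r^T) = 1%N by rewrite mxrank_ker mxrank_tr rank_rV r0.
      have : (v^T <= x^T)%MS.
        apply: (submx_trans kv); rewrite -(geq_leqif (mxrank_leqif_sup kx)) rk lt0n mxrank_eq0.
        by rewrite -trmx0 (inj_eq trmx_inj).
      case/sub_rVP => c vx; exists c%:M.
      by apply: trmx_inj; rewrite vx trmx_mul tr_scalar_mx mul_scalar_mx.
    - split; first by rewrite arr_cons oner_neq0.
        move=> a _; right; exists 1; rewrite ?inE ?eqxx //.
        by apply/sub_rVP; exists ((a *m x) 0 0); rewrite {1}[a *m x]mx11_scalar scalemx1.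
      move=> l; rewrite inE => /eqP ->.
      have [i xi] : exists i, x i 0 != 0.
        apply/existsP; apply: contraNT x0; rewrite negb_exists => /forallP h.
        by apply/eqP/matrixP => i j; rewrite ord1 mxE; apply/eqP; have := h i; rewrite negbK.
      exists (delta_mx 0 i) => //; rewrite -rowE; apply/sub_rVP; exists (x i 0)^-1.
      apply/matrixP => a b; rewrite !ord1 !mxE eqxx mulVf //.
  by move=> s _ _; rewrite mulmx0.
move=> x; have [->|x0] := eqVneq x 0; first by exists [::]; apply: c0.
have [[r [hr r0 rx]]|hn] := EM (exists r, [/\ Phi r, r != 0 & r *m x = 0]).
  by exists [:: 1%N]; apply: (c1 x r).
pose S' := [seq r <- S | `[<Phi r>]].
have [L [h1 h2 h3]] := arr_extract S' (delta0_neq0 0).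
have S'E r : r \in S' <-> Phi r.
  by rewrite mem_filter; split=> [/andP [/asboolP]|hr] //; rewrite hS // andbT; apply/asboolP.
have hL l : l \in delta_mx 0 0 :: L -> Phi l.
  by rewrite inE => /predU1P [->|/h2 /S'E].
have L0 : (0 < size L)%N.
  case: L h1 h3 {h2 hL} => // _ /(_ (delta_mx 0 1)) [|/eqP|[l]]; first exact/S'E.
    by rewrite (negPf (delta0_neq0 1)).
  rewrite inE => /eqP -> /sub_rVP [c /matrixP /(_ 0 1)]; rewrite !mxE /= mulr0.
  by move/eqP; rewrite oner_eq0.
exists [:: 1%N; size L]; apply: (@chain_rcons _ _ _ _ (delta_mx 0 0) [:: 1%N]).
- by rewrite /= L0.
- exists 2%N, 1%:M, (delta_mx 0 0 :: L); split; last exact: free_exp_plane.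
    split=> [|v]; first by rewrite /row_full mxrank1.
    split=> [_|_ r hr rx]; first by exists v; rewrite mul1mx.
    have [->|r0] := eqVneq r 0; first by rewrite mul0mx.
    by case: hn; exists r.
  split=> // [r /S'E /h3|l lL]; rewrite ?mulmx1 //.
  by exists l; [exact: hL|rewrite mulmx1].
- move=> r hr rx; have [->|r0] := eqVneq r 0; first by rewrite mul0mx.
  by case: hn; exists r.
- apply: (c1 _ (delta_mx 0 1)) => //; first exact: delta0_neq0.
    by rewrite mul_delta_mx_cond mulr0n.
  by rewrite -trmx_delta -(inj_eq trmx_inj) trmxK trmx0 delta0_neq0.
Qed.

End RankTwo.

(** * Classification of the diagrams *)

Section PositiveDiagrams.

Variables (R : realType) (n : nat) (m : 'I_n -> 'I_n -> nat).
Hypothesis m1 : forall i, m i i = 1%N.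
Hypothesis msym : forall i j, m i j = m j i.
Hypothesis m2 : forall i j, i != j -> (1 < m i j)%N.
Hypothesis mpos : posdef (coxmx R m).

Lemma coxmx_gram_add (u : 'rV[R]_n) c x :
  ((u + c *: (delta_mx 0 x : 'rV[R]_n)) *m coxmx R m *m (u + c *: (delta_mx 0 x : 'rV[R]_n))^T) 0 0 =
  (u *m coxmx R m *m u^T) 0 0 + c ^+ 2 - 2 * c * \sum_y u 0 y * cosm R (m x y).
Proof.
set B := coxmx R m; have Bt : B^T = B by apply/matrixP => i j; rewrite !mxE msym.
have E (v : 'rV[R]_n) : (v *m B *m (delta_mx 0 x : 'rV[R]_n)^T) 0 0 = - \sum_y v 0 y * cosm R (m x y).
  rewrite mxE (bigD1 x) //= [X in _ + X]big1 ?addr0 => [|y yx]; last by rewrite !mxE (negPf yx) mulr0.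
  rewrite !mxE !eqxx mulr1 -sumrN; apply: eq_bigr => y _.
  by rewrite !mxE msym mulrN.
have E' (v : 'rV[R]_n) : ((delta_mx 0 x : 'rV[R]_n) *m B *m v^T) 0 0 = (v *m B *m (delta_mx 0 x : 'rV[R]_n)^T) 0 0.
  have := congr1 (fun A : 'M_1 => A 0 0) (trmx_mul (v *m B) (delta_mx 0 x : 'rV[R]_n)^T).
  by rewrite mxE => ->; rewrite trmxK trmx_mul Bt mulmxA.
have aD (A C : 'M[R]_1) : (A + C) 0 0 = A 0 0 + C 0 0 by rewrite mxE.
have aZ d (A : 'M[R]_1) : (d *: A) 0 0 = d * A 0 0 by rewrite mxE.
rewrite linearD linearZ /= !mulmxDl !mulmxDr -!scalemxAl -!scalemxAr !(aD, aZ) !E' !E.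
suff -> : \sum_y (delta_mx 0 x : 'rV[R]_n) 0 y * cosm R (m x y) = -1 by ring.
rewrite (bigD1 x) //= [X in _ + X]big1 ?addr0; last by move=> y yx; rewrite mxE (negPf yx) andbF mul0r.
by rewrite mxE !eqxx m1 cosm1 mul1r.
Qed.

Definition comb (h : nat -> 'I_n) (c : nat -> R) N : 'rV[R]_n := \sum_(0 <= t < N) c t *: delta_mx 0 (h t).

Lemma combE h c N x : comb h c N 0 x = \sum_(0 <= t < N) c t * (x == h t)%:R.
Proof. by rewrite /comb summxE; apply: eq_bigr => t _; rewrite !mxE. Qed.

Lemma comb_sum h c N (f : 'I_n -> R) : \sum_x comb h c N 0 x * f x = \sum_(0 <= t < N) c t * f (h t).
Proof.
under eq_bigr => x _ do rewrite combE mulr_suml.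
rewrite exchange_big; apply: eq_bigr => t _.
rewrite (bigD1 (h t)) //= eqxx mulr1 big1 ?addr0 // => x /negPf ->.
by rewrite mulr0 mul0r.
Qed.

(* As the off-diagonal entries of the form are nonpositive, the edges not counted in [S] only
   decrease the norm. *)
Lemma gram_gt0 N h (c S : nat -> R) : (0 < N)%N -> (forall s t, (s < t < N)%N -> h s != h t) ->
  (forall t, (t < N)%N -> 0 < c t) ->
  (forall t, (0 < t < N)%N -> S t <= \sum_(0 <= s < t) c s * cosm R (m (h t) (h s))) ->
  0 < \sum_(0 <= t < N) c t ^+ 2 - 2 * \sum_(1 <= t < N) c t * S t.
Proof.
move=> N0 hh hc hS.
have u0 : comb h c N != 0.
  apply/eqP => /rowP /(_ (h 0%N)); rewrite combE mxE big_ltn // eqxx mulr1 => /eqP.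
  rewrite gt_eqF // ltr_wpDr ?hc // big_nat_cond; apply: sumr_ge0 => t /andP [/andP [_ lt] _].
  by rewrite mulr_ge0 ?ler0n // ltW ?hc.
apply: lt_le_trans (mpos u0) _.
elim: N N0 hh hc hS {u0} => // -[_ _ _ hc _|N IH _ hh hc hS].
  rewrite /comb !big_nat1 [X in _ * X]big_geq // mulr0 subr0.
  rewrite -[_ *: _]add0r coxmx_gram_add !mul0mx mxE add0r lerBlDr lerDl.
  by rewrite big1 ?mulr0 // => y _; rewrite mxE mul0r.
rewrite /comb big_nat_recr //= -/(comb h c N.+1) coxmx_gram_add comb_sum.
rewrite [X in _ <= X - _]big_nat_recr //= [X in _ <= _ - _ * X]big_nat_recr //=.
have h2 := hS N.+1 (ltnSn _); have c0 := hc N.+1 (ltnSn _).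
have h3 : c N.+1 * S N.+1 <= c N.+1 * \sum_(0 <= s < N.+1) c s * cosm R (m (h N.+1) (h s)).
  by rewrite ler_pM2l.
have h4 : (comb h c N.+1 *m coxmx R m *m (comb h c N.+1)^T) 0 0 <=
   \sum_(0 <= t < N.+1) c t ^+ 2 - 2 * \sum_(1 <= t < N.+1) c t * S t.
  apply: IH => // [s t st|t tN|t tN]; [apply: hh|apply: hc|apply: hS]; lia.
lra.
Qed.

Lemma cosm_ne_ge0 x y : x != y -> 0 <= cosm R (m x y).
Proof. by move=> xy; apply: cosm_ge0; apply: m2. Qed.

(** Each node after the first keeps only the edge to its parent, with [k] a lower bound for its
    cosine. A choice of [c] making the expression nonpositive excludes the subdiagram. *)
Lemma tree_gt0 N h (c : nat -> R) par (k : nat -> R) : (0 < N)%N -> (forall s t, (s < t < N)%N -> h s != h t) ->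
  (forall t, (t < N)%N -> 0 < c t) ->
  (forall t, (0 < t < N)%N -> (par t < t)%N /\ k t <= cosm R (m (h t) (h (par t)))) ->
  0 < \sum_(0 <= t < N) c t ^+ 2 - 2 * \sum_(1 <= t < N) c t * (c (par t) * k t).
Proof.
move=> N0 hh hc hp; apply: (@gram_gt0 _ h) => // t /andP [t0 tN].
have [pt kt] := hp t (introT andP (conj t0 tN)).
have c0 : 0 <= c (par t) by apply/ltW/hc; apply: ltn_trans pt tN.
rewrite (bigD1_seq (par t)) ?iota_uniq ?mem_index_iota //=.
rewrite -[leLHS]addr0 lerD ?ler_wpM2l // big_nat_cond big_seq_cond; apply: sumr_ge0 => s.
rewrite mem_index_iota -!andbA => /and3P [_ st _].
rewrite mulr_ge0 //; first by apply/ltW/hc; exact: ltn_trans st tN.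
by apply: cosm_ne_ge0; rewrite eq_sym hh // st.
Qed.

(** Chords are not excluded here; that there are none follows in [ispath_far] from the absence of
    cycles. *)
Definition ispath (f : nat -> 'I_n) k :=
  (forall s t, (s < t < k)%N -> f s != f t) /\ forall t, (t.+1 < k)%N -> (2 < m (f t) (f t.+1))%N.

Lemma cosm_edge x y : (2 < m x y)%N -> 2^-1 <= cosm R (m x y).
Proof. by move=> h; rewrite -(cosm3 R); apply: cosm_mono. Qed.

Lemma ispath_sub f k a l : ispath f k -> (a + l <= k)%N -> ispath (fun t => f (a + t)%N) l.
Proof.
move=> [h1 h2] le; split=> [s t /andP [st tl]|t tl]; first by apply: h1; lia.
by rewrite addnS; apply: h2; lia.
Qed.

Lemma ispath_rev f k : ispath f k -> ispath (fun t => f (k.-1 - t)%N) k.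
Proof.
move=> [h1 h2]; split=> [s t /andP [st tl]|t tl]; first by rewrite eq_sym; apply: h1; lia.
by rewrite msym (_ : (k.-1 - t)%N = (k.-1 - t.+1).+1); [apply: h2|]; lia.
Qed.

Lemma sum_halves N : (0 < N)%N -> \sum_(1 <= t < N) (2^-1 : R) = (N%:R - 1) / 2.
Proof. by case: N => // N _; rewrite sumr_const_nat subn1 /= -mulr_natr -natr1; lra. Qed.

(** On a cycle the sum of the simple roots has norm at most zero: each vertex contributes 1, and
    each of the equally many edges at most -1. *)
Lemma ispath_acyclic f k : ispath f k -> (2 < k)%N -> (2 < m (f 0%N) (f k.-1))%N -> False.
Proof.
case: k => // k [h1 h2] k2 h0.
(* The value 1 at the last vertex accounts for its two earlier neighbours, its predecessor and the
   first vertex. *)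
have := @gram_gt0 k.+1 f (fun=> 1) (fun t => if t == k then 1 else 2^-1) isT h1 (fun _ _ => ltr01).
have hs t s : (t < k.+1)%N -> (s < t)%N -> 0 <= 1 * cosm R (m (f t) (f s)).
  by move=> tk st; rewrite mul1r cosm_ne_ge0 // eq_sym h1 // st.
move=> /(_ _)/[dup] H {H}; move=> /(_ _) H.
have : 0 < \sum_(0 <= t < k.+1) 1 ^+ 2 - 2 * \sum_(1 <= t < k.+1) 1 * (if t == k then 1 else 2^-1) :> R.
  apply: H => -[//|t] /andP [_ tk]; rewrite big_nat_recr //= mul1r msym.
  case: eqP => [tE|_].
    case: t tE tk => [|t] tE tk; first by lia.
    rewrite big_nat_recl //= mul1r msym addrAC -[leLHS]addr0 lerD //.
      rewrite [leLHS](_ : _ = 2^-1 + 2^-1); last by lra.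
      by apply: lerD; apply: cosm_edge; [rewrite msym tE msym|apply: h2].
    by rewrite big_nat_cond; apply: sumr_ge0 => s /andP [/andP [_ st] _]; apply: (hs t.+2 s.+1) => //; apply: ltnW.
  apply: ler_wpDl; last by apply: cosm_edge; apply: h2.
  by rewrite big_nat_cond; apply: sumr_ge0 => s /andP [/andP [_ st] _]; apply: hs => //; apply: ltnW.
rewrite [X in _ - _ * X](big_nat_recr k) //=; last by lia.
rewrite eqxx [\sum_(1 <= _ < k) _](eq_big_nat _ _ (F2 := fun=> 2^-1)); last by move=> t /andP [_ tk]; rewrite mul1r ltn_eqF.
rewrite sum_halves; last by lia.
rewrite sumr_const_nat subn0 expr1n -mulr_natr -[k.+1]addn1 natrD; lra.
Qed.

Lemma ispath_far f k s t : ispath f k -> (s.+1 < t < k)%N -> m (f s) (f t) = 2%N.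
Proof.
move=> hp /andP [st tk]; have := m2 (hp.1 s t _); rewrite tk ltnW // => /(_ isT) h.
apply/eqP; rewrite eqn_leq h andbT leqNgt; apply/negP => h3.
apply: (@ispath_acyclic (fun i => f (s + i)%N) (t - s).+1); first by apply: ispath_sub hp _; lia.
- by lia.
- by rewrite addn0 /= subnKC // ltnW // ltnW.
Qed.

(* The sum of the roots on a path has norm at most 1, and adding a neighbour with coefficient
   [cos (pi / m)] lowers the norm by [cos (pi / m) ^ 2]. *)
Lemma pendants_lt1 f l (ps : seq ('I_n * nat)) : (0 < l)%N -> ispath f l -> uniq (unzip1 ps) ->
  (forall p, p \in ps -> [/\ (p.2 < l)%N, forall t, (t < l)%N -> f t != p.1 & (2 < m p.1 (f p.2))%N]) ->
  \sum_(p <- ps) cosm R (m p.1 (f p.2)) ^+ 2 < 1.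
Proof.
move=> l0 [h1 h2] ups hps; pose p0 := (f 0%N, 0%N); pose pt t := nth p0 ps (t - l).
have hpt t : (t < l + size ps)%N -> (t < l)%N = false -> pt t \in ps.
  by move=> lt tl; apply: mem_nth; rewrite ltn_subLR // leqNgt tl.
pose k t := cosm R (m (pt t).1 (f (pt t).2)).
have := @tree_gt0 (l + size ps) (fun t => if (t < l)%N then f t else (pt t).1)
  (fun t => if (t < l)%N then 1 else k t) (fun t => if (t < l)%N then t.-1 else (pt t).2)
  (fun t => if (t < l)%N then 2^-1 else k t).
have lN : (0 < l + size ps)%N by lia.
move=> /(_ lN) H.
have {H} : 0 < \sum_(0 <= t < l + size ps) (if (t < l)%N then 1 else k t) ^+ 2 - 2 *
  \sum_(1 <= t < l + size ps) (if (t < l)%N then 1 else k t) * ((if ((if (t < l) then t.-1 else (pt t).2) < l)%N then 1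
    else k (if (t < l)%N then t.-1 else (pt t).2)) * (if (t < l)%N then 2^-1 else k t)).
  apply: H => [s t /andP [st tN]|t tN|t /andP [t0 tN]].
  - case: ifP => sl; case: ifP => tl.
    + by apply: h1; rewrite st.
    + by have [_ + _] := hps _ (hpt t tN tl); apply.
    + by lia.
    + have : nth (f 0%N) (unzip1 ps) (s - l) != nth (f 0%N) (unzip1 ps) (t - l).
        by rewrite nth_uniq ?size_map //; lia.
      by rewrite !(nth_map p0) //; lia.
  - case: ifP => // tl; apply: cosm_gt0.
    by have [_ _] := hps _ (hpt t tN tl).
  - case: ifP => tl.
      have tp : (t.-1 < l)%N by lia.
      rewrite tp; split; first by lia.
      by apply: cosm_edge; rewrite msym; case: t t0 tl {tN tp} => // t _ tl /=; apply: h2.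
    have [h3 _ _] := hps _ (hpt t tN tl); rewrite h3; split; first by apply: leq_trans h3 _; rewrite leqNgt tl.
    exact: lexx.
rewrite (@big_cat_nat _ _ _ l 0) ?leq_addr //= (@big_cat_nat _ _ _ l 1) ?leq_addr //=.
rewrite (eq_big_nat _ _ (F2 := fun=> 1)); last by move=> t /andP [_ tl]; rewrite tl expr1n.
rewrite [\sum_(1 <= _ < l) _](eq_big_nat _ _ (F2 := fun=> 2^-1)); last first.
  by move=> t /andP [t1 tl]; rewrite tl (_ : (t.-1 < l)%N) ?mul1r //; lia.
rewrite sum_halves // sumr_const_nat subn0.
have E (F G : nat -> R) : (forall t, (l <= t < l + size ps)%N -> F t = G t) ->
    \sum_(l <= t < l + size ps) F t = \sum_(l <= t < l + size ps) G t by apply: eq_big_nat.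
rewrite (E _ (fun t => k t ^+ 2)); last by move=> t /andP [tl _]; rewrite ltnNge tl.
rewrite [X in _ - _ * (_ + X)](E _ (fun t => k t ^+ 2)); last first.
  move=> t /andP [tl tN]; have tl' : (t < l)%N = false by rewrite ltnNge tl.
  by have [h3 _ _] := hps _ (hpt t tN tl'); rewrite tl' h3 mul1r expr2.
have -> : \sum_(l <= t < l + size ps) k t ^+ 2 = \sum_(p <- ps) cosm R (m p.1 (f p.2)) ^+ 2.
  rewrite (big_nth p0) -{1}[l]add0n [(l + _)%N]addnC big_addn addnK.
  by apply: eq_big_nat => t _; rewrite /k /pt addnK.
set X := \sum_(p <- ps) _; lra.
Qed.

Definition inj_upto (g : nat -> 'I_n) K := forall s t, (s < t < K)%N -> g s != g t.

Definition fcons (y : 'I_n) (f : nat -> 'I_n) (t : nat) := if t is t'.+1 then f t' else y.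

Lemma inj_fcons y f k : inj_upto f k -> (forall t, (t < k)%N -> f t != y) -> inj_upto (fcons y f) k.+1.
Proof.
move=> hf hy [|s] [|t] /andP [st tk] //=; first by rewrite eq_sym hy.
by apply: hf; rewrite -ltnS st.
Qed.

Lemma inj_upto_eq g K s t : inj_upto g K -> (s < K)%N -> (t < K)%N -> (g s == g t) = (s == t).
Proof.
move=> hg sK tK; case: (ltngtP s t) => [st|ts|->]; last by rewrite eqxx.
  by have /negPf -> : g s != g t by apply: hg; rewrite st.
by have h : g t != g s; [apply: hg; rewrite ts|rewrite eq_sym (negPf h)].
Qed.

Lemma ispath_cons y f k : ispath f k -> (forall t, (t < k)%N -> f t != y) ->
  (2 < m y (f 0%N))%N -> ispath (fcons y f) k.+1.
Proof.
move=> [h1 h2] hy h0; split; first exact: inj_fcons.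
by case=> [|t] //= tk; apply: h2.
Qed.

(** [idx] lists the nodes of a tree, [par] the positions of their parents and [cs] integral
    coefficients. For an affine diagram the marks of the null root give a vector of norm zero and
    turn the inequality into an equality. *)
Lemma simply_laced_excl g K (idx cs par : seq nat) : inj_upto g K -> uniq idx ->
  all (fun t => t < K)%N idx -> (0 < size idx)%N ->
  all (fun t => 0 < nth 0 cs t)%N (iota 0 (size idx)) ->
  all (fun t => nth 0 par t < t)%N (iota 1 (size idx).-1) ->
  (sumn [seq nth 0 cs t ^ 2 | t <- iota 0 (size idx)] <=
   sumn [seq nth 0 cs t * nth 0 cs (nth 0 par t) | t <- iota 1 (size idx).-1])%N ->
  (forall t, (0 < t < size idx)%N -> 2 < m (g (nth 0 idx t)) (g (nth 0 idx (nth 0 par t))))%N ->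
  False.
Proof.
move=> hg ui /allP hK N0 /allP hc /allP hp hs he.
have hN t : (t < size idx)%N -> (nth 0 idx t < K)%N by move=> lt; apply/hK/mem_nth.
have hpt t : (0 < t < size idx)%N -> (nth 0 par t < t)%N.
  by move=> /andP [t0 tN]; apply: hp; rewrite mem_iota; lia.
have := @tree_gt0 (size idx) (fun t => g (nth 0%N idx t)) (fun t => (nth 0%N cs t)%:R)
  (nth 0%N par) (fun=> 2^-1) N0.
move=> H; suff : 0 < \sum_(0 <= t < size idx) (nth 0%N cs t)%:R ^+ 2 - 2 *
    \sum_(1 <= t < size idx) (nth 0%N cs t)%:R * ((nth 0%N cs (nth 0%N par t))%:R * 2^-1) :> R.
  move: hs; rewrite !sumnE !big_map -(ler_nat R) !natr_sum => hs.
  rewrite mulr_sumr [X in _ - X](eq_bigr (fun t => (nth 0%N cs t * nth 0%N cs (nth 0%N par t))%:R)) => [|t _].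
    rewrite [X in X - _](eq_bigr (fun t => (nth 0%N cs t ^ 2)%:R)) => [|t _]; last by rewrite natrX.
    by rewrite /index_iota subn0 subn1; lra.
  by rewrite natrM; lra.
apply: H => [s t /andP [st tN]|t tN|t tN].
- by rewrite (inj_upto_eq hg) ?hN ?(ltn_trans st) // nth_uniq ?(ltn_trans st) // ltn_eqF.
- by rewrite ltr0n; apply: hc; rewrite mem_iota.
- by split; [apply: hpt|apply/cosm_edge/he].
Qed.

Lemma cosm_sq3 x y : (2 < m x y)%N -> 4^-1 <= cosm R (m x y) ^+ 2.
Proof. by move=> /cosm_edge; nra. Qed.

Lemma cosm_sq4 x y : (3 < m x y)%N -> 2^-1 <= cosm R (m x y) ^+ 2.
Proof.
move=> h; have := @cosm_mono R 4 _ isT h; have := cosm4_sq R; have := @cosm_gt0 R 4 isT.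
by rewrite !expr2; nra.
Qed.

Lemma cosm_sq6 x y : (5 < m x y)%N -> 3 / 4 <= cosm R (m x y) ^+ 2.
Proof.
move=> h; have := @cosm_mono R 6 _ isT h; have := cosm6_sq R; have := @cosm_gt0 R 6 isT.
by rewrite !expr2; nra.
Qed.

Lemma cosm5_ge x y : (4 < m x y)%N -> 4 / 5 <= cosm R (m x y).
Proof.
move=> h; have := @cosm_mono R 5 _ isT h; have := cosm5 R; have := @cosm_gt0 R 5 isT.
by rewrite !expr2; nra.
Qed.

(** The segment between the two heavy edges has two further neighbours, each with squared cosine at
    least 1/2, against [pendants_lt1]. *)
Lemma ispath_labels f k i j : ispath f k -> (i < j)%N -> (j.+1 < k)%N ->
  (3 < m (f i) (f i.+1))%N -> (3 < m (f j) (f j.+1))%N -> False.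
Proof.
move=> hf ij jk li lj.
have := @pendants_lt1 (fun t => f (i.+1 + t)%N) (j - i) [:: (f i, 0%N); (f j.+1, (j - i).-1)].
have hd s t : (s < t < k)%N -> f s != f t by apply: hf.1.
rewrite !big_cons big_nil /= => H.
suff : cosm R (m (f i) (f (i.+1 + 0)%N)) ^+ 2 + (cosm R (m (f j.+1) (f (i.+1 + (j - i).-1)%N)) ^+ 2 + 0) < 1.
  rewrite addn0 (_ : (i.+1 + (j - i).-1)%N = j); last by lia.
  by rewrite msym in lj; have := cosm_sq4 li; have := cosm_sq4 lj; lra.
apply: H; first by lia.
- by apply: ispath_sub hf _; lia.
- by rewrite /= !inE andbT; apply: hd; lia.
move=> p; rewrite !inE => /orP [] /eqP -> /=; split; try lia.
- by move=> t tl; rewrite eq_sym; apply: hd; lia.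
- by rewrite addn0; lia.
- by move=> t tl; apply: hd; lia.
- by rewrite (_ : (i.+1 + (j - i).-1)%N = j) 1?msym; lia.
Qed.

(** A node of the heavy edge with a further neighbour would have squared cosines at least 3/4 and
    1/4. *)
Lemma ispath_no6 f k i : ispath f k -> (2 < k)%N -> (i.+1 < k)%N -> (5 < m (f i) (f i.+1))%N -> False.
Proof.
have main f' i' : ispath f' k -> (i'.+2 < k)%N -> (5 < m (f' i') (f' i'.+1))%N -> False.
  move=> hf ik li.
  have hd s t : (s < t < k)%N -> f' s != f' t by apply: hf.1.
  have := @pendants_lt1 (fun t => f' (i'.+1 + t)%N) 1 [:: (f' i', 0%N); (f' i'.+2, 0%N)].
  rewrite !big_cons big_nil /= addn0 => H.
  have l2 : (2 < m (f' i'.+2) (f' i'.+1))%N by rewrite msym; apply: hf.2.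
  have : cosm R (m (f' i') (f' i'.+1)) ^+ 2 + (cosm R (m (f' i'.+2) (f' i'.+1)) ^+ 2 + 0) < 1.
    apply: H => //; first by apply: ispath_sub hf _; lia.
    + by rewrite /= !inE andbT; apply: hd; lia.
    move=> p; rewrite !inE => /orP [] /eqP -> /=; split; rewrite ?addn0 //; try lia.
    * by move=> t tl; rewrite eq_sym; apply: hd; lia.
    * by move=> t tl; apply: hd; lia.
  by have := cosm_sq6 li; have := cosm_sq3 l2; lra.
move=> hf k2 ik li; case: (ltnP i.+2 k) => [|ki]; first by move=> lt; apply: (main f i).
apply: (main (fun t => f (k.-1 - t)%N) 0%N); [exact: ispath_rev|by []|].
by rewrite subn0 (_ : k.-1 = i.+1) 1?(_ : (i.+1 - 1)%N = i) 1?msym; lia.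
Qed.

Lemma ispath_matrix f k (T : nat -> nat -> nat) : ispath f k -> (forall i, T i i = 1%N) ->
  (forall i j, T i j = T j i) -> (forall i j, (i.+1 < j)%N -> T i j = 2%N) ->
  (forall t, (t.+1 < k)%N -> m (f t) (f t.+1) = T t t.+1) ->
  forall i j, (i < k)%N -> (j < k)%N -> m (f i) (f j) = T i j.
Proof.
move=> hf T1 Ts T2 hT.
have main i j : (i < j)%N -> (j < k)%N -> m (f i) (f j) = T i j.
  rewrite leq_eqVlt => /predU1P [<-|ij] jk; first exact: hT.
  by rewrite T2 // (ispath_far hf) // ij.
move=> i j ik jk; case: (ltngtP i j) => [ij|ji|->]; [exact: main| |by rewrite m1 T1].
by rewrite msym Ts main.
Qed.

(** Two nodes form a standard diagram whatever their label. On longer paths the heavy edge comes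
    first, except in F4, where it is in the middle. *)
Inductive std : nat -> (nat -> nat -> nat) -> Prop :=
| std_A k : std k (pathM 3)
| std_B k : std k (pathM 4)
| std_D k : (2 < k)%N -> std k (forkM 2)
| std_E k : (5 < k < 9)%N -> std k (forkM 3)
| std_H k : (2 < k < 5)%N -> std k (pathM 5)
| std_F : std 4 pathF4
| std_I T : std 2 T.

Definition realizes (g : nat -> 'I_n) K := exists2 T, std K T &
  forall i j, (i < K)%N -> (j < K)%N -> m (g i) (g j) = T i j.

Lemma pathM_path p i j : (i.+1 < j)%N -> pathM p i j = 2%N.
Proof. by rewrite /pathM /adjp => ij; rewrite !ifF //; lia. Qed.

Lemma pathM_sym p i j : pathM p i j = pathM p j i.
Proof. by rewrite /pathM /adjp eq_sym orbC [(i == 0%N) || _]orbC. Qed.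

Lemma pathM_diag p i : pathM p i i = 1%N.
Proof. by rewrite /pathM eqxx. Qed.

Lemma pathM_succ p t : pathM p t t.+1 = if t == 0%N then p else 3%N.
Proof. by rewrite /pathM /adjp ltn_eqF // eqxx orbF. Qed.

Lemma ispath_pathM f k p : ispath f k -> (1 < k -> m (f 0%N) (f 1%N) = p)%N ->
  (forall t, (0 < t)%N -> (t.+1 < k)%N -> m (f t) (f t.+1) = 3%N) ->
  forall i j, (i < k)%N -> (j < k)%N -> m (f i) (f j) = pathM p i j.
Proof.
move=> hf h0 h3; apply: ispath_matrix => //; [exact: pathM_diag|exact: pathM_sym|exact: pathM_path|].
by case=> [|t] tk; rewrite pathM_succ; [exact: h0|exact: h3].
Qed.

(** The coefficients are the marks 1, 2, 3, 4, 2 of the affine diagram of F4, divided by the square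
    root of 2 on the short roots. The two sums are 24 and 12, so the norm is zero. *)
Lemma affine_F4_excl f : ispath f 5 -> (3 < m (f 2) (f 3))%N -> False.
Proof.
move=> [h1 h2] l4; pose r := 2 * cosm R 4.
have r2 : r * r = 2 by have := cosm4_sq R; rewrite /r; nra.
have r0 : 0 < r by have := @cosm_gt0 R 4 isT; rewrite /r; lra.
have := @tree_gt0 5 f (fun t => nth 0 [:: 1; 2; 3; 2 * r; r] t) predn
  (fun t => if t == 3 then r / 2 else 2^-1) isT h1 _ _.
rewrite /index_iota /= !big_cons !big_nil /= => H.
suff : 0 < 1 ^+ 2 + (2 ^+ 2 + (3 ^+ 2 + ((2 * r) ^+ 2 + (r ^+ 2 + 0)))) - 2 * (2 * (1 * 2^-1) +
   (3 * (2 * 2^-1) + (2 * r * (3 * (r / 2)) + (r * (2 * r * 2^-1) + 0)))) :> R by nra.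
apply: H; first by case=> [|[|[|[|[|t]]]]] //= _; lra.
case=> [|[|[|[|[|t]]]]] //= _; split=> //; rewrite msym; try by apply/cosm_edge/h2.
by rewrite /r [leLHS](_ : _ = cosm R 4); [apply: cosm_mono|lra].
Qed.

(** The bound 4/5 for [cos (pi / 5)] suffices. The coefficients 20, 15, 10, 5 decrease linearly
    along the simple edges, and 16 is 4/5 of 20; the norm is at most 1006 - 1012. *)
Lemma affine_H4_excl f : ispath f 5 -> (4 < m (f 0%N) (f 1))%N -> False.
Proof.
move=> [h1 h2] l5.
have := @tree_gt0 5 f (fun t => nth 0 [:: 16; 20; 15; 10; 5] t) predn
  (fun t => if t == 1 then 4 / 5 else 2^-1) isT h1 _ _.
rewrite /index_iota /= !big_cons !big_nil /= => H.
suff : 0 < 16 ^+ 2 + (20 ^+ 2 + (15 ^+ 2 + (10 ^+ 2 + (5 ^+ 2 + 0)))) - 2 * (20 * (16 * (4 / 5)) +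
   (15 * (20 * 2^-1) + (10 * (15 * 2^-1) + (5 * (10 * 2^-1) + 0)))) :> R by lra.
apply: H; first by case=> [|[|[|[|[|t]]]]] //= _; lra.
by case=> [|[|[|[|[|t]]]]] //= _; split=> //; rewrite msym; try (by apply/cosm_edge/h2); apply: cosm5_ge.
Qed.

(** With the bound 4/5 for [cos (pi / 5)] the coefficients 1, 2, 2, 1 give a norm of at most 10 -
    10.4. *)
Lemma interior5_excl f : ispath f 4 -> (4 < m (f 1) (f 2))%N -> False.
Proof.
move=> [h1 h2] l5.
have := @tree_gt0 4 f (fun t => nth 0 [:: 1; 2; 2; 1] t) predn
  (fun t => if t == 2 then 4 / 5 else 2^-1) isT h1 _ _.
rewrite /index_iota /= !big_cons !big_nil /= => H.
suff : 0 < 1 ^+ 2 + (2 ^+ 2 + (2 ^+ 2 + (1 ^+ 2 + 0))) - 2 * (2 * (1 * 2^-1) +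
   (2 * (2 * (4 / 5)) + (1 * (2 * 2^-1) + 0))) :> R by lra.
apply: H; first by case=> [|[|[|[|t]]]] //= _; lra.
by case=> [|[|[|[|t]]]] //= _; split=> //; rewrite msym; try (by apply/cosm_edge/h2); apply: cosm5_ge.
Qed.

(** At most one edge is heavy, and after a reversal it lies in the first half. At the end it gives
    types B and H; further inside its label is 4, and the path has exactly four nodes, because five
    contain the affine diagram of F4. *)
Lemma ispath_realizes f k : ispath f k -> (0 < k)%N ->
  realizes f k \/ realizes (fun t => f (k.-1 - t)%N) k.
Proof.
move=> hf k0; have [hall|] := EM (forall t, (t.+1 < k)%N -> m (f t) (f t.+1) = 3%N).
  by left; exists (pathM 3); [exact: std_A|apply: ispath_pathM => // [k1|t _ tk]; exact: hall].
have [k2|k2] := eqVneq k 2%N; first by rewrite k2; left; exists (fun i j => m (f i) (f j)); [exact: std_I|].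
move=> hex; have {hex} [t [tk lt]] : exists t, (t.+1 < k)%N /\ (3 < m (f t) (f t.+1))%N.
  apply: contrapT => hn; apply: hex => t tk; apply/eqP; rewrite eqn_leq hf.2 // andbT leqNgt.
  by apply/negP => h; apply: hn; exists t.
have k3 : (2 < k)%N by lia.
have main f' t' : ispath f' k -> (t'.+1 < k)%N -> (3 < m (f' t') (f' t'.+1))%N -> (t'.*2.+2 <= k)%N ->
    realizes f' k.
  move=> {hf f t tk lt} hf tk lt tt; set f := f' in hf lt *; set t := t' in tk lt tt *.
  have l3 s : (s.+1 < k)%N -> s != t -> m (f s) (f s.+1) = 3%N.
    move=> sk st; apply/eqP; rewrite eqn_leq hf.2 // andbT leqNgt; apply/negP => h.
    by case: (ltngtP s t) st => // st _; [apply: (ispath_labels hf st)|apply: (ispath_labels hf st)].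
  have l6 : (m (f t) (f t.+1) < 6)%N by rewrite ltnNge; apply/negP; apply: ispath_no6 hf k3 tk.
  have [t0|t0] := posnP t.
    have h p : m (f 0%N) (f 1%N) = p -> forall i j, (i < k)%N -> (j < k)%N -> m (f i) (f j) = pathM p i j.
      by move=> e; apply: ispath_pathM => // s s0 sk; apply: l3; rewrite // t0 -lt0n.
    rewrite t0 in lt l6; have [l4|l4] := eqVneq (m (f 0%N) (f 1%N)) 4%N.
      by exists (pathM 4); [exact: std_B|exact: h].
    have l5 : m (f 0%N) (f 1%N) = 5%N by lia.
    exists (pathM 5); last exact: h.
    apply: std_H; rewrite k3 ltnNge; apply/negP => k5; apply: (@affine_H4_excl f); last by rewrite l5.
    exact: (@ispath_sub f k 0 5).
  have l4 : m (f t) (f t.+1) = 4%N.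
    apply/eqP; rewrite eqn_leq lt andbT leqNgt; apply/negP => l5.
    apply: (@interior5_excl (fun s => f (t.-1 + s)%N)); first by apply: ispath_sub hf _; lia.
    by rewrite (_ : (t.-1 + 1)%N = t) 1?(_ : (t.-1 + 2)%N = t.+1) //; lia.
  have [k4|k4] := eqVneq k 4%N.
    have t1 : t = 1%N by lia.
    exists pathF4; first by rewrite k4; apply: std_F.
    apply: ispath_matrix => // [i|i j|i j ij|s sk].
    - by rewrite /pathF4 eqxx.
    - by rewrite /pathF4 /adjp eq_sym orbC addnC.
    - by rewrite /pathF4 /adjp !ifF //; lia.
    have [->|st] := eqVneq s t; first by rewrite l4 t1.
    rewrite l3 // /pathF4 /adjp ltn_eqF // eqxx /= ifF //; lia.
  exfalso; apply: (@affine_F4_excl (fun s => f (t.+3 - s)%N)); last first.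
    by rewrite (_ : (t.+3 - 2)%N = t.+1) 1?(_ : (t.+3 - 3)%N = t) 1?msym ?l4 //; lia.
  have := @ispath_sub f k t.-1 5 hf; rewrite (_ : (t.-1 + 5 <= k)%N); last by lia.
  move=> /(_ isT) /ispath_rev [h1 h2]; have e s : (s < 5)%N -> (t.-1 + (4 - s))%N = (t.+3 - s)%N by lia.
  split=> [s u /andP [su u5]|s s5].
    by have := h1 s u; rewrite su u5 /= !e; [apply|lia|lia].
  by have := h2 s s5; rewrite /= !e; lia.
case: (leqP t.*2.+2 k) => h; first by left; apply: (main f t).
right; apply: (main _ (k.-2 - t)%N); [exact: ispath_rev|by lia| |by lia].
by rewrite msym (_ : (k.-1 - (k.-2 - t))%N = t.+1) 1?(_ : (k.-1 - (k.-2 - t).+1)%N = t); lia.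
Qed.

(** Maximal length among all paths of the diagram, so that it also bounds paths that turn off at a
    branch node. *)
Definition maximal k := forall f k', ispath f k' -> (k' <= k)%N.

Definition outside (f : nat -> 'I_n) k x := forall t, (t < k)%N -> f t != x.

Lemma label2 x y : x != y -> ~ (2 < m x y)%N -> m x y = 2%N.
Proof. by move=> xy h; apply/eqP; rewrite eqn_leq m2 // andbT leqNgt; apply/negP. Qed.

Lemma outside_rev f k x : outside f k x -> outside (fun t => f (k.-1 - t)%N) k x.
Proof. by move=> h t tk; apply: h; lia. Qed.

Lemma rev_rev (f : nat -> 'I_n) k i : (i < k)%N -> f (k.-1 - (k.-1 - i))%N = f i.
Proof. by move=> ik; congr f; lia. Qed.

(** A neighbour of an end node would lengthen the path. *)
Lemma maximal_interior f k x i : ispath f k -> maximal k -> outside f k x -> (i < k)%N ->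
  (2 < m x (f i))%N -> (0 < i)%N && (i.+1 < k)%N.
Proof.
have main f' : ispath f' k -> maximal k -> outside f' k x -> ~ (2 < m x (f' 0%N))%N.
  by move=> hf hm hx h0; have := hm _ _ (ispath_cons hf hx h0); rewrite ltnn.
move=> hf hm hx ik hi; apply/andP; split; first by rewrite lt0n; apply: contraPneq hi => ->; apply: main.
rewrite ltn_neqAle ik andbT; apply: contraPneq hi => ek.
have := main _ (ispath_rev hf) hm (outside_rev hx).
by rewrite subn0 -ek.
Qed.

(** A second neighbour on the path would close a cycle. *)
Lemma neighbour_uniq f k x i j : ispath f k -> outside f k x -> (i < k)%N -> (j < k)%N ->
  (2 < m x (f i))%N -> (2 < m x (f j))%N -> i = j.
Proof.
move=> hf hx; wlog ij : i j / (i < j)%N => [h ik jk hi hj|ik jk hi hj].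
  by case: (ltngtP i j) => // lt; [apply: h|apply/esym/h].
exfalso; have hs : ispath (fun t => f (i + t)%N) (j - i).+1 by apply: ispath_sub hf _; lia.
have := @ispath_cons x _ _ hs; rewrite addn0 => H.
apply: (ispath_acyclic (H _ hi)) => [t tl||/=]; [by apply: hx; lia|by lia|].
by rewrite subnKC // ltnW.
Qed.

Section Fork.

Variables (f : nat -> 'I_n) (k : nat) (y : 'I_n) (i : nat).
Hypotheses (hf : ispath f k) (hm : maximal k) (hy : outside f k y) (ik : (i < k)%N).
Hypothesis hi : (2 < m y (f i))%N.

(** The segment from the branch node to a heavy edge would have three further neighbours, with
    squared cosines at least 1/4, 1/4 and 1/2. *)
Lemma fork_path3 t : (t.+1 < k)%N -> m (f t) (f t.+1) = 3%N.
Proof.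
have main f' i' t' : ispath f' k -> outside f' k y -> (2 < m y (f' i'))%N -> (0 < i')%N ->
    (i' <= t')%N -> (t'.+1 < k)%N -> ~ (3 < m (f' t') (f' t'.+1))%N.
  move=> hf' hy' hi' i0 it tk l4.
  have hd s u : (s < u < k)%N -> f' s != f' u by apply: hf'.1.
  have := @pendants_lt1 (fun u => f' (i' + u)%N) (t' - i').+1
    [:: (y, 0%N); (f' i'.-1, 0%N); (f' t'.+1, (t' - i')%N)].
  rewrite !big_cons big_nil /= addn0 (_ : (i' + (t' - i'))%N = t'); last by lia.
  have l3 : (2 < m (f' i'.-1) (f' i'))%N by case: i' i0 tk it {hi'} => // i' _ tk it; apply: hf'.2; lia.
  move=> H; rewrite msym in l4.
  have : cosm R (m y (f' i')) ^+ 2 + (cosm R (m (f' i'.-1) (f' i')) ^+ 2 +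
      (cosm R (m (f' t'.+1) (f' t')) ^+ 2 + 0)) < 1.
    apply: H => //; first by apply: ispath_sub hf' _; lia.
    + rewrite /= !inE !negb_or ![y == _]eq_sym !hy' ?andbT; [|lia|lia].
      by apply: hd; lia.
    move=> p; rewrite !inE => /or3P [] /eqP -> /=; split; rewrite ?addn0 ?subnKC //; try lia.
    * by move=> u ul; apply: hy'; lia.
    * by move=> u ul; rewrite eq_sym; apply: hd; lia.
    * by move=> u ul; apply: hd; lia.
  by have := cosm_sq3 hi'; have := cosm_sq3 l3; have := cosm_sq4 l4; lra.
move=> tk; apply/eqP; rewrite eqn_leq hf.2 // andbT leqNgt; apply/negP => l4.
have /andP [i0 i1] := maximal_interior hf hm hy ik hi.
case: (leqP i t) => it; first exact: (main f i t).
apply: (main (fun u => f (k.-1 - u)%N) (k.-1 - i)%N (k.-2 - t)%N); rewrite ?rev_rev //; try lia.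
- exact: ispath_rev.
- exact: outside_rev.
- by rewrite msym (_ : (k.-1 - (k.-2 - t))%N = t.+1) 1?(_ : (k.-1 - (k.-2 - t).+1)%N = t) //; lia.
Qed.

(** Otherwise the three squared cosines at the branch node would be at least 1/2, 1/4 and 1/4. *)
Lemma fork_branch3 : m y (f i) = 3%N.
Proof.
apply/eqP; rewrite eqn_leq hi andbT leqNgt; apply/negP => l4.
have /andP [i0 i1] := maximal_interior hf hm hy ik hi.
have hd s u : (s < u < k)%N -> f s != f u by apply: hf.1.
have := @pendants_lt1 (fun u => f (i + u)%N) 1 [:: (y, 0%N); (f i.-1, 0%N); (f i.+1, 0%N)].
rewrite !big_cons big_nil /= addn0 => H.
have l3 : (2 < m (f i.-1) (f i))%N by have := hf.2 i.-1; rewrite prednK //; apply.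
have l3' : (2 < m (f i.+1) (f i))%N by rewrite msym; apply: hf.2.
have : cosm R (m y (f i)) ^+ 2 + (cosm R (m (f i.-1) (f i)) ^+ 2 +
    (cosm R (m (f i.+1) (f i)) ^+ 2 + 0)) < 1.
  apply: H => //; first by apply: ispath_sub hf _; lia.
  + rewrite /= !inE !negb_or ![y == _]eq_sym !hy ?andbT; [|lia|lia].
    by apply: hd; lia.
  move=> p; rewrite !inE => /or3P [] /eqP -> /=; split; rewrite ?addn0 //; try lia.
  * by move=> u ul; apply: hy; lia.
  * by move=> u ul; rewrite eq_sym; apply: hd; lia.
  * by move=> u ul; apply: hd; lia.
by have := cosm_sq4 l4; have := cosm_sq3 l3; have := cosm_sq3 l3'; lra.
Qed.

(** With a second branch, the segment between the two attachments would have four further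
    neighbours, each contributing at least 1/4. *)
Lemma fork_closed_path x t : y != x -> outside f k x -> (t < k)%N -> ~ (2 < m x (f t))%N.
Proof.
move=> yx.
have main f' i' j : ispath f' k -> outside f' k y -> outside f' k x -> (i' <= j)%N -> (0 < i')%N ->
    (j.+1 < k)%N -> (2 < m y (f' i'))%N -> ~ (2 < m x (f' j))%N.
  move=> hf' hy' hx' ij i0 jk hi' hj.
  have hd s u : (s < u < k)%N -> f' s != f' u by apply: hf'.1.
  have := @pendants_lt1 (fun u => f' (i' + u)%N) (j - i').+1
    [:: (y, 0%N); (f' i'.-1, 0%N); (x, (j - i')%N); (f' j.+1, (j - i')%N)].
  rewrite !big_cons big_nil /= addn0 (_ : (i' + (j - i'))%N = j); last by lia.
  have l3 : (2 < m (f' i'.-1) (f' i'))%N by case: i' i0 ij {hi'} => // i' _ ij; apply: hf'.2; lia.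
  have l3' : (2 < m (f' j.+1) (f' j))%N by rewrite msym; apply: hf'.2.
  move=> H.
  have : cosm R (m y (f' i')) ^+ 2 + (cosm R (m (f' i'.-1) (f' i')) ^+ 2 +
      (cosm R (m x (f' j)) ^+ 2 + (cosm R (m (f' j.+1) (f' j)) ^+ 2 + 0))) < 1.
    apply: H => //; first by apply: ispath_sub hf' _; lia.
    + rewrite /= !inE !negb_or yx ![y == _]eq_sym [x == _]eq_sym !hy' ?hx' ?andbT; try lia.
      by apply: hd; lia.
    move=> p; rewrite !inE => /or4P [] /eqP -> /=; split; rewrite ?addn0 ?subnKC //; try lia.
    * by move=> u ul; apply: hy'; lia.
    * by move=> u ul; rewrite eq_sym; apply: hd; lia.
    * by move=> u ul; apply: hx'; lia.
    * by move=> u ul; apply: hd; lia.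
  by have := cosm_sq3 hi'; have := cosm_sq3 l3; have := cosm_sq3 hj; have := cosm_sq3 l3'; lra.
move=> hx tk ht; have /andP [i0 i1] := maximal_interior hf hm hy ik hi.
have /andP [t0 t1] := maximal_interior hf hm hx tk ht.
case: (leqP i t) => it; first exact: (main f i t).
apply: (main (fun u => f (k.-1 - u)%N) (k.-1 - i)%N (k.-1 - t)%N); rewrite ?rev_rev //; try lia.
- exact: ispath_rev.
- exact: outside_rev.
- exact: outside_rev.
Qed.

(** By maximality both arms of the path at the branch node have at least two nodes, which together
    with [y] and [x] is too much. *)
Lemma fork_closed_branch x : y != x -> outside f k x -> ~ (2 < m x y)%N.
Proof.
move=> yx hx hxy.
have main f' i' : ispath f' k -> outside f' k y -> outside f' k x -> (i' < k)%N ->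
    (2 < m y (f' i'))%N -> (1 < i')%N.
  move=> hf' hy' hx' ik' hi'.
  have hs : ispath (fun t => f' (i' + t)%N) (k - i') by apply: ispath_sub hf' _; lia.
  have h1 : ispath (fcons y (fun t => f' (i' + t)%N)) (k - i').+1.
    by apply: ispath_cons => // [t tl|]; [apply: hy'; lia|rewrite addn0].
  have h2 : ispath (fcons x (fcons y (fun t => f' (i' + t)%N))) (k - i').+2.
    by apply: ispath_cons => // -[|t] //= tl; apply: hx'; lia.
  by have := hm h2; lia.
have i2 := main f i hf hy hx ik hi.
have := main _ (k.-1 - i)%N (ispath_rev hf) (outside_rev hy) (outside_rev hx).
rewrite rev_rev // => /(_ _ hi) i2'; have {}i2' : (1 < k.-1 - i)%N by apply: i2'; lia.
have hg : inj_upto (fcons x (fcons y f)) k.+2.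
  by apply: inj_fcons; [apply: inj_fcons hy; exact: hf.1|case=> [|t] //= tk; apply: hx].
(* the affine diagram of type E6 *)
apply: (@simply_laced_excl (fcons x (fcons y f)) k.+2
  [:: i.+2; i.+1; i.+3; 1; i; i.+4; 0]%N [:: 3; 2; 2; 2; 1; 1; 1]%N [:: 0; 0; 0; 0; 1; 2; 3]%N) => //.
- by rewrite /= !inE; lia.
- by rewrite /=; lia.
have [j ij] : exists j, i = j.+2 by exists (i - 2)%N; lia.
have hj := hi; rewrite ij in hj i2' *; have jk : (j.+4 < k)%N by lia.
have up t : (t.+1 < k)%N -> (2 < m (f t) (f t.+1))%N by apply: hf.2.
have down t : (t.+1 < k)%N -> (2 < m (f t.+1) (f t))%N by rewrite msym; apply: hf.2.
by case=> [|[|[|[|[|[|[|t]]]]]]] //= _; [apply: up|apply: down|apply: up|apply: down]; lia.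
Qed.

(** [i] is the length of the shorter arm: 1 gives type D and 2 gives type E, where positivity bounds
    the longer arm; a shorter arm of length 3 or more is impossible. *)
Lemma fork_realizes : (i <= k.-1 - i)%N -> realizes (fcons y f) k.+1.
Proof.
move=> ile; have /andP [i0 i1] := maximal_interior hf hm hy ik hi.
have hg : inj_upto (fcons y f) k.+1 by apply: inj_fcons hy; exact: hf.1.
have hmx a b : (a < k.+1)%N -> (b < k.+1)%N -> m (fcons y f a) (fcons y f b) = forkM i.+1 a b.
  have hp : forall a b, (a < k)%N -> (b < k)%N -> m (f a) (f b) = pathM 3 a b.
    by apply: ispath_pathM => // [k1|t _ tk]; apply: fork_path3.
  have hb j : (j < k)%N -> m y (f j) = if j.+1 == i.+1 then 3%N else 2%N.
    move=> jk; rewrite eqSS; case: eqP => [->|ji]; first exact: fork_branch3.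
    apply: label2 => [|h]; first by rewrite eq_sym hy.
    by apply: ji; apply: (neighbour_uniq hf hy jk ik h hi).
  case: a b => [|a] [|b] ak bk; rewrite /forkM //=.
  - by rewrite hb.
  - by rewrite msym hb.
  - by rewrite hp // /pathM /adjp !eqSS; case: eqP => // _; rewrite if_same.
have down t : (t.+1 < k)%N -> (2 < m (f t) (f t.+1))%N by apply: hf.2.
have up t : (t.+1 < k)%N -> (2 < m (f t.+1) (f t))%N by rewrite msym; apply: hf.2.
have [e1|n1] := eqVneq i 1%N; first 
  by have h := hmx; rewrite e1 in h; exists (forkM 2) => //; apply: std_D; lia.
have [e2|n2] := eqVneq i 2%N.
  have h := hmx; rewrite e2 in h; exists (forkM 3) => //.
  apply: std_E; rewrite e2 in ile; apply/andP; split; first by lia.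
  rewrite ltnS leqNgt; apply/negP => k8.
  (* the affine diagram of type E8 *)
  apply: (@simply_laced_excl (fcons y f) k.+1
    [:: 3; 2; 1; 0; 4; 5; 6; 7; 8]%N [:: 6; 4; 2; 3; 5; 4; 3; 2; 1]%N [:: 0; 0; 1; 0; 0; 4; 5; 6; 7]%N) => //.
    by rewrite /=; lia.
  have hi2 := hi; rewrite e2 in hi2.
  by case=> [|[|[|[|[|[|[|[|[|t]]]]]]]]] //= _; [apply: down|apply: down|
    apply: up|apply: up|apply: up|apply: up|apply: up]; lia.
exfalso; have [j ij] : exists j, i = j.+3 by exists (i - 3)%N; lia.
have hj := hi; rewrite ij in hj ile i1.
(* the affine diagram of type E7 *)
apply: (@simply_laced_excl (fcons y f) k.+1
  [:: j.+4; j.+3; j.+4.+1; j.+2; j.+4.+2; j.+1; j.+4.+3; 0]%N [:: 4; 3; 3; 2; 2; 1; 1; 2]%N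
  [:: 0; 0; 0; 1; 2; 3; 4; 0]%N) => //.
- by rewrite /= !inE; lia.
- by rewrite /=; lia.
by case=> [|[|[|[|[|[|[|[|t]]]]]]]] //= _; [apply: down|apply: up|apply: down|
  apply: up|apply: down|apply: up]; lia.
Qed.

End Fork.

Definition isolated (g : nat -> 'I_n) K := forall x, outside g K x ->
  forall t, (t < K)%N -> m x (g t) = 2%N.

Lemma inj_upto_leq g K : inj_upto g K -> (K <= n)%N.
Proof.
move=> hg; rewrite -[K](size_iota 0) -(size_map g) -[n in (_ <= n)%N]size_enum_ord.
apply: uniq_leq_size => [|x _]; last by rewrite mem_enum.
rewrite map_inj_in_uniq ?iota_uniq // => s t; rewrite !mem_iota /= add0n => sK tK /eqP.
by rewrite (inj_upto_eq hg) // => /eqP.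
Qed.

Lemma exists_maximal : (0 < n)%N -> exists f k, [/\ (0 < k)%N, ispath f k & maximal k].
Proof.
move=> n0; pose P k := `[<exists f, ispath f k>].
have P1 : P 1%N by apply/asboolP; exists (fun=> Ordinal n0); split=> [s t|t]; lia.
have bound k : P k -> (k <= n)%N by move=> /asboolP [f [h _]]; apply: inj_upto_leq h.
case: (ex_maxnP (ex_intro (fun k => P k) 1%N P1) bound) => k /asboolP [f hf] kmax; exists f, k; split=> //.
  exact: kmax.
by move=> f' k' h; apply: kmax; apply/asboolP; exists f'.
Qed.

(** A longest path, together with the branch attached to it if there is one, is a whole
    component. *)
Lemma exists_component : (0 < n)%N -> exists g K,
  [/\ (0 < K)%N, inj_upto g K, isolated g K & realizes g K].
Proof.
move=> n0; have [f [k [k0 hf hm]]] := exists_maximal n0.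
have [[y [i [hy ik hi]]]|hn] := EM (exists y i, [/\ outside f k y, (i < k)%N & (2 < m y (f i))%N]).
  have main f' i' : ispath f' k -> outside f' k y -> (i' < k)%N -> (2 < m y (f' i'))%N ->
      (i' <= k.-1 - i')%N -> exists g K, [/\ (0 < K)%N, inj_upto g K, isolated g K & realizes g K].
    move=> hf' hy' ik' hi' ile; exists (fcons y f'), k.+1; split=> //.
    - by apply: inj_fcons hy'; exact: hf'.1.
    - move=> x hx t tk.
      have yx : y != x by apply: (hx 0%N).
      have hx' : outside f' k x by move=> u uk; apply: (hx u.+1).
      apply: label2; first by rewrite eq_sym hx.
      by case: t tk => [|t] tk /=; [exact: (fork_closed_branch hf' hm hy' ik' hi')|exact: (fork_closed_path hf' hm hy' ik' hi')].
    - exact: (fork_realizes hf' hm hy' ik' hi').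
  case: (leqP i (k.-1 - i)) => ile; first exact: (main f i).
  apply: (main _ (k.-1 - i)%N (ispath_rev hf) (outside_rev hy)); rewrite ?rev_rev //; lia.
have iso : isolated f k.
  move=> x hx t tk; apply: label2; first by rewrite eq_sym hx.
  by move=> h; apply: hn; exists x, t.
have [h|h] := ispath_realizes hf k0; first by exists f, k; split=> //; exact: hf.1.
exists (fun t => f (k.-1 - t)%N), k; split=> //; first exact: (ispath_rev hf).1.
by move=> x /outside_rev hx t tk; apply: iso; [move=> u uk; rewrite -(rev_rev f uk); apply: hx|lia].
Qed.

End PositiveDiagrams.

(** * Reduction to connected diagrams *)

Section FiniteCoxeter.

Variable R : realType.

(** Finiteness in a form that is inherited by subdiagrams, so that parabolic subgroups do not have
    to be constructed. *)
Definition finite_coxeter n (m : 'I_n -> 'I_n -> nat) : Prop :=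
  [/\ forall i, m i i = 1%N, forall i j, m i j = m j i, forall i j, i != j -> (1 < m i j)%N,
      posdef (coxmx R m) &
      exists S : seq 'rV[R]_n, forall r, isroot (2 *: coxmx R m) r -> r \in S].

Lemma finite_coxeter_sub n k (m : 'I_n -> 'I_n -> nat) (h : 'I_k -> 'I_n) : injective h ->
  finite_coxeter m -> finite_coxeter (fun i j => m (h i) (h j)).
Proof.
move=> hinj [m1 ms m2 mp [S hS]].
pose E : 'M[R]_(k, n) := \matrix_(i, j) (j == h i)%:R.
have rE i : row i E = delta_mx 0 (h i) by apply/rowP => j; rewrite !mxE eqxx.
have EK : E *m E^T = 1%:M.
  apply/matrixP => i j; rewrite !mxE (bigD1 (h i)) //= !mxE eqxx mul1r (inj_eq hinj) big1 ?addr0 //.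
  by move=> x /negPf xi; rewrite !mxE xi mul0r.
have colE p (X : 'M[R]_(p, n)) a i : (X *m E^T) a i = X a (h i).
  rewrite mxE (bigD1 (h i)) //= !mxE eqxx mulr1 big1 ?addr0 // => x /negPf xi.
  by rewrite !mxE xi mulr0.
have BE : coxmx R (fun i j => m (h i) (h j)) = E *m coxmx R m *m E^T.
  apply/matrixP => i j; rewrite colE [RHS]mxE (bigD1 (h i)) //= [E _ _]mxE eqxx mul1r.
  rewrite [X in _ + X]big1 => [|x /negPf xi]; last by rewrite [E _ _]mxE xi mul0r.
  by rewrite addr0 !mxE.
split=> // [i j ij||].
- by apply: m2; rewrite (inj_eq hinj).
- move=> u u0; have uE : u *m E != 0.
    by apply: contraNneq u0 => e; rewrite -[u]mulmx1 -EK mulmxA e mul0mx.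
  by have := mp _ uE; rewrite BE trmx_mul !mulmxA.
exists [seq v *m E^T | v <- S] => r hr.
(* Roots of the subdiagram, extended by zero, are roots of the whole diagram. *)
suff hrE : isroot (2 *: coxmx R m) (r *m E).
  by apply/mapP; exists (r *m E); [exact: hS|rewrite -mulmxA EK mulmx1].
elim: hr => [i|i {}r _ IH]; first by rewrite -rowE rE; apply: root_simple.
have -> : refl (2 *: coxmx R (fun i j => m (h i) (h j))) i r *m E = refl (2 *: coxmx R m) (h i) (r *m E).
  rewrite /refl mulmxBl -scalemxAl.
  have -> : (delta_mx 0 i : 'rV[R]_k) *m E = delta_mx 0 (h i) by rewrite -rowE rE.
  by rewrite BE scalemxAl scalemxAr -!mulmxA !mulmxA colE.
exact: root_refl.
Qed.

Lemma hacc_dim0 (Phi : 'rV[R]_0 -> Prop) : hacc Phi.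
Proof. by move=> x; exists [::]; apply: chain_nil => v _; apply/matrixP => -[]. Qed.

Lemma hacc_std k T : std k T -> forall m : 'I_k -> 'I_k -> nat, finite_coxeter m ->
  (forall i j, m i j = T i j) -> hacc (isroot (2 *: coxmx R m)).
Proof.
case=> {k T} [[|k]|[|k]|[//|k k2]|k kb|k kb||T].
- by move=> *; apply: hacc_dim0.
- by move=> m [_ _ _ mp _] hmT; apply: hacc_typeA.
- by move=> *; apply: hacc_dim0.
- by move=> m [_ _ _ mp _] hmT; apply: hacc_typeB.
- by move=> m [_ _ _ mp _] hmT; apply: hacc_typeD.
- case: k kb => [|[|[|[|[|[|[|[|[|k]]]]]]]]] // _ m _ hmT.
  + exact: hacc_E6.
  + exact: hacc_E7.
  + exact: hacc_E8.
- case: k kb => [|[|[|[|[|k]]]]] // _ m _ hmT.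
  + exact: hacc_H3.
  + exact: hacc_H4.
- by move=> m _ hmT; apply: hacc_F4.
- by move=> m [_ _ _ _ [S hS]] _; apply: hacc_rank2 hS _ => i; apply: root_simple.
Qed.

(** Induction on the rank: one component is split off, and since its labels towards the complement
    are 2 and [cos (pi / 2) = 0], the matrix becomes block diagonal. *)
Lemma hacc_finite_coxeter n (m : 'I_n -> 'I_n -> nat) : finite_coxeter m ->
  hacc (isroot (2 *: coxmx R m)).
Proof.
elim/ltn_ind: n m => -[|n'] IH m hm; first exact: hacc_dim0.
set n := n'.+1 in IH m hm *; have [m1 ms m2 mp _] := hm.
have [g [K [K0 hg iso [T hT hmT]]]] := exists_component m1 ms m2 mp isT.
pose h1 (i : 'I_K) := g i; have h1inj : injective h1.
  by move=> i j /eqP; rewrite /h1 (inj_upto_eq hg) // => /eqP /val_inj.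
pose C := ~: [set h1 i | i : 'I_K]; pose l := #|C|; pose h2 (j : 'I_l) := enum_val j.
have cardC : (K + l)%N = n.
  by rewrite -[K in (K + _)%N]card_ord -(card_imset _ h1inj) cardsC card_ord.
have h12 i j : h1 i != h2 j.
  by have := enum_valP j; rewrite inE; apply: contraNneq => e; rewrite -[enum_val j]/(h2 j) -e imset_f.
pose t (u : 'I_(K + l)) := match split u with inl i => h1 i | inr j => h2 j end.
have tl i : t (lshift l i) = h1 i by rewrite /t (unsplitK (inl i)).
have tr j : t (rshift K j) = h2 j by rewrite /t (unsplitK (inr j)).
have tinj : injective t.
  move=> u v; rewrite -[u]splitK -[v]splitK; case: (split u) (split v) => [a|a] [b|b] /=;
    rewrite ?tl ?tr.
  - by move/h1inj ->.
  - by move/eqP; rewrite (negPf (h12 _ _)).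
  - by move/esym/eqP; rewrite (negPf (h12 _ _)).
  - by move/enum_val_inj ->.
have [s tK sK] : bijective t by apply: inj_card_bij; rewrite // !card_ord cardC.
have hac1 := hacc_std hT (finite_coxeter_sub h1inj hm) (fun i j => hmT i j (ltn_ord i) (ltn_ord j)).
have hac2 := IH l _ _ (finite_coxeter_sub (@enum_val_inj _ _) hm).
apply: (hacc_reindex sK tK (d := fun=> 1) _ _ (hacc_block hac1 (hac2 _))) => [i|k i|].
- exact: oner_neq0.
- rewrite mul1r mulr1 -{2}[k]sK -{2}[i]sK.
  have far (a : 'I_K) (b : 'I_l) : m (h2 b) (h1 a) = 2%N.
    by apply: iso => // c cK; apply: (h12 (Ordinal cK)).
  case: (split_ordP (s k)) => a ->; case: (split_ordP (s i)) => b ->; rewrite ?tl ?tr.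
  + by rewrite block_mxEul !mxE.
  + by rewrite block_mxEur !mxE ms far cos_pihalf oppr0 mulr0.
  + by rewrite block_mxEdl !mxE far cos_pihalf oppr0 mulr0.
  + by rewrite block_mxEdr !mxE.
- by rewrite -cardC -[l in (l < _)%N]add0n ltn_add2r.
Qed.

End FiniteCoxeter.

Theorem corollary5p14 (R : realType) (W : finGroupType) (n : nat)
    (s : 'I_n -> W) (hW : coxeter_system s)
    (rG : mx_representation R [set: W] n)
    (hrG : is_reflection_representation s rG)
    (X : {vspace 'rV[R]_n})
    (hX : in_intersection_lattice (coxeter_arrangement s rG) X) :
  accurate (restriction (coxeter_arrangement s rG) X).
Proof.
have [sinj s2 sgen _] := hW.
(* The hyperplane of a root [r] is the zero set of [r *m B *m v^T], so the Coxeter form [B] serves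
   as the matrix [G]. *)
apply: (accurate_of_chain (posdef_unit (coxmx_posdef s2 hrG))) hX.
- exact: arrangement_roots.
- exact: roots_arrangement.
- apply: hacc_finite_coxeter; split.
  + exact: cox_ii.
  + exact: cox_sym.
  + exact: cox_ge2.
  + exact: coxmx_posdef hrG.
  + exact: roots_finite hrG.
Qed.
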